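(* Let $q\geq 2$ be an integer and let $f$ be a pseudo-polynomial, i.e. $f(x)=\alpha_0x^{\beta_0}+\alpha_1x^{\beta_1}+\cdots+\alpha_dx^{\beta_d}$ with real $\alpha_0,\beta_0,\ldots,\alpha_d,\beta_d$, $\alpha_0>0$, $\beta_0>\beta_1>\cdots>\beta_d>0$ and at least one $\beta_i\notin\mathbb{Z}$. Let $\tau_q(f)$ be the real number defined in the context. Then for every fixed integer $\ell\geq1$, \[ \mathcal{R}_{N,\ell}(\tau_q(f))\ll(\log N)^{-1}\qquad(N\to\infty), \] where the implicit constant may depend on $q$, $f$ and $\ell$.
   Context: Every real $\theta\in[0,1)$ has a $q$-ary expansion $\theta=\sum_{k\geq1}a_kq^{-k}$ with digits $a_k\in\{0,\ldots,q-1\}$. For a block $d_1\cdots d_\ell$ of digits, $\mathcal{N}(\theta,d_1\cdots d_\ell,N)$ denotes the number of indices $0\leq i<N$ with $a_{i+1}=d_1,\ldots,a_{i+\ell}=d_\ell$. The discrepancy is $\mathcal{R}_{N,\ell}(\theta)=\sup_{d_1\cdots d_\ell}\left|\frac{\mathcal{N}(\theta,d_1\cdots d_\ell,N)}{N}-q^{-\ell}\right|$, the supremum over all blocks of length $\ell$. For an integer $m$, $\lfloor m\rfloor_q$ (and more generally $\lfloor x\rfloor_q$ for real $x$) denotes the string of $q$-ary digits of the integer part of $x$. The number $\tau_q(f)$ is $0.\lfloor f(2)\rfloor_q\lfloor f(3)\rfloor_q\lfloor f(5)\rfloor_q\lfloor f(7)\rfloor_q\lfloor f(11)\rfloor_q\cdots$,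 obtained by concatenating the $q$-ary expansions of $\lfloor f(p)\rfloor$ as $p$ runs through the primes in increasing order. *)

(* Defs.v *)
From Stdlib Require Import Reals ZArith Znumtheory List Arith.
From Coquelicot Require Import Coquelicot.
Import ListNotations.
Open Scope R_scope.

Definition pseudo_poly (d : nat) (alpha beta : nat -> R) (x : R) : R :=
  sum_f_R0 (fun i => alpha i * Rpower x (beta i)) d.

(** Number of q-ary digits of m (the length of the string floor(m)_q);
    by convention the empty string for m = 0. *)
Fixpoint ndigits_aux (fuel q m : nat) : nat :=
  match fuel with
  | O => O
  | S fuel' => if Nat.eqb m 0 then O else S (ndigits_aux fuel' q (Nat.div m q))
  end.
Definition ndigits (q m : nat) : nat := ndigits_aux m q m.

Definition is_primeb (n : nat) : bool :=
  if prime_dec (Z.of_nat n) then true else false.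

(** The integer floor(f(p)) whose q-ary digits are concatenated
    (negative values, which occur for at most finitely many p, are read as 0). *)
Definition block_val (f : R -> R) (p : nat) : nat :=
  Z.to_nat (Int_part (f (INR p))).

Fixpoint endpos (f : R -> R) (q n : nat) : nat :=
  match n with
  | O => O
  | S n' => endpos f q n' + (if is_primeb n then ndigits q (block_val f n) else O)
  end.

(** tau_q(f) = 0.floor(f(2))_q floor(f(3))_q floor(f(5))_q ...
    The block of the prime p occupies the digit positions
    endpos(p-1)+1 .. endpos(p), so it contributes floor(f(p)) * q^(-endpos p). *)
Definition tau (q : nat) (f : R -> R) : R :=
  Series (fun n => if is_primeb n
                   then INR (block_val f n) / (INR q) ^ (endpos f q n)
                   else 0).

Definition digit (q : nat) (theta : R) (k : nat) : nat :=
  Z.to_nat (Z.modulo (Int_part ((INR q) ^ k * theta)) (Z.of_nat q)).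

Definition occurs_at (q : nat) (theta : R) (w : list nat) (i : nat) : bool :=
  forallb (fun j => Nat.eqb (digit q theta (i + 1 + j)) (nth j w O))
          (seq 0 (length w)).

Definition Nocc (q : nat) (theta : R) (w : list nat) (N : nat) : nat :=
  length (filter (occurs_at q theta w) (seq 0 N)).

Fixpoint words (q l : nat) : list (list nat) :=
  match l with
  | O => [ [] ]
  | S l' => flat_map (fun w => map (fun a => a :: w) (seq 0 q)) (words q l')
  end.

Definition discrepancy (q : nat) (N l : nat) (theta : R) : R :=
  fold_right Rmax 0
    (map (fun w => Rabs (INR (Nocc q theta w N) / INR N - / (INR q) ^ l))
         (words q l)).

(* Main.v *)
(** For a dyadic range X < p <= 2 X the occurrences of a block inside the expansion of f(p) at the digit
    position e are detected by the fractional part of f(p) / q^e lying in a cell of length 1 / Q, Q = q^l. Fejer's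
    kernel reduces the error to the sums of e(xi f(p)) over primes, with xi = h x and x a power of 1 / q.
    Let T be the minimum of x X^b and 1 / x, b the leading exponent.

    If xi f is not close to a polynomial with rational coefficients of small denominators, at a level equal to a
    power of ln X, then Vaughan's identity and Weyl differencing (applied to the polynomial part of f and to the
    Taylor expansions of its powers with fractional exponents) save any power of ln X.

    For the remaining xi only a power of T can be saved, so sieve losses must be avoided. There f is smooth on
    progressions to a small modulus r, and xi f varies slowly. Selberg's weights
    Lambda ln + Lambda * Lambda are equidistributed in short progressions modulo r, so they may be replaced by their
    local mean; this leaves a sum over integers for Lambda ln, and a bilinear sum for Lambda * Lambda in which
    the bounds of Brun-Titchmarsh type coming from the same weights make the primes harmless.

    Altogether the cell error is << (X / ln X) (T^(-g) + 1 / ln X) for some g > 0. Along the about ln X digit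
    positions the terms T^(-g) form two geometric series, so the total error is << X / ln X. As the digits of the
    primes up to n fill a stretch of length N of order n, this is N / ln N. *)
Require Import Defs.
From Stdlib Require Import Reals ZArith Znumtheory List Arith Lia Lra.
From Stdlib Require Import Classical ClassicalEpsilon.
From Coquelicot Require Import Coquelicot.
Open Scope R_scope.

(** * Finite sums, indicators and trigonometric basics *)

(** Each of the about ln X digit positions contributes X / ln X times its own saving. A saving 1 /
    ln X suffices where T is at least a power of ln X; below that, only the decay of T^(-g) away
    from both ends of a block can be summed. There D is a small power of T, possibly bounded, and no
    factor ln X may be lost, which excludes Vaughan's identity. The gap is bridged by squaring D:
    the levels D^C, D^(2C), D^(4C), ... are tried until xi F becomes major. At that step a
    denominator r <= D^(2C) and the failure at level D^C hold together: the former makes the phase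
    slow on progressions modulo r, the latter gives cancellation in bilinear sums. Selberg's weights
    leave a relative error 1 / sqrt (ln X); it is absorbed by T^(-g), because it occurs only for T
    below a fixed power of ln X and g is small. A last obstacle is that the blocks would not be the
    digits of tau if all late ones consisted of digits q - 1; the count of the digit 0 excludes
    this. *)

Fixpoint rsum (n : nat) (f : nat -> R) : R :=
  match n with O => 0 | S m => rsum m f + f m end.

Lemma rsum_S n f : rsum (S n) f = rsum n f + f n.
Proof. easy. Qed.

Notation dsum X := (rsum (S (2 * X))).
Notation coprime a b := (Nat.gcd a b = 1%nat).

Definition ind (P : Prop) : R := if excluded_middle_informative P then 1 else 0.

Lemma ind_T (P : Prop) : P -> ind P = 1.
Proof. intros H; unfold ind; destruct (excluded_middle_informative P); [easy|tauto]. Qed.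

Lemma ind_F (P : Prop) : ~ P -> ind P = 0.
Proof. intros H; unfold ind; destruct (excluded_middle_informative P); [tauto|easy]. Qed.

Lemma ind_cases (P : Prop) : (P /\ ind P = 1) \/ (~ P /\ ind P = 0).
Proof. destruct (classic P) as [H|H]; [left|right]; split; auto using ind_T, ind_F. Qed.

Lemma ind_01 (P : Prop) : 0 <= ind P <= 1.
Proof. destruct (ind_cases P) as [[_ ->]|[_ ->]]; lra. Qed.

Lemma ind_iff (P Q : Prop) : (P <-> Q) -> ind P = ind Q.
Proof. intros H. destruct (ind_cases P) as [[a ->]|[a ->]], (ind_cases Q) as [[b ->]|[b ->]]; tauto. Qed.

Lemma ind_and (P Q : Prop) : ind (P /\ Q) = ind P * ind Q.
Proof.
 destruct (ind_cases P) as [[a ->]|[a ->]], (ind_cases Q) as [[b ->]|[b ->]]; destruct (ind_cases (P /\ Q)) as [[c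
  ->]|[c ->]]; tauto || lra.
Qed.

Lemma ind_imp (P Q : Prop) : (P -> Q) -> ind P <= ind Q.
Proof. intros H. destruct (ind_cases P) as [[a ->]|[a ->]], (ind_cases Q) as [[b ->]|[b ->]]; tauto || lra. Qed.

Lemma ind_sq (P : Prop) : ind P * ind P = ind P.
Proof. destruct (ind_cases P) as [[_ ->]|[_ ->]]; ring. Qed.

Lemma rsum_ext n f g : (forall i, (i < n)%nat -> f i = g i) -> rsum n f = rsum n g.
Proof. induction n as [|n IH]; intros H; simpl; [easy|]. rewrite IH by auto. rewrite H by lia. easy. Qed.

Lemma rsum_le n f g : (forall i, (i < n)%nat -> f i <= g i) -> rsum n f <= rsum n g.
Proof.
 induction n as [|n IH]; intros H; simpl; [lra|]. assert (rsum n f <= rsum n g) by auto. specialize (H n ltac:(lia)).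
 lra.
Qed.

Lemma rsum_plus n f g : rsum n (fun i => f i + g i) = rsum n f + rsum n g.
Proof. induction n as [|n IH]; simpl; [ring|lra]. Qed.

Lemma rsum_minus n f g : rsum n (fun i => f i - g i) = rsum n f - rsum n g.
Proof. induction n as [|n IH]; simpl; [ring|lra]. Qed.

Lemma rsum_scal n c f : rsum n (fun i => c * f i) = c * rsum n f.
Proof. induction n as [|n IH]; simpl; [ring|lra]. Qed.

Lemma rsum_scalr n c f : rsum n (fun i => f i * c) = rsum n f * c.
Proof. induction n as [|n IH]; simpl; [ring|lra]. Qed.

Lemma rsum_const n c : rsum n (fun _ => c) = INR n * c.
Proof. induction n as [|n IH]; [simpl; ring|]. rewrite S_INR; simpl; rewrite IH; ring. Qed.

Lemma rsum_zero n f : (forall i, (i < n)%nat -> f i = 0) -> rsum n f = 0.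
Proof. intros H. rewrite (rsum_ext n f (fun _ => 0)) by easy. rewrite rsum_const; ring. Qed.

Lemma rsum_nonneg n f : (forall i, (i < n)%nat -> 0 <= f i) -> 0 <= rsum n f.
Proof. intros H. replace 0 with (rsum n (fun _ => 0)) by (rewrite rsum_const; ring). apply rsum_le; auto. Qed.

Lemma rsum_abs n f : Rabs (rsum n f) <= rsum n (fun i => Rabs (f i)).
Proof. induction n as [|n IH]; simpl; [rewrite Rabs_R0; lra|]. eapply Rle_trans; [apply Rabs_triang|]. lra. Qed.

Lemma rsum_swap n m f :
  rsum n (fun i => rsum m (fun j => f i j)) = rsum m (fun j => rsum n (fun i => f i j)).
Proof. induction n as [|n IH]; simpl; [symmetry; apply rsum_zero; easy|]. rewrite IH, <- rsum_plus. easy. Qed.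

Lemma rsum_split n m f : rsum (n + m) f = rsum n f + rsum m (fun i => f (n + i)%nat).
Proof. induction m as [|m IH]; [rewrite Nat.add_0_r; simpl; ring|]. rewrite Nat.add_succ_r; simpl. lra. Qed.

Lemma rsum_first n f : rsum (S n) f = f 0%nat + rsum n (fun i => f (S i)).
Proof. induction n as [|n IH]; [simpl; ring|]. rewrite rsum_S, IH, rsum_S. lra. Qed.

Lemma rsum_pick n a f : (a < n)%nat -> rsum n (fun i => ind (i = a) * f i) = f a.
Proof.
 induction n as [|n IH]; intros H; [lia|]. simpl. destruct (Nat.eq_dec n a) as [->|E].
 - rewrite ind_T, rsum_zero; [ring| |easy]. intros i Hi. rewrite ind_F by lia. ring.
 - rewrite IH by lia. rewrite ind_F by easy. ring.
Qed.

Lemma rsum_pick_le n a f :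
  (forall i, 0 <= f i) -> rsum n (fun i => ind (i = a) * f i) <= f a.
Proof.
 intros H. destruct (Nat.lt_ge_cases a n).
 - rewrite rsum_pick by easy. lra.
 - rewrite rsum_zero; [easy|]. intros i Hi. rewrite ind_F by lia. ring.
Qed.

Lemma rsum_term_le n a f :
  (a < n)%nat -> (forall i, (i < n)%nat -> 0 <= f i) -> f a <= rsum n f.
Proof.
 intros Ha H. rewrite <- (rsum_pick n a f Ha). apply rsum_le. intros i Hi. specialize (H i Hi).
 pose proof (ind_01 (i = a)). nra.
Qed.

Lemma rsum_mono_n n m f : (n <= m)%nat -> (forall i, (i < m)%nat -> 0 <= f i) -> rsum n f <= rsum m f.
Proof.
 intros Hn H. replace m with (n + (m - n))%nat by lia. rewrite rsum_split.
 assert (0 <= rsum (m - n) (fun i => f (n + i)%nat)) by (apply rsum_nonneg; intros; apply H; lia). lra.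
Qed.

Lemma rsum_trunc n m f :
  (n <= m)%nat -> (forall i, (n <= i < m)%nat -> f i = 0) -> rsum m f = rsum n f.
Proof.
 intros Hn H. replace m with (n + (m - n))%nat by lia. rewrite rsum_split. rewrite (rsum_zero (m - n)); [ring|].
 intros; apply H; lia.
Qed.

Lemma rsum_mul n m f g :
  rsum n f * rsum m g = rsum n (fun i => rsum m (fun j => f i * g j)).
Proof. rewrite <- rsum_scalr. apply rsum_ext; intros i _. rewrite rsum_scal. ring. Qed.

(** The form t^2 A + 2 t u C + u^2 B is a sum of squares. It is evaluated at (B, -C) or, when B = 0
    and C is not, at a point where it would equal -1. *)
Lemma cauchy_schwarz n f g :
  (rsum n (fun i => f i * g i))^2 <= rsum n (fun i => f i ^ 2) * rsum n (fun i => g i ^ 2).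
Proof.
 set (A := rsum n (fun i => f i ^ 2)). set (B := rsum n (fun i => g i ^ 2)). set (C := rsum n (fun i => f i * g i)).
 assert (HB : 0 <= B) by (apply rsum_nonneg; intros; apply pow2_ge_0).
 assert (H : forall t u, 0 <= t^2 * A + 2 * t * u * C + u^2 * B). { intros t u. unfold A, B, C.
  rewrite <- !rsum_scal, <- !rsum_plus. apply rsum_nonneg; intros i _.
  match goal with |- 0 <= ?x => replace x with ((t * f i + u * g i)^2) by ring end. apply pow2_ge_0. }
 destruct (Req_dec B 0) as [E|E].
 - rewrite E in *. destruct (Req_dec C 0) as [E'|E']; [rewrite E'; lra|]. specialize (H 1 (-(A + 1) / (2 * C))).
  replace (1^2 * A + 2 * 1 * (- (A + 1) / (2 * C)) * C + (- (A + 1) / (2 * C)) ^ 2 * 0) with (-1) in H by (field;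
   auto). lra.
 - specialize (H B (-C)). nra.
Qed.

Lemma rsum_avg n f c : (0 < n)%nat -> INR n * c <= rsum n f -> exists i, (i < n)%nat /\ c <= f i.
Proof.
 intros Hn H. apply NNPP; intros HN. assert (Hlt : forall i, (i < n)%nat -> f i < c). { intros i Hi. apply Rnot_le_lt.
  intros Hc. eauto. }
 clear HN. assert (rsum n f < INR n * c); [|lra]. clear H. induction n as [|n IH]; [lia|]. simpl.
 specialize (Hlt n ltac:(lia)) as Hl. destruct n as [|n]; [simpl; lra|].
 assert (rsum (S n) f < INR (S n) * c) by (apply IH; [lia|intros; apply Hlt; lia]). lra.
Qed.

Lemma rsum_eq_count n (P : nat -> Prop) : rsum n (fun i => ind (P i)) <= INR n.
Proof. rewrite <- Rmult_1_r, <- rsum_const. apply rsum_le. intros; apply ind_01. Qed.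

Lemma pow_pos_2 D n : 2 <= D -> 0 < D ^ n.
Proof. intros; apply pow_lt; lra. Qed.

Lemma pow_mono D a b : 1 <= D -> (a <= b)%nat -> D ^ a <= D ^ b.
Proof. intros; apply Rle_pow; easy. Qed.

Lemma pow_ge_1 D a : 1 <= D -> 1 <= D ^ a.
Proof. intros; apply pow_R1_Rle; easy. Qed.

Lemma ln_le x y : 0 < x -> x <= y -> ln x <= ln y.
Proof. intros Hx [H|<-]; [left; now apply ln_increasing|lra]. Qed.

Lemma le_ln c x : exp c <= x -> c <= ln x.
Proof. intros H. rewrite <- (ln_exp c). apply ln_le; [apply exp_pos|easy]. Qed.

Lemma ln_ge_0 x : 1 <= x -> 0 <= ln x.
Proof. intros H. rewrite <- ln_1. apply ln_le; lra. Qed.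

Lemma Rpower_pos x b : 0 < Rpower x b.
Proof. apply exp_pos. Qed.

(* [pos_leaf] is redefined below, when further nonnegative functions become available. *)
Ltac pos_leaf := fail.
Ltac pos :=
  first [ assumption | pos_leaf
  | match goal with
    | |- 0 <= INR _ => apply pos_INR
    | |- 0 < INR _ => apply lt_0_INR; lia
    | |- 1 <= INR _ => apply (le_INR 1); lia
    | |- 0 <= _ * _ => apply Rmult_le_pos; pos
    | |- 0 < _ * _ => apply Rmult_lt_0_compat; pos
    | |- 0 <= _ + _ => apply Rplus_le_le_0_compat; pos
    | |- 0 < _ + _ => apply Rplus_lt_le_0_compat; pos
    | |- 0 <= _ / _ => apply Rdiv_le_0_compat; pos
    | |- 0 < _ / _ => apply Rdiv_lt_0_compat; pos
    | |- 0 < / _ => apply Rinv_0_lt_compat; pos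
    | |- 0 <= / _ => left; apply Rinv_0_lt_compat; pos
    | |- 0 <= _ ^ 2 => apply pow2_ge_0
    | |- 0 <= _ ^ _ => apply pow_le; pos
    | |- 0 < _ ^ _ => apply pow_lt; pos
    | |- 1 <= _ ^ _ => apply pow_R1_Rle; pos
    | |- 0 < Rpower _ _ => apply Rpower_pos
    | |- 0 <= Rpower _ _ => left; apply Rpower_pos
    | |- 0 <= Rabs _ => apply Rabs_pos
    | |- 0 <= sqrt _ => apply sqrt_pos
    | |- 0 < sqrt _ => apply sqrt_lt_R0; pos
    | |- 0 < exp _ => apply exp_pos
    | |- 0 <= exp _ => left; apply exp_pos
    | |- 0 <= ind _ => apply ind_01
    | |- ind _ <= 1 => apply ind_01
    | |- 0 <= rsum _ _ => apply rsum_nonneg; intros; pos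
    | |- 0 <= ln _ => apply ln_ge_0; pos
    | |- 0 < ln _ => rewrite <- ln_1; apply ln_increasing; pos
    | |- ?x <> 0 => apply Rgt_not_eq; red; pos
    | |- _ >= _ => apply Rle_ge; pos
    end
  | lra | lia | solve [auto] ].

Ltac mono :=
  first [ assumption | apply Rle_refl
  | match goal with
    | |- INR _ <= INR _ => apply le_INR; lia
    | |- INR _ < INR _ => apply lt_INR; lia
    | |- ?c * _ <= ?c * _ => apply Rmult_le_compat_l; [pos|mono]
    | |- _ * ?c <= _ * ?c => apply Rmult_le_compat_r; [pos|mono]
    | |- _ / ?c <= _ / ?c => apply Rmult_le_compat_r; [pos|mono]
    | |- ?c / _ <= ?c / _ => apply Rmult_le_compat_l; [pos|mono]
    | |- _ * _ <= _ * _ => apply Rmult_le_compat; [pos|pos|mono|mono]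
    | |- _ / _ <= _ / _ => apply Rmult_le_compat; [pos|pos|mono|mono]
    | |- _ + _ <= _ + _ => apply Rplus_le_compat; mono
    | |- / _ <= / _ => apply Rinv_le_contravar; [pos|mono]
    | |- ?x ^ _ <= ?x ^ _ => apply pow_mono; [pos|lia]
    | |- _ ^ ?n <= _ ^ ?n => apply pow_incr; split; [pos|mono]
    | |- rsum ?n _ <= rsum ?n _ => apply rsum_le; intros; mono
    | |- rsum ?n _ = rsum ?n _ => apply rsum_ext; intros; (ring || (f_equal; ring) || mono)
    | |- ln _ <= ln _ => apply ln_le; [pos|mono]
    | |- sqrt _ <= sqrt _ => apply sqrt_le_1_alt; mono
    | |- Rpower ?x _ <= Rpower ?x _ => apply Rle_Rpower; pos
    | |- ?x <= ?x * _ => rewrite <- (Rmult_1_r x) at 1; apply Rmult_le_compat_l; pos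
    | |- ?x <= _ * ?x => rewrite <- (Rmult_1_l x) at 1; apply Rmult_le_compat_r; pos
    | |- ?x * _ <= ?x => rewrite <- (Rmult_1_r x) at 2; apply Rmult_le_compat_l; pos
    | |- _ * ?x <= ?x => rewrite <- (Rmult_1_l x) at 2; apply Rmult_le_compat_r; pos
    | H : ?x <= ?D ^ _ |- ?x <= ?D ^ _ => apply (Rle_trans _ _ _ H); apply pow_mono; [pos|lia]
    | |- Rabs (_ + _) <= _ + _ => eapply Rle_trans; [apply Rabs_triang|]; mono
    | |- Rabs (_ - _) <= _ + _ => eapply Rle_trans; [apply Rabs_triang|]; rewrite ?Rabs_Ropp; mono
    end
  | solve [pos] ].

Ltac inr :=
  match goal with
  | |- (_ <= _)%nat => apply INR_le
  | |- (_ < _)%nat => apply INR_lt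
  | |- IZR (Zpos ?p) <= INR _ => apply (Rle_trans _ (INR (Pos.to_nat p))); [rewrite INR_IPR; apply Rle_refl | apply le_INR; lia]
  | |- _ => idtac
  end; rewrite ?S_INR, ?plus_INR, ?mult_INR, ?pow_INR; simpl INR; try lra.

(* [lhs b], [rhs b] and [arg b] replace a side of the goal, or the argument of its first absolute value, by b. *)
Tactic Notation "replace_by" constr(a) constr(b) := replace a with b by first [ring | field; lra | lra | unfold Rdiv; ring | field].
Tactic Notation "lhs" constr(b) := match goal with |- _ ?a _ => replace_by a b end.
Tactic Notation "rhs" constr(b) := match goal with |- _ _ ?a => replace_by a b end.
Tactic Notation "arg" constr(b) := match goal with |- context [Rabs ?a] => replace_by a b end.
Tactic Notation "lhs" constr(b) "by" tactic3(t) := match goal with |- _ ?a _ => replace a with b by t end.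
Tactic Notation "rhs" constr(b) "by" tactic3(t) := match goal with |- _ _ ?a => replace a with b by t end.
Tactic Notation "arg" constr(b) "by" tactic3(t) := match goal with |- context [Rabs ?a] => replace a with b by t end.
Tactic Notation "etrans" := eapply Rle_trans.
Tactic Notation "ind_case" constr(P) "as" ident(H) := destruct (ind_cases P) as [[H ->]|[H ->]].
Tactic Notation "euclid" constr(a) constr(b) "as" ident(E) ident(H) :=
  pose proof (Nat.div_mod_eq a b) as E; assert (H : (a mod b < b)%nat) by (apply Nat.mod_upper_bound; lia).
Tactic Notation "euclid" constr(a) constr(b) := let E := fresh in let H := fresh in euclid a b as E H.
(* Transitivity of <=: through b, from a bound of the left hand side, up to a bound of the right hand side. *)
Tactic Notation "via" constr(b) := apply Rle_trans with b.
Tactic Notation "from" uconstr(h) := eapply Rle_trans; [apply h|].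
Tactic Notation "upto" uconstr(h) := eapply Rle_trans; [|apply h].
Tactic Notation "mul_l" := apply Rmult_le_compat_l; [pos|].
Tactic Notation "mul_r" := apply Rmult_le_compat_r; [pos|].
Tactic Notation "have" constr(h) := pose proof h.
Tactic Notation "have" constr(h) "as" simple_intropattern(p) := pose proof h as p.
Tactic Notation "ext" simple_intropattern(i) simple_intropattern(h) := apply rsum_ext; intros i h.
Tactic Notation "termwise" simple_intropattern(i) simple_intropattern(h) := apply rsum_le; intros i h.

#[local] Coercion INR : nat >-> R.

(** Pairs (a, b) are sorted by their distance h. In this form squares of sums enter Weyl
    differencing. *)
Lemma rsum_triangle M (g : nat -> nat -> R) :
  rsum M (fun a => rsum M (fun b => g a b)) =
  rsum M (fun a => g a a)
  + rsum M (fun h => ind (1 <= h)%nat * rsum (M - h) (fun n => g n (n + h)%nat + g (n + h)%nat n)).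
Proof.
 induction M as [|M IH]; [simpl; ring|].
 assert (E0 : rsum (S M) (fun a => rsum (S M) (fun b => g a b)) = rsum M (fun a => rsum M (fun b => g a b)) + rsum M
  (fun a => g a M) + (rsum M (fun b => g M b) + g M M)). {
  rewrite rsum_S, (rsum_ext M _ (fun a => rsum M (fun b => g a b) + g a M)), rsum_plus, rsum_S by easy. easy. }
 rewrite E0, IH. clear E0 IH. rewrite rsum_S, rsum_S.
 assert (E : rsum M (fun h => ind (1 <= h)%nat * rsum (S M - h) (fun n => g n (n + h)%nat + g (n + h)%nat n)) = rsum M
  (fun h => ind (1 <= h)%nat * rsum (M - h) (fun n => g n (n + h)%nat + g (n + h)%nat n)) + rsum M (fun h => ind (1 <=
  h)%nat * (g (M - h)%nat M + g M (M - h)%nat))). { rewrite <- rsum_plus. ext h Hh.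
  replace (S M - h)%nat with (S (M - h)) by lia. rewrite rsum_S. replace (M - h + h)%nat with M by lia. ring. }
 replace (S M - M)%nat with 1%nat by lia. rewrite rsum_S. change (rsum 0 _) with 0. rewrite Nat.add_0_l.
 assert (E2 : rsum M (fun h => ind (1 <= h)%nat * (g (M - h)%nat M + g M (M - h)%nat)) + ind (1 <= M)%nat * (g 0%nat M
  + g M 0%nat) = rsum M (fun i => g i M) + rsum M (fun i => g M i)). { rewrite <- rsum_plus.
  assert (Rv : forall n (u : nat -> R), rsum n (fun i => u (n - S i)%nat) = rsum n u). {
   induction n as [|n IH]; intros u; [easy|]. rewrite rsum_first, rsum_S, <- (IH u).
   replace (S n - 1)%nat with n by lia. rewrite Rplus_comm. f_equal. }
  destruct M as [|M]; [simpl; rewrite ind_F by lia; ring|].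
  rewrite <- (Rv (S M) (fun i => g i (S M) + g (S M) i)), rsum_first, rsum_S, ind_F, ind_T by lia.
  replace (S M - S M)%nat with 0%nat by lia.
  rewrite (rsum_ext M (fun i => ind (1 <= S i)%nat * _) (fun i => g (S M - S i)%nat (S M) + g (S M) (S M - S i)%nat)).
  - ring.
  - intros i Hi. rewrite ind_T by lia. ring. }
 lra.
Qed.

(* Real and imaginary parts of e(x) = exp (2 pi i x), so that all exponential sums below are real. *)
Definition cs (x : R) : R := cos (2 * PI * x).
Definition sn (x : R) : R := sin (2 * PI * x).
(** This is || x || <= e for the distance to the nearest integer. As a relation it adds up under
    sums and integer multiples without any choice of the nearest integer. *)
Definition near (e x : R) : Prop := exists z : Z, Rabs (x - IZR z) <= e.

Lemma cs_sub x y : cs (x - y) = cs x * cs y + sn x * sn y.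
Proof. unfold cs, sn. replace (2 * PI * (x - y)) with (2 * PI * x - 2 * PI * y) by ring. apply cos_minus. Qed.

Lemma cs_opp x : cs (- x) = cs x.
Proof. unfold cs. replace (2 * PI * - x) with (- (2 * PI * x)) by ring. apply cos_neg. Qed.

Lemma sn_as_cs x : sn x = cs (x - / 4).
Proof.
 unfold sn, cs. replace (2 * PI * (x - / 4)) with (- (PI / 2 - 2 * PI * x)) by field. rewrite cos_neg. symmetry.
 apply cos_shift.
Qed.

Lemma cs_bound x : -1 <= cs x <= 1.
Proof. apply COS_bound. Qed.

Lemma cs_abs x : Rabs (cs x) <= 1.
Proof. apply Rabs_le, cs_bound. Qed.

Lemma cs_period_nat x n : cs (x + INR n) = cs x.
Proof. unfold cs. replace (2 * PI * (x + n)) with (2 * PI * x + 2 * n * PI) by ring. apply cos_period. Qed.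

Lemma cs_period x z : cs (x + IZR z) = cs x.
Proof.
 destruct (Z.le_gt_cases 0 z).
 - rewrite <- (Z2Nat.id z), <- INR_IZR_INZ by easy. apply cs_period_nat.
 - rewrite <- (cs_period_nat (x + IZR z) (Z.to_nat (- z))). f_equal. rewrite INR_IZR_INZ, Z2Nat.id, opp_IZR by lia.
  ring.
Qed.

Lemma sin_abs_le x : Rabs (sin x) <= Rabs x.
Proof.
 assert (P : forall y, 0 < y -> Rabs (sin y) <= y). { intros y Hy. destruct (Rle_lt_dec y 1).
  - rewrite Rabs_right. { left; apply sin_lt_x; lra. }
   apply Rle_ge, sin_ge_0; have PI2_3_2; have PI2_1; lra.
  - have (SIN_bound y). apply Rabs_le. lra. }
 destruct (Rtotal_order x 0) as [H|[->|H]].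
 - replace x with (- - x) at 1 by ring. rewrite sin_neg, Rabs_Ropp, (Rabs_left x) by easy. apply P; lra.
 - rewrite sin_0, Rabs_R0; lra.
 - rewrite (Rabs_right x) by lra. pos.
Qed.

Lemma PI_gt_3 : 3 < PI.
Proof. have PI2_3_2; lra. Qed.

Lemma cs_lip x y : Rabs (cs x - cs y) <= 8 * Rabs (x - y).
Proof.
 unfold cs. rewrite form2. replace ((2 * PI * x - 2 * PI * y) / 2) with (PI * (x - y)) by field.
 rewrite !Rabs_mult, Rabs_left by lra. set (s := sin ((2 * PI * x + 2 * PI * y) / 2)).
 assert (Rabs s <= 1) by (apply Rabs_le, SIN_bound). have (sin_abs_le (PI * (x - y))) as H1.
 rewrite Rabs_mult, (Rabs_right PI) in H1 by (have PI_gt_3; lra). have PI_4; have PI_gt_3.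
 have (Rabs_pos (sin (PI * (x - y)))). have (Rabs_pos (x - y)). nra.
Qed.

Lemma sin_half x : (sin (PI * x))^2 = (1 - cs x) / 2.
Proof. unfold cs. replace (2 * PI * x) with (2 * (PI * x)) by ring. rewrite cos_2a_sin. field. Qed.

Lemma sin_lower y : Rabs y <= / 2 -> Rabs y <= Rabs (sin (PI * y)).
Proof.
 assert (P : forall y, 0 <= y <= / 2 -> y <= sin (PI * y)). { clear. intros y Hy. have PI_gt_3; have PI_4.
  assert (Ha : 0 <= PI * y <= 2) by nra. have (pre_sin_bound (PI * y) 0 ltac:(lra) ltac:(lra)) as [H1 _].
  set (a := PI * y) in *. assert (3 * y <= a) by (unfold a; nra).
  assert (E : sin_approx a (2 * 0 + 1) = a - a^3/6) by (unfold sin_approx, sin_term; simpl; field). nra. }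
 intros H. destruct (Rle_lt_dec 0 y).
 - rewrite Rabs_right in * by lra. etrans; [apply P; lra|]. apply Rle_abs.
 - rewrite Rabs_left in * by lra. replace y with (- - y) at 2 by ring.
  rewrite Ropp_mult_distr_r_reverse, sin_neg, Rabs_Ropp. etrans; [apply P; lra|]. apply Rle_abs.
Qed.

Lemma nearest x : exists z eta, x = IZR z + eta /\ Rabs eta <= / 2.
Proof.
 exists (Int_part (x + / 2)), (x - IZR (Int_part (x + / 2))). split; [ring|]. have (base_Int_part (x + / 2)).
 apply Rabs_le. lra.
Qed.

Lemma near_le e e' x : e <= e' -> near e x -> near e' x.
Proof. intros H [z Hz]. exists z. lra. Qed.

Lemma near_add e e' x y : near e x -> near e' y -> near (e + e') (x + y).
Proof. intros [z Hz] [w Hw]. exists (z + w)%Z. rewrite plus_IZR. arg ((x - IZR z) + (y - IZR w)). mono. Qed.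

Lemma near_opp e x : near e x -> near e (- x).
Proof. intros [z Hz]. exists (- z)%Z. rewrite opp_IZR. arg (- (x - IZR z)). now rewrite Rabs_Ropp. Qed.

Lemma near_sub e e' x y : near e x -> near e' y -> near (e + e') (x - y).
Proof. intros H H'. apply near_add; [easy|now apply near_opp]. Qed.

Lemma near_mul e x n : near e x -> near (INR n * e) (INR n * x).
Proof.
 intros [z Hz]. exists (Z.of_nat n * z)%Z. rewrite mult_IZR, <- INR_IZR_INZ. arg (n * (x - IZR z)).
 rewrite Rabs_mult, Rabs_right by pos. mono.
Qed.

(** The right side is the square of the modulus of the sum of b e(phi); it exceeds the left side by
    the square of the sine sum. *)
Lemma weighted_square n b phi :
  (rsum n (fun i => b i * cs (phi i)))^2
  <= rsum n (fun i => rsum n (fun j => b i * b j * cs (phi i - phi j))).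
Proof.
 set (A := rsum n (fun i => b i * cs (phi i))). set (B := rsum n (fun i => b i * sn (phi i))).
 assert (E : rsum n (fun i => rsum n (fun j => b i * b j * cs (phi i - phi j))) = A * A + B * B). { unfold A, B.
  rewrite !rsum_mul, <- rsum_plus. ext i _. rewrite <- rsum_plus. ext j _. rewrite cs_sub. ring. }
 nra.
Qed.

Lemma geometric_cs n c t :
  2 * sin (PI * t) * rsum n (fun i => cs (c + t * i))
  = sin (2 * PI * (c + t * n) - PI * t) - sin (2 * PI * c - PI * t).
Proof.
 induction n as [|n IH].
 - simpl rsum. simpl INR. replace (c + t * 0) with c by ring. ring.
 - rewrite rsum_S, Rmult_plus_distr_l, IH. unfold cs. rewrite S_INR. set (u := 2 * PI * (c + t * n)).
  replace (2 * PI * (c + t * (n + 1)) - PI * t) with (u + PI * t) by (unfold u; ring). rewrite sin_plus, sin_minus.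
  ring.
Qed.

Lemma geometric_bound n c t : Rabs (sin (PI * t)) * Rabs (rsum n (fun i => cs (c + t * i))) <= 1.
Proof.
 rewrite <- Rabs_mult. arg ((2 * sin (PI * t) * rsum n (fun i => cs (c + t * i))) / 2). rewrite geometric_cs.
 have (SIN_bound (2 * PI * (c + t * n) - PI * t)). have (SIN_bound (2 * PI * c - PI * t)). apply Rabs_le. lra.
Qed.

Lemma sin_sq_period t z : Rabs (sin (PI * (IZR z + t))) = Rabs (sin (PI * t)).
Proof. apply Rsqr_eq_abs_0. rewrite !Rsqr_pow2, !sin_half, Rplus_comm, cs_period. easy. Qed.

(** A geometric sum is at most 1 / |sin (PI t)|, and |sin (PI t)| is at least the distance from t to
    the nearest integer. *)
Lemma linear_sum_near n c t B :
  0 < B -> B <= rsum n (fun i => cs (c + t * i)) -> near (/ B) t.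
Proof.
 intros HB H. destruct (nearest t) as (z & eta & E & Heta). exists z. have (geometric_bound n c t) as G.
 assert (G2 : Rabs (sin (PI * t)) = Rabs (sin (PI * eta))) by (rewrite E; apply sin_sq_period).
 have (sin_lower eta Heta). replace (t - IZR z) with eta by lra.
 have (Rle_abs (rsum n (fun i => cs (c + t * i)))) as H2. assert (Rabs eta * B <= 1). { have (Rabs_pos eta). nra. }
 apply (Rmult_le_reg_r B); [easy|]. rewrite Rinv_l by lra. easy.
Qed.

(** * Recurrence of polynomial sequences and a Weyl inequality without logarithms *)

Lemma nfloor x : 0 <= x -> exists n : nat, n <= x < n + 1.
Proof.
 intros H. exists (Z.to_nat (Int_part x)). have (base_Int_part x) as [H1 H2]. assert (0 <= Int_part x)%Z. {
  apply le_IZR. destruct (Z_lt_le_dec (Int_part x) 0) as [E|E].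
  - assert (Int_part x <= -1)%Z as E2 by lia. apply IZR_le in E2. lra.
  - apply IZR_le. easy. }
 rewrite INR_IZR_INZ, Z2Nat.id by easy. lra.
Qed.

Lemma le_div_inv a b c : 0 < c -> a <= b / c -> a * c <= b.
Proof. intros Hc H. apply Rle_div_r; easy. Qed.

Lemma div_le_inv a b c : 0 < c -> a / c <= b -> a <= b * c.
Proof. intros Hc H. apply Rle_div_l; easy. Qed.

Lemma le_div_inv_r a b c : 0 < c -> a * c <= b -> a <= b * / c.
Proof. intros Hc H. apply Rle_div_r; easy. Qed.

Lemma le_div a b c : 0 < c -> a * c <= b -> a <= b / c.
Proof. intros Hc H. apply Rle_div_r; easy. Qed.

Lemma div_le a b c : 0 < c -> a <= b * c -> a / c <= b.
Proof. intros Hc H. apply Rle_div_l; easy. Qed.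

Lemma pow2_absorb D a b : 2 <= D -> 2 ^ a * D ^ b <= D ^ (a + b).
Proof. intros H. rewrite pow_add. mono. Qed.

Lemma rsum_blocks K G f :
  rsum (K * G) f = rsum K (fun b => rsum G (fun j => f (b * G + j)%nat)).
Proof.
 induction K as [|K IH]; [easy|]. rewrite rsum_S, <- IH. replace (S K * G)%nat with (K * G + G)%nat by lia.
 apply rsum_split.
Qed.

Lemma count_two G (P : nat -> Prop) :
  1 < rsum G (fun i => ind (P i)) -> exists i j, (i < j < G)%nat /\ P i /\ P j.
Proof.
 induction G as [|G IH]; [simpl; lra|]. rewrite rsum_S. intros H.
 destruct (ind_cases (P G)) as [[HG E]|[HG E]]; rewrite E in H.
 - apply NNPP; intros N. assert (rsum G (fun i => ind (P i)) = 0); [|lra]. apply rsum_zero. intros i Hi. apply ind_F.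
  intros Hp. apply N. exists i, G. auto.
 - destruct IH as (i & j & H1 & H2); [lra|]. exists i, j. split; [lia|easy].
Qed.

Lemma count_diameter T (P : nat -> Prop) d :
  0 <= d -> (forall i j, (i < j < T)%nat -> P i -> P j -> j - i <= d) ->
  rsum T (fun i => ind (P i)) <= d + 1.
Proof.
 intros Hd H.
 assert (Q : rsum T (fun i => ind (P i)) = 0 \/ exists i j, (i <= j < T)%nat /\ P i /\ P j /\ rsum T (fun i => ind (P
  i)) <= j - i + 1). { clear H. induction T as [|T IH]; [pos|]. rewrite rsum_S.
  destruct (ind_cases (P T)) as [[HT E]|[HT E]]; rewrite E; destruct IH as [IH|(i & j & H1 & H2 & H3 & H4)].
  - right. exists T, T. repeat split; auto; lia || lra.
  - right. exists i, T. repeat split; auto; try lia. assert (j + 1 <= T) by (rewrite <- S_INR; apply le_INR; lia).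
   lra.
  - lra.
  - right. exists i, j. repeat split; auto; lia || lra. }
 destruct Q as [Q|(i & j & H1 & H2 & H3 & H4)]; [lra|]. destruct (Nat.eq_dec i j) as [->|N]; [lra|].
 specialize (H i j ltac:(lia) H2 H3). lra.
Qed.

(** Let s t = z + eta. Within one residue class modulo s the phase moves by eta modulo 1 at each
    step, and over T steps by at most 1/2, so it does not wrap around. All visits to an interval of
    length 2 e therefore lie within 2 e / |eta| steps of each other. *)
Lemma recurrent_block e c t s z n0 T :
  (1 <= s)%nat -> 0 <= e <= / 8 -> INR s * t - IZR z <> 0 ->
  INR T * Rabs (INR s * t - IZR z) <= / 2 ->
  rsum (T * s) (fun i => ind (near e (c + t * INR (n0 + i)%nat)))
  <= INR s * (2 * e / Rabs (INR s * t - IZR z) + 1).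
Proof.
 intros Hs He Hnz HT. set (eta := s * t - IZR z) in *. assert (Hpos : 0 < Rabs eta) by now apply Rabs_pos_lt.
 rewrite rsum_blocks, rsum_swap, <- rsum_const. termwise rho Hrho. apply count_diameter. { pos. }
 intros i j Hij Hi Hj. have (near_sub _ _ _ _ Hj Hi) as [w Hw].
 assert (Hu : exists u : nat, (1 <= u)%nat /\ j = (i + u)%nat) by (exists (j - i)%nat; lia).
 destruct Hu as (u & Hu & ->).
 assert (E : c + t * INR (n0 + ((i + u) * s + rho)) - (c + t * INR (n0 + (i * s + rho))) = u * eta + IZR (Z.of_nat u *
  z)). { rewrite mult_IZR, <- INR_IZR_INZ. repeat rewrite ?plus_INR, ?mult_INR. unfold eta. ring. }
 rewrite E in Hw. assert (Hut : u * Rabs eta <= / 2). { upto HT. mono. }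
 assert (Hue : Rabs (u * eta) <= 2 * e). {
  replace (u * eta + IZR (Z.of_nat u * z) - IZR w) with (u * eta - IZR (w - Z.of_nat u * z)) in Hw by (rewrite
   minus_IZR; ring). set (v := (w - Z.of_nat u * z)%Z) in *.
  assert (Hue : Rabs (u * eta) <= / 2) by (rewrite Rabs_mult, Rabs_right by (apply Rle_ge, pos_INR); easy).
  destruct (Z.eq_dec v 0) as [->|Hv].
  - replace (u * eta - IZR 0) with (u * eta) in Hw by lra. lra.
  - apply Rabs_le_between in Hw. apply Rabs_le_between in Hue. assert (Hv2 : (v <= -1 \/ 1 <= v)%Z) by lia.
   destruct Hv2 as [Hv2|Hv2]; apply IZR_le in Hv2; lra. }
 rewrite Rabs_mult, Rabs_right in Hue by pos. rewrite plus_INR. apply (Rmult_le_reg_r (Rabs eta)); [easy|].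
 unfold Rdiv. rewrite Rmult_assoc, Rinv_l by lra. lra.
Qed.

(** Among blocks of floor(2 D) + 1 consecutive indices, a density 1 / D puts more than one index
    into some block. *)
Lemma recurrent_close D M (P : nat -> Prop) :
  1 <= D -> 8 * D <= INR M -> INR M / D <= rsum M (fun i => ind (P i)) ->
  exists n s, (1 <= s)%nat /\ INR s <= 2 * D /\ P n /\ P (n + s)%nat.
Proof.
 intros HD HM H. destruct (nfloor (2 * D) ltac:(lra)) as (g & Hg1 & Hg2). set (G := S g).
 assert (HG : INR G = g + 1) by (unfold G; apply S_INR). set (K := S (M / G)). assert (HK : (M <= K * G)%nat). {
  have (Nat.div_mod_eq M G). have (Nat.mod_upper_bound M G ltac:(unfold G; lia)). lia. }
 set (f := fun i => ind (P i /\ (i < M)%nat)). assert (Hs : M / D <= rsum (K * G) f). { from H.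
  etrans; [|apply (rsum_mono_n M); [easy|intros; apply ind_01]]. termwise i Hi. apply ind_imp. tauto. }
 rewrite rsum_blocks in Hs.
 destruct (rsum_avg K (fun b => rsum G (fun j => f (b * G + j)%nat)) (M / D / K)) as (b & Hb & Hb2). { lia. }
 { assert (0 < K) by pos. lhs (M / D). easy. }
 assert (HKR : K <= M / (2 * D) + 1). { unfold K. rewrite S_INR. apply Rplus_le_compat_r.
  assert (INR (M / G) * G <= M). { rewrite <- mult_INR. apply le_INR. rewrite Nat.mul_comm. apply Nat.mul_div_le. lia. }
  apply (Rmult_le_reg_r (2 * D)); [lra|]. unfold Rdiv. rewrite Rmult_assoc, Rinv_l by lra. nra. }
 assert (HK0 : 0 < K) by pos. assert (1 < M / D / K). { apply (Rmult_lt_reg_r (INR K)); [easy|]. unfold Rdiv at 1.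
  rewrite Rmult_assoc, Rinv_l, Rmult_1_l, Rmult_1_r by lra. eapply Rle_lt_trans; [apply HKR|]. assert (8 <= M / D). {
   apply (Rmult_le_reg_r D); [lra|]. unfold Rdiv. rewrite Rmult_assoc, Rinv_l by lra. lra. }
  replace (M / (2 * D)) with (M / D / 2) by (field; lra). lra. }
 destruct (count_two G (fun j => P (b * G + j)%nat /\ (b * G + j < M)%nat)) as (i & j & Hij & [Hi _] & [Hj _]). {
  unfold f in Hb2. lra. }
 exists (b * G + i)%nat, (j - i)%nat. split; [lia|]. split. { upto Hg1. mono. }
 replace (b * G + i + (j - i))%nat with (b * G + j)%nat by lia. easy.
Qed.

(** Two close visits provide s, with s t within 2 e of an integer. If the distance eta of s t to
    that integer exceeded the claimed bound, counting the visits along progressions modulo s would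
    contradict their density 1 / D. The gain of a factor M over the trivial 2 e costs only powers of
    D and no logarithm. *)
Lemma recurrent_linear D M e c t :
  1 <= D -> 16 * D ^ 2 <= INR M -> 0 <= e <= / (64 * D) ->
  INR M / D <= rsum M (fun i => ind (near e (c + t * INR i))) ->
  exists s, (1 <= s)%nat /\ INR s <= 2 * D /\ near (8 * D ^ 2 * e / INR M) (INR s * t).
Proof.
 intros HD HM He H. assert (HDD : D <= D ^ 2) by nra. assert (HeD : e * (64 * D) <= 1). { apply Rle_div_r; [lra|].
  lra. }
 assert (He64 : e <= / 64) by nra.
 destruct (recurrent_close D M (fun i => near e (c + t * i)) HD ltac:(nra) H) as (n & s & Hs1 & Hs2 & Hn1 & Hn2).
 exists s. split; [easy|]. split; [easy|]. have (near_sub _ _ _ _ Hn2 Hn1) as [z Hz].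
 replace (c + t * INR (n + s) - (c + t * n)) with (s * t) in Hz by inr. exists z. apply Rnot_lt_le. intros Hlt.
 set (eta := Rabs (s * t - IZR z)) in *. assert (Hlow : 0 <= 8 * D ^ 2 * e / M). { pos. }
 assert (Heta : 0 < eta) by lra.
 assert (Hnz : s * t - IZR z <> 0) by (intros E; unfold eta in Heta; rewrite E, Rabs_R0 in Heta; lra).
 assert (Hlt' : 8 * D ^ 2 * e < eta * M). { apply Rlt_div_l; lra. }
 assert (HMD : INR M = D * (M / D)) by (field; lra). set (Q := M / D) in *. assert (Hlt2 : 8 * D * e < eta * Q). {
  nra. }
 assert (HQ : 16 * D <= Q) by nra. assert (Hiee : / eta * eta = 1) by (field; lra). set (T := S (M / s)).
 assert (HTs : M <= T * s). { rewrite <- mult_INR. apply le_INR. euclid M s. lia. }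
 (* Either the whole range passes without wrapping around, or it is cut into stretches of U steps
    with U eta between 1/4 and 1/2. *)
 destruct (Rle_lt_dec (T * eta) (/ 2)) as [HT|HT].
 - have (recurrent_block e c t s z 0 T Hs1 ltac:(lra) Hnz HT) as HB. assert (Hsum : Q <= s * (2 * e / eta + 1)). {
   from H. upto HB. apply rsum_mono_n; [|intros; apply ind_01]. apply INR_le. rewrite mult_INR. easy. }
  assert (Q * eta <= s * (2 * e + eta)) by (replace (s * (2 * e + eta)) with (s * (2 * e * / eta + 1) * eta) by
   (rewrite Rmult_assoc, Rmult_plus_distr_r, Rmult_assoc, Hiee; ring); nra). nra.
 - destruct (nfloor (/ (2 * eta))) as (U & HU1 & HU2). { pos. }
  rewrite Rinv_mult in HU1, HU2. assert (HUe : U * eta <= / 2) by nra. assert (HU3 : 1 <= 4 * U * eta) by nra.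
  assert (HU0 : (1 <= U)%nat) by (destruct U; [simpl in HU3; lra|lia]). set (B := (U * s)%nat). set (K := S (M / B)).
  assert (HKB : (M <= K * B)%nat). { have (Nat.div_mod_eq M B). have (Nat.mod_upper_bound M B ltac:(unfold B; nia)).
   lia. }
  assert (Hsum : Q <= K * (s * (2 * e / eta + 1))). { from H.
   etrans; [apply (rsum_mono_n M (K * B)); [easy|intros; apply ind_01]|]. rewrite rsum_blocks, <- rsum_const.
   termwise b Hb. apply (recurrent_block e c t s z (b * B) U Hs1 ltac:(lra) Hnz HUe). }
  assert (HKR : (K - 1) * (U * s) <= M). { unfold K. rewrite S_INR.
   replace (INR (M / B) + 1 - 1) with (INR (M / B)) by ring. rewrite <- mult_INR, <- mult_INR. apply le_INR.
   rewrite Nat.mul_comm. apply Nat.mul_div_le. lia. }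
  assert (HTR : (T - 1) * s <= M). { unfold T. rewrite S_INR.
   replace (INR (M / s) + 1 - 1) with (INR (M / s)) by ring. rewrite <- mult_INR. apply le_INR. rewrite Nat.mul_comm.
   apply Nat.mul_div_le. lia. }
  assert (Hse : s <= 4 * M * eta). { nra. }
  set (k1 := K - 1) in *. assert (Hk1 : k1 * s <= 4 * eta * M). {
   assert (0 <= k1) by (unfold k1, K; rewrite S_INR; have (pos_INR (M / B)); lra).
   assert (k1 * s * 1 <= k1 * s * (4 * U * eta)) by mono. assert (k1 * (U * s) * (4 * eta) <= M * (4 * eta)) by mono.
   lra. }
  assert (Hf : K * (s * (2 * e / eta + 1)) = (k1 * s + s) * (2 * e * / eta + 1)) by (unfold k1, Rdiv; ring).
  assert (HX : Q * eta <= (k1 * s + s) * (2 * e + eta)). { rhs ((k1 * s + s) * (2 * e * / eta + 1) * eta). nra. }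
  assert (HY : (k1 * s + s) * (2 * e + eta) <= 8 * eta * M * (2 * e) + (4 * eta * M + s) * eta). {
   assert (k1 * s * (2 * e + eta) <= 4 * eta * M * (2 * e + eta)) by mono.
   assert (s * (2 * e) <= 4 * M * eta * (2 * e)) by mono. lra. }
  assert (HZ : Q <= 16 * e * M + 4 * eta * M + s). { apply (Rmult_le_reg_r eta); [easy|]. lra. }
  assert (e * M * 64 <= Q). { rewrite HMD. assert (e * (64 * D) * Q <= 1 * Q) by mono. lra. }
  assert (eta * M <= 2 * e * M) by mono. lra.
Qed.

(* [ispoly k t phi]: the k-th differences of phi are constant, equal to
   t * h1 * ... * hk for steps h1, ..., hk; so t is k! times the leading coefficient. *)
Fixpoint ispoly (k : nat) (t : R) (phi : nat -> R) : Prop :=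
  match k with
  | O => forall n, phi n = t
  | S k' => forall h, ispoly k' (t * INR h) (fun n => phi (n + h)%nat - phi n)
  end.

Lemma ispoly_ext k : forall t phi psi, (forall n, phi n = psi n) -> ispoly k t phi -> ispoly k t psi.
Proof.
 induction k as [|k IH]; simpl; intros t phi psi E H.
 - intros n. rewrite <- E. apply H.
 - intros h. apply (IH _ (fun n => phi (n + h)%nat - phi n)); [|easy]. intros n. now rewrite !E.
Qed.

Lemma ispoly_add k : forall t u phi psi, ispoly k t phi -> ispoly k u psi ->
  ispoly k (t + u) (fun n => phi n + psi n).
Proof.
 induction k as [|k IH]; simpl; intros t u phi psi H1 H2.
 - intros n. now rewrite H1, H2.
 - intros h. rewrite Rmult_plus_distr_r.
  apply (ispoly_ext k _ (fun n => (phi (n + h)%nat - phi n) + (psi (n + h)%nat - psi n))).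
  + intros; ring.
  + pos.
Qed.

Lemma ispoly_scal k : forall c t phi, ispoly k t phi -> ispoly k (c * t) (fun n => c * phi n).
Proof.
 induction k as [|k IH]; simpl; intros c t phi H.
 - intros n. now rewrite H.
 - intros h. rewrite Rmult_assoc. apply (ispoly_ext k _ (fun n => c * (phi (n + h)%nat - phi n))).
  + intros; ring.
  + pos.
Qed.

Lemma ispoly_shift k : forall t a phi, ispoly k t phi -> ispoly k t (fun n => phi (n + a)%nat).
Proof.
 induction k as [|k IH]; simpl; intros t a phi H; [easy|]. intros h.
 apply (ispoly_ext k _ (fun n => phi (n + a + h)%nat - phi (n + a)%nat)).
 - intros n. now replace (n + h + a)%nat with (n + a + h)%nat by lia.
 - apply (IH _ a (fun n => phi (n + h)%nat - phi n)). apply H.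
Qed.

Lemma ispoly_lift k : forall t phi, ispoly k t phi -> ispoly (S k) 0 phi.
Proof.
 induction k as [|k IH]; intros t phi H.
 - intros h n. rewrite !H. ring.
 - intros h. rewrite Rmult_0_l. apply (IH (t * h)). apply H.
Qed.

Lemma ispoly_lift_le k m : forall t phi, (k < m)%nat -> ispoly k t phi -> ispoly m 0 phi.
Proof.
 induction m as [|m IH]; intros t phi Hm H; [lia|]. destruct (Nat.eq_dec k m) as [->|N].
 - now apply (ispoly_lift m t).
 - apply (ispoly_lift m 0). apply (IH t); [lia|easy].
Qed.

Lemma ispoly_affine_mul k : forall t a s phi, ispoly k t phi ->
  ispoly (S k) (INR (S k) * s * t) (fun n => (a + s * n) * phi n).
Proof.
 induction k as [|k IH]; intros t a s phi H.
 - simpl in *. intros h n. rewrite !H, plus_INR. ring.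
 - intros h. rewrite S_INR. lhs (INR (S k) * s * (t * h) + s * h * t).
  apply (ispoly_ext (S k) _ (fun n => (a + s * n) * (phi (n + h)%nat - phi n) + s * h * phi (n + h)%nat)).
  + intros n. inr.
  + apply ispoly_add.
   * pos.
   * apply ispoly_scal. now apply ispoly_shift.
Qed.

Lemma ispoly_affine_pow k a s :
  ispoly k (INR (fact k) * s ^ k) (fun n => (a + s * n) ^ k).
Proof.
 induction k as [|k IH]; [simpl; intros; ring|]. rewrite fact_simpl, mult_INR.
 lhs (INR (S k) * s * (INR (fact k) * s ^ k)) by (simpl; ring).
 apply (ispoly_affine_mul k _ a s (fun n => (a + s * n) ^ k) IH).
Qed.

Lemma ispoly_sum k (c : nat -> R) a s :
  ispoly k (c k * (INR (fact k) * s ^ k)) (fun n => rsum (S k) (fun i => c i * (a + s * n) ^ i)).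
Proof.
 assert (L : forall m, (m <= k)%nat -> ispoly k 0 (fun n => rsum m (fun i => c i * (a + s * n) ^ i))). {
  induction m as [|m IH]; intros Hm.
  - destruct k; [easy|]. apply (ispoly_lift_le 0 _ 0); [lia|easy].
  - replace 0 with (0 + 0) by ring. apply ispoly_add.
   + apply IH; lia.
   + apply (ispoly_lift_le m k (c m * (INR (fact m) * s ^ m))); [lia|]. apply ispoly_scal. apply ispoly_affine_pow. }
 rewrite <- (Rplus_0_l (c k * _)). apply ispoly_add.
 - pos.
 - apply ispoly_scal. apply ispoly_affine_pow.
Qed.

(** Used to make a denominator depending on the index uniform, at the cost of a factor B in the
    density. *)
Lemma pigeonhole n B (P : nat -> Prop) (Q : nat -> nat -> Prop) :
  1 <= B ->
  (forall i, (i < n)%nat -> P i -> exists s, (1 <= s)%nat /\ s <= B /\ Q s i) ->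
  exists s, (1 <= s)%nat /\ s <= B /\
  rsum n (fun i => ind (P i)) <= B * rsum n (fun i => ind (Q s i)).
Proof.
 intros HB H. destruct (nfloor B ltac:(lra)) as (S0 & HS1 & HS2). assert (HS0 : (0 < S0)%nat). {
  destruct S0; [simpl in HS2; lra|lia]. }
 assert (A : rsum n (fun i => ind (P i)) <= rsum S0 (fun s => rsum n (fun i => ind (Q (S s) i)))). {
  rewrite rsum_swap. termwise i Hi. ind_case (P i) as Hp; [|pos]. destruct (H i Hi Hp) as (s & Hs1 & Hs2 & Hs3).
  assert (Hs4 : (s < S S0)%nat) by inr.
  rewrite <- (ind_T (Q (S (s - 1)) i)) by (now replace (S (s - 1)) with s by lia).
  apply (rsum_term_le S0 (s - 1) (fun s => ind (Q (S s) i))); [lia|]. intros; apply ind_01. }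
 set (tot := rsum n (fun i => ind (P i))) in *. assert (HI : 0 < S0) by now apply lt_0_INR.
 destruct (rsum_avg S0 (fun s => rsum n (fun i => ind (Q (S s) i))) (tot / S0) HS0) as (s & Hs & Hs2). {
  replace (S0 * (tot / S0)) with tot by (field; lra). easy. }
 exists (S s). split; [lia|]. split. { upto HS1. mono. }
 apply div_le_inv in Hs2; [|easy]. assert (0 <= rsum n (fun i => ind (Q (S s) i))) by pos. nra.
Qed.

(** Here [T h] will be the correlation at distance h. The values below the threshold account for
    only part of the square, so the other ones, each at most M, are numerous. *)
Lemma many_diagonals D M (T : nat -> R) :
  1 <= D -> 4 * D ^ 2 <= INR M ->
  (forall h, (h < M)%nat -> T h <= INR M) ->
  (INR M / D) ^ 2 <= INR M + 2 * rsum M (fun h => ind (1 <= h)%nat * T h) ->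
  INR M / (4 * D ^ 2) <= rsum M (fun h => ind ((1 <= h)%nat /\ INR M / (8 * D ^ 2) <= T h)).
Proof.
 intros HD HM HT H. set (m := INR M) in *. assert (HD2 : 1 <= D ^ 2) by nra.
 assert (A : rsum M (fun h => ind (1 <= h)%nat * T h) <= rsum M (fun h => m * ind ((1 <= h)%nat /\ m / (8 * D ^ 2) <=
  T h)) + rsum M (fun _ => m / (8 * D ^ 2))). { rewrite <- rsum_plus. termwise h Hh. specialize (HT h Hh).
  assert (0 <= m / (8 * D ^ 2)) by pos. rewrite ind_and.
  destruct (ind_cases (1 <= h)%nat) as [[_ ->]|[_ ->]]; destruct (ind_cases (m / (8 * D ^ 2) <= T h)) as [[Hc ->]|[Hc
   ->]]; try apply Rnot_le_lt in Hc; lra. }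
 rewrite rsum_scal, rsum_const in A. fold m in A. apply Rle_div_l; [nra|].
 assert (E1 : (m / D) ^ 2 * (8 * D ^ 2) = 8 * m ^ 2) by (field; lra).
 assert (E2 : m * (m / (8 * D ^ 2)) * (8 * D ^ 2) = m ^ 2) by (field; lra). nra.
Qed.

(** The induction step common to [weyl] and [recurrence]. The differences of step h yield
    denominators for t h; one denominator s serves for a positive proportion of the h, and then h ->
    s t h is a linear phase that is near integers with density at least D^(-5 C - 4).
    [recurrent_linear] passes from t h to t and divides the error by M. The exponents 5 C arise
    because the case of lower degree is applied with D^5, which exceeds 8 D^2. *)
Lemma diagonal_step C D M e t (P : nat -> Prop) :
  2 <= D -> D ^ (15 * C + 16) <= INR M -> 0 <= e -> e * D ^ (5 * C + 10) <= 1 ->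
  INR M / (4 * D ^ 2) <= rsum M (fun h => ind (P h)) ->
  (forall h, (h < M)%nat -> P h ->
  exists s, (1 <= s)%nat /\ INR s <= D ^ (5 * C) /\ near e (INR s * (t * INR h))) ->
  exists s, (1 <= s)%nat /\ INR s <= D ^ (15 * C + 16) /\ near (e * D ^ (10 * C + 11) / INR M) (INR s * t).
Proof.
 intros HD HM He HeD Hmany HP. assert (P0 : forall a b, (a <= b)%nat -> D ^ a <= D ^ b) by (intros; mono).
 assert (HP0 : forall a, 0 < D ^ a) by (intros; pos).
 assert (HM0 : 1 <= M) by (etrans; [apply (pow_ge_1 D (15 * C + 16)); lra|easy]).
 destruct (pigeonhole M (D ^ (5 * C)) P (fun s h => near e (s * t * h))) as (s & Hs1 & Hs2 & Hs3). { pos. }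
 { intros h Hh Hp. destruct (HP h Hh Hp) as (s & E1 & E2 & E3). exists s. now rewrite Rmult_assoc. }
 destruct (recurrent_linear (D ^ (5 * C + 4)) M e 0 (s * t)) as (s' & F1 & F2 & F3).
 - pos.
 - rewrite <- pow_mult. replace 16 with (2 ^ 4) by ring. etrans; [apply pow2_absorb; lra|]. upto HM; apply P0. lia.
 - split; [easy|]. rewrite <- Rmult_1_l. apply le_div_inv_r. { pos. }
  via (e * D ^ (5 * C + 10)); [|easy]. mul_l. replace 64 with (2 ^ 6) by ring. etrans; [apply pow2_absorb; lra|].
  mono.
 - apply Rle_div_l; [apply HP0|].
  assert (Hq : M / (4 * D ^ 2) <= D ^ (5 * C) * rsum M (fun i => ind (near e (0 + s * t * i)))). { from Hmany.
   from Hs3. right. f_equal. apply rsum_ext. intros. now rewrite Rplus_0_l. }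
  apply div_le_inv in Hq; [|pos].
  replace (D ^ (5 * C + 4)) with (D ^ (5 * C) * (D ^ 2 * D ^ 2)) by (rewrite pow_add; ring).
  assert (4 <= D ^ 2) by nra. nra.
 - exists (s' * s)%nat. split; [nia|]. rewrite mult_INR. split.
  + via (2 * D ^ (5 * C + 4) * D ^ (5 * C)).
   * mono.
   * rewrite Rmult_assoc, <- pow_add. rewrite <- (pow_1 2) at 1. etrans; [apply pow2_absorb; lra|]. mono.
  + rewrite Rmult_assoc. eapply near_le; [|apply F3]. rewrite <- !pow_mult. mul_r. rewrite Rmult_comm. mul_l.
   replace 8 with (2 ^ 3) by ring. etrans; [apply pow2_absorb; lra|]. mono.
Qed.

(** Squaring and differencing lowers the degree. The return from t h to t uses recurrence in h
    instead of a divisor bound, so every loss is a power of D, even when D is bounded. *)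
Lemma weyl k : exists C : nat, forall D M M' t phi,
  2 <= D -> D ^ C <= INR M -> (M' <= M)%nat -> ispoly (S k) t phi ->
  INR M / D <= rsum M' (fun n => cs (phi n)) ->
  exists s, (1 <= s)%nat /\ INR s <= D ^ C /\ near (D ^ C / INR M ^ (S k)) (INR s * t).
Proof.
 induction k as [|k [C IH]].
 - exists 1%nat. intros D M M' t phi HD HM HM' Hp H. exists 1%nat. split; [lia|]. split; [simpl; lra|].
  lhs (/ (M / D)). rewrite Rmult_1_l. apply (linear_sum_near M' (phi 0%nat) t).
  + pos.
  + from H. right. ext n _. f_equal. specialize (Hp n 0%nat). simpl in Hp. lra.
 - exists (15 * C + 16)%nat. intros D M M' t phi HD HM HM' Hp H. set (C' := (15 * C + 16)%nat) in *.
  assert (HM0 : 1 <= M) by (etrans; [apply (pow_ge_1 D C'); lra|easy]).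
  set (T := fun h => rsum (M' - h) (fun n => cs (phi (n + h)%nat - phi n))).
  assert (HT : forall h, (h < M)%nat -> T h <= M). { intros h _. etrans; [apply rsum_le; intros; apply cs_bound|].
   rewrite rsum_const, Rmult_1_r. mono. }
  assert (Hsq : (M / D) ^ 2 <= M + 2 * rsum M (fun h => ind (1 <= h)%nat * T h)). {
   via ((rsum M' (fun n => 1 * cs (phi n))) ^ 2). { apply pow_incr. split; [pos|]. from H. mono. }
   from weighted_square. rewrite rsum_triangle. apply Rplus_le_compat.
   - from (rsum_le _ _ (fun _ => 1)).
    + intros i _. have (cs_bound (phi i - phi i)). lra.
    + rewrite rsum_const, Rmult_1_r. mono.
   - rewrite <- rsum_scal.
    rewrite (rsum_trunc M' M) by (easy || (intros i Hi; unfold T; replace (M' - i)%nat with 0%nat by lia; simpl;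
     ring)). termwise h Hh. right. unfold T. rewrite <- Rmult_assoc, (Rmult_comm 2), Rmult_assoc. f_equal.
    rewrite <- rsum_scal. ext n _. rewrite <- cs_opp, Ropp_minus_distr. ring. }
  assert (H4 : 4 * D ^ 2 <= M). { via (D ^ (2 + 2)); [|upto HM; unfold C'; mono]. replace 4 with (2 ^ 2) by ring.
   now apply pow2_absorb. }
  have (many_diagonals D M T ltac:(lra) H4 HT Hsq) as Hmany. assert (H5 : 8 * D ^ 2 <= D ^ 5). {
   replace 8 with (2 ^ 3) by ring. now apply pow2_absorb. }
  destruct (diagonal_step C D M ((D ^ 5) ^ C / M ^ S k) t (fun h => (1 <= h)%nat /\ M / (8 * D ^ 2) <= T h)) as (s &
   F1 & F2 & F3); auto. { pos. }
  { rewrite <- pow_mult. unfold Rdiv. rewrite (Rmult_comm (D ^ _) (/ _)), Rmult_assoc, <- pow_add, Rmult_comm.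
   apply Rle_div_l; [apply pow_lt; lra|]. rewrite Rmult_1_l. via (M ^ 1).
   - rewrite pow_1. upto HM; mono.
   - mono. }
  { intros h Hh [Hh1 Hh2].
   destruct (IH (D ^ 5) M (M' - h)%nat (t * h) (fun n => phi (n + h)%nat - phi n)) as (s & E1 & E2 & E3).
   - nra.
   - rewrite <- pow_mult. upto HM; mono.
   - lia.
   - easy.
   - upto Hh2. mono.
   - exists s. rewrite pow_mult. easy. }
  exists s. repeat split; auto. eapply near_le; [|apply F3]. rewrite <- pow_mult.
  lhs (D ^ (5 * C + (10 * C + 11)) / M ^ S (S k)) by (rewrite pow_add; simpl; field; split; [apply pow_nonzero;
   lra|lra]). mono.
Qed.

(** The same scheme as for [weyl], with the indicator of a visit in place of the exponential: if n
    and n + h are both visits, the difference of the phase is within 2 e of an integer. *)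
Lemma recurrence k : exists C : nat, forall D M e t phi,
  2 <= D -> D ^ C <= INR M -> 0 <= e -> e * D ^ C <= 1 -> ispoly (S k) t phi ->
  INR M / D <= rsum M (fun n => ind (near e (phi n))) ->
  exists s, (1 <= s)%nat /\ INR s <= D ^ C /\ near (e * D ^ C / INR M ^ (S k)) (INR s * t).
Proof.
 induction k as [|k [C IH]].
 - exists 7%nat. intros D M e t phi HD HM He HeD Hp H. assert (H64 : 64 * D <= D ^ 7). {
   replace 64 with (2 ^ 6) by ring. rewrite <- (pow_1 D) at 1. now apply pow2_absorb. }
  destruct (recurrent_linear D M e (phi 0%nat) t) as (s & F1 & F2 & F3).
  + lra.
  + replace 16 with (2 ^ 4) by ring. etrans; [apply pow2_absorb; lra|]. upto HM; mono.
  + split; [easy|]. rewrite <- Rmult_1_l. apply le_div_inv_r; [lra|]. nra.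
  + from H. right. ext n _. f_equal. f_equal. specialize (Hp n 0%nat). simpl in Hp. lra.
  + exists s. repeat split; auto; [lra|]. eapply near_le; [|apply F3]. rewrite pow_1. mul_r. rewrite Rmult_comm.
   mul_l. replace 8 with (2 ^ 3) by ring. etrans; [apply pow2_absorb; lra|]. mono.
 - exists (15 * C + 16)%nat. intros D M e t phi HD HM He HeD Hp H. set (C' := (15 * C + 16)%nat) in *.
  assert (HM0 : 1 <= M) by (etrans; [apply (pow_ge_1 D C'); lra|easy]). assert (HMk : 1 <= M ^ S k) by pos.
  set (a := fun n => ind (near e (phi n))). set (T := fun h => rsum (M - h) (fun n => a n * a (n + h)%nat)).
  assert (Ha : forall n, 0 <= a n <= 1) by (intros; apply ind_01). assert (HT : forall h, (h < M)%nat -> T h <= M). {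
   intros h _. from (rsum_le _ _ (fun _ => 1)).
   - intros i _. have (Ha i). have (Ha (i + h)%nat). nra.
   - rewrite rsum_const, Rmult_1_r. mono. }
  assert (Hsq : (M / D) ^ 2 <= M + 2 * rsum M (fun h => ind (1 <= h)%nat * T h)). { via ((rsum M a) ^ 2). { mono. }
   lhs (rsum M a * rsum M a). rewrite rsum_mul, rsum_triangle. apply Rplus_le_compat.
   - from (rsum_le _ _ (fun _ => 1)).
    + intros i _. have (Ha i). nra.
    + rewrite rsum_const, Rmult_1_r. lra.
   - rewrite <- rsum_scal. termwise h Hh. right. unfold T. rewrite <- Rmult_assoc, (Rmult_comm 2), Rmult_assoc.
    f_equal. rewrite <- rsum_scal. mono. }
  assert (H4 : 4 * D ^ 2 <= M). { via (D ^ (2 + 2)); [|upto HM; unfold C'; mono]. replace 4 with (2 ^ 2) by ring.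
   now apply pow2_absorb. }
  have (many_diagonals D M T ltac:(lra) H4 HT Hsq) as Hmany. assert (H5 : 8 * D ^ 2 <= D ^ 5). {
   replace 8 with (2 ^ 3) by ring. now apply pow2_absorb. }
  assert (HeP : forall b, (b + 1 <= C')%nat -> 2 * e * D ^ b <= 1). { intros b Hb. via (e * D ^ C'); [|easy].
   lhs (e * (2 * D ^ b)). mul_l. rewrite <- (pow_1 2) at 1. etrans; [apply pow2_absorb; lra|]. mono. }
  destruct (diagonal_step C D M (2 * e * (D ^ 5) ^ C / M ^ S k) t (fun h => (1 <= h)%nat /\ M / (8 * D ^ 2) <= T h))
   as (s & F1 & F2 & F3); auto. { pos. }
  { rewrite <- pow_mult. unfold Rdiv. rewrite (Rmult_comm _ (/ _)), Rmult_assoc, Rmult_assoc, <- pow_add, Rmult_comm.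
   apply Rle_div_l; [lra|]. rewrite Rmult_1_l. via 1; [|easy]. apply HeP. lia. }
  { intros h Hh [Hh1 Hh2].
   destruct (IH (D ^ 5) M (2 * e) (t * h) (fun n => phi (n + h)%nat - phi n)) as (s & E1 & E2 & E3).
   - nra.
   - rewrite <- pow_mult. upto HM; mono.
   - lra.
   - rewrite <- pow_mult. apply HeP. lia.
   - easy.
   - via (T h).
    + upto Hh2. mono.
    + etrans; [|apply (rsum_mono_n (M - h) M); [lia|intros; apply ind_01]]. termwise n _. unfold a.
     rewrite <- ind_and. apply ind_imp. intros [Q1 Q2]. lhs (e + e). now apply near_sub.
   - exists s. rewrite pow_mult. easy. }
  exists s. repeat split; auto. eapply near_le; [|apply F3]. rewrite <- pow_mult.
  lhs (e * (2 * D ^ (5 * C + (10 * C + 11))) / M ^ S (S k)) by (rewrite pow_add; simpl; field; split; [apply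
   pow_nonzero; lra|lra]). mul_r. mul_l. rewrite <- (pow_1 2) at 1. etrans; [apply pow2_absorb; lra|]. mono.
Qed.

Lemma cs_near e x y : near e (x - y) -> Rabs (cs x - cs y) <= 8 * e.
Proof. intros [z Hz]. rewrite <- (cs_period y z). from cs_lip. arg (x - y - IZR z). lra. Qed.

Lemma near_rsum n e x : (forall i, (i < n)%nat -> near (e i) (x i)) -> near (rsum n e) (rsum n x).
Proof.
 induction n as [|n IH]; intros H.
 - exists 0%Z. simpl. rewrite Rminus_0_r, Rabs_R0. lra.
 - apply near_add; [pos|pos].
Qed.

Lemma pow_add_quotient a b i :
  exists Q : nat, ((a + b) ^ i = a ^ i + b * Q /\ Q <= i * (a + b) ^ (i - 1))%nat.
Proof.
 induction i as [|i (Q & H1 & H2)].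
 - exists 0%nat. simpl. lia.
 - exists (a ^ i + (a + b) * Q)%nat. split.
  + rewrite !Nat.pow_succ_r', H1. nia.
  + replace (S i - 1)%nat with i by lia. destruct i as [|i].
   * lia.
   * replace (S i - 1)%nat with i in H2 by lia. rewrite (Nat.pow_succ_r' (a + b)) in *. nia.
Qed.

Lemma const_le_pow (c : nat) D : 2 <= D -> c <= D ^ c.
Proof.
 intros HD. via (2 ^ c); [|mono]. induction c as [|c IH]; [simpl; lra|]. rewrite S_INR. simpl.
 have (pow_ge_1 2 c ltac:(lra)). lra.
Qed.

(** The range is covered by progressions of step s and length B, of total size at most 2 M, and one
    of them does at least as well as the average. [B'] trims the progression that the end of the
    range cuts. *)
Lemma large_on_progression D M L s B (g : nat -> R) :
  2 <= D -> (1 <= s)%nat -> (1 <= B)%nat -> (B * s <= M)%nat -> (L <= M)%nat ->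
  M / D <= rsum L g ->
  exists n0 B', (B' <= B)%nat /\ (forall t, (t < B')%nat -> (n0 + s * t < L)%nat) /\
  B / (2 * D) <= rsum B' (fun t => g (n0 + s * t)%nat).
Proof.
 intros HD Hs HB HBs HL H. set (K := S (L / (B * s))). assert (HK : (L <= K * (B * s))%nat). {
  have (Nat.div_mod_eq L (B * s)). have (Nat.mod_upper_bound L (B * s) ltac:(nia)). nia. }
 set (g' := fun t => ind (t < L)%nat * g t). assert (E : rsum L g = rsum (K * (B * s)) g'). {
  rewrite (rsum_trunc L (K * (B * s))); [|easy|].
  - ext i Hi. unfold g'. rewrite ind_T by easy. ring.
  - intros i Hi. unfold g'. rewrite ind_F by lia. ring. }
 rewrite E, rsum_blocks in H. assert (HBsM : B * s <= M) by (rewrite <- mult_INR; apply le_INR; easy).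
 assert (HKR : K * (B * s) <= 2 * M). { unfold K. rewrite S_INR, Rmult_plus_distr_r.
  assert (INR (L / (B * s)) * (B * s) <= M); [|lra]. rewrite <- !mult_INR. apply le_INR.
  have (Nat.mul_div_le L (B * s) ltac:(nia)). nia. }
 destruct (rsum_avg K (fun b => rsum (B * s) (fun j => g' (b * (B * s) + j)%nat)) (s * (B / (2 * D)))) as (b & Hb &
  Hb2); [pos| |]. { upto H. lhs (K * (B * s) / 2 / D). mono. }
 rewrite rsum_blocks, rsum_swap in Hb2. destruct (rsum_avg s _ (B / (2 * D)) ltac:(lia) Hb2) as (rho & Hr & Hr2).
 set (n0 := (b * (B * s) + rho)%nat).
 assert (Hcut : forall a b, exists B', (B' <= b)%nat /\ forall t, (t < b)%nat -> ((t < B')%nat <-> (a + s * t <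
  L)%nat)). { clear -Hs. intros a b. induction b as [|b IH]; [exists 0%nat; split; [lia|pos]|].
  destruct IH as (B' & H1 & H2). destruct (Nat.lt_ge_cases (a + s * b) L) as [Hl|Hl].
  - exists (S b). split; [lia|]. intros t Ht. nia.
  - exists B'. split; [lia|]. intros t Ht. destruct (Nat.eq_dec t b) as [->|]; [lia|apply H2; lia]. }
 specialize (Hcut n0 B). destruct Hcut as (B' & HB1 & HB2). exists n0, B'. split; [easy|].
 split; [intros t Ht; apply HB2; lia|]. from Hr2. right. rewrite (rsum_trunc B' B); [|easy|].
 - ext t Ht. unfold g'. replace (b * (B * s) + (t * s + rho))%nat with (n0 + s * t)%nat by lia.
  rewrite ind_T by (apply HB2; lia). ring.
 - intros t Ht. unfold g'. replace (b * (B * s) + (t * s + rho))%nat with (n0 + s * t)%nat by lia.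
  rewrite ind_F; [ring|]. rewrite <- HB2 by lia. lia.
Qed.

(** Coefficients are treated from the top. When those of degree above j have a common denominator s,
    the upper part of the polynomial is almost constant modulo 1 on progressions of step s and
    length M / D^C2, so the lower part alone has a large sum there and [weyl] applies to its leading
    coefficient. The constant 32 k^2 enters as the exponent [kap], through n <= D^n. *)
Lemma weyl_peel k u : (u <= k)%nat -> exists C : nat, forall D M (c : nat -> R) m0 L,
  2 <= D -> D ^ C <= INR M -> (m0 + L <= M)%nat ->
  INR M / D <= rsum L (fun t => cs (rsum (S k) (fun i => c i * INR (m0 + t) ^ i))) ->
  exists s, (1 <= s)%nat /\ INR s <= D ^ C /\
  forall i, (k - u < i <= k)%nat -> near (D ^ C / INR M ^ i) (INR s * c i).
Proof.
 induction u as [|u IH]; intros Hu.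
 - exists 0%nat. intros. exists 1%nat. split; [lia|]. split; [easy|]. intros; lia.
 - destruct (IH ltac:(lia)) as [C HC]. assert (Hj : exists j', (k - u = S j')%nat) by (exists (k - u - 1)%nat; lia).
  destruct Hj as [j' Hj']. set (j := (k - u)%nat) in *. destruct (weyl j') as [Cw HW]. set (kap := (32 * k * k)%nat).
  set (C2 := (C + kap + 1)%nat).
  set (C3 := (3 * Cw + (C2 + 1) * j + fact j + C * j + C + C2 + 3 * Cw * (C2 + 4) + 1)%nat). exists C3.
  intros D M c m0 L HD HM HmL H. assert (HP0 : forall a, 0 < D ^ a) by (intros; pos).
  assert (HP1 : forall a, 1 <= D ^ a) by (intros; pos).
  assert (HMC : forall a, (a <= C3)%nat -> D ^ a <= M) by (intros a Ha; via (D ^ C3); [apply pow_mono; [pos|exact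
   Ha]|exact HM]). assert (HM0 : 1 <= M) by (specialize (HMC 0%nat ltac:(lia)); simpl in HMC; lra).
  destruct (HC D M c m0 L HD ltac:(apply HMC; unfold C3; lia) HmL H) as (s & Hs1 & Hs2 & Hs3).
  destruct (nfloor (M / D ^ C2)) as (B & HB1 & HB2). { pos. }
  assert (HB1' : 1 <= M / D ^ C2). { apply Rle_div_r; [apply HP0|]. rewrite Rmult_1_l. apply HMC. lia. }
  assert (HB0 : (1 <= B)%nat). { destruct B; [simpl in HB2; lra|lia]. }
  assert (HBR : 1 <= B) by inr. assert (HBD : B * D ^ C2 <= M) by (apply le_div_inv; [pos|easy]).
  assert (HBs : (B * s <= M)%nat). { apply INR_le. rewrite mult_INR. upto HBD. mono. }
  set (ph := fun n => rsum (S k) (fun i => c i * n ^ i)).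
  destruct (large_on_progression D M L s B (fun t => cs (ph (m0 + t)%nat)) HD Hs1 HB0 HBs ltac:(lia) H) as (n1 & B' &
   HB' & Hn1 & Hcell). set (n0 := (m0 + n1)%nat).
  set (hi := fun n => rsum (k - j) (fun i => c (S j + i)%nat * n ^ (S j + i))).
  set (lo := fun n => rsum (S j) (fun i => c i * n ^ i)). assert (Eph : forall n, ph n = lo n + hi n). { intros n.
   unfold ph, lo, hi. replace (S k) with (S j + (k - j))%nat by lia. apply rsum_split. }
  (* The difference of the e-th powers is s t Q with Q <= k M^(e-1). Hence the error D^C / M^e of s
     c_e is multiplied by t Q and stays below k D^C B / M. *)
  assert (Hhi : forall t, (t < B')%nat -> near (/ (32 * D)) (hi (n0 + s * t)%nat - hi n0)). { intros t Ht. unfold hi.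
   rewrite <- rsum_minus. apply near_le with (rsum (k - j) (fun _ => k * D ^ C * B / M)).
   - rewrite rsum_const, <- Rmult_1_l. apply le_div_inv_r; [lra|]. via (k * (k * D ^ C * B / M) * (32 * D)). { mono. }
    lhs ((kap * (B * D ^ (C + 1))) / M) by (unfold kap; rewrite !mult_INR, pow_add; simpl (INR 32); field; lra).
    apply Rle_div_l; [lra|]. rewrite Rmult_1_l. upto HBD. via (D ^ kap * (B * D ^ (C + 1))). {
     apply Rmult_le_compat_r; [|now apply const_le_pow]. pos. }
    right. replace C2 with (kap + (C + 1))%nat by lia. rewrite (pow_add D kap). ring.
   - apply near_rsum. intros i Hi. set (e := (S j + i)%nat).
    destruct (pow_add_quotient n0 (s * t) e) as (Q & Q1 & Q2). destruct (Hs3 e ltac:(unfold e; lia)) as [z Hz].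
    exists (Z.of_nat (t * Q) * z)%Z. rewrite mult_IZR, <- INR_IZR_INZ, <- !pow_INR, Q1, plus_INR, !mult_INR.
    arg (t * Q * (s * c e - IZR z)). rewrite !Rabs_mult, !Rabs_right by pos. assert (HQ : Q <= k * M ^ (e - 1)). {
     rewrite <- pow_INR, <- mult_INR. apply le_INR. specialize (Hn1 t Ht).
     assert ((n0 + s * t) ^ (e - 1) <= M ^ (e - 1))%nat by (apply Nat.pow_le_mono_l; unfold n0; lia). nia. }
    via (B * (k * M ^ (e - 1)) * (D ^ C / M ^ e)). { mono. }
    right. replace e with (S (e - 1)) at 2 by lia. simpl. field. split; [lra|]. pos. }
  assert (Hcell2 : B / D ^ 3 <= rsum B' (fun t => cs (hi n0 + lo (n0 + s * t)%nat))). {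
   via (B / (2 * D) - B' * (8 * / (32 * D))).
   - assert (B' <= B) by mono. via (B / (4 * D)).
    + mul_l. apply Rinv_le_contravar; [lra|]. nra.
    + lhs (B / (2 * D) - B * (8 * / (32 * D))). assert (0 < / (32 * D)) by pos. nra.
   - rewrite <- rsum_const.
    assert (rsum B' (fun t => cs (ph (m0 + (n1 + s * t))%nat)) - rsum B' (fun _ => 8 * / (32 * D)) <= rsum B' (fun t
     => cs (hi n0 + lo (n0 + s * t)%nat))); [|lra]. rewrite <- rsum_minus. termwise t Ht.
    replace (m0 + (n1 + s * t))%nat with (n0 + s * t)%nat by lia.
    assert (Hd : Rabs (cs (ph (n0 + s * t)%nat) - cs (hi n0 + lo (n0 + s * t)%nat)) <= 8 * / (32 * D)). {
     apply cs_near. rewrite Eph. rhs (hi (n0 + s * t)%nat - hi n0). pos. }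
    apply Rabs_le_between in Hd. lra. }
  destruct (HW (D ^ 3) B B' (c j * (INR (fact j) * s ^ j)) (fun t => hi n0 + lo (n0 + s * t)%nat)) as (s' & G1 & G2 &
   G3); auto. { nra. }
  { rewrite <- pow_mult. assert (D ^ (3 * Cw) + 1 <= M / D ^ C2); [|lra]. apply Rle_div_r; [apply HP0|].
   via (D ^ (3 * Cw + 1) * D ^ C2).
   - mul_r. rewrite pow_add, pow_1. specialize (HP1 (3 * Cw)%nat). nra.
   - rewrite <- pow_add. apply HMC. lia. }
  { rewrite <- Hj', <- (Rplus_0_l (c j * _)). apply ispoly_add.
   - apply (ispoly_lift_le 0 _ (hi n0)); [lia|]. easy.
   - apply (ispoly_ext j _ (fun n => rsum (S j) (fun i => c i * (n0 + s * n) ^ i))).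
    + intros n. unfold lo. inr.
    + apply ispoly_sum. }
  rewrite <- pow_mult in G2, G3. exists (s' * (fact j * s ^ j))%nat. have (lt_O_fact j) as Hf.
  assert (Hsj : (1 <= s ^ j)%nat) by (assert (s ^ j <> 0)%nat by (apply Nat.pow_nonzero; lia); lia). split; [nia|].
  rewrite !mult_INR, pow_INR. assert (HsC : s ^ j <= D ^ (C * j)). { rewrite pow_mult. mono. }
  split. { via (D ^ (3 * Cw) * (D ^ (fact j) * D ^ (C * j))).
   - apply Rmult_le_compat; auto; try apply pos_INR.
    + pos.
    + apply Rmult_le_compat; auto; try apply pos_INR; [pos|]. now apply const_le_pow.
   - rewrite <- !pow_add. mono. }
  intros i Hi. destruct (Nat.eq_dec i j) as [->|Nij].
  + rhs (s' * (c j * (INR (fact j) * s ^ j))). eapply near_le; [|apply G3]. assert (HBM : M <= B * D ^ (C2 + 1)). {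
    rewrite pow_add, pow_1. apply Rlt_le in HB2. apply div_le_inv in HB2; [|pos]. from HB2. rhs (B * D * D ^ C2).
    mul_r. nra. }
   apply Rle_div_l; [apply pow_lt; lra|]. unfold Rdiv. rewrite Rmult_assoc, (Rmult_comm (/ _)), <- Rmult_assoc.
   apply le_div_inv_r; [pos|]. via (D ^ (3 * Cw) * (B * D ^ (C2 + 1)) ^ j). { mono. }
   rewrite Rpow_mult_distr, <- pow_mult. lhs (D ^ (3 * Cw + (C2 + 1) * j) * B ^ j) by (rewrite pow_add; ring). mono.
  + have (near_mul _ _ (s' * (fact j * s ^ (j - 1))) (Hs3 i ltac:(lia))) as Hn.
   replace (INR (s' * (fact j * s ^ (j - 1))) * (s * c i)) with (s' * (INR (fact j) * s ^ j) * c i) in Hn. 2:{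
    rewrite !mult_INR, pow_INR. replace j with (S (j - 1)) at 2 by lia. simpl. ring. }
   eapply near_le; [|apply Hn]. unfold Rdiv. rewrite <- Rmult_assoc. mul_r. rewrite !mult_INR, pow_INR.
   via (D ^ (3 * Cw) * (D ^ (fact j) * D ^ (C * j)) * D ^ C).
   * mul_r. apply Rmult_le_compat; auto; try apply pos_INR.
    -- pos.
    -- apply Rmult_le_compat; auto; try apply pos_INR; [pos|now apply const_le_pow|]. upto HsC. mono.
   * rewrite <- !pow_add. mono.
Qed.

Lemma weyl_all k : exists C : nat, forall D M (c : nat -> R) m0 L,
  2 <= D -> D ^ C <= INR M -> (m0 + L <= M)%nat ->
  INR M / D <= rsum L (fun t => cs (rsum (S k) (fun i => c i * INR (m0 + t) ^ i))) ->
  exists s, (1 <= s)%nat /\ INR s <= D ^ C /\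
  forall i, (1 <= i <= k)%nat -> near (D ^ C / INR M ^ i) (INR s * c i).
Proof.
 destruct (weyl_peel k k ltac:(lia)) as [C HC]. exists C. intros D M c m0 L H1 H2 H3 H4.
 destruct (HC D M c m0 L H1 H2 H3 H4) as (s & G1 & G2 & G3). exists s. repeat split; auto. intros i Hi. apply G3. lia.
Qed.

(** * Phases with real exponents *)

Fixpoint fall (b : R) (e : nat) : R :=
  match e with O => 1 | S e' => fall b e' * (b - e') end.

Definition nonint (b : R) : Prop := forall z : Z, b <> IZR z.

Lemma fall_neq_0 b e : nonint b -> fall b e <> 0.
Proof.
 intros H. induction e as [|e IH]; simpl; [lra|]. apply Rmult_integral_contrapositive_currified; [easy|]. intros E.
 apply (H (Z.of_nat e)). rewrite <- INR_IZR_INZ. lra.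
Qed.

Lemma is_derive_Rpower b x : 0 < x -> is_derive (fun x => Rpower x b) x (b * Rpower x (b - 1)).
Proof. intros Hx. apply is_derive_Reals. now apply derivable_pt_lim_power. Qed.

Lemma is_derive_n_Rpower b e : forall x, 0 < x ->
  is_derive_n (fun x => Rpower x b) e x (fall b e * Rpower x (b - e)).
Proof.
 induction e as [|e IH]; intros x Hx.
 - simpl. rewrite Rminus_0_r. ring.
 - rewrite S_INR. change (fall b (S e)) with (fall b e * (b - e)).
  apply (is_derive_ext_loc (fun y => fall b e * Rpower y (b - e))).
  + exists (mkposreal x Hx). intros y Hy. change (Rabs (y - x) < x) in Hy. apply Rabs_lt_between in Hy. symmetry.
   apply is_derive_n_unique, IH. lra.
  + rhs (fall b e * ((b - e) * Rpower x (b - e - 1))) by (replace (b - (e + 1)) with (b - e - 1) by ring; ring).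
   apply is_derive_scal. now apply is_derive_Rpower.
Qed.

Lemma Rpower_decr x y b : 0 < x <= y -> b <= 0 -> Rpower y b <= Rpower x b.
Proof.
 intros [Hx Hy] Hb. unfold Rpower. destruct (Rle_lt_or_eq_dec _ _ Hy) as [Hlt|<-]; [|lra].
 assert (ln x < ln y) by now apply ln_increasing. assert (b * ln y <= b * ln x) by nra.
 destruct H0 as [H0| ->]; [left; now apply exp_increasing|lra].
Qed.

Lemma Rpower_incr x y b : 0 < x <= y -> 0 <= b -> Rpower x b <= Rpower y b.
Proof. intros [Hx Hy] Hb. apply Rle_Rpower_l; lra. Qed.

Lemma sum_f_R0_rsum n f : sum_f_R0 f n = rsum (S n) f.
Proof. induction n as [|n IH]; [simpl; ring|]. simpl sum_f_R0. rewrite IH. easy. Qed.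

(** Since b <= K + 1, the power in the Lagrange remainder is decreasing, so its value at the left
    end point bounds it. *)
Lemma taylor_Rpower b K x t : 0 < x -> 0 <= t -> b <= INR (S K) ->
  Rabs (Rpower (x + t) b
  - rsum (S K) (fun e => fall b e / INR (fact e) * Rpower x (b - e) * t ^ e))
  <= Rabs (fall b (S K)) * Rpower x (b - INR (S K)) * t ^ (S K).
Proof.
 intros Hx Ht Hb. destruct (Rle_lt_or_eq_dec _ _ Ht) as [Ht'|<-].
 - destruct (Taylor_Lagrange (fun x => Rpower x b) K x (x + t)) as (z & Hz & E); [lra| |]. { intros y Hy k _.
   destruct k; [easy|]. destruct (is_derive_n_Rpower b (S k) y) as [? ?]; [lra|].
   exists (fall b (S k) * Rpower y (b - INR (S k))). easy. }
  rewrite E, sum_f_R0_rsum. replace (x + t - x) with t by ring.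
  rewrite (rsum_ext (S K) (fun e => fall b e / INR (fact e) * Rpower x (b - e) * t ^ e) (fun e => t ^ e / INR (fact e)
   * Derive_n (fun x => Rpower x b) e x)). 2:{ intros e _.
   rewrite (is_derive_n_unique _ _ _ _ (is_derive_n_Rpower b e x Hx)). lra. }
  match goal with |- Rabs (?u + ?v - ?u) <= _ => replace (u + v - u) with v by ring end.
  rewrite (is_derive_n_unique _ _ _ _ (is_derive_n_Rpower b (S K) z ltac:(lra))), !Rabs_mult.
  have (Rpower_pos z (b - INR (S K))). rewrite (Rabs_right (Rpower _ _)) by lra. assert (Hp : 0 <= t ^ S K) by pos.
  assert (Hf : 1 <= INR (fact (S K))) by (apply (le_INR 1), lt_O_fact).
  assert (Rabs (t ^ S K / INR (fact (S K))) <= t ^ S K). { rewrite Rabs_right by pos. apply Rle_div_l; nra. }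
  assert (Rpower z (b - INR (S K)) <= Rpower x (b - INR (S K))) by (apply Rpower_decr; lra).
  rewrite (Rmult_comm (_ * _) (t ^ _)). mono.
 - rewrite Rplus_0_r, rsum_first. simpl (fall b 0). simpl (0 ^ 0). simpl (fact 0).
  rewrite Rminus_0_r, rsum_zero by (intros; simpl; ring). simpl (INR 1).
  replace (Rpower x b - (1 / 1 * Rpower x b * 1 + 0)) with 0 by field. rewrite Rabs_R0. pos.
Qed.

Lemma lipschitz_Rpower b M x t : 0 < M -> M <= x -> 0 <= t -> x + t <= 4 * M ->
  Rabs (Rpower (x + t) b - Rpower x b) <= Rabs b * Rpower 4 (Rabs b + 1) * Rpower M b * (t / M).
Proof.
 intros HM Hx Ht Hxt. destruct (Rle_lt_or_eq_dec _ _ Ht) as [Ht'|<-].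
 - destruct (MVT_gen (fun x => Rpower x b) x (x + t) (fun y => b * Rpower y (b - 1))) as (z & Hz & E). { intros y.
   rewrite Rmin_left, Rmax_right by lra. intros Hy. apply is_derive_Rpower. lra. }
  { intros y. rewrite Rmin_left, Rmax_right by lra. intros Hy.
   apply continuity_pt_filterlim, (ex_derive_continuous (fun x => Rpower x b)). eexists. apply is_derive_Rpower. lra. }
  rewrite Rmin_left, Rmax_right in Hz by lra. rewrite E. replace (x + t - x) with t by ring.
  rewrite !Rabs_mult, (Rabs_right t) by lra. have (Rpower_pos z (b - 1)). rewrite (Rabs_right (Rpower z _)) by lra.
  assert (Hz2 : Rpower z (b - 1) <= Rpower 4 (Rabs b + 1) * Rpower M (b - 1)). {
   assert (H4 : 1 <= Rpower 4 (Rabs b + 1)). { via (Rpower 4 0); [rewrite Rpower_O; lra|]. mono. }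
   destruct (Rle_lt_dec (b - 1) 0).
   - via (Rpower M (b - 1)); [apply Rpower_decr; lra|]. mono.
   - via (Rpower (4 * M) (b - 1)); [apply Rpower_incr; lra|]. rewrite <- Rpower_mult_distr by lra. mul_r.
    apply Rle_Rpower; [lra|]. have (Rle_abs b). lra. }
  replace (Rabs b * Rpower 4 (Rabs b + 1) * Rpower M b * (t / M)) with (Rabs b * (Rpower 4 (Rabs b + 1) * Rpower M (b
   - 1)) * t).
  + mono.
  + replace (Rpower M b) with (Rpower M (b - 1) * M); [field; lra|]. rewrite <- (Rpower_1 M) at 2 by lra.
   rewrite <- Rpower_plus. f_equal. ring.
 - rewrite Rplus_0_r. unfold Rminus. rewrite Rplus_opp_r, Rabs_R0. lra.
Qed.

Lemma ispoly_rsum m k : forall t (phi : nat -> nat -> R), (forall j, (j < m)%nat -> ispoly k (t j) (phi j)) ->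
  ispoly k (rsum m t) (fun n => rsum m (fun j => phi j n)).
Proof.
 induction m as [|m IH]; intros t phi H.
 - destruct k; [easy|]. apply (ispoly_lift_le 0 _ 0); [lia|easy].
 - apply ispoly_add.
  + pos.
  + pos.
Qed.

Lemma INR_Rpower_pow x n : 0 < x -> Rpower x (INR n) = x ^ n.
Proof. apply Rpower_pow. Qed.

(** A polynomial part and m real powers with separate coefficients: substituting x n for x, and
    subtracting two such phases, changes the coefficients but not the exponents. *)
Definition gph (k : nat) (c : nat -> R) (m : nat) (g b : nat -> R) (x : R) : R :=
  rsum (S k) (fun i => c i * x ^ i) + rsum m (fun j => g j * Rpower x (b j)).

Lemma pow2_exceeds x : exists a : nat, x <= 2 ^ a.
Proof.
 destruct (Rle_lt_dec x 0); [exists 0%nat; simpl; lra|]. destruct (nfloor x ltac:(lra)) as (n & H1 & H2).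
 exists (S n). have (const_le_pow (S n) 2 ltac:(lra)). rewrite S_INR in H. lra.
Qed.

Lemma Rpower_minus_nat x b n : 0 < x -> Rpower x (b - INR n) = Rpower x b / x ^ n.
Proof. intros Hx. unfold Rminus. rewrite Rpower_plus, Rpower_Ropp, Rpower_pow by easy. easy. Qed.

Lemma pow_le_reg x y n : 0 <= y -> x ^ (S n) <= y ^ (S n) -> x <= y.
Proof.
 intros Hy H. apply Rnot_lt_le. intros Hlt. assert (y ^ S n < x ^ S n); [|lra]. induction n as [|n IH]; [pos|].
 rewrite <- !tech_pow_Rmult. rewrite <- !tech_pow_Rmult in IH. assert (0 <= y * y ^ n) by pos. nra.
Qed.

(** Some window of length W keeps a sum W / (8 D). An approximation of the phase to within 1 / (128
    D) changes each cosine by at most 1 / (16 D), so half of the sum survives. *)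
Lemma core_window D M m0 L W (ph : R -> R) (err : R) (app : nat -> nat -> R) :
  2 <= D -> (1 <= W)%nat -> (W <= M)%nat -> (m0 + L <= 4 * M)%nat ->
  M / D <= rsum L (fun t => cs (ph (INR (m0 + t)))) ->
  (forall n0 t, (t <= W)%nat -> (m0 <= n0)%nat -> (n0 + t <= 4 * M)%nat ->
  Rabs (ph (INR (n0 + t)) - app n0 t) <= / (128 * D)) ->
  exists n0 B', (B' <= W)%nat /\ (m0 <= n0)%nat /\ (n0 + B' <= 4 * M)%nat /\
  W / (16 * D) <= rsum B' (fun t => cs (app n0 t)).
Proof.
 intros HD HW1 HW2 HL H Happ.
 destruct (large_on_progression (4 * D) (4 * M) L 1 W (fun t => cs (ph (INR (m0 + t))))) as (n1 & B' & HB & Hn & Hc);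
  try lia; try lra. { upto H. rewrite mult_INR. simpl (INR 4). right. field. lra. }
 exists (m0 + n1)%nat, (Nat.min B' (L - n1))%nat. assert (HB2 : (B' = 0 \/ n1 + B' <= L)%nat). { destruct B'; [lia|].
  specialize (Hn B' ltac:(lia)). lia. }
 destruct HB2 as [HB2|HB2]. { subst. simpl in Hc. assert (0 < W / (2 * (4 * D))); [|lra]. pos. }
 replace (Nat.min B' (L - n1)) with B' by lia. repeat split; try lia.
 via (W / (2 * (4 * D)) - B' * (8 * / (128 * D))).
 - assert (B' <= W) by mono. lhs (W / (2 * (4 * D)) - W * (8 * / (128 * D))). assert (0 < / (128 * D)) by pos. nra.
 - rewrite <- rsum_const.
  assert (rsum B' (fun t => cs (ph (INR (m0 + (n1 + 1 * t))))) - rsum B' (fun _ => 8 * / (128 * D)) <= rsum B' (fun t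
   => cs (app (m0 + n1)%nat t))); [|lra]. rewrite <- rsum_minus. termwise t Ht.
  specialize (Happ (m0 + n1)%nat t ltac:(lia) ltac:(lia) ltac:(lia)).
  replace (m0 + (n1 + 1 * t))%nat with (m0 + n1 + t)%nat by lia.
  have (cs_lip (ph (INR (m0 + n1 + t))) (app (m0 + n1)%nat t)) as Hl. apply Rabs_le_between in Hl. lra.
Qed.

(** Power terms of size at most D^C1 vary slowly: on windows of length M / D^C2 they are constant up
    to the tolerance, and a purely polynomial sum remains. *)
Lemma core_poly k m b C1 : exists C : nat, forall D M c g m0 L,
  2 <= D -> D ^ C <= INR M -> (M <= m0)%nat -> (m0 + L <= 4 * M)%nat ->
  (forall j, (j < m)%nat -> Rabs (g j) * Rpower (INR M) (b j) <= D ^ C1) ->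
  INR M / D <= rsum L (fun t => cs (gph k c m g b (INR (m0 + t)))) ->
  exists s, (1 <= s)%nat /\ INR s <= D ^ C /\
  forall i, (1 <= i <= k)%nat -> near (D ^ C / INR M ^ i) (INR s * c i).
Proof.
 destruct (weyl_all k) as [Ca HCa]. set (A3 := rsum m (fun j => Rabs (b j) * Rpower 4 (Rabs (b j) + 1))).
 destruct (pow2_exceeds A3) as [a Ha]. set (C2 := (C1 + a + 8)%nat). exists ((C2 + 8) * Ca + C2 + 8)%nat.
 intros D M c g m0 L HD HM HmM HmL Hg H. assert (HP0 : forall a, 0 < D ^ a) by (intros; pos).
 assert (HMC : forall e, (e <= (C2 + 8) * Ca + C2 + 8)%nat -> D ^ e <= M) by (intros e He; upto HM; apply pow_mono;
  [pos|easy]). assert (HM0 : 1 <= M) by (specialize (HMC 0%nat ltac:(lia)); simpl in HMC; lra).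
 destruct (nfloor (M / D ^ C2)) as (W & HW1 & HW2); [pos|].
 assert (HW3 : 1 <= M / D ^ C2) by (apply Rle_div_r; [apply HP0|]; rewrite Rmult_1_l; apply HMC; nia).
 assert (HW : (1 <= W)%nat) by (destruct W; [simpl in HW2; lra|lia]). apply le_div_inv in HW1; [|pos].
 assert (HWM : (W <= M)%nat). { apply INR_le. have (pow_ge_1 D C2 ltac:(lra)). nra. }
 destruct (core_window D M m0 L W (gph k c m g b) (/ (128 * D)) (fun n0 t => rsum m (fun j => g j * Rpower n0 (b j)) +
  rsum (S k) (fun i => c i * INR (n0 + t) ^ i))) as (n0 & B' & HB1 & HB2 & HB3 & HB4); auto. { intros n0 t Ht Hn0 Hnt.
  unfold gph.
  match goal with |- Rabs (?p + ?u - (?v + ?p)) <= _ => replace (p + u - (v + p)) with (u - v) by ring end.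
  rewrite <- rsum_minus. from rsum_abs.
  via (rsum m (fun j => (Rabs (b j) * Rpower 4 (Rabs (b j) + 1)) * (D ^ C1 * (t / M)))).
  - termwise j Hj. rewrite <- Rmult_minus_distr_l, Rabs_mult, plus_INR.
   have (lipschitz_Rpower (b j) (INR M) (INR n0) (INR t)) as HL.
   assert (Hl := HL ltac:(lra) ltac:(apply le_INR; lia) (pos_INR t) ltac:(rewrite <- plus_INR; replace (4 * M) with
    (INR (4 * M)) by (rewrite mult_INR; simpl; ring); apply le_INR; lia)).
   via (Rabs (g j) * (Rabs (b j) * Rpower 4 (Rabs (b j) + 1) * Rpower M (b j) * (t / M))). { mono. }
   lhs ((Rabs (b j) * Rpower 4 (Rabs (b j) + 1)) * ((Rabs (g j) * Rpower M (b j)) * (t / M))). mono.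
  - rewrite rsum_scalr. assert (HtM : t / M <= / D ^ C2). { apply Rle_div_l; [lra|]. rewrite Rmult_comm.
    apply le_div_inv_r; [pos|]. upto HW1. mono. }
   assert (HA : A3 <= D ^ a) by (from Ha; apply pow_incr; lra). via (D ^ a * (D ^ C1 * / D ^ C2)). { mono. }
   unfold C2. rewrite !pow_add. replace (D ^ a * (D ^ C1 * / (D ^ C1 * D ^ a * D ^ 8))) with (/ D ^ 8). 2:{
    have (HP0 a). have (HP0 C1). field; lra. }
   apply Rinv_le_contravar; [lra|]. replace 128 with (2 ^ 7) by ring. rewrite <- (pow_1 D) at 1.
   now apply pow2_absorb. }
 destruct (HCa (D ^ (C2 + 8)) (4 * M)%nat (fun i => if Nat.eq_dec i 0 then c 0%nat + rsum m (fun j => g j * Rpower n0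
  (b j)) else c i) n0 B') as (s & Hs1 & Hs2 & Hs3); auto. { via (D ^ 1); [lra|mono]. }
 { rewrite <- pow_mult, mult_INR. via (INR M); [apply HMC; lia|]. inr. }
 { via (W / (16 * D)).
  - via (M / D ^ C2 / 2 / (16 * D)).
   + rewrite mult_INR. replace (INR 4) with 4 by inr. rewrite pow_add. have (HP0 C2). rhs (M / (D ^ C2 * (32 * D))).
    lhs (M / (D ^ C2 * (D ^ 8 / 4))). mul_l. apply Rinv_le_contravar; [pos|]. mul_l. apply le_div; [lra|].
    lhs (2 ^ 7 * D ^ 1). now apply pow2_absorb.
   + mul_r. assert (1 <= W) by inr. lra.
  - from HB4. right. ext t _. f_equal. rewrite !rsum_first. simpl. ring. }
 rewrite <- pow_mult in Hs2, Hs3. exists s. split; [easy|]. split; [etrans; [mono|mono]|]. intros i Hi.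
 specialize (Hs3 i Hi). destruct (Nat.eq_dec i 0); [lia|]. eapply near_le; [|apply Hs3]. mono.
Qed.

(** On a window the power terms are expanded to degree K, which exceeds k, so the coefficient of
    degree K comes from them alone. It has order G / M^K, because the exponent of the dominant term
    is not an integer and the other terms are smaller by the factor [kap]. [weyl] then forces this
    coefficient to be tiny unless G is a power of D. *)
Lemma core_frac k m b K : (k < K)%nat -> (0 < m)%nat -> nonint (b 0%nat) ->
  (forall j, (j < m)%nat -> b j <= INR K) ->
  exists (C : nat) (kap : R), 0 < kap /\ forall D M c g m0 L,
  2 <= D -> D ^ C <= INR M -> (M <= m0)%nat -> (m0 + L <= 4 * M)%nat ->
  let G := Rabs (g 0%nat) * Rpower (INR M) (b 0%nat) in
  (forall j, (1 <= j < m)%nat -> Rabs (g j) * Rpower (INR M) (b j) <= kap * G) ->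
  G <= INR M ^ (K - 1) ->
  INR M / D <= rsum L (fun t => cs (gph k c m g b (INR (m0 + t)))) ->
  G <= D ^ C.
Proof.
 intros HkK Hm Hb0 HbK. assert (HK' : exists K', K = S K') by (exists (K - 1)%nat; lia). destruct HK' as [K' EK].
 destruct (weyl K') as [Cw HCw]. set (A := rsum m (fun j => Rabs (fall (b j) (S K)))).
 set (A2 := rsum m (fun j => Rabs (fall (b j) K))). set (c0 := Rabs (fall (b 0%nat) K) * Rpower 4 (b 0%nat - K)).
 assert (Hc0 : 0 < c0) by (apply Rmult_lt_0_compat; [apply Rabs_pos_lt, fall_neq_0, Hb0|apply Rpower_pos]).
 assert (HA : 0 <= A) by (apply rsum_nonneg; intros; apply Rabs_pos).
 assert (HA2 : 0 <= A2) by (apply rsum_nonneg; intros; apply Rabs_pos).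
 destruct (pow2_exceeds (A + A2 + / c0)) as [a Ha]. assert (Hic0 : 0 < / c0) by now apply Rinv_0_lt_compat.
 set (kap := Rmin 1 (c0 / (2 * (A2 + 1)))).
 assert (Hkap : 0 < kap) by (apply Rmin_pos; [lra|apply Rdiv_lt_0_compat; lra]). set (C' := (5 * Cw + 3)%nat).
 set (E := (5 * Cw + a + 1 + K)%nat). set (C := (C' * S K + a + 8 + E * S K + (a + 8) * K + 5 * Cw + a + 2)%nat).
 exists C, kap. split; [easy|]. intros D M c g m0 L HD HM HmM HmL G Hg HG H. subst K. set (K := S K') in *.
 assert (HP0 : forall a, 0 < D ^ a) by (intros; pos). assert (HP1 : forall a, 1 <= D ^ a) by (intros; pos).
 assert (HMC : forall e, (e <= C)%nat -> D ^ e <= M) by (intros e He; upto HM; apply pow_mono; [pos|easy]).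
 assert (HM0 : 1 <= M) by (specialize (HMC 0%nat ltac:(lia)); simpl in HMC; lra).
 assert (HDa : A + A2 + / c0 <= D ^ a) by (from Ha; apply pow_incr; lra). apply Rnot_lt_le. intros HGC.
 (* The window length is M / y with y^(K+1) = D^(a+8) G, the longest for which the Taylor remainder,
    of order G (W / M)^(K+1), stays below the tolerance. *)
 assert (HG0 : 1 <= G) by (specialize (HP1 C); lra). set (Y := D ^ (a + 8) * G). set (y := Rpower Y (/ INR (S K))).
 assert (HY : 1 <= Y) by (unfold Y; specialize (HP1 (a + 8)%nat); nra). assert (HyK : y ^ (S K) = Y). { unfold y.
  rewrite <- Rpower_pow by apply Rpower_pos. rewrite Rpower_mult, Rinv_l.
  - apply Rpower_1; lra.
  - pos. }
 assert (Hy0 : 0 < y) by apply Rpower_pos. assert (Hy1 : 1 <= y). { apply (pow_le_reg 1 y K); [lra|]. rewrite pow1.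
  lra. }
 assert (HMy : D ^ C' <= M / y). { apply (pow_le_reg _ _ K); [pos|]. unfold Rdiv.
  rewrite Rpow_mult_distr, pow_inv, HyK, <- pow_mult. apply le_div; [lra|]. unfold Y. via (M * (M * M ^ (K - 1))).
  - rewrite <- Rmult_assoc. apply Rmult_le_compat; auto; try lra.
   + pos.
   + rewrite <- pow_add. apply HMC. lia.
   + nra.
  - unfold K. replace (S K' - 1)%nat with K' by lia. easy. }
 destruct (nfloor (M / y)) as (W & HW1 & HW2); [pos|]. assert (HWD : D ^ (5 * Cw + 2) <= W). {
  assert (D ^ (5 * Cw + 2) + 1 <= D ^ C'); [|lra]. unfold C'.
  replace (5 * Cw + 3)%nat with (5 * Cw + 2 + 1)%nat by lia. rewrite (pow_add D (5 * Cw + 2) 1), pow_1.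
  specialize (HP1 (5 * Cw + 2)%nat). nra. }
 assert (HW0 : 1 <= W) by (specialize (HP1 (5 * Cw + 2)%nat); lra). assert (HW : (1 <= W)%nat) by inr.
 apply le_div_inv in HW1; [|easy]. assert (HWM : (W <= M)%nat) by (apply INR_le; nra).
 set (app := fun n0 t => rsum (S k) (fun i => c i * (n0 + 1 * t) ^ i) + rsum m (fun j => g j * rsum (S K) (fun e =>
  (fall (b j) e / INR (fact e) * Rpower n0 (b j - e)) * (0 + 1 * t) ^ e))).
 assert (HgG : forall j, (j < m)%nat -> Rabs (g j) * Rpower M (b j) <= G). { intros j Hj. destruct j; [easy|].
  specialize (Hg (S j) ltac:(lia)). assert (kap <= 1) by apply Rmin_l. nra. }
 destruct (core_window D M m0 L W (gph k c m g b) (/ (128 * D)) app) as (n0 & B' & HB1 & HB2 & HB3 & HB4); auto. {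
  intros n0 t Ht Hn0 Hnt. unfold gph, app. assert (Hx0 : 1 <= n0) by inr.
  assert (E1 : rsum (S k) (fun i => c i * INR (n0 + t) ^ i) = rsum (S k) (fun i => c i * (n0 + 1 * t) ^ i)). {
   rewrite plus_INR, Rmult_1_l. easy. }
  rewrite E1.
  match goal with |- Rabs (?p + ?u - (?p + ?v)) <= _ => replace (p + u - (p + v)) with (u - v) by ring end.
  rewrite <- rsum_minus. from rsum_abs. via (rsum m (fun j => Rabs (fall (b j) (S K)) * (G * (t / M) ^ S K))).
  - termwise j Hj. rewrite <- Rmult_minus_distr_l, Rabs_mult, plus_INR.
   have (taylor_Rpower (b j) K (INR n0) (INR t) ltac:(lra) (pos_INR t)) as HT.
   assert (HbSK : b j <= INR (S K)) by (rewrite S_INR; specialize (HbK j Hj); lra). specialize (HT HbSK).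
   rewrite (rsum_ext (S K) (fun e => fall (b j) e / INR (fact e) * Rpower n0 (b j - e) * (0 + 1 * t) ^ e) (fun e =>
    fall (b j) e / INR (fact e) * Rpower n0 (b j - e) * t ^ e)) by (intros; now rewrite Rplus_0_l, Rmult_1_l).
   etrans; [apply Rmult_le_compat_l; [apply Rabs_pos|apply HT]|].
   assert (HR : Rpower n0 (b j - INR (S K)) <= Rpower M (b j) / M ^ S K). { rewrite <- Rpower_minus_nat by lra.
    apply Rpower_decr; [|lra]. split; [lra|]. mono. }
   via (Rabs (g j) * (Rabs (fall (b j) (S K)) * (Rpower M (b j) / M ^ S K) * t ^ S K)). { mono. }
   unfold Rdiv. rewrite Rpow_mult_distr, pow_inv.
   lhs (Rabs (fall (b j) (S K)) * ((Rabs (g j) * Rpower M (b j)) * (t ^ S K * / M ^ S K))). mono.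
  - rewrite rsum_scalr. fold A. assert (HtM : (t / M) ^ S K <= / Y). { unfold Rdiv. rewrite Rpow_mult_distr, pow_inv.
    apply Rle_div_l; [apply pow_lt; lra|]. rewrite Rmult_comm. apply le_div_inv_r; [lra|].
    rewrite <- HyK, <- Rpow_mult_distr. apply pow_incr. split; [pos|]. upto HW1. mono. }
   via (D ^ a * (G * / Y)). { mono. }
   unfold Y. rewrite pow_add. replace (D ^ a * (G * / (D ^ a * D ^ 8 * G))) with (/ D ^ 8). 2:{ field; lra. }
   apply Rinv_le_contravar; [lra|]. replace 128 with (2 ^ 7) by ring. rewrite <- (pow_1 D) at 1.
   now apply pow2_absorb. }
 set (x0 := INR n0) in *. assert (Hx0 : M <= x0 <= 4 * M). { unfold x0. split; [mono|]. rhs (INR (4 * M)) by inr.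
  mono. }
 set (th := rsum m (fun j => g j * (fall (b j) K * Rpower x0 (b j - K)))). assert (HMK : 0 < M ^ K) by pos.
 assert (Hpoly : ispoly K th (app n0)). { rewrite <- (Rplus_0_l th). apply ispoly_add.
  - apply (ispoly_lift_le k K (c k * (INR (fact k) * 1 ^ k))); [easy|]. apply ispoly_sum.
  - apply ispoly_rsum. intros j Hj.
   apply (ispoly_scal K (g j) _ (fun t => rsum (S K) (fun e => fall (b j) e / INR (fact e) * Rpower n0 (b j - e) * (0
    + 1 * t) ^ e))). have (ispoly_sum K (fun e => fall (b j) e / INR (fact e) * Rpower n0 (b j - e)) 0 1) as HS.
   replace (fall (b j) K * Rpower x0 (b j - K)) with (fall (b j) K / INR (fact K) * Rpower n0 (b j - K) * (INR (fact
    K) * 1 ^ K)); [pos|]. rewrite pow1. unfold x0. field. apply INR_fact_neq_0. }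
 assert (HRj : forall j, (j < m)%nat -> Rpower x0 (b j - K) <= Rpower M (b j) / M ^ K). { intros j Hj.
  rewrite <- Rpower_minus_nat by lra. specialize (HbK j Hj). apply Rpower_decr; lra. }
 assert (Hth1 : Rabs th <= A2 * G / M ^ K). { from rsum_abs. unfold A2, Rdiv. rewrite Rmult_assoc, <- rsum_scalr.
  termwise j Hj. rewrite !Rabs_mult, (Rabs_right (Rpower _ _)) by pos. specialize (HRj j Hj). specialize (HgG j Hj).
  lhs (Rabs (fall (b j) K) * (Rabs (g j) * Rpower x0 (b j - K))). mul_l. apply le_div; [easy|]. upto HgG.
  rewrite Rmult_assoc. mul_l. now apply le_div_inv. }
 assert (Hth2 : c0 * G / 2 / M ^ K <= Rabs th). { unfold th. destruct m as [|m']; [lia|]. rewrite rsum_first.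
  set (r := rsum m' _). assert (Hr : Rabs r <= kap * A2 * G / M ^ K). { from rsum_abs.
   via (rsum m' (fun j => Rabs (fall (b (S j)) K)) * (kap * G / M ^ K)).
   - rewrite <- rsum_scalr. termwise j Hj. rewrite !Rabs_mult, (Rabs_right (Rpower _ _)) by pos.
    specialize (HRj (S j) ltac:(lia)). specialize (Hg (S j) ltac:(lia)).
    lhs (Rabs (fall (b (S j)) K) * (Rabs (g (S j)) * Rpower x0 (b (S j) - K))). mul_l. apply le_div; [easy|]. upto Hg.
    rewrite Rmult_assoc. mul_l. now apply le_div_inv.
   - rhs (A2 * (kap * G / M ^ K)). apply Rmult_le_compat_r.
    + pos.
    + unfold A2. rewrite rsum_first. have (Rabs_pos (fall (b 0%nat) K)). lra. }
  assert (H0 : c0 * G / M ^ K <= Rabs (g 0%nat * (fall (b 0%nat) K * Rpower x0 (b 0%nat - K)))). {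
   rewrite !Rabs_mult, (Rabs_right (Rpower _ _)) by pos.
   via (Rabs (g 0%nat) * (Rabs (fall (b 0%nat) K) * Rpower (4 * M) (b 0%nat - K))).
   - rewrite <- Rpower_mult_distr, (Rpower_minus_nat (INR M)) by lra. unfold c0, G. lra.
   - mul_l. mul_l. specialize (HbK 0%nat ltac:(lia)). apply Rpower_decr; lra. }
  assert (Hkc : kap * A2 <= c0 / 2). {
   via (c0 / (2 * (A2 + 1)) * A2); [apply Rmult_le_compat_r; [easy|apply Rmin_r]|]. lhs (c0 / 2 * (A2 / (A2 + 1))).
   rewrite <- (Rmult_1_r (c0 / 2)) at 2. mul_l. apply div_le; lra. }
  assert (Hr2 : Rabs r <= c0 / 2 * G / M ^ K). { from Hr. mono. }
  set (p := g 0%nat * _) in *. have (Rabs_triang (p + r) (- r)) as Ht. rewrite Rabs_Ropp in Ht.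
  replace (p + r + - r) with p in Ht by ring. lra. }
 destruct (HCw (D ^ 5) W B' th (app n0)) as (s & S1 & S2 & S3); auto. { via (D ^ 1); [lra|mono]. }
 { rewrite <- pow_mult. upto HWD; mono. }
 { upto HB4. mul_l. apply Rinv_le_contravar; [lra|]. replace 16 with (2 ^ 4) by ring. rewrite <- (pow_1 D) at 1.
  now apply pow2_absorb. }
 rewrite <- pow_mult in S2, S3. assert (Hs1 : 1 <= s) by inr. assert (Hsth : s * Rabs th <= / 4). {
  via (D ^ (5 * Cw) * (A2 * G / M ^ K)). { mono. }
  via (D ^ (5 * Cw) * (D ^ a * / M)). { mul_l. unfold Rdiv. rewrite Rmult_assoc. apply Rmult_le_compat; try lra.
   - pos.
   - apply Rle_div_l; [easy|]. unfold K in *. replace (S K' - 1)%nat with K' in HG by lia. simpl. rhs (M ^ K'). easy. }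
  rewrite <- Rmult_assoc, <- pow_add. apply Rle_div_l; [lra|]. rewrite Rmult_comm. apply le_div; [lra|].
  via (D ^ (5 * Cw + a + 2)).
  - rewrite (pow_add D (5 * Cw + a)). specialize (HP0 (5 * Cw + a)%nat). assert (4 <= D ^ 2) by nra. nra.
  - apply HMC. lia. }
 assert (HWK : D ^ (5 * Cw) / W ^ K <= / 4). { apply div_le; [pos|]. rewrite Rmult_comm. apply le_div; [lra|].
  via (W ^ 1).
  - rewrite pow_1. upto HWD. rewrite pow_add. assert (4 <= D ^ 2) by nra. nra.
  - mono. }
 (* The nearest integer must be 0, since s |th| and the error are both at most 1/4. Rational
    approximation thus becomes an upper bound for th. *)
 assert (Hsm : s * Rabs th <= D ^ (5 * Cw) / W ^ K). { destruct S3 as [z Hz].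
  rewrite <- (Rabs_right (INR s)) in Hsth |- * by lra. rewrite <- Rabs_mult in Hsth |- *.
  destruct (Z.eq_dec z 0) as [->|Nz]; [simpl in Hz; rewrite Rminus_0_r in Hz; easy|].
  assert (Hz2 : Rabs (s * th - IZR z) <= / 4) by lra. apply Rabs_le_between in Hz2. apply Rabs_le_between in Hsth.
  assert (Hz3 : (z <= -1 \/ 1 <= z)%Z) by lia. destruct Hz3 as [Hz3|Hz3]; apply IZR_le in Hz3; lra. }
 assert (HWy : M <= W * (2 * y)). { apply Rlt_le in HW2. apply div_le_inv in HW2; [|easy]. nra. }
 assert (HGy : G <= D ^ E * y ^ K). { assert (H1 : c0 * G / 2 / M ^ K <= D ^ (5 * Cw) / W ^ K). {
   via (s * Rabs th); [|easy]. from Hth2. mono. }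
  apply div_le_inv in H1; [|easy]. assert (H2 : D ^ (5 * Cw) / W ^ K * M ^ K <= D ^ (5 * Cw) * (2 ^ K * y ^ K)). {
   unfold Rdiv. rewrite Rmult_assoc. mul_l. rewrite <- Rpow_mult_distr, <- pow_inv, <- Rpow_mult_distr.
   apply pow_incr. split.
   - pos.
   - rewrite Rmult_comm. apply div_le; [lra|]. lra. }
  assert (H4 : G <= / c0 * (D ^ (5 * Cw) * (2 ^ K * y ^ K) * 2)). { rewrite Rmult_comm. apply le_div; lra. }
  from H4. lhs (/ c0 * (D ^ (5 * Cw) * 2 ^ K * 2) * y ^ K). mul_r. unfold E. rewrite !pow_add, pow_1.
  rhs (D ^ a * (D ^ (5 * Cw) * D ^ K * D)). mono. }
 (* The bound G <= D^E y^K, raised to the power K + 1, contains y only through y^(K+1), that is,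
    through G. One factor G remains after cancellation. *)
 assert (HGK : G ^ (S K) <= D ^ (E * S K + (a + 8) * K) * G ^ K). { via ((D ^ E * y ^ K) ^ S K); [mono|].
  rewrite Rpow_mult_distr, <- !pow_mult. replace (K * S K)%nat with (S K * K)%nat by lia. rewrite (pow_mult y), HyK.
  unfold Y. rewrite Rpow_mult_distr, <- pow_mult, <- Rmult_assoc, <- pow_add. lra. }
 assert (HGp : 0 < G ^ K) by pos. apply Rmult_le_reg_r in HGK; [|easy].
 assert (D ^ (E * S K + (a + 8) * K) <= D ^ C) by mono. lra.
Qed.

(** * Bilinear sums *)

(* A pseudo-polynomial, split into its integer exponents and its fractional ones. *)
Record ppdata := { deg : nat; co : nat -> R; nfr : nat; fco : nat -> R; fex : nat -> R }.

Definition ppok (F : ppdata) : Prop :=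
  ((0 < nfr F)%nat -> fco F 0%nat <> 0 /\ nonint (fex F 0%nat)) /\
  (forall j, (j < nfr F)%nat -> 0 < fex F j) /\
  (forall j, (1 <= j < nfr F)%nat -> fex F j < fex F 0%nat).

Definition ppval (F : ppdata) (x : R) : R := gph (deg F) (co F) (nfr F) (fco F) (fex F) x.

(* xi * F is major at level Q on the scale X: the fractional part varies by at most Q and the
   coefficients of the polynomial part are simultaneously close to rationals of denominator at most Q. *)
Definition Maj (F : ppdata) (X Q xi : R) : Prop :=
  ((0 < nfr F)%nat -> Rabs xi * Rpower X (fex F 0%nat) <= Q) /\
  exists r, (1 <= r)%nat /\ r <= Q /\
    forall i, (1 <= i <= deg F)%nat -> near (Q / X ^ i) (r * (xi * co F i)).

Lemma Maj_mono F X Q Q' xi : 0 < X -> Q <= Q' -> Maj F X Q xi -> Maj F X Q' xi.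
Proof.
 intros HX HQ [H1 (r & R1 & R2 & R3)]. split; [intros H; specialize (H1 H); lra|]. exists r.
 repeat split; auto; [lra|]. intros i Hi. eapply near_le; [|now apply R3]. mono.
Qed.

Lemma Rpower_large e A : 0 < e -> exists X0, 1 <= X0 /\ forall x, X0 <= x -> A <= Rpower x e.
Proof.
 intros He. set (B := Rmax A 1). exists (Rpower B (/ e)). assert (HB : 1 <= B) by apply Rmax_r. split.
 - via (Rpower B 0); [rewrite Rpower_O; lra|]. mono.
 - intros x Hx. via B; [apply Rmax_l|]. via (Rpower (Rpower B (/ e)) e).
  + rewrite Rpower_mult, Rinv_l, Rpower_1; lra.
  + apply Rpower_incr; [|lra]. split; [pos|easy].
Qed.

Lemma Rpower_large_all n (e A : nat -> R) : (forall j, (j < n)%nat -> 0 < e j) ->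
  exists X0, 1 <= X0 /\ forall x j, (j < n)%nat -> X0 <= x -> A j <= Rpower x (e j).
Proof.
 induction n as [|n IH]; intros H.
 - exists 1. easy.
 - destruct IH as (X1 & H1 & H2); [pos|]. destruct (Rpower_large (e n) (A n)) as (X2 & H3 & H4); [pos|].
  exists (Rmax X1 X2). split; [etrans; [apply H1|apply Rmax_l]|]. intros x j Hj Hx. have (Rmax_l X1 X2).
  have (Rmax_r X1 X2). destruct (Nat.eq_dec j n) as [->|]; [apply H4; lra|apply H2; [lia|lra]].
Qed.

Lemma Rpower_diff_lower b N x y : 0 < b -> 0 < N -> N <= x -> x <= y -> y <= 2 * N ->
  b / 2 * Rpower N b * ((y - x) / N) <= Rpower y b - Rpower x b.
Proof.
 intros Hb HN Hx Hxy Hy. destruct (MVT_gen (fun x => Rpower x b) x y (fun y => b * Rpower y (b - 1))) as (z & Hz & E).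
 { intros u. rewrite Rmin_left, Rmax_right by lra. intros Hu. apply is_derive_Rpower. lra. }
 { intros u. rewrite Rmin_left, Rmax_right by lra. intros Hu.
  apply continuity_pt_filterlim, (ex_derive_continuous (fun x => Rpower x b)). eexists. apply is_derive_Rpower. lra. }
 rewrite Rmin_left, Rmax_right in Hz by lra. rewrite E. assert (HR : Rpower N b = Rpower N (b - 1) * N). {
  rewrite <- (Rpower_1 N) at 3 by easy. rewrite <- Rpower_plus. f_equal. ring. }
 assert (Hz2 : / 2 * Rpower N (b - 1) <= Rpower z (b - 1)). { have (Rpower_pos N (b - 1)).
  destruct (Rle_lt_dec (b - 1) 0).
  - via (Rpower (2 * N) (b - 1)); [|apply Rpower_decr; lra]. rewrite <- Rpower_mult_distr by lra. mul_r.
   via (Rpower 2 (- (1))); [|mono]. rewrite Rpower_Ropp, Rpower_1; lra.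
  - via (Rpower N (b - 1)); [lra|apply Rpower_incr; lra]. }
 rewrite HR. lhs (b * (/ 2 * Rpower N (b - 1)) * (y - x)). mono.
Qed.

Lemma Rpower_diff_ratio b e N x y : 0 < N -> N <= x -> x <= y -> 0 <= b <= e ->
  Rpower y b - Rpower x b <= Rpower N (b - e) * (Rpower y e - Rpower x e).
Proof.
 intros HN Hx Hxy Hb. assert (Hy : y = x * (y / x)) by (field; lra). set (t := y / x) in *.
 assert (Ht : 1 <= t) by nra. rewrite Hy, <- !Rpower_mult_distr by lra.
 assert (H1 : Rpower t b <= Rpower t e) by mono. assert (H2 : 1 <= Rpower t b). {
  via (Rpower t 0); [rewrite Rpower_O; lra|]. mono. }
 assert (H3 : Rpower x b <= Rpower N (b - e) * Rpower x e). {
  lhs (Rpower x (b - e) * Rpower x e) by (rewrite <- Rpower_plus; f_equal; ring). mul_r. apply Rpower_decr; lra. }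
 have (Rpower_pos x b). nra.
Qed.

Lemma common_multiple B k (e x : nat -> R) : 1 <= B -> (forall i, 0 <= e i) ->
  (forall i, (1 <= i <= k)%nat -> exists s, (1 <= s)%nat /\ s <= B /\ near (e i) (s * x i)) ->
  exists r, (1 <= r)%nat /\ r <= B ^ k /\
  forall i, (1 <= i <= k)%nat -> near (B ^ k * e i) (r * x i).
Proof.
 intros HB He. induction k as [|k IH]; intros H.
 - exists 1%nat. split; [lia|]. split; [easy|pos].
 - destruct IH as (r & R1 & R2 & R3); [intros; apply H; lia|]. destruct (H (S k) ltac:(lia)) as (s & S1 & S2 & S3).
  exists (s * r)%nat. split; [nia|]. rewrite mult_INR. have (pos_INR s). have (pos_INR r).
  split; [simpl; apply Rmult_le_compat; auto|]. intros i Hi. destruct (Nat.eq_dec i (S k)) as [->|].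
  + have (near_mul _ _ r S3) as Hn. rewrite <- Rmult_assoc, (Rmult_comm (INR r) (INR s)) in Hn.
   eapply near_le; [|apply Hn]. mono.
  + have (near_mul _ _ s (R3 i ltac:(lia))) as Hn. rewrite <- (Rmult_assoc _ _ (x i)) in Hn.
   eapply near_le; [|apply Hn]. rewrite <- Rmult_assoc. simpl. mono.
Qed.

Lemma interval_sum n lo hi (g : nat -> R) : (hi < n)%nat ->
  rsum n (fun i => ind (lo < i <= hi)%nat * g i) = rsum (hi - lo) (fun t => g (lo + 1 + t)%nat).
Proof.
 intros H. destruct (Nat.le_gt_cases hi lo) as [Hl|Hl].
 - replace (hi - lo)%nat with 0%nat by lia. apply rsum_zero. intros i _. rewrite ind_F by lia. ring.
 - rewrite (rsum_trunc (lo + 1 + (hi - lo)) n); [|lia|intros i Hi; rewrite ind_F by lia; ring].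
  rewrite rsum_split, rsum_zero.
  + rewrite Rplus_0_l. ext i Hi. rewrite ind_T by lia. ring.
  + intros i Hi. rewrite ind_F by lia. ring.
Qed.

Lemma div_lt_iff X m n : (1 <= n)%nat -> (X < m * n <-> X / n < m)%nat.
Proof.
 intros Hn. split; intros H.
 - apply Nat.Div0.div_lt_upper_bound; lia.
 - euclid X n. nia.
Qed.

Lemma le_div_iff Y m n : (1 <= n)%nat -> (m * n <= Y <-> m <= Y / n)%nat.
Proof. intros Hn. have (div_lt_iff Y m n Hn). lia. Qed.

(** Transfers [core_frac] to the argument x n or to a pair x n, x n'. The factors [mu] stand for
    n^b_j or for differences of such powers; the assumption on their ratios makes the lower
    fractional terms smaller than the first one by a power of M N, hence of X. *)
Lemma frac_bound F : ppok F -> (0 < nfr F)%nat -> exists (C : nat) (X0 : R), 1 <= X0 /\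
  forall D X xi M N (mu : nat -> R) c m0 L,
  2 <= D -> X0 <= X -> D ^ C <= INR M -> Rabs xi <= X -> X <= INR M ^ 3 ->
  1 <= N -> X <= 4 * (INR M * N) -> INR M * N <= X ->
  (forall j, (1 <= j < nfr F)%nat -> Rabs (mu j) <= Rpower N (fex F j - fex F 0%nat) * Rabs (mu 0%nat)) ->
  Rabs (mu 0%nat) <= Rpower (2 * N) (fex F 0%nat) ->
  (M <= m0)%nat -> (m0 + L <= 4 * M)%nat ->
  INR M / D <= rsum L (fun t => cs (gph (deg F) c (nfr F) (fun j => xi * fco F j * mu j) (fex F) (INR (m0 + t)))) ->
  Rabs xi * Rabs (mu 0%nat) * Rpower (INR M) (fex F 0%nat) <= D ^ C.
Proof.
 intros (HF1 & HF2 & HF3) Hm. destruct (HF1 Hm) as [Hg0 Hn0]. set (m := nfr F) in *. set (k := deg F).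
 set (b := fex F) in *. set (ga := fco F) in *. assert (Hb0 : 0 < b 0%nat) by now apply HF2.
 destruct (nfloor (b 0%nat) ltac:(lra)) as (B0' & HB1 & HB2). set (B0 := S B0').
 (* The size G is at most X^(B0 + 2) <= M^(3 B0 + 6), and [core_frac] asks for G <= M^(K - 1) and k
    < K. *)
 assert (HB0 : b 0%nat <= B0) by (unfold B0; rewrite S_INR; lra). set (K := (k + 3 * B0 + 8)%nat).
 assert (HbK : forall j, (j < m)%nat -> b j <= K). { intros j Hj. via (INR B0); [|mono]. destruct j; [easy|].
  specialize (HF3 (S j) ltac:(lia)). lra. }
 destruct (core_frac k m b K ltac:(unfold K; lia) Hm Hn0 HbK) as (C1 & kap & Hkap & HC1).
 assert (Hga : 0 < Rabs (ga 0%nat)) by now apply Rabs_pos_lt.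
 destruct (Rpower_large_all m (fun j => if Nat.eq_dec j 0 then 1 else b 0%nat - b j) (fun j => Rabs (ga j) / (Rabs (ga
  0%nat) * kap))) as (X1 & HX1 & HX2). { intros j Hj. destruct (Nat.eq_dec j 0); [lra|].
  specialize (HF3 j ltac:(lia)). lra. }
 set (Z := Rabs (ga 0%nat) * Rpower 2 (b 0%nat)). destruct (pow2_exceeds (/ Rabs (ga 0%nat))) as [a Ha].
 exists (C1 + a)%nat, (4 * X1 + Z). assert (HZ : 0 < Z) by (apply Rmult_lt_0_compat; [easy|apply Rpower_pos]).
 split; [lra|]. intros D X xi M N mu c m0 L HD HX HM Hxi HXM HN HX4 HXN Hmu Hmu0 HmM HmL H.
 assert (HMp : 1 <= M) by (etrans; [apply (pow_ge_1 D (C1 + a)); lra|easy]).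
 set (g := fun j => xi * ga j * mu j) in *. set (G := Rabs (g 0%nat) * Rpower M (b 0%nat)).
 assert (HGE : G = Rabs (ga 0%nat) * (Rabs xi * Rabs (mu 0%nat) * Rpower M (b 0%nat))). { unfold G, g.
  rewrite !Rabs_mult. ring. }
 assert (HGC : G <= D ^ C1). { apply (HC1 D M c g m0 L); auto.
  - upto HM. mono.
  - intros j Hj. fold G. specialize (Hmu j Hj). rewrite HGE. unfold g. rewrite !Rabs_mult.
   specialize (HX2 (M * N) j ltac:(lia) ltac:(lra)). destruct (Nat.eq_dec j 0); [lia|].
   rewrite <- Rpower_mult_distr in HX2 by lra. apply div_le_inv in HX2; [|pos].
   set (u := Rpower M (b 0%nat - b j)) in *. set (v := Rpower N (b 0%nat - b j)) in *.
   assert (Hu : Rpower M (b 0%nat) = u * Rpower M (b j)) by (unfold u; rewrite <- Rpower_plus; f_equal; ring).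
   assert (Hv : Rpower N (b j - b 0%nat) = / v) by (unfold v; rewrite <- Rpower_Ropp; f_equal; ring).
   rewrite Hv in Hmu. rewrite Hu. have (Rpower_pos (INR M) (b j)). have (Rpower_pos N (b 0%nat - b j) : 0 < v).
   assert (Hmu' : Rabs (mu j) * v <= Rabs (mu 0%nat)). { apply (Rmult_le_reg_r (/ v)); [pos|].
    rewrite Rmult_assoc, Rinv_r by lra. lra. }
   have (Rpower_pos (INR M) (b 0%nat - b j) : 0 < u). set (W := Rpower M (b j)) in *.
   lhs (Rabs xi * W * (Rabs (ga j) * Rabs (mu j))). rhs (Rabs xi * W * (kap * Rabs (ga 0%nat) * Rabs (mu 0%nat) * u)).
   mul_l. via (u * v * (Rabs (ga 0%nat) * kap) * Rabs (mu j)). { mono. }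
   lhs (u * (Rabs (ga 0%nat) * kap) * (Rabs (mu j) * v)). rhs (u * (Rabs (ga 0%nat) * kap) * Rabs (mu 0%nat)). mono.
  - fold G. rewrite HGE. via (X ^ (B0 + 2)).
   + via (Rabs (ga 0%nat) * (X * Rpower (2 * N) (b 0%nat) * Rpower M (b 0%nat))). { mono. }
    rewrite <- Rpower_mult_distr by lra.
    lhs (Z * (X * (Rpower M (b 0%nat) * Rpower N (b 0%nat)))) by (unfold Z; ring). rewrite Rpower_mult_distr by lra.
    rhs (X * (X * X ^ B0)) by (rewrite pow_add; simpl; ring). apply Rmult_le_compat; try lra.
    * pos.
    * mul_l. rewrite <- Rpower_pow by lra. via (Rpower X (b 0%nat)).
     -- apply Rpower_incr; [|lra]. lra.
     -- mono.
   + via ((M ^ 3) ^ (B0 + 2)); [mono|]. rewrite <- pow_mult. mono. }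
 assert (H2 : Rabs xi * Rabs (mu 0%nat) * Rpower M (b 0%nat) <= / Rabs (ga 0%nat) * D ^ C1). {
  rewrite (Rmult_comm (/ _)). apply le_div_inv_r; [easy|]. lra. }
 from H2. rewrite pow_add, Rmult_comm. mul_l. from Ha. mono.
Qed.

(** The phases belonging to n and n' are correlated along some interval of m in [M, 4 M]. The free
    shift [om] includes large negative correlations, by om = 1/2. *)
Definition bigpair (F : ppdata) (D xi : R) (M n n' : nat) : Prop :=
  exists m0 L om, (M <= m0)%nat /\ (m0 + L <= 4 * M)%nat /\
   M / D <= rsum L (fun t => cs (xi * (ppval F (INR (m0 + t) * n) - ppval F (INR (m0 + t) * n')) + om)).

Definition pairc (F : ppdata) (xi om : R) (n n' : nat) (i : nat) : R :=
  xi * co F i * (n ^ i - n' ^ i) + (if Nat.eq_dec i 0 then om else 0).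

Definition pairmu (F : ppdata) (n n' : nat) (j : nat) : R :=
  Rpower n (fex F j) - Rpower n' (fex F j).

Lemma pair_phase F xi om n n' x : 0 < x -> (1 <= n)%nat -> (1 <= n')%nat ->
  xi * (ppval F (x * n) - ppval F (x * n')) + om
  = gph (deg F) (pairc F xi om n n') (nfr F) (fun j => xi * fco F j * pairmu F n n' j) (fex F) x.
Proof.
 intros Hx Hn Hn'. apply le_INR in Hn. apply le_INR in Hn'. simpl in Hn, Hn'. unfold ppval, gph. set (k := deg F).
 set (m := nfr F).
 assert (E1 : rsum (S k) (fun i => pairc F xi om n n' i * x ^ i) = om + xi * (rsum (S k) (fun i => co F i * (x * n) ^
  i) - rsum (S k) (fun i => co F i * (x * n') ^ i))). {
  rewrite <- rsum_minus, <- rsum_scal, !rsum_first, (rsum_ext k (fun i => pairc F xi om n n' (S i) * x ^ S i) (fun i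
   => xi * (co F (S i) * (x * n) ^ S i - co F (S i) * (x * n') ^ S i))).
  - unfold pairc. simpl. ring.
  - intros i _. unfold pairc. destruct (Nat.eq_dec (S i) 0); [lia|]. rewrite !Rpow_mult_distr. ring. }
 assert (E2 : rsum m (fun j => xi * fco F j * pairmu F n n' j * Rpower x (fex F j)) = xi * (rsum m (fun j => fco F j *
  Rpower (x * n) (fex F j)) - rsum m (fun j => fco F j * Rpower (x * n') (fex F j)))). {
  rewrite <- rsum_minus, <- rsum_scal. ext j _. unfold pairmu. rewrite <- !Rpower_mult_distr by lra. ring. }
 lra.
Qed.

Lemma bigpair_phase F D xi M n n' : (1 <= M)%nat -> (1 <= n)%nat -> (1 <= n')%nat -> bigpair F D xi M n n' ->
  exists m0 L om, (M <= m0)%nat /\ (m0 + L <= 4 * M)%nat /\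
  M / D <= rsum L (fun t => cs (gph (deg F) (pairc F xi om n n') (nfr F)
  (fun j => xi * fco F j * pairmu F n n' j) (fex F) (INR (m0 + t)))).
Proof.
 intros HM Hn Hn' (m0 & L & om & H1 & H2 & H3). exists m0, L, om. repeat split; auto. from H3. right. ext t _.
 f_equal. apply pair_phase; auto. pos.
Qed.

Lemma pairmu_abs F N n n' j : (1 <= N)%nat -> (N <= n <= 2 * N)%nat -> (N <= n' <= 2 * N)%nat -> 0 < fex F j ->
  Rabs (pairmu F n n' j) <= Rpower (2 * N) (fex F j).
Proof.
 intros HN Hn Hn' Hb. unfold pairmu.
 assert (B : forall n, (N <= n <= 2 * N)%nat -> 0 < Rpower n (fex F j) <= Rpower (2 * N) (fex F j)). { intros u Hu.
  split; [pos|]. apply Rpower_incr; [|lra]. split; [pos|]. rhs (INR (2 * N)) by inr. mono. }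
 have (B n Hn). have (B n' Hn'). apply Rabs_le. lra.
Qed.

Lemma pairmu_ratio F N n n' j : (1 <= N)%nat -> (N <= n)%nat -> (N <= n')%nat ->
  0 < fex F j -> fex F j <= fex F 0%nat ->
  Rabs (pairmu F n n' j) <= Rpower N (fex F j - fex F 0%nat) * Rabs (pairmu F n n' 0%nat).
Proof.
 intros HN Hn Hn' Hb He. unfold pairmu.
 assert (A : forall n n', (N <= n)%nat -> (n <= n')%nat -> Rabs (Rpower n' (fex F j) - Rpower n (fex F j)) <= Rpower N
  (fex F j - fex F 0%nat) * Rabs (Rpower n' (fex F 0%nat) - Rpower n (fex F 0%nat))). { intros u v Hu Huv.
  assert (0 < N) by pos. apply le_INR in Hu. apply le_INR in Huv.
  assert (forall b, 0 < b -> 0 <= Rpower v b - Rpower u b). { intros b Hb'. apply Rge_le, Rge_minus, Rle_ge.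
   apply Rpower_incr; lra. }
  rewrite !Rabs_right by (apply Rle_ge; auto; apply H0; lra). apply Rpower_diff_ratio; lra. }
 destruct (Nat.le_ge_cases n n').
 - rewrite Rabs_minus_sym, (Rabs_minus_sym (Rpower n (fex F 0%nat))). now apply A.
 - now apply A.
Qed.

Lemma pairmu_lower F N n n' D : (1 <= N)%nat -> (N <= n <= 2 * N)%nat -> (N <= n' <= 2 * N)%nat ->
  0 < fex F 0%nat -> 0 < D -> N / (4 * D) <= Rabs (n - n') ->
  fex F 0%nat / (8 * D) * Rpower N (fex F 0%nat) <= Rabs (pairmu F n n' 0%nat).
Proof.
 intros HN Hn Hn' Hb HD H. unfold pairmu. set (b := fex F 0%nat) in *. assert (HNR : 0 < N) by pos.
 assert (A : forall n n', (N <= n)%nat -> (n <= n')%nat -> (n' <= 2 * N)%nat -> N / (4 * D) <= n' - n -> b / (8 * D) *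
  Rpower N b <= Rabs (Rpower n' b - Rpower n b)). { intros u v Hu Huv Hv Hd. apply le_INR in Hu. apply le_INR in Huv.
  apply le_INR in Hv. rewrite mult_INR in Hv. simpl (INR 2) in Hv. upto Rle_abs.
  etrans; [|apply (Rpower_diff_lower b (INR N)); lra]. lhs (b / 2 * Rpower N b * (/ (4 * D))). mul_l.
  apply le_div; [easy|]. lra. }
 destruct (Nat.le_ge_cases n n') as [Hc|Hc]; have (le_INR _ _ Hc).
 - rewrite Rabs_minus_sym in H |- *. rewrite Rabs_right in H by lra. apply A; auto; lia.
 - rewrite Rabs_right in H by lra. apply A; auto; lia.
Qed.

(** As the bad n have density 1 / D, one of them differs from n' by at least N / (4 D). For this n
    the difference n^b0 - n'^b0 has order at least N^b0 / D, and a single pair already bounds the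
    fractional part. *)
Lemma pairs_frac F : ppok F -> exists (C : nat) (X0 : R), 1 <= X0 /\ forall D X xi M N n' (bad : nat -> Prop),
  2 <= D -> X0 <= X -> D ^ C <= INR M -> D ^ C <= INR N -> Rabs xi <= X -> X <= INR M ^ 3 ->
  X <= 4 * (INR M * INR N) -> INR M * INR N <= X ->
  (N <= n' < 2 * N)%nat ->
  (forall n, (N <= n < 2 * N)%nat -> bad n -> bigpair F D xi M n n') ->
  INR N / D <= rsum N (fun u => ind (bad (N + u)%nat)) ->
  (0 < nfr F)%nat -> Rabs xi * Rpower X (fex F 0%nat) <= D ^ C.
Proof.
 intros HF. destruct (Nat.eq_dec (nfr F) 0) as [E|E]. { exists 0%nat, 1. split; [lra|]. intros; lia. }
 destruct (frac_bound F HF ltac:(lia)) as (C & X0 & HX0 & HC). destruct HF as (HF1 & HF2 & HF3).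
 set (b0 := fex F 0%nat) in *. assert (Hb0 : 0 < b0) by (apply HF2; lia).
 destruct (pow2_exceeds (Rpower 4 b0 * (8 / b0))) as [a Ha]. exists (C + a + 3)%nat, X0. split; [easy|].
 intros D X xi M N n' bad HD HX HM HN Hxi HXM HX4 HXN Hn' Hbad Hcnt _. assert (HD3' : 4 * D <= D ^ 3). { nra. }
 assert (HD3N : D ^ 3 <= N) by (upto HN; mono). assert (HN1 : (1 <= N)%nat) by lia. assert (HM1 : (1 <= M)%nat). {
  apply INR_le. simpl. upto HM. pos. }
 assert (Hex : exists n, (N <= n < 2 * N)%nat /\ bad n /\ N / (4 * D) <= Rabs (n - n')). { apply NNPP. intros Hno.
  assert (Hc : rsum N (fun u => ind (bad (N + u)%nat)) <= N / (2 * D) + 1). { apply count_diameter; [pos|].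
   intros i j Hij Hi Hj.
   assert (Q : forall u, (u < N)%nat -> bad (N + u)%nat -> Rabs (INR (N + u) - n') < N / (4 * D)). { intros u Hu Hb.
    apply Rnot_le_lt. intros Hle. apply Hno. exists (N + u)%nat. split; [lia|]. auto. }
   have (Q i ltac:(lia) Hi) as Q1. have (Q j ltac:(lia) Hj) as Q2. apply Rabs_lt_between in Q1.
   apply Rabs_lt_between in Q2. rewrite !plus_INR in *. rhs (2 * (N / (4 * D))). lra. }
  assert (N / D <= N / (2 * D) + 1) by lra. replace (N / D) with (2 * (N / (2 * D))) in H by (field; lra).
  assert (1 < N / (2 * D)); [|lra]. apply Rlt_div_r; lra. }
 destruct Hex as (n & Hn & Hbn & Hd).
 destruct (bigpair_phase F D xi M n n' HM1 ltac:(lia) ltac:(lia) (Hbad n Hn Hbn)) as (m0 & L & om & H1 & H2 & H3).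
 assert (HNR : 1 <= N) by lra.
 have (HC D X xi M (INR N) (pairmu F n n') (pairc F xi om n n') m0 L HD HX ltac:(upto HM; mono) Hxi HXM HNR HX4 HXN)
  as HB.
 specialize (HB ltac:(intros j Hj; apply pairmu_ratio; try lia; [apply HF2; lia|specialize (HF3 j Hj); unfold b0 in *;
  lra])). specialize (HB ltac:(apply pairmu_abs; auto; lia) H1 H2 H3).
 have (pairmu_lower F N n n' D HN1 ltac:(lia) ltac:(lia) Hb0 ltac:(lra) Hd) as Hlow.
 assert (H5 : Rabs xi * (b0 / (8 * D) * Rpower N b0) * Rpower M b0 <= D ^ C). { upto HB. mono. }
 via (Rabs xi * (Rpower 4 b0 * (Rpower M b0 * Rpower N b0))). { mul_l. rewrite !Rpower_mult_distr by nra.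
  apply Rpower_incr; lra. }
 lhs ((Rpower 4 b0 * (8 / b0)) * (D * (Rabs xi * (b0 / (8 * D) * Rpower N b0) * Rpower M b0))).
 via (D ^ a * (D * D ^ C)).
 - apply Rmult_le_compat.
  + pos.
  + pos.
  + from Ha; apply pow_incr; lra.
  + mono.
 - lhs (D ^ (a + S C)) by (rewrite pow_add; simpl; ring). mono.
Qed.

Lemma recurrence_unif k : exists C : nat, forall i D M e t phi, (1 <= i <= k)%nat ->
  2 <= D -> D ^ C <= INR M -> 0 <= e -> e * D ^ C <= 1 -> ispoly i t phi ->
  INR M / D <= rsum M (fun n => ind (near e (phi n))) ->
  exists s, (1 <= s)%nat /\ INR s <= D ^ C /\ near (e * D ^ C / INR M ^ i) (INR s * t).
Proof.
 induction k as [|k [C IH]]; [exists 0%nat; intros; lia|]. destruct (recurrence k) as [C' HC']. exists (C + C')%nat.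
 intros i D M e t phi Hi HD HM He HeD Hp H.
 assert (P : forall a, (a <= C + C')%nat -> D ^ a <= D ^ (C + C')) by (intros; mono).
 assert (HMp : 1 <= M) by (etrans; [apply (pow_ge_1 D (C + C')); lra|easy]).
 assert (G : exists c s, (c <= C + C')%nat /\ (1 <= s)%nat /\ s <= D ^ c /\ near (e * D ^ c / M ^ i) (s * t)). {
  destruct (Nat.eq_dec i (S k)) as [->|N].
  - destruct (HC' D M e t phi) as (s & S1 & S2 & S3); auto.
   + upto HM; mono.
   + upto HeD. mono.
   + exists C', s. repeat split; auto; lia.
  - destruct (IH i D M e t phi) as (s & S1 & S2 & S3); auto.
   + lia.
   + upto HM; mono.
   + upto HeD. mono.
   + exists C, s. repeat split; auto; lia. }
 destruct G as (c & s & Hc & S1 & S2 & S3). exists s. specialize (P c Hc). repeat split; auto; [lra|].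
 eapply near_le; [|apply S3]. mono.
Qed.

(** Each bad n gives a rational approximation, with error about M^(-i), to xi c_i (n^i - n'^i). With
    one denominator for many n, this polynomial of degree i in n is near integers with density a
    power of 1 / D, so [recurrence] approximates xi c_i itself and divides the error by N^i. As M N
    is of order X, the result is the condition [Maj]. *)
Lemma pairs_major F : ppok F -> exists (C : nat) (X0 : R), 1 <= X0 /\ forall D X xi M N n' (bad : nat -> Prop),
  2 <= D -> X0 <= X -> D ^ C <= INR M -> D ^ C <= INR N -> Rabs xi <= X -> X <= INR M ^ 3 ->
  X <= 4 * (INR M * INR N) -> INR M * INR N <= X ->
  (N <= n' < 2 * N)%nat ->
  (forall n, (N <= n < 2 * N)%nat -> bad n -> bigpair F D xi M n n') ->
  INR N / D <= rsum N (fun u => ind (bad (N + u)%nat)) ->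
  Maj F X (D ^ C) xi.
Proof.
 intros HF. destruct (pairs_frac F HF) as (Cf & X0 & HX0 & HCf). set (k := deg F). set (m := nfr F).
 destruct (pow2_exceeds (rsum m (fun j => Rabs (fco F j) * Rpower 2 (fex F j)))) as [a Ha]. set (C1 := (a + Cf)%nat).
 destruct (core_poly k m (fex F) C1) as (Cp & HCp). destruct (recurrence_unif k) as (Cr & HCr).
 set (E := ((Cp + 1) * Cr + Cp + fact k)%nat).
 set (C := (Cf + Cp + E * k + Cp + (Cp + 1) * Cr + 2 * k + (Cp + 1) * Cr + 1)%nat). exists C, X0. split; [easy|].
 intros D X xi M N n' bad HD HX HM HN Hxi HXM HX4 HXN Hn' Hbad Hcnt.
 assert (HP1 : forall a, 1 <= D ^ a) by (intros; pos).
 assert (HMC : forall e, (e <= C)%nat -> D ^ e <= M) by (intros e He; upto HM; apply pow_mono; [pos|easy]).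
 assert (HNC : forall e, (e <= C)%nat -> D ^ e <= N) by (intros e He; upto HN; apply pow_mono; [pos|easy]).
 assert (HMp : 1 <= M) by (specialize (HMC 0%nat ltac:(lia)); simpl in HMC; lra). assert (HNp : 1 <= N) by inr.
 assert (HM1 : (1 <= M)%nat) by inr. assert (HN1 : (1 <= N)%nat) by lia.
 assert (Hfrac : (0 < m)%nat -> Rabs xi * Rpower X (fex F 0%nat) <= D ^ Cf). {
  apply (HCf D X xi M N n' bad); auto; [apply HMC|apply HNC]; unfold C; nia. }
 destruct HF as (HF1 & HF2 & HF3).
 assert (Hg : forall n, (N <= n < 2 * N)%nat -> forall j, (j < m)%nat -> Rabs (xi * fco F j * pairmu F n n' j) *
  Rpower M (fex F j) <= D ^ C1). { intros n Hn j Hj. rewrite !Rabs_mult. specialize (Hfrac ltac:(lia)).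
  have (HF2 j Hj) as Hbj. assert (Hbj0 : fex F j <= fex F 0%nat). { destruct j; [lra|].
   specialize (HF3 (S j) ltac:(unfold m in Hj; lia)). lra. }
  have (pairmu_abs F N n n' j HN1 ltac:(lia) ltac:(lia) Hbj) as Hmu.
  via (Rabs xi * Rabs (fco F j) * Rpower (2 * N) (fex F j) * Rpower M (fex F j)). { mono. }
  rewrite <- Rpower_mult_distr by lra.
  lhs ((Rabs (fco F j) * Rpower 2 (fex F j)) * (Rabs xi * (Rpower M (fex F j) * Rpower N (fex F j)))).
  rewrite Rpower_mult_distr by lra. unfold C1. rewrite pow_add. apply Rmult_le_compat.
  - pos.
  - pos.
  - via (2 ^ a); [|mono]. upto Ha. apply (rsum_term_le m j (fun j => Rabs (fco F j) * Rpower 2 (fex F j))); [easy|].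
   intros; apply Rmult_le_pos; [pos|pos].
  - upto Hfrac. mul_l. via (Rpower X (fex F j)); [apply Rpower_incr; [nra|lra]|mono]. }
 destruct (pigeonhole N (D ^ Cp) (fun u => bad (N + u)%nat) (fun s u => forall i, (1 <= i <= k)%nat -> near (D ^ Cp /
  M ^ i) (s * (xi * co F i * (INR (N + u) ^ i - n' ^ i))))) as (s & Hs1 & Hs2 & Hs3). { easy. }
 { intros u Hu Hb.
  destruct (bigpair_phase F D xi M (N + u) n' HM1 ltac:(lia) ltac:(lia) (Hbad (N + u)%nat ltac:(lia) Hb)) as (m0 & L &
   om & H1 & H2 & H3).
  destruct (HCp D M (pairc F xi om (N + u) n') (fun j => xi * fco F j * pairmu F (N + u) n' j) m0 L) as (s & S1 & S2 &
   S3); auto.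
  - apply HMC; unfold C; lia.
  - intros j Hj. apply Hg; [lia|easy].
  - exists s. repeat split; auto. intros i Hi. specialize (S3 i Hi). unfold pairc in S3.
   destruct (Nat.eq_dec i 0); [lia|]. now rewrite Rplus_0_r in S3. }
 set (ei := fun i => D ^ Cp / M ^ i). assert (HMi : forall i, 0 < M ^ i) by (intros; apply pow_lt; lra).
 assert (HNi : forall i, 0 < N ^ i) by (intros; apply pow_lt; lra).
 assert (HD2 : (D ^ (Cp + 1)) ^ Cr = D ^ ((Cp + 1) * Cr)) by (symmetry; apply pow_mult).
 destruct (common_multiple (D ^ E) k (fun i => ei i * D ^ ((Cp + 1) * Cr) / N ^ i) (fun i => xi * co F i)) as (r & R1
  & R2 & R3). { easy. }
 { intros i. unfold ei. pos. }
 { intros i Hi. set (A := s * (xi * co F i)).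
  destruct (HCr i (D ^ (Cp + 1)) N (ei i) (A * (INR (fact i) * 1 ^ i)) (fun u => - (A * n' ^ i) + A * (N + 1 * u) ^
   i)) as (t & T1 & T2 & T3); auto.
  - via (D ^ 1); [lra|mono].
  - rewrite HD2. apply HNC. lia.
  - unfold ei. pos.
  - rewrite HD2. unfold ei, Rdiv. rewrite Rmult_assoc, (Rmult_comm (/ _)), <- Rmult_assoc, <- pow_add.
   apply (div_le _ _ _ (HMi i)). rewrite Rmult_1_l. via (M ^ 1).
   + rewrite pow_1. apply HMC. lia.
   + mono.
  - rewrite <- (Rplus_0_l (A * _)). apply ispoly_add.
   + apply (ispoly_lift_le 0 _ (- (A * n' ^ i))); [lia|easy].
   + apply (ispoly_scal i A _ (fun u => (N + 1 * u) ^ i)). apply ispoly_affine_pow.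
  -
   via (rsum N (fun u => ind (forall i, (1 <= i <= k)%nat -> near (D ^ Cp / M ^ i) (s * (xi * co F i * (INR (N + u) ^
    i - n' ^ i)))))).
   + rewrite pow_add, pow_1. apply div_le; [pos|].
    assert (H1 : N / D <= D ^ Cp * rsum N (fun u => ind (forall i, (1 <= i <= k)%nat -> near (D ^ Cp / M ^ i) (s * (xi
     * co F i * (INR (N + u) ^ i - n' ^ i)))))) by lra. apply div_le_inv in H1; [|lra]. lra.
   + termwise u _. apply ind_imp. intros Hq. specialize (Hq i Hi). rewrite plus_INR in Hq. rewrite Rmult_1_l.
    rhs (s * (xi * co F i * ((N + u) ^ i - n' ^ i))) by (unfold A; ring). easy.
  - rewrite HD2 in T2, T3. exists (t * (s * fact i))%nat. have (lt_O_fact i). split; [nia|]. rewrite !mult_INR. split.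
   + unfold E. rewrite !pow_add, Rmult_assoc. apply Rmult_le_compat; auto; try apply pos_INR.
    * pos.
    * apply Rmult_le_compat; auto; try apply pos_INR. etrans; [apply const_le_pow, HD|].
     apply pow_mono; [pos|apply fact_le; lia].
   + rhs (t * (A * (INR (fact i) * 1 ^ i))) by (unfold A; rewrite pow1; ring). easy. }
 split.
 - intros Hm. specialize (Hfrac Hm). mono.
 - exists r. split; [easy|]. rewrite <- pow_mult in R2, R3. split.
  + mono.
  + intros i Hi. specialize (R3 i Hi). eapply near_le; [|apply R3]. assert (HXi : 0 < X ^ i) by pos.
   apply le_div; [easy|]. unfold ei.
   lhs (D ^ (E * k) * D ^ Cp * D ^ ((Cp + 1) * Cr) * (X ^ i / (M ^ i * N ^ i))) by (specialize (HMi i); specialize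
    (HNi i); field; lra). via (D ^ (E * k) * D ^ Cp * D ^ ((Cp + 1) * Cr) * D ^ (2 * k)).
   * mul_l. apply div_le; [pos|]. rewrite <- Rpow_mult_distr. via ((4 * (M * N)) ^ i); [mono|].
    rewrite Rpow_mult_distr. mul_r. via ((D ^ 2) ^ i); [apply pow_incr; nra|]. rewrite <- pow_mult. mono.
   * rewrite <- !pow_add. mono.
Qed.

(** The case of one fixed factor d <= D. The approximations concern xi c_i d^i; multiplying the
    denominator by d^k, with k the degree, turns them into approximations to xi c_i. *)
Lemma linear_major F : ppok F -> exists (C : nat) (X0 : R), 1 <= X0 /\ forall D X xi M d m0 L om,
  2 <= D -> X0 <= X -> D ^ C <= INR M -> (1 <= d)%nat -> INR d <= D -> Rabs xi <= X -> X <= INR M ^ 3 ->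
  X <= 4 * (INR M * INR d) -> INR M * INR d <= X ->
  (M <= m0)%nat -> (m0 + L <= 4 * M)%nat ->
  INR M / D <= rsum L (fun t => cs (xi * ppval F (INR (m0 + t) * INR d) + om)) ->
  Maj F X (D ^ C) xi.
Proof.
 intros HF. set (k := deg F). set (m := nfr F). set (b0 := fex F 0%nat).
 assert (HFr : exists (C : nat) (X0 : R), 1 <= X0 /\ forall D X xi M d m0 L c, 2 <= D -> X0 <= X -> D ^ C <= INR M ->
  (1 <= d)%nat -> Rabs xi <= X -> X <= INR M ^ 3 -> X <= 4 * (INR M * INR d) -> INR M * INR d <= X -> (M <= m0)%nat ->
  (m0 + L <= 4 * M)%nat -> INR M / D <= rsum L (fun t => cs (gph k c m (fun j => xi * fco F j * Rpower (INR d) (fex F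
  j)) (fex F) (INR (m0 + t)))) -> (0 < m)%nat -> Rabs xi * Rpower X b0 <= D ^ C). {
  destruct (Nat.eq_dec m 0) as [E|E]. { exists 0%nat, 1. split; [lra|]. intros; lia. }
  destruct (frac_bound F HF ltac:(unfold m in E; lia)) as (C & X0 & HX0 & HC).
  destruct (pow2_exceeds (Rpower 4 b0)) as [a Ha]. exists (C + a)%nat, X0. split; [easy|].
  intros D X xi M d m0 L c HD HX HM Hd Hxi HXM HX4 HXd HmM HmL H _. apply le_INR in Hd. simpl in Hd.
  assert (Hb0 : 0 < b0) by (apply HF; unfold m in E; lia).
  assert (HMC : D ^ C <= INR M) by (upto HM; apply pow_mono; lra || lia). assert (HMp : 1 <= INR M) by nra.
  have (HC D X xi M (INR d) (fun j => Rpower (INR d) (fex F j)) c m0 L HD HX HMC Hxi HXM Hd HX4 HXd) as HB.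
  cbv beta in HB. fold b0 in HB. rewrite !Rabs_right in HB by pos.
  assert (HBB := HB ltac:(intros j Hj; rewrite Rabs_right by (left; apply Rpower_pos); rewrite <- Rpower_plus; right;
   f_equal; ring) ltac:(apply Rpower_incr; lra) HmM HmL H).
  via (Rabs xi * (Rpower 4 b0 * (Rpower (INR M) b0 * Rpower (INR d) b0))). { mul_l. rewrite !Rpower_mult_distr by nra.
   apply Rpower_incr; lra. }
  lhs (Rabs xi * Rpower (INR d) b0 * Rpower (INR M) b0 * Rpower 4 b0). rewrite pow_add. apply Rmult_le_compat; auto.
  - pos.
  - pos.
  - from Ha; apply pow_incr; lra. }
 destruct HFr as (Cf & X0 & HX0 & HCf). destruct (pow2_exceeds (rsum m (fun j => Rabs (fco F j)))) as [a Ha].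
 set (C1 := (a + Cf)%nat). destruct (core_poly k m (fex F) C1) as (Cp & HCp). set (C := (Cf + Cp + 4 * k + 1)%nat).
 exists C, X0. split; [easy|]. intros D X xi M d m0 L om HD HX HM Hd HdD Hxi HXM HX4 HXd HmM HmL H.
 assert (HMC : forall e, (e <= C)%nat -> D ^ e <= INR M) by (intros e He; upto HM; apply pow_mono; [pos|easy]).
 assert (HMp : 1 <= INR M) by (specialize (HMC 0%nat ltac:(lia)); simpl in HMC; lra).
 assert (HdR : 1 <= INR d) by inr. set (c := fun i => xi * co F i * INR d ^ i + (if Nat.eq_dec i 0 then om else 0)).
 set (g := fun j => xi * fco F j * Rpower (INR d) (fex F j)).
 assert (Hph : INR M / D <= rsum L (fun t => cs (gph k c m g (fex F) (INR (m0 + t))))). { from H. right. ext t _.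
  f_equal. assert (Hx : 0 < INR (m0 + t)). { apply lt_0_INR. assert (1 <= M)%nat by inr. lia. }
  set (x := INR (m0 + t)) in *. unfold ppval, gph. fold k m.
  rewrite !rsum_first, Rmult_plus_distr_l, Rmult_plus_distr_l, <- !rsum_scal, (rsum_ext k (fun i => xi * (co F (S i) *
   (x * INR d) ^ S i)) (fun i => c (S i) * x ^ S i)). 2:{ intros i _. unfold c. destruct (Nat.eq_dec (S i) 0); [lia|].
   rewrite Rpow_mult_distr. ring. }
  rewrite (rsum_ext m (fun i => xi * (fco F i * Rpower (x * INR d) (fex F i))) (fun j => g j * Rpower x (fex F j))).
  2:{ intros j _. unfold g. rewrite <- Rpower_mult_distr by lra. ring. }
  unfold c at 2. simpl. ring. }
 assert (Hfrac : (0 < m)%nat -> Rabs xi * Rpower X b0 <= D ^ Cf). { apply (HCf D X xi M d m0 L c); auto.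
  apply HMC; unfold C; lia. }
 destruct HF as (HF1 & HF2 & HF3). destruct (HCp D M c g m0 L) as (s & S1 & S2 & S3); auto. {
  apply HMC; unfold C; lia. }
 { intros j Hj. specialize (Hfrac ltac:(lia)). have (HF2 j Hj) as Hbj. assert (Hbj0 : fex F j <= b0). { unfold b0.
   destruct j; [lra|]. specialize (HF3 (S j) ltac:(unfold m in Hj; lia)). lra. }
  unfold g. rewrite !Rabs_mult, (Rabs_right (Rpower _ _)) by pos.
  lhs (Rabs (fco F j) * (Rabs xi * (Rpower (INR M) (fex F j) * Rpower (INR d) (fex F j)))).
  rewrite Rpower_mult_distr by lra. unfold C1. rewrite pow_add. apply Rmult_le_compat.
  - pos.
  - pos.
  - via (2 ^ a); [|mono]. upto Ha. apply (rsum_term_le m j (fun j => Rabs (fco F j))); [easy|].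
   intros; apply Rabs_pos.
  - upto Hfrac. mul_l. via (Rpower X (fex F j)); [apply Rpower_incr; [nra|lra]|mono]. }
 split.
 - intros Hm. etrans; [pos|mono].
 - exists (s * d ^ k)%nat.
  assert (Hdk : (1 <= d ^ k)%nat) by (assert (d ^ k <> 0)%nat by (apply Nat.pow_nonzero; lia); lia). split; [nia|].
  rewrite mult_INR, pow_INR. assert (HdkD : forall e, INR d ^ e <= D ^ e) by (intros; apply pow_incr; lra). split. {
   via (D ^ Cp * D ^ k).
   - mono.
   - rewrite <- pow_add. mono. }
  intros i Hi. specialize (S3 i Hi). unfold c in S3. destruct (Nat.eq_dec i 0); [lia|]. rewrite Rplus_0_r in S3.
  have (near_mul _ _ (d ^ (k - i)) S3) as Hn. rewrite pow_INR in Hn.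
  replace (INR d ^ (k - i) * (INR s * (xi * co F i * INR d ^ i))) with (INR s * INR d ^ k * (xi * co F i)) in Hn. 2:{
   replace k with (k - i + i)%nat at 1 by lia. rewrite pow_add. ring. }
  eapply near_le; [|apply Hn]. assert (HXi : 0 < X ^ i) by pos. assert (HMi : 0 < INR M ^ i) by pos.
  apply le_div; [easy|]. via (D ^ k * (D ^ Cp * D ^ (3 * k))).
  + lhs (INR d ^ (k - i) * (D ^ Cp * (X ^ i / INR M ^ i))). apply Rmult_le_compat.
   * pos.
   * pos.
   * from HdkD. mono.
   * mul_l. apply div_le; [easy|]. via ((4 * (INR M * INR d)) ^ i); [mono|].
    replace (4 * (INR M * INR d)) with (4 * INR d * INR M) by ring. rewrite Rpow_mult_distr. mul_r. via ((D ^ 3) ^ i).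
    { apply pow_incr. nra. }
    rewrite <- pow_mult. mono.
  + rewrite <- !pow_add. mono.
Qed.

Lemma cs_half x : cs (x + / 2) = - cs x.
Proof. unfold cs. replace (2 * PI * (x + / 2)) with (2 * PI * x + PI) by field. apply neg_cos. Qed.

(** After the Cauchy-Schwarz inequality in m, the matrix of correlations [I u v] is bounded through
    its row sums (Schur's test), so arbitrary coefficients enter by their square norms only. A row
    with N / D large entries would make xi F major. *)
Lemma bilinear F : ppok F -> exists (C : nat) (X0 : R), 1 <= X0 /\ forall D (X Y N : nat) xi om (a b : nat -> R),
  2 <= D -> X0 <= X -> D ^ C <= N -> N ^ 2 <= 4 * X -> (Y <= 2 * X)%nat ->
  Rabs xi <= X -> ~ Maj F (INR X) (D ^ C) xi ->
  (rsum (2 * X / N + 1) (fun m => a m * rsum N (fun u => ind (X < m * (N + u) <= Y)%nat * b (N + u)%nat *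
  cs (xi * ppval F (m * INR (N + u)) + om)))) ^ 2
  <= rsum (2 * X / N + 1) (fun m => a m ^ 2) * (rsum N (fun u => b (N + u)%nat ^ 2) * (5 * X / D)).
Proof.
 intros HF. destruct (pairs_major F HF) as (Cp & X0 & HX0 & HCp). exists (Cp + 7)%nat, X0. split; [easy|].
 intros D X Y N xi om a b HD HX HN HNX HY Hxi Hmaj. assert (HP1 : forall a, 1 <= D ^ a) by (intros; pos).
 (* For n in [N, 2 N) the condition X < m n <= 2 X confines m to [M, 4 M]. *)
 set (M := (X / (2 * N) + 1)%nat). set (T := (2 * X / N + 1)%nat). assert (HN128 : 128 <= INR N). { upto HN.
  rewrite pow_add. specialize (HP1 Cp).
  assert (128 <= D ^ 7) by (replace 128 with (2 ^ 7) by ring; apply pow_incr; lra). nra. }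
 assert (HN1 : (1 <= N)%nat) by inr. euclid X (2 * N)%nat as HXq HXr. assert (HMlo : INR X <= 2 * (INR M * INR N)). {
  rewrite <- mult_INR. change 2 with (INR 2). rewrite <- mult_INR. mono. }
 assert (HMhi : 2 * (INR M * INR N) <= INR X + 2 * INR N). { change 2 with (INR 2). rewrite <- !mult_INR, <- plus_INR.
  mono. }
 assert (HMN8 : INR N / 8 <= INR M) by nra. assert (HMD : D ^ Cp <= INR M). { via (INR N / 8); [|easy].
  apply le_div; [lra|]. upto HN. rewrite pow_add. mul_l. replace 8 with (2 ^ 3) by ring. via (D ^ 3); [mono|mono]. }
 assert (HMNX : INR M * INR N <= INR X) by nra. assert (HM3 : INR X <= INR M ^ 3). { nra. }
 set (ph := fun m u => xi * ppval F (INR m * INR (N + u)) + om).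
 set (be := fun m u => ind (X < m * (N + u) <= Y)%nat * b (N + u)%nat).
 set (I := fun u v => rsum T (fun m => ind (X < m * (N + u) <= Y)%nat * ind (X < m * (N + v) <= Y)%nat * cs (ph m u -
  ph m v))). assert (HIs : forall u v, I u v = I v u). { intros u v. ext m _.
  rewrite <- (cs_opp (ph m v - ph m u)), Ropp_minus_distr. ring. }
 assert (HT4 : (T <= 4 * M)%nat). { assert (2 * X / N < 4 * (X / (2 * N)) + 4)%nat; [|lia].
  apply Nat.Div0.div_lt_upper_bound. nia. }
 assert (HI4 : forall u v, Rabs (I u v) <= 4 * INR M). { intros u v. from rsum_abs. via (rsum T (fun _ => 1)).
  - termwise m _. rewrite !Rabs_mult, !Rabs_right by pos. have (cs_abs (ph m u - ph m v)).
   have (Rabs_pos (cs (ph m u - ph m v))). have (ind_01 (X < m * (N + u) <= Y)%nat).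
   have (ind_01 (X < m * (N + v) <= Y)%nat).
   assert (ind (X < m * (N + u) <= Y)%nat * ind (X < m * (N + v) <= Y)%nat <= 1) by nra. nra.
  - rewrite rsum_const, Rmult_1_r. rhs (INR (4 * M)) by inr. mono. }
 assert (HbigI : forall u v, (u < N)%nat -> (v < N)%nat -> INR M / D <= Rabs (I u v) -> bigpair F D xi M (N + u) (N +
  v)). { intros u v Hu Hv Hbig. set (lo := Nat.max (X / (N + u)) (X / (N + v))).
  set (hi := Nat.min (Y / (N + u)) (Y / (N + v))). set (g := fun m => cs (ph m u - ph m v)).
  assert (EI : I u v = rsum (hi - lo) (fun t => g (lo + 1 + t)%nat)). { rewrite <- (interval_sum T).
   - ext m _. f_equal. rewrite <- ind_and. apply ind_iff. rewrite !div_lt_iff, !le_div_iff by lia. lia.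
   - assert (Y / (N + u) <= 2 * X / N)%nat; [|lia].
    transitivity (2 * X / (N + u))%nat; [apply Nat.Div0.div_le_mono; easy|apply Nat.div_le_compat_l; lia]. }
  assert (Hlo : (M <= lo + 1)%nat). { assert (X / (2 * N) <= X / (N + u))%nat by (apply Nat.div_le_compat_l; lia).
   lia. }
  assert (Hhi : (hi - lo = 0 \/ lo + 1 + (hi - lo) <= T)%nat). { assert (Y / (N + u) <= 2 * X / N)%nat; [|lia].
   transitivity (2 * X / (N + u))%nat; [apply Nat.Div0.div_le_mono; easy|apply Nat.div_le_compat_l; lia]. }
  destruct Hhi as [Hhi|Hhi]. { rewrite EI, Hhi in Hbig. simpl in Hbig. rewrite Rabs_R0 in Hbig.
   assert (0 < INR M / D); [|lra]. pos. }
  destruct (Rle_lt_dec 0 (I u v)) as [Hs|Hs].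
  - exists (lo + 1)%nat, (hi - lo)%nat, 0. split; [easy|]. split; [lia|]. rewrite Rabs_right in Hbig by lra.
   rewrite EI in Hbig. from Hbig. right. ext t _. unfold g. f_equal. unfold ph. ring.
  - exists (lo + 1)%nat, (hi - lo)%nat, (/ 2). split; [easy|]. split; [lia|]. rewrite Rabs_left in Hbig by lra.
   from Hbig. right. lhs (-1 * rsum (hi - lo) (fun t => g (lo + 1 + t)%nat)). rewrite <- rsum_scal. ext t _.
   rewrite cs_half. unfold g.
   replace (ph (lo + 1 + t)%nat u - ph (lo + 1 + t)%nat v) with (xi * (ppval F (INR (lo + 1 + t) * INR (N + u)) -
    ppval F (INR (lo + 1 + t) * INR (N + v)))) by (unfold ph; ring). ring. }
 (* Fewer than N / D entries need the trivial bound 4 M, all others are below M / D; with M N <= X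
    this adds up to 5 X / D. *)
 assert (Hrow : forall u, (u < N)%nat -> rsum N (fun v => Rabs (I u v)) <= 5 * INR X / D). { intros u Hu.
  set (bad := fun n => exists v, (v < N)%nat /\ n = (N + v)%nat /\ INR M / D <= Rabs (I u v)).
  assert (Hcnt : rsum N (fun v => ind (bad (N + v)%nat)) < INR N / D). { apply Rnot_le_lt. intros Hc. apply Hmaj.
   apply (Maj_mono _ _ (D ^ Cp)); [lra|mono|]. apply (HCp D (INR X) xi M N (N + u)%nat bad); auto; try lra.
   - upto HN; mono.
   - lia.
   - intros n Hn (v & Hv & -> & Hb). apply HbigI; auto. rewrite HIs. easy. }
  via (rsum N (fun v => ind (bad (N + v)%nat) * (4 * INR M) + INR M / D)).
  - termwise v Hv. specialize (HI4 u v). assert (0 < INR M / D) by pos.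
   destruct (Rle_lt_dec (INR M / D) (Rabs (I u v))) as [Hc|Hc].
   + rewrite ind_T by (exists v; auto). lra.
   + have (ind_01 (bad (N + v)%nat)). nra.
  - rewrite rsum_plus, rsum_scalr, rsum_const. assert (INR M * INR N / D <= INR X / D) by mono. nra. }
 from cauchy_schwarz. mul_l.
 via (rsum T (fun m => rsum N (fun u => rsum N (fun v => be m u * be m v * cs (ph m u - ph m v))))). { termwise m _.
  apply weighted_square. }
 via (rsum N (fun u => rsum N (fun v => (b (N + u)%nat ^ 2 / 2 + b (N + v)%nat ^ 2 / 2) * Rabs (I u v)))). {
  rewrite rsum_swap. termwise u _. rewrite rsum_swap. termwise v _. via (b (N + u)%nat * b (N + v)%nat * I u v).
  - right. unfold I. rewrite <- rsum_scal. ext m _. unfold be. ring.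
  - set (p := b (N + u)%nat). set (q := b (N + v)%nat). from Rle_abs. rewrite !Rabs_mult. mul_r.
   rewrite <- pow2_abs, <- (pow2_abs q). have (pow2_ge_0 (Rabs p - Rabs q)). lra. }
 assert (Hsym : rsum N (fun u => rsum N (fun v => (b (N + u)%nat ^ 2 / 2 + b (N + v)%nat ^ 2 / 2) * Rabs (I u v))) =
  rsum N (fun u => b (N + u)%nat ^ 2 * rsum N (fun v => Rabs (I u v)))). {
  set (A := rsum N (fun u => b (N + u)%nat ^ 2 * rsum N (fun v => Rabs (I u v)))).
  replace A with (A / 2 + A / 2) by field.
  assert (EA : rsum N (fun u => rsum N (fun v => b (N + v)%nat ^ 2 / 2 * Rabs (I u v))) = A / 2). { rewrite rsum_swap.
   unfold A, Rdiv. rewrite <- rsum_scalr. ext u _. rewrite <- rsum_scal, <- rsum_scalr. ext v _. rewrite HIs. ring. }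
  assert (EB : rsum N (fun u => rsum N (fun v => b (N + u)%nat ^ 2 / 2 * Rabs (I u v))) = A / 2). { unfold A, Rdiv.
   rewrite <- rsum_scalr. ext u _. rewrite rsum_scal. ring. }
  rewrite <- EA at 2. rewrite <- EB, <- rsum_plus. ext u _. rewrite <- rsum_plus. mono. }
 rewrite Hsym, <- rsum_scalr. mono.
Qed.

(** * Arithmetic functions *)

Definition nprime (p : nat) : Prop := (2 <= p)%nat /\ forall d, Nat.divide d p -> d = 1%nat \/ d = p.

Lemma nprime_dvd_mul p a b : nprime p -> Nat.divide p (a * b) -> Nat.divide p a \/ Nat.divide p b.
Proof.
 intros [H1 H2] H. destruct (H2 (Nat.gcd p a) (Nat.gcd_divide_l p a)) as [E|E].
 - right. now apply (Nat.gauss p a b).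
 - left. rewrite <- E. apply Nat.gcd_divide_r.
Qed.

Lemma nprime_dvd_pow p q k : nprime p -> nprime q -> Nat.divide p (q ^ k) -> p = q.
Proof.
 intros Hp Hq. induction k as [|k IH]; simpl; intros H.
 - apply Nat.divide_1_r in H. destruct Hp; lia.
 - destruct (nprime_dvd_mul _ _ _ Hp H) as [H'|H']; [|auto]. destruct Hq as [_ Hq].
  destruct (Hq p H'); [destruct Hp; lia|easy].
Qed.

Lemma exists_prime_divisor n : (2 <= n)%nat -> exists p, nprime p /\ Nat.divide p n.
Proof.
 induction n as [n IH] using lt_wf_ind. intros Hn.
 destruct (classic (nprime n)) as [H|H]; [exists n; split; [easy|easy]|].
 assert (Hd : exists d, Nat.divide d n /\ d <> 1%nat /\ d <> n). { apply NNPP. intros Hno. apply H. split; [easy|].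
  intros d Hd. apply NNPP. intros Hc. apply Hno. exists d. tauto. }
 destruct Hd as (d & Hd & Hd1 & Hdn). assert (d <= n)%nat by (apply Nat.divide_pos_le; [lia|easy]).
 assert (d <> 0)%nat by (intros ->; apply Nat.divide_0_l in Hd; lia).
 destruct (IH d ltac:(lia) ltac:(lia)) as (p & Hp & Hpd). exists p. split; [easy|].
 now apply (Nat.divide_trans p d n).
Qed.

Lemma prime_pow_dvd_mul p q k m : nprime p -> nprime q -> p <> q -> Nat.divide (p ^ k) (q * m) -> Nat.divide (p ^ k) m.
Proof.
 intros Hp Hq Hne H. apply (Nat.gauss (p ^ k) q m); [easy|]. destruct Hq as [Hq1 Hq2].
 destruct (Hq2 (Nat.gcd (p ^ k) q) (Nat.gcd_divide_r _ _)) as [E|E]; [easy|exfalso]. apply Hne. symmetry.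
 apply (nprime_dvd_pow q p k); auto; [easy|]. rewrite <- E. apply Nat.gcd_divide_l.
Qed.

Lemma pow_gt_exp q k : (2 <= q)%nat -> (k < q ^ k)%nat.
Proof. intros H. now apply Nat.pow_gt_lin_r. Qed.

(** The sum of ln p over the prime powers p^k dividing n; [N] only bounds the ranges, to make them
    independent of n. That it equals ln n is shown by splitting off one prime factor at a time,
    instead of using unique factorization. *)
Definition Lsum (N n : nat) : R :=
  rsum (S N) (fun p => ind (nprime p) * ln p * rsum (S N) (fun k => ind ((1 <= k)%nat /\ Nat.divide (p ^ k) n))).

Lemma Lsum_mul N q m : nprime q -> (1 <= m)%nat -> (q * m <= N)%nat -> Lsum N (q * m) = Lsum N m + ln q.
Proof.
 intros Hq Hm HN. unfold Lsum. assert (Hq2 : (2 <= q)%nat) by apply Hq. assert (HqN : (q < S N)%nat) by nia.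
 rewrite <- (rsum_pick (S N) q (fun p => ln p) HqN), <- rsum_plus. ext p _. ind_case (nprime p) as Hp. 2:{
  rewrite ind_F; [ring|]. intros ->. easy. }
 destruct (Nat.eq_dec p q) as [->|Hne].
 - rewrite ind_T by easy.
  assert (E : rsum (S N) (fun k => ind ((1 <= k)%nat /\ Nat.divide (q ^ k) (q * m))) = rsum (S N) (fun k => ind ((1 <=
   k)%nat /\ Nat.divide (q ^ k) m)) + 1). { rewrite rsum_first, ind_F by lia.
   rewrite (rsum_ext N _ (fun k => ind (Nat.divide (q ^ k) m))). 2:{ intros k _. apply ind_iff.
    rewrite Nat.pow_succ_r'. split.
    - intros [_ [c Hc]]. exists c. nia.
    - intros [c Hc]. split; [lia|]. exists c. lia. }
   rewrite (rsum_trunc N (S N)); [|lia|]. 2:{ intros i Hi. apply ind_F. intros [_ Hd].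
    apply Nat.divide_pos_le in Hd; [|lia]. have (pow_gt_exp q i Hq2). nia. }
   destruct N as [|N]; [lia|]. rewrite !rsum_first, ind_T by apply Nat.divide_1_l. rewrite ind_F by lia.
   rewrite (rsum_ext N (fun i => ind ((1 <= S i)%nat /\ _)) (fun k => ind (Nat.divide (q ^ S k) m))).
   - ring.
   - intros i _. apply ind_iff. split; [tauto|]. intros; split; [lia|easy]. }
  nra.
 - rewrite ind_F, Rmult_0_l, Rplus_0_r by easy. f_equal. ext k _. apply ind_iff.
  split; intros [H1 H2]; (split; [easy|]).
  + now apply (prime_pow_dvd_mul p q k m).
  + now apply Nat.divide_mul_r.
Qed.

Lemma Lsum_ln N n : (1 <= n <= N)%nat -> Lsum N n = ln n.
Proof.
 induction n as [n IH] using lt_wf_ind. intros Hn. destruct (Nat.eq_dec n 1) as [->|H1].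
 - simpl INR. rewrite ln_1. apply rsum_zero. intros p _. ind_case (nprime p) as Hp; [|ring].
  rewrite rsum_zero; [ring|]. intros k _. apply ind_F. intros [Hk Hd]. apply Nat.divide_1_r in Hd. destruct Hp.
  have (pow_gt_exp p k H). lia.
 - destruct (exists_prime_divisor n ltac:(lia)) as (q & Hq & [m Hm]). rewrite Nat.mul_comm in Hm. subst n.
  assert (2 <= q)%nat by apply Hq. assert (1 <= m)%nat by nia. rewrite Lsum_mul by easy. rewrite IH by nia.
  rewrite mult_INR, ln_mult; [ring| |]; apply lt_0_INR; lia.
Qed.

(* The von Mangoldt function. *)
Definition lam (n : nat) : R :=
  rsum (S n) (fun p => ind (nprime p) * ln p * rsum (S n) (fun k => ind ((1 <= k)%nat /\ (p ^ k = n)%nat))).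

Lemma lam_extend N n : (n <= N)%nat -> lam n =
  rsum (S N) (fun p => ind (nprime p) * ln p * rsum (S N) (fun k => ind ((1 <= k)%nat /\ (p ^ k = n)%nat))).
Proof.
 intros H. symmetry. rewrite (rsum_trunc (S n) (S N)); [|lia|].
 - ext p _. ind_case (nprime p) as Hp; [|ring]. f_equal. apply rsum_trunc; [lia|]. intros k Hk. apply ind_F.
  intros [_ E]. destruct Hp as [Hp _]. have (pow_gt_exp p k Hp). lia.
 - intros p Hp. rewrite rsum_zero; [ring|]. intros k _. apply ind_F. intros [Hk E].
  assert (p ^ 1 <= p ^ k)%nat by (apply Nat.pow_le_mono_r; lia). rewrite Nat.pow_1_r in H0. lia.
Qed.

Lemma ln_INR_nonneg n : 0 <= ln (INR n).
Proof.
 destruct n as [|n].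
 - simpl. unfold ln. destruct (Rlt_dec 0 0) as [r|r]; [exfalso; exact (Rlt_irrefl 0 r)|pos].
 - pos.
Qed.

Lemma ln_INR_le n m : (1 <= n)%nat -> (n <= m)%nat -> ln n <= ln m.
Proof. intros Hn H. mono. Qed.

Lemma lam_nonneg n : 0 <= lam n.
Proof.
 apply rsum_nonneg. intros p _. apply Rmult_le_pos.
 - apply Rmult_le_pos; [pos|apply ln_INR_nonneg].
 - pos.
Qed.

Ltac pos_leaf ::= apply lam_nonneg.

Lemma lam_divisor_sum n : (1 <= n)%nat ->
  rsum (S n) (fun d => ind (Nat.divide d n) * lam d) = ln n.
Proof.
 intros Hn. rewrite <- (Lsum_ln n n) by lia.
 rewrite (rsum_ext _ _ (fun d => rsum (S n) (fun p => ind (nprime p) * ln p * rsum (S n) (fun k => ind (d = (p ^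
  k)%nat) * ind ((1 <= k)%nat /\ Nat.divide d n))))). 2:{ intros d Hd. rewrite (lam_extend n d), <- rsum_scal by lia.
  ext p _. rewrite <- Rmult_assoc, (Rmult_comm (ind (Nat.divide d n))), Rmult_assoc. f_equal. rewrite <- rsum_scal.
  ext k _. rewrite <- !ind_and. apply ind_iff. easy. }
 rewrite rsum_swap. ext p _. rewrite rsum_scal. f_equal. rewrite rsum_swap. ext k _.
 destruct (Nat.lt_ge_cases (p ^ k) (S n)) as [H|H].
 - rewrite (rsum_pick (S n) (p ^ k) (fun d => ind ((1 <= k)%nat /\ Nat.divide d n)) H). easy.
 - rewrite rsum_zero by (intros i Hi; rewrite ind_F by lia; ring). symmetry. apply ind_F. intros [_ Hd].
  apply Nat.divide_pos_le in Hd; lia.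
Qed.

Lemma lam_prime p : nprime p -> lam p = ln p.
Proof.
 intros Hp. assert (Hp2 : (2 <= p)%nat) by apply Hp. unfold lam. rewrite (rsum_ext _ _ (fun q => ind (q = p) * ln q)).
 - apply rsum_pick. lia.
 - intros q _. destruct (Nat.eq_dec q p) as [->|Hne].
  + rewrite ind_T, ind_T, Rmult_1_l by easy. rewrite <- (Rmult_1_r (ln p)) at 2.
   rewrite (rsum_ext _ _ (fun k => ind (k = 1%nat) * 1)).
   * rewrite rsum_pick; [easy|lia].
   * intros k _. rewrite Rmult_1_r. apply ind_iff. split.
    -- intros [Hk E]. destruct k as [|[|k]]; [lia|easy|exfalso].
     assert (p ^ 1 < p ^ S (S k))%nat by (apply Nat.pow_lt_mono_r; lia). rewrite Nat.pow_1_r in H. lia.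
    -- intros ->. split; [lia|apply Nat.pow_1_r].
  + rewrite (ind_F (q = p)) by easy. ind_case (nprime q) as Hq; [|ring]. rewrite rsum_zero; [ring|]. intros k _.
   apply ind_F. intros [Hk E]. apply Hne. symmetry. apply (nprime_dvd_pow p q k); auto. rewrite E. easy.
Qed.

Lemma lam_le_ln n : lam n <= ln n.
Proof.
 destruct n as [|n].
 - unfold lam. simpl. rewrite ind_F; [|intros [H _]; lia]. have (ln_INR_nonneg 0). simpl in H. lra.
 - rewrite <- lam_divisor_sum by lia.
  have (rsum_term_le (S (S n)) (S n) (fun d => ind (Nat.divide d (S n)) * lam d) ltac:(lia)) as H. cbv beta in H.
  rewrite ind_T, Rmult_1_l in H by apply Nat.divide_refl. apply H. intros i _. pos.
Qed.

(** * The Moebius function *)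

Fixpoint rprod (n : nat) (f : nat -> R) : R := match n with O => 1 | S m => rprod m f * f m end.

Lemma rprod_ext n f g : (forall i, (i < n)%nat -> f i = g i) -> rprod n f = rprod n g.
Proof. induction n as [|n IH]; intros H; simpl; [easy|]. rewrite IH by pos. now rewrite H by lia. Qed.

Lemma rprod_trunc n m f : (n <= m)%nat -> (forall i, (n <= i < m)%nat -> f i = 1) -> rprod m f = rprod n f.
Proof.
 induction m as [|m IH]; intros Hn H; [now replace n with 0%nat by lia|].
 destruct (Nat.eq_dec n (S m)) as [->|]; [easy|]. simpl. rewrite IH by (try lia; intros; apply H; lia).
 rewrite H by lia. ring.
Qed.

Lemma rprod_neg n a f g : (a < n)%nat -> f a = - g a -> (forall i, i <> a -> f i = g i) -> rprod n f = - rprod n g.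
Proof.
 induction n as [|n IH]; intros Ha H1 H2; [lia|]. simpl. destruct (Nat.eq_dec n a) as [->|].
 - rewrite H1, (rprod_ext a f g); [ring|]. intros i Hi. apply H2; lia.
 - rewrite IH, H2 by pos. ring.
Qed.

Lemma rprod_0 n a f : (a < n)%nat -> f a = 0 -> rprod n f = 0.
Proof.
 induction n as [|n IH]; intros Ha H; [lia|]. simpl. destruct (Nat.eq_dec n a) as [->|]; [rewrite H; ring|].
 rewrite IH; auto; [ring|lia].
Qed.

Lemma rprod_abs n f : (forall i, Rabs (f i) <= 1) -> Rabs (rprod n f) <= 1.
Proof.
 intros H. induction n as [|n IH]; simpl; [rewrite Rabs_R1; lra|]. rewrite Rabs_mult. specialize (H n).
 have (Rabs_pos (f n)). nra.
Qed.

(** The local factor of the Moebius function at p. It is 1 at every p that is not a prime divisor of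
    n, so the product may run over any longer range, and a new prime factor changes just one
    factor. *)
Definition mufac (n p : nat) : R :=
  if excluded_middle_informative (nprime p /\ Nat.divide p n)
  then (if excluded_middle_informative (Nat.divide (p * p) n) then 0 else -1) else 1.

(* The Moebius function. *)
Definition mu (n : nat) : R := rprod (S n) (mufac n).

Lemma mu_abs n : Rabs (mu n) <= 1.
Proof.
 apply rprod_abs. intros p. unfold mufac.
 destruct (excluded_middle_informative _); [destruct (excluded_middle_informative _)|].
 - rewrite Rabs_R0; lra.
 - rewrite Rabs_left; lra.
 - rewrite Rabs_R1; lra.
Qed.

Lemma mu_extend N n : (1 <= n <= N)%nat -> mu n = rprod (S N) (mufac n).
Proof.
 intros H. symmetry. apply rprod_trunc; [lia|]. intros p Hp. unfold mufac.
 destruct (excluded_middle_informative _) as [[_ Hd]|]; [|easy]. apply Nat.divide_pos_le in Hd; lia.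
Qed.

Lemma mu_sq p n : (1 <= n)%nat -> nprime p -> Nat.divide (p * p) n -> mu n = 0.
Proof.
 intros Hn Hp Hd. apply (rprod_0 _ p).
 - assert (p * p <= n)%nat by (apply Nat.divide_pos_le; [lia|easy]). nia.
 - unfold mufac. destruct (excluded_middle_informative (nprime p /\ _)) as [_|Hc].
  + destruct (excluded_middle_informative _); [easy|tauto].
  + exfalso. apply Hc. split; [easy|]. destruct Hd as [c ->]. exists (c * p)%nat. ring.
Qed.

Lemma mu_mul p e : (1 <= e)%nat -> nprime p -> ~ Nat.divide p e -> mu (p * e) = - mu e.
Proof.
 intros He Hp Hn. assert (Hp2 : (2 <= p)%nat) by apply Hp. rewrite (mu_extend (p * e) e) by nia.
 apply (rprod_neg _ p); [nia| |].
 - unfold mufac. destruct (excluded_middle_informative (nprime p /\ Nat.divide p (p * e))) as [_|Hc].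
  + destruct (excluded_middle_informative (nprime p /\ Nat.divide p e)) as [[_ Hc]|_]; [tauto|].
   destruct (excluded_middle_informative (Nat.divide (p * p) (p * e))) as [[c Hc]|_]; [|ring]. exfalso. apply Hn.
   exists c. nia.
  + exfalso. apply Hc. split; [easy|]. exists e. ring.
 - intros q Hq. unfold mufac. assert (E1 : nprime q -> (Nat.divide q (p * e) <-> Nat.divide q e)). { intros Hqp.
   split; [|now apply Nat.divide_mul_r]. intros H. rewrite <- (Nat.pow_1_r q) in H |- *.
   now apply (prime_pow_dvd_mul q p 1 e). }
  assert (E2 : nprime q -> (Nat.divide (q * q) (p * e) <-> Nat.divide (q * q) e)). { intros Hqp.
   split; [|now apply Nat.divide_mul_r]. intros H. replace (q * q)%nat with (q ^ 2)%nat in * by (simpl; lia).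
   now apply (prime_pow_dvd_mul q p 2 e). }
  destruct (excluded_middle_informative (nprime q /\ Nat.divide q (p * e))) as [[A1 A2]|A]; destruct
   (excluded_middle_informative (nprime q /\ Nat.divide q e)) as [[B1 B2]|B]; try tauto.
  destruct (excluded_middle_informative (Nat.divide (q * q) (p * e))); destruct (excluded_middle_informative
   (Nat.divide (q * q) e)); tauto.
Qed.

Lemma sum_multiples N p (g : nat -> R) : (1 <= p)%nat ->
  rsum (S N) (fun d => ind ((1 <= d)%nat /\ Nat.divide p d) * g d)
  = rsum (S N) (fun e => ind ((1 <= e)%nat /\ (p * e <= N)%nat) * g (p * e)%nat).
Proof.
 intros Hp.
 assert (E : forall d, (d < S N)%nat -> ind ((1 <= d)%nat /\ Nat.divide p d) * g d = rsum (S N) (fun e => ind (d = (p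
  * e)%nat) * (ind (1 <= e)%nat * g d))). { intros d Hd. destruct (classic ((1 <= d)%nat /\ Nat.divide p d)) as [H|H].
  - rewrite ind_T by easy. destruct H as [Hd1 [c Hc]]. rewrite (rsum_ext _ _ (fun e => ind (e = c) * g d)).
   + rewrite rsum_pick; [ring|nia].
   + intros e _. destruct (Nat.eq_dec e c) as [->|Hne].
    * rewrite !ind_T by nia. ring.
    * rewrite (ind_F (e = c)), ind_F by nia. ring.
  - rewrite ind_F by easy. rewrite rsum_zero; [ring|]. intros e _. ind_case (d = (p * e)%nat) as Hc; [|ring].
   destruct (ind_cases (1 <= e)%nat) as [[He ->]|[_ ->]]; [|ring]. exfalso. apply H. split; [nia|]. exists e. lia. }
 rewrite (rsum_ext _ _ _ E), rsum_swap. ext e _. destruct (Nat.lt_ge_cases (p * e) (S N)) as [H|H].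
 - rewrite rsum_pick, ind_and, (ind_T (p * e <= N)%nat) by lia. ring.
 - rewrite (ind_F (_ /\ _)) by lia. rewrite rsum_zero; [ring|]. intros i Hi. rewrite ind_F by lia. ring.
Qed.

Lemma dvd_pos d n : (1 <= n)%nat -> Nat.divide d n -> (1 <= d <= n)%nat.
Proof.
 intros Hn Hd. split; [|apply Nat.divide_pos_le; [lia|easy]]. destruct d; [apply Nat.divide_0_l in Hd; lia|lia].
Qed.

Lemma mu_1 : mu 1 = 1.
Proof.
 assert (H : forall p, (p < 2)%nat -> mufac 1 p = 1). { intros p Hp. unfold mufac.
  destruct (excluded_middle_informative _) as [[[Hc _] _]|_]; [lia|easy]. }
 unfold mu. simpl. rewrite !H by lia. ring.
Qed.

(** For a prime p dividing n, the divisors e prime to p cancel against the divisors p e, while mu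
    vanishes at the multiples of p^2. *)
Lemma mu_divisor_sum n : (1 <= n)%nat ->
  rsum (S n) (fun d => ind (Nat.divide d n) * mu d) = ind (n = 1%nat).
Proof.
 intros Hn. destruct (Nat.eq_dec n 1) as [->|H1].
 - rewrite ind_T, !rsum_S by easy. change (rsum 0 _) with 0.
  rewrite ind_F by (intros H; apply Nat.divide_0_l in H; lia). rewrite ind_T, mu_1 by apply Nat.divide_refl. ring.
 - rewrite ind_F by easy. destruct (exists_prime_divisor n ltac:(lia)) as (p & Hp & Hpn).
  assert (Hp2 : (2 <= p)%nat) by apply Hp.
  assert (E : rsum (S n) (fun d => ind (Nat.divide d n) * mu d) = rsum (S n) (fun d => ind ((1 <= d)%nat /\ Nat.divide
   p d) * (ind (Nat.divide d n) * mu d)) + rsum (S n) (fun d => ind (~ Nat.divide p d) * (ind (Nat.divide d n) * mu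
   d))). { rewrite <- rsum_plus. ext d _. ind_case (Nat.divide d n) as Hd; [|ring]. apply dvd_pos in Hd; [|easy].
   destruct (classic (Nat.divide p d)) as [Hc|Hc].
   - rewrite ind_T, ind_F by easy. ring.
   - rewrite ind_F, ind_T by tauto. ring. }
  rewrite E, sum_multiples, <- rsum_plus by lia. apply rsum_zero. intros e He. destruct (Nat.eq_dec e 0) as [->|He0].
  { rewrite ind_F by lia. rewrite (ind_F (Nat.divide 0 n)) by (intros H; apply Nat.divide_0_l in H; lia). ring. }
  destruct (classic (Nat.divide p e)) as [Hpe|Hpe].
  + rewrite (ind_F (~ _)) by tauto. rewrite (mu_sq p (p * e)); [ring|nia|easy|]. destruct Hpe as [c ->]. exists c.
   ring.
  + rewrite (ind_T (~ _)) by easy. rewrite mu_mul by pos. assert (Hiff : Nat.divide (p * e) n <-> Nat.divide e n). {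
    split; [intros [c ->]; exists (c * p)%nat; ring|]. intros [c Hc]. rewrite Hc in Hpn.
    destruct (nprime_dvd_mul p c e Hp Hpn) as [[c' Hc']|]; [|tauto]. exists c'. lia. }
   destruct (classic (Nat.divide e n)) as [Hen|Hen].
   * rewrite (ind_T (Nat.divide e n)), (ind_T (Nat.divide (p * e) n)) by tauto. rewrite ind_T; [ring|]. split; [lia|].
    apply dvd_pos; tauto.
   * rewrite (ind_F (Nat.divide e n)), (ind_F (Nat.divide (p * e) n)) by tauto. ring.
Qed.

Lemma div_pairs T (G : nat -> R) (h : nat -> nat -> R) :
  rsum (S T) (fun k => ind (1 <= k)%nat * (G k * rsum (S T) (fun d => ind (Nat.divide d k) * h d k)))
  = rsum (S T) (fun d => rsum (S T) (fun j => ind ((1 <= d)%nat /\ (1 <= j)%nat /\ (d * j <= T)%nat)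
  * (h d (d * j)%nat * G (d * j)%nat))).
Proof.
 rewrite (rsum_ext _ _ (fun k => rsum (S T) (fun d => ind (1 <= d)%nat * (ind ((1 <= k)%nat /\ Nat.divide d k) * (h d
  k * G k))))). 2:{ intros k _. rewrite <- !rsum_scal. ext d _. rewrite ind_and.
  destruct (ind_cases (1 <= k)%nat) as [[Hk ->]|[Hk ->]]; [|ring]. ind_case (Nat.divide d k) as Hd; [|ring].
  apply dvd_pos in Hd; [|easy]. rewrite ind_T by lia. ring. }
 rewrite rsum_swap. ext d _. rewrite rsum_scal. destruct (Nat.eq_dec d 0) as [->|Hd].
 - rewrite ind_F, Rmult_0_l by lia. symmetry. apply rsum_zero. intros j _. rewrite ind_F by lia. ring.
 - rewrite ind_T, Rmult_1_l, sum_multiples by lia. ext j _. f_equal. apply ind_iff. lia.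
Qed.

(** * Chebyshev and Mertens bounds *)

Definition psi (n : nat) : R := rsum (S n) lam.

Definition lnfact (n : nat) : R := rsum (S n) (fun k => ind (1 <= k)%nat * ln k).

Lemma ln_INR_0 : ln (INR 0) = 0.
Proof. simpl. unfold ln. destruct (Rlt_dec 0 0) as [r|r]; [exfalso; exact (Rlt_irrefl 0 r)|easy]. Qed.

Lemma lam_0 : lam 0 = 0.
Proof. have (lam_le_ln 0). have (lam_nonneg 0). rewrite ln_INR_0 in H. lra. Qed.

Lemma count_multiples n d : (1 <= d)%nat ->
  rsum (S n) (fun j => ind ((1 <= j)%nat /\ (d * j <= n)%nat)) = INR (n / d).
Proof.
 intros Hd. assert (n / d <= n)%nat by (apply Nat.Div0.div_le_upper_bound; nia).
 rewrite (rsum_ext _ _ (fun j => ind (0 < j <= n / d)%nat * 1)).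
 - rewrite interval_sum, rsum_const, Nat.sub_0_r by lia. ring.
 - intros j _. rewrite Rmult_1_r. apply ind_iff. rewrite <- (le_div_iff n j d Hd), (Nat.mul_comm j d). lia.
Qed.

Lemma lnfact_lam n : lnfact n = rsum (S n) (fun d => lam d * INR (n / d)).
Proof.
 unfold lnfact.
 rewrite (rsum_ext _ _ (fun k => ind (1 <= k)%nat * (1 * rsum (S n) (fun d => ind (Nat.divide d k) * lam d)))).
 - rewrite div_pairs. ext d _. destruct (Nat.eq_dec d 0) as [->|Hd].
  + rewrite lam_0, rsum_zero; [ring|intros; ring].
  + rewrite <- count_multiples, <- rsum_scal by lia. ext j _. rewrite Rmult_1_r, Rmult_comm. f_equal. apply ind_iff.
   lia.
 - intros k Hk. destruct (ind_cases (1 <= k)%nat) as [[H ->]|[H ->]]; [|ring]. f_equal.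
  rewrite Rmult_1_l, <- (lam_divisor_sum k H). symmetry. apply rsum_trunc; [lia|]. intros i Hi.
  rewrite ind_F; [ring|]. intros Hd. apply dvd_pos in Hd; [lia|easy].
Qed.

Lemma lnfact_S n : lnfact (S n) = lnfact n + ln (INR (S n)).
Proof. unfold lnfact. rewrite rsum_S, ind_T by lia. ring. Qed.

Lemma ln2_bounds : / 2 <= ln 2 <= 1.
Proof.
 split; [left; apply ln_lt_2|]. rewrite <- ln_exp. left. apply ln_increasing; [lra|]. have (exp_ineq1 1). lra.
Qed.

Lemma ln_le_sub x : 0 < x -> ln x <= x - 1.
Proof.
 intros Hx. destruct (Req_dec x 1) as [->|Hne]; [rewrite ln_1; lra|]. rewrite <- ln_exp. left.
 apply ln_increasing; [easy|]. have (exp_ineq1 (x - 1)). lra.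
Qed.

(** The middle term is the logarithm of the central binomial coefficient, which lies between 2^n and
    4^n. *)
Lemma lnfact_double n : INR n * ln 2 <= lnfact (2 * n) - 2 * lnfact n <= INR n * (2 * ln 2).
Proof.
 induction n as [|n IH].
 - unfold lnfact. simpl. rewrite ind_F by lia. lra.
 - replace (2 * S n)%nat with (S (S (2 * n))) by lia. rewrite !lnfact_S. assert (Hn : 0 < INR (S n)) by pos.
  assert (E : ln (INR (S (S (2 * n)))) = ln 2 + ln (INR (S n))). { rewrite <- ln_mult by lra. f_equal. inr. }
  assert (H1 : ln (INR (S n)) <= ln (INR (S (2 * n)))) by mono.
  assert (H2 : ln (INR (S (2 * n))) <= ln (INR (S (S (2 * n))))) by mono. rewrite E in H2 |- *.
  set (a := ln (INR (S n))) in *. set (u := ln (INR (S (2 * n)))) in *. inr.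
Qed.

Lemma psi_split n : psi (2 * n) = psi n + rsum n (fun i => lam (S n + i)).
Proof. unfold psi. replace (S (2 * n)) with (S n + n)%nat by lia. apply rsum_split. Qed.

Lemma floor_double n d : (1 <= d)%nat -> (2 * (n / d) <= 2 * n / d <= 2 * (n / d) + 1)%nat.
Proof.
 intros Hd. euclid n d. split.
 - apply Nat.div_le_lower_bound; nia.
 - assert (2 * n / d < 2 * (n / d) + 2)%nat; [|lia]. apply Nat.Div0.div_lt_upper_bound. nia.
Qed.

(** Chebyshev's argument: floor(2n/d) - 2 floor(n/d) is 0 or 1, and it is 1 for n < d <= 2n. *)
Lemma lnfact_double_lam n :
  psi (2 * n) - psi n <= lnfact (2 * n) - 2 * lnfact n <= psi (2 * n).
Proof.
 assert (E : lnfact (2 * n) - 2 * lnfact n = rsum (S (2 * n)) (fun d => lam d * (INR (2 * n / d) - 2 * INR (n / d)))).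
 { rewrite !lnfact_lam.
  assert (E : rsum (S n) (fun d => lam d * INR (n / d)) = rsum (S (2 * n)) (fun d => lam d * INR (n / d))). {
   symmetry. apply rsum_trunc; [lia|]. intros i Hi. rewrite Nat.div_small by lia. inr. }
  rewrite E, <- rsum_scal, <- rsum_minus. mono. }
 rewrite E. assert (B : forall d, (1 <= d)%nat -> 0 <= INR (2 * n / d) - 2 * INR (n / d) <= 1). { intros d Hd.
  have (floor_double n d Hd) as [H1 H2]. apply le_INR in H1. apply le_INR in H2. rewrite plus_INR, !mult_INR in *.
  simpl (INR 2) in *. simpl (INR 1) in *. lra. }
 split.
 - rewrite psi_split. replace (S (2 * n)) with (S n + n)%nat at 1 by lia. rewrite rsum_split.
  assert (0 <= rsum (S n) (fun d => lam d * (INR (2 * n / d) - 2 * INR (n / d)))). { apply rsum_nonneg. intros d _.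
   destruct d; [rewrite lam_0; lra|]. apply Rmult_le_pos; [pos|apply B; lia]. }
  assert (rsum n (fun i => lam (S n + i)) <= rsum n (fun i => lam (S n + i) * (INR (2 * n / (S n + i)) - 2 * INR (n /
   (S n + i))))). { termwise i Hi. rewrite (Nat.div_small n) by lia.
   assert (2 * n / (S n + i) = 1)%nat as -> by (symmetry; apply (Nat.div_unique _ _ 1 (n - 1 - i)); lia). inr. }
  lra.
 - termwise d _. destruct d; [rewrite lam_0; lra|]. have (lam_nonneg (S d)). specialize (B (S d) ltac:(lia)). nra.
Qed.

(** Halving n: psi(2m) exceeds psi(m) by at most 2 m, and the slack between 6 m and 8 m pays for one
    more term when n is odd. *)
Lemma psi_upper n : psi n <= 4 * n.
Proof.
 induction n as [n IH] using lt_wf_ind. destruct (Nat.le_gt_cases n 1) as [H|H]. {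
  assert (psi n <= 0); [|have (pos_INR n); lra]. via (rsum (S n) (fun _ => 0)); [|rewrite rsum_const; lra].
  termwise i Hi. from lam_le_ln. destruct i as [|[|i]]; [rewrite ln_INR_0; lra|simpl; rewrite ln_1; lra|lia]. }
 euclid n 2%nat. set (m := (n / 2)%nat) in *. have (lnfact_double m) as [_ A1]. have (lnfact_double_lam m) as [A2 _].
 have ln2_bounds. specialize (IH m ltac:(lia)). have (pos_INR m). assert (A3 : psi (2 * m) <= 6 * m) by nra.
 destruct (Nat.eq_dec (n mod 2) 0) as [E|E].
 - replace n with (2 * m)%nat by lia. inr.
 - replace n with (S (2 * m))%nat by lia. unfold psi. rewrite rsum_S. fold (psi (2 * m)).
  have (lam_le_ln (S (2 * m))). have (ln_le_sub (INR (S (2 * m))) ltac:(apply lt_0_INR; lia)).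
  rewrite S_INR, mult_INR in *. simpl (INR 2) in *. lra.
Qed.

Lemma psi_mono n m : (n <= m)%nat -> psi n <= psi m.
Proof. intros H. apply rsum_mono_n; [lia|intros; apply lam_nonneg]. Qed.

Lemma psi_lower n : (2 <= n)%nat -> n / 8 <= psi n.
Proof.
 intros Hn. euclid n 2%nat. set (m := (n / 2)%nat) in *. have (lnfact_double m) as [A1 _].
 have (lnfact_double_lam m) as [_ A2]. have (psi_mono (2 * m) n ltac:(lia)). have ln2_bounds. assert (n <= 2 * m + 1).
 { change 2 with (INR 2). change 1 with (INR 1). rewrite <- mult_INR, <- plus_INR. mono. }
 assert (1 <= m) by inr. nra.
Qed.

Lemma lnfact_upper n : lnfact n <= n * ln n.
Proof.
 unfold lnfact. rewrite rsum_first, ind_F, Rmult_0_l, Rplus_0_l, <- rsum_const by lia. termwise i Hi.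
 rewrite ind_T, Rmult_1_l by lia. mono.
Qed.

(** Replacing n / d by its floor, to reach ln(n!), costs at most psi(n) <= 4 n in all. *)
Lemma mertens_upper n : (1 <= n)%nat -> rsum (S n) (fun d => lam d / d) <= ln n + 4.
Proof.
 intros Hn. have (lnfact_upper n) as H. rewrite lnfact_lam in H. have (psi_upper n) as H2. assert (H0 : 0 < n) by pos.
 apply (Rmult_le_reg_l (INR n)); [easy|].
 assert (n * rsum (S n) (fun d => lam d / d) <= rsum (S n) (fun d => lam d * INR (n / d)) + psi n); [|lra].
 unfold psi. rewrite <- rsum_scal, <- rsum_plus. termwise d _. destruct d as [|d]; [rewrite lam_0; unfold Rdiv; lra|].
 have (lam_nonneg (S d)). assert (Hd : 0 < INR (S d)) by pos. assert (n / INR (S d) <= INR (n / S d) + 1). {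
  apply div_le; [easy|]. change 1 with (INR 1). rewrite <- plus_INR, <- mult_INR. apply le_INR. euclid n (S d). nia. }
 nra.
Qed.

(** Only primes up to sqrt x have a proper power below x, and the exponents k >= 2 of such a prime
    number at most ln x / ln p, each with weight ln p. *)
Lemma lam_proper_powers x : (1 <= x)%nat ->
  rsum (S x) (fun n => (1 - ind (nprime n)) * lam n) <= (INR (Nat.sqrt x) + 1) * ln x.
Proof.
 intros Hx.
 assert (A : forall n, (n < S x)%nat -> (1 - ind (nprime n)) * lam n <= rsum (S x) (fun p => ind (nprime p) * ln p *
  rsum (S x) (fun k => ind (n = (p ^ k)%nat) * ind (2 <= k)%nat))). { intros n Hn. rewrite (lam_extend x n) by lia.
  ind_case (nprime n) as Hp.
  - rewrite Rminus_diag, Rmult_0_l. apply rsum_nonneg. intros p _. apply Rmult_le_pos.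
   + apply Rmult_le_pos; [pos|apply ln_INR_nonneg].
   + pos.
  - rewrite Rminus_0_r, Rmult_1_l. termwise p _. ind_case (nprime p) as Hq; [|lra].
   apply Rmult_le_compat_l; [have (ln_INR_nonneg p); lra|]. termwise k _. rewrite <- ind_and. apply ind_imp.
   intros [Hk E]. destruct k as [|[|k]]; [lia| |lia]. rewrite Nat.pow_1_r in E. subst. tauto. }
 etrans; [apply rsum_le, A|]. rewrite rsum_swap. via (rsum (S x) (fun p => ind (p < Nat.sqrt x + 1)%nat * ln x)).
 - termwise p Hpx. rewrite rsum_scal, rsum_swap. ind_case (nprime p) as Hp. 2:{ rewrite !Rmult_0_l. pos. }
  assert (Hp2 : (2 <= p)%nat) by apply Hp. assert (HpR : 2 <= p) by inr. assert (Hlp : 0 < ln p) by pos.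
  rewrite (rsum_ext _ _ (fun k => ind ((2 <= k)%nat /\ (p ^ k <= x)%nat))). 2:{ intros k _.
   destruct (Nat.le_gt_cases (p ^ k) x).
   - rewrite rsum_pick by lia. apply ind_iff. tauto.
   - rewrite rsum_zero by (intros; rewrite ind_F by lia; ring). rewrite ind_F by lia. easy. }
  destruct (Nat.lt_ge_cases p (Nat.sqrt x + 1)) as [Hs|Hs].
  + rewrite ind_T, !Rmult_1_l, Rmult_comm by easy. apply le_div_inv; [easy|]. assert (Hpx1 : ln p <= ln x) by mono.
   via (ln x / ln p - 1 + 1); [|lra]. apply count_diameter.
   * assert (1 <= ln x / ln p) by (apply le_div; lra). lra.
   * intros i j Hij [Hi _] [Hj Hj2]. assert (j <= ln x / ln p). { apply le_div; [easy|].
     rewrite <- ln_pow, <- pow_INR by lra. assert (Hpj : 0 < INR (p ^ j)) by (rewrite pow_INR; apply pow_lt; lra).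
     destruct Hj2 as [Hj2|Hj2]; [mono|mono]. }
    assert (1 <= i) by inr. lra.
  + rewrite ind_F by lia. rewrite rsum_zero; [lra|]. intros k _. apply ind_F. intros [Hk Hk2].
   assert (p ^ 2 <= p ^ k)%nat by (apply Nat.pow_le_mono_r; lia). have (Nat.sqrt_spec x ltac:(lia)) as [_ Hsq].
   simpl in H. nia.
 - rewrite rsum_scalr. mul_r. have (Nat.sqrt_le_lin x) as Hs. rewrite (rsum_trunc (Nat.sqrt x + 1) (S x)); [|lia|].
  + from rsum_eq_count. inr.
  + intros i Hi. apply ind_F. lia.
Qed.

(** * Sums over primes: minor arcs *)

Definition inI (X Y n : nat) : R := ind (X < n <= Y)%nat.

Lemma linear_sum F : ppok F -> exists (C : nat) (X0 : R), 1 <= X0 /\ forall D (X Y d T : nat) xi om,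
  2 <= D -> X0 <= X -> D ^ C <= X -> (1 <= d)%nat -> d <= D -> (Y <= 2 * X)%nat -> (Y <= T)%nat ->
  Rabs xi <= X -> ~ Maj F (INR X) (D ^ C) xi ->
  Rabs (rsum (S T) (fun j => inI X Y (d * j) * cs (xi * ppval F (INR (d * j)) + om))) <= X / D.
Proof.
 intros HF. destruct (linear_major F HF) as (C & X0 & HX0 & HC). exists (C + 7)%nat, X0. split; [easy|].
 intros D X Y d T xi om HD HX HXC Hd HdD HY HT Hxi Hmaj. assert (HP1 : forall a, 1 <= D ^ a) by (intros; pos).
 assert (HdR : 1 <= d) by inr. set (M := (X / d)%nat). euclid X d as HXq HXr.
 assert (HMd : M * d <= X) by (rewrite <- mult_INR; apply le_INR; nia).
 assert (HMd2 : X <= M * d + d) by (rewrite <- mult_INR, <- plus_INR; apply le_INR; nia).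
 assert (HX7 : D ^ C * D ^ 7 <= X) by (rewrite <- pow_add; exact HXC).
 assert (HD5 : 32 <= D ^ 5) by (replace 32 with (2 ^ 5) by ring; apply pow_incr; lra).
 assert (HMlow : D ^ C * D ^ 5 <= M). { specialize (HP1 C). assert (X <= (M + 1) * D) by nra.
  assert (D ^ C * D ^ 5 * D <= M + 1). { nra. }
  assert (1 <= D ^ C * D ^ 5) by nra. nra. }
 assert (HM32 : 32 <= M) by (specialize (HP1 C); nra). assert (HX2 : X <= 2 * (M * d)) by nra. assert (HDM : D <= M).
 { specialize (HP1 C). assert (D ^ 1 <= D ^ 5) by mono. nra. }
 assert (HM3 : X <= M ^ 3). { nra. }
 assert (HlT : (Y / d < S T)%nat). { assert (Y / d <= Y)%nat by (apply Nat.Div0.div_le_upper_bound; nia). lia. }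
 assert (Hsum : forall om', rsum (S T) (fun j => inI X Y (d * j) * cs (xi * ppval F (INR (d * j)) + om')) <= X / D).
 { intros om'.
  assert (E : rsum (S T) (fun j => inI X Y (d * j) * cs (xi * ppval F (INR (d * j)) + om')) = rsum (Y / d - X / d)
   (fun t => cs (xi * ppval F (INR (X / d + 1 + t) * d) + om'))). {
   rewrite <- (interval_sum (S T) (X / d) (Y / d) (fun j => cs (xi * ppval F (j * d) + om')) HlT). ext j _.
   rewrite mult_INR, (Rmult_comm (INR d)). f_equal. apply ind_iff.
   rewrite Nat.mul_comm, div_lt_iff, le_div_iff by lia. easy. }
  apply Rnot_lt_le. intros Hc. apply Hmaj. apply (Maj_mono _ _ (D ^ C)); [lra|mono|].
  apply (HC D (INR X) xi M d (X / d + 1)%nat (Y / d - X / d)%nat om'); auto.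
  - nra.
  - lra.
  - lia.
  - assert (Y / d <= 2 * M + 1)%nat. { assert (Y / d < 2 * M + 2)%nat; [|lia]. apply Nat.Div0.div_lt_upper_bound. nia. }
   assert (1 <= M)%nat by inr. lia.
  - via (X / D); [|lra]. mul_r. nra. }
 apply Rabs_le. split; [|easy]. specialize (Hsum (om + / 2)).
 rewrite (rsum_ext _ _ (fun j => -1 * (inI X Y (d * j) * cs (xi * ppval F (INR (d * j)) + om)))) in Hsum.
 - rewrite rsum_scal in Hsum. lra.
 - intros j _. rewrite <- Rplus_assoc, cs_half. ring.
Qed.

Lemma dyadic_sum I N0 g : rsum (2 ^ I * N0) g = rsum N0 g + rsum I (fun i => rsum (2 ^ i * N0) (fun u => g (2 ^ i * N0 + u)%nat)).
Proof.
 induction I as [|I IH]; [simpl; rewrite Nat.add_0_r; ring|]. rewrite rsum_S, <- Rplus_assoc, <- IH.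
 replace (2 ^ S I * N0)%nat with (2 ^ I * N0 + 2 ^ I * N0)%nat by (simpl; ring). apply rsum_split.
Qed.

(** Dyadic decomposition of n, with [bilinear] on each of the I ranges. The cut n <= Rn is put into
    the coefficient of n, and [Rn ^ 2 <= 4 * X] keeps every range within the reach of [bilinear]. *)
Lemma type_two F : ppok F -> exists (C : nat) (X0 : R), 1 <= X0 /\
  forall D (X Y N0 Rn I : nat) xi om (a b : nat -> R) al be,
  2 <= D -> X0 <= X -> D ^ C <= N0 -> Rn ^ 2 <= 4 * X -> (Rn < 2 ^ I * N0)%nat ->
  (Y <= 2 * X)%nat -> Rabs xi <= X -> ~ Maj F (INR X) (D ^ C) xi -> 0 <= al -> 0 <= be ->
  (forall N, (N0 <= N)%nat -> rsum (2 * X / N + 1) (fun m => a m ^ 2) <= al * (X / N)) ->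
  (forall N, (N0 <= N)%nat -> rsum N (fun u => b (N + u)%nat ^ 2) <= be * N) ->
  Rabs (rsum (S Rn) (fun n => ind (N0 <= n)%nat * b n * dsum X (fun m => a m * (inI X Y (m * n) * cs (xi * ppval F (m * n) + om)))))
  <= I * (X * sqrt (5 * (al * be) / D)).
Proof.
 intros HF. destruct (bilinear F HF) as (C & X0 & HX0 & HC). exists C, X0. split; [easy|].
 intros D X Y N0 Rn I xi om a b al be HD HX HN0 HRn HI HY Hxi Hmaj Hal Hbe Ha Hb.
 set (g := fun n => ind (N0 <= n)%nat * b n * dsum X (fun m => a m * (inI X Y (m * n) * cs (xi * ppval F (m * n) +
  om)))). set (g' := fun n => ind (n <= Rn)%nat * g n). assert (HN01 : (1 <= N0)%nat) by lia.
 assert (E : rsum (S Rn) g = rsum I (fun i => rsum (2 ^ i * N0) (fun u => g' (2 ^ i * N0 + u)%nat))). {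
  assert (E1 : rsum (S Rn) g = rsum (2 ^ I * N0) g'). { rewrite (rsum_trunc (S Rn) (2 ^ I * N0)); [|lia|].
   - ext n Hn. unfold g'. rewrite ind_T by lia. ring.
   - intros n Hn. unfold g'. rewrite ind_F by lia. ring. }
  rewrite E1, dyadic_sum, rsum_zero; [ring|]. intros n Hn. unfold g', g. rewrite (ind_F (N0 <= n)%nat) by lia. ring. }
 rewrite E. from rsum_abs. rewrite <- rsum_const. termwise i Hi. set (N := (2 ^ i * N0)%nat).
 assert (HNN0 : (N0 <= N)%nat). { assert (2 ^ i <> 0)%nat by (apply Nat.pow_nonzero; lia). nia. }
 assert (HNR : 1 <= N) by inr. assert (HABD : 0 <= 5 * (al * be) / D). { pos. }
 destruct (Nat.le_gt_cases N Rn) as [HNR2|HNR2]. 2:{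
  rewrite rsum_zero; [rewrite Rabs_R0; apply Rmult_le_pos; [lra|pos]|]. intros u Hu. unfold g'. rewrite ind_F by lia.
  ring. }
 assert (HN2 : N ^ 2 <= 4 * X). { upto HRn. mono. }
 set (b' := fun n => ind (n <= Rn)%nat * b n).
 assert (E2 : rsum N (fun u => g' (N + u)%nat) = rsum (2 * X / N + 1) (fun m => a m * rsum N (fun u => ind (X < m * (N
  + u) <= Y)%nat * b' (N + u)%nat * cs (xi * ppval F (m * INR (N + u)) + om)))). {
  rewrite (rsum_ext (2 * X / N + 1) _ (fun m => rsum N (fun u => a m * (ind (X < m * (N + u) <= Y)%nat * b' (N +
   u)%nat * cs (xi * ppval F (m * INR (N + u)) + om))))), rsum_swap by (intros; now rewrite rsum_scal). ext u Hu.
  unfold g', g, b'. rewrite (ind_T (N0 <= N + u)%nat), Rmult_1_l, <- Rmult_assoc, <- rsum_scal by lia.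
  assert (HTN : (2 * X / N + 1 <= S (2 * X))%nat). {
   assert (2 * X / N <= 2 * X)%nat by (apply Nat.Div0.div_le_upper_bound; nia). lia. }
  rewrite (rsum_trunc (2 * X / N + 1) (S (2 * X))); [|easy|].
  - ext m _. unfold inI. ring.
  - intros m Hm. unfold inI. rewrite (ind_F (X < m * (N + u) <= Y)%nat); [ring|].
   assert (2 * X < m * N)%nat by (apply div_lt_iff; [lia|]; set (q := (2 * X / N)%nat) in *; lia). nia. }
 rewrite E2. apply Rsqr_incr_0_var; [|pos]. rewrite <- Rsqr_abs, !Rsqr_pow2, Rpow_mult_distr, pow2_sqrt by easy.
 etrans; [apply (HC D X Y N xi om a b'); auto|].
 { from HN0. mono. }
 via (al * (X / N) * (be * N * (5 * X / D))).
 - apply Rmult_le_compat.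
  + pos.
  + pos.
  + pos.
  + mul_r. upto (Hb N HNN0). termwise u _. unfold b'. destruct (ind_cases (N + u <= Rn)%nat) as [[_ ->]|[_ ->]].
   * lra.
   * nra.
 - right. field. lra.
Qed.

(** * Vaughan's identity and its coefficients *)

Lemma harmonic_upper n : (1 <= n)%nat -> rsum n (fun i => / INR (S i)) <= 1 + ln n.
Proof.
 induction n as [|n IH]; intros Hn; [lia|]. rewrite rsum_S.
 destruct (Nat.eq_dec n 0) as [->|H0]; [simpl; rewrite ln_1; lra|]. specialize (IH ltac:(lia)).
 assert (Hp : 0 < n) by pos. assert (Hs : 0 < INR (S n)) by pos.
 have (ln_le_sub (n / INR (S n)) ltac:(now apply Rdiv_lt_0_compat)) as H. rewrite ln_div in H by easy.
 assert (n / INR (S n) - 1 = - / INR (S n)) by (rewrite S_INR in *; field; lra). lra.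
Qed.

(** The truncated divisor sum of Vaughan's identity: it agrees with the full sum for 1 <= n <= U,
    hence is 1 at 1 and 0 at 2, ..., U. *)
Definition bU (U n : nat) : R := rsum (S U) (fun d => ind (Nat.divide d n) * mu d).

Lemma bU_1 U : (1 <= U)%nat -> bU U 1 = 1.
Proof.
 intros HU. unfold bU. rewrite (rsum_trunc 2 (S U)); [|lia|].
 - rewrite mu_divisor_sum by lia. now apply ind_T.
 - intros d Hd. rewrite ind_F; [ring|]. intros Hc. apply Nat.divide_1_r in Hc. lia.
Qed.

Lemma bU_small U n : (2 <= n <= U)%nat -> bU U n = 0.
Proof.
 intros Hn. unfold bU. rewrite (rsum_trunc (S n) (S U)); [|lia|].
 - rewrite mu_divisor_sum by lia. apply ind_F. lia.
 - intros d Hd. rewrite ind_F; [ring|]. intros Hc. apply dvd_pos in Hc; lia.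
Qed.

Lemma count_common_multiples x d e : (1 <= d)%nat -> (1 <= e)%nat ->
  rsum (S x) (fun n => ind (1 <= n)%nat * (ind (Nat.divide d n) * ind (Nat.divide e n)))
  <= x * (INR (Nat.gcd d e) / (d * e)).
Proof.
 intros Hd He. assert (Hl : (1 <= Nat.lcm d e)%nat). { assert (Nat.lcm d e <> 0)%nat; [|lia]. intros E.
  apply Nat.lcm_eq_0 in E. lia. }
 rewrite (rsum_ext _ _ (fun n => ind ((1 <= n)%nat /\ Nat.divide (Nat.lcm d e) n) * 1)).
 -
  rewrite (sum_multiples x (Nat.lcm d e) (fun _ => 1) Hl), (rsum_ext _ _ (fun j => ind ((1 <= j)%nat /\ (Nat.lcm d e *
   j <= x)%nat))) by (intros; ring). rewrite count_multiples by easy.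
  assert (Hg : (Nat.gcd d e * Nat.lcm d e = d * e)%nat). { unfold Nat.lcm. destruct (Nat.gcd_divide_r d e) as [c Hc].
   assert (Nat.gcd d e <> 0)%nat by lia. set (g := Nat.gcd d e) in *.
   assert (E : (e / g = c)%nat) by (rewrite Hc; apply Nat.div_mul; easy). lia. }
  apply (f_equal INR) in Hg. rewrite !mult_INR in Hg. assert (0 < INR (Nat.lcm d e)) by pos. assert (0 < d) by pos.
  assert (0 < e) by pos. assert (HG : INR (Nat.gcd d e) = d * e / INR (Nat.lcm d e)) by (rewrite <- Hg; field; lra).
  rewrite HG. rhs (x / INR (Nat.lcm d e)). apply le_div; [easy|]. rewrite <- mult_INR. apply le_INR.
  rewrite Nat.mul_comm. apply Nat.mul_div_le. lia.
 - intros n _. rewrite Rmult_1_r, <- !ind_and. apply ind_iff. split.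
  + intros (H1 & H2 & H3). split; [easy|]. now apply Nat.lcm_least.
  + intros (H1 & H2). split; [easy|]. split; (eapply Nat.divide_trans; [|apply H2]).
   * apply Nat.divide_lcm_l.
   * apply Nat.divide_lcm_r.
Qed.

(** With |mu| <= 1 the square is bounded by a count of common multiples of d and e, about x gcd(d,
    e) / (d e). Bounding gcd(d, e) by the sum of all common divisors g separates d from e; each g
    contributes at most H^2 / g, and the sum over g gives a third factor H. *)
Lemma bU_square x U : (1 <= U)%nat ->
  rsum (S x) (fun n => ind (1 <= n)%nat * bU U n ^ 2) <= x * (1 + ln U) ^ 3.
Proof.
 intros HU. set (H := 1 + ln U).
 set (w := fun d e => ind (1 <= d)%nat * ind (1 <= e)%nat * (INR (Nat.gcd d e) / (d * e))).
 via (x * rsum (S U) (fun d => rsum (S U) (fun e => w d e))). {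
  via (rsum (S x) (fun n => rsum (S U) (fun d => rsum (S U) (fun e => ind (1 <= n)%nat * (ind (Nat.divide d n) * ind
   (Nat.divide e n)))))).
  - termwise n _. via (ind (1 <= n)%nat * (rsum (S U) (fun d => ind (Nat.divide d n))) ^ 2).
   + mul_l. rewrite <- pow2_abs. apply pow_incr. split; [pos|]. from rsum_abs. termwise d _.
    rewrite Rabs_mult, Rabs_right by pos. have (mu_abs d). mono.
   + right. set (A := rsum (S U) _). replace (A ^ 2) with (A * A) by ring. unfold A. rewrite rsum_mul, <- rsum_scal.
    ext d _. rewrite <- rsum_scal. easy.
  - rewrite rsum_swap, <- rsum_scal. termwise d _. rewrite rsum_swap, <- rsum_scal. termwise e _. unfold w.
   destruct (Nat.eq_dec d 0) as [->|Hd]; [|destruct (Nat.eq_dec e 0) as [->|He]].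
   + rewrite ind_F by lia. rewrite rsum_zero; [lra|]. intros n _.
    destruct (ind_cases (1 <= n)%nat) as [[Hn ->]|[Hn ->]]; [|ring]. rewrite ind_F; [ring|]. intros Hc.
    apply Nat.divide_0_l in Hc. lia.
   + rewrite (ind_F (1 <= 0)%nat) by lia. rewrite rsum_zero; [lra|]. intros n _.
    destruct (ind_cases (1 <= n)%nat) as [[Hn ->]|[Hn ->]]; [|ring]. rewrite (ind_F (Nat.divide 0 n)); [ring|].
    intros Hc. apply Nat.divide_0_l in Hc. lia.
   + rewrite !ind_T, !Rmult_1_l by lia. apply count_common_multiples; lia. }
 mul_l. set (r := fun g => rsum (S U) (fun d => ind ((1 <= d)%nat /\ Nat.divide g d) * / d)).
 assert (Hr : forall g, (1 <= g)%nat -> 0 <= r g <= H / g). { intros g Hg. unfold r. rewrite sum_multiples by easy.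
  assert (Hg0 : 0 < g) by pos. split.
  - apply rsum_nonneg. intros j _. destruct (Nat.eq_dec (g * j) 0) as [->|Hc]; [simpl; rewrite Rinv_0; lra|]. pos.
  - rewrite rsum_first, ind_F, Rmult_0_l, Rplus_0_l by lia. via (rsum U (fun i => / INR (S i)) * / g).
   + rewrite <- rsum_scalr. termwise i _. rewrite mult_INR, Rinv_mult, Rmult_comm. assert (0 < / INR (S i)) by pos.
    assert (0 < / g) by now apply Rinv_0_lt_compat. have (ind_01 ((1 <= S i)%nat /\ (g * S i <= U)%nat)).
    assert (0 < / g * / INR (S i)) by now apply Rmult_lt_0_compat. nra.
   + mul_r. now apply harmonic_upper. }
 via (rsum (S U) (fun g => ind (1 <= g)%nat * g * (r g * r g))).
 -
  set (t := fun g d e => ind (1 <= g)%nat * g * ((ind ((1 <= d)%nat /\ Nat.divide g d) * / d) * (ind ((1 <= e)%nat /\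
   Nat.divide g e) * / e))).
  assert (Et : rsum (S U) (fun g => ind (1 <= g)%nat * g * (r g * r g)) = rsum (S U) (fun d => rsum (S U) (fun e =>
   rsum (S U) (fun g => t g d e)))). {
   rewrite (rsum_ext (S U) _ (fun g => rsum (S U) (fun d => rsum (S U) (fun e => t g d e)))).
   - rewrite rsum_swap. ext d _. apply rsum_swap.
   - intros g _. unfold r, t. rewrite rsum_mul, <- rsum_scal. ext d _. now rewrite <- rsum_scal. }
  rewrite Et. termwise d Hd. termwise e He. unfold t, w.
  destruct (Nat.eq_dec d 0) as [->|Hd0]; [|destruct (Nat.eq_dec e 0) as [->|He0]].
  + rewrite ind_F by lia. rewrite rsum_zero; [lra|]. intros g _. rewrite (ind_F ((1 <= 0)%nat /\ _)) by lia. ring.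
  + rewrite (ind_F (1 <= 0)%nat) by lia. rewrite rsum_zero; [lra|]. intros g _.
   rewrite (ind_F ((1 <= 0)%nat /\ _)) by lia. ring.
  + rewrite !ind_T by lia.
   assert (Hg1 : (1 <= Nat.gcd d e)%nat) by (assert (Nat.gcd d e <> 0)%nat by (intros E; apply Nat.gcd_eq_0 in E;
    lia); lia). assert (HgU : (Nat.gcd d e < S U)%nat). {
    assert (Nat.gcd d e <= d)%nat by (apply Nat.divide_pos_le; [lia|apply Nat.gcd_divide_l]). lia. }
   assert (0 < d) by pos. assert (0 < e) by pos.
   have (rsum_term_le (S U) (Nat.gcd d e) (fun g => ind (1 <= g)%nat * g * ((ind ((1 <= d)%nat /\ Nat.divide g d) * /
    d) * (ind ((1 <= e)%nat /\ Nat.divide g e) * / e))) HgU) as Ht. cbv beta in Ht. rewrite ind_T, ind_T, ind_T in Ht.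
   * upto Ht.
    -- right. field. lra.
    -- intros g _. pos.
   * split; [lia|apply Nat.gcd_divide_r].
   * split; [lia|apply Nat.gcd_divide_l].
   * easy.
 - rewrite rsum_first, ind_F, !Rmult_0_l, Rplus_0_l by lia. via (rsum U (fun i => / INR (S i)) * H ^ 2).
  + rewrite <- rsum_scalr. termwise i _. specialize (Hr (S i) ltac:(lia)). assert (Hi : 0 < INR (S i)) by pos.
   via (INR (S i) * (H / INR (S i) * (H / INR (S i)))).
   * mono.
   * right. field. lra.
  + rhs (H * H ^ 2). mul_r. now apply harmonic_upper.
Qed.

(** The sum of lam m bU n H(m n) over all m and n is evaluated in two ways: summing over the
    multiples of d first, with the divisor sum of lam equal to ln, gives the first term on the
    right; separating n = 1 from n > U, and m <= V from m > V, gives the other three. For m <= V <=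
    X the term n = 1 lies outside the support of H. *)
Lemma vaughan (X Y U V T : nat) (H : nat -> R) :
  (1 <= U)%nat -> (V <= X)%nat -> (Y <= T)%nat ->
  (forall n, ~ (X < n <= Y)%nat -> H n = 0) ->
  rsum (S T) (fun m => lam m * H m)
  = rsum (S U) (fun d => mu d * rsum (S T) (fun k => ln k * H (d * k)%nat))
  - rsum (S V) (fun m => lam m * rsum (S U) (fun d => mu d * rsum (S T) (fun j => H (m * d * j)%nat)))
  - rsum (S T) (fun m => rsum (S T) (fun n => ind (V < m)%nat * lam m * (ind (U < n)%nat * bU U n) * H (m * n)%nat)).
Proof.
 intros HU HV HY HH. assert (H0 : forall m, H (m * 0)%nat = 0) by (intros m; apply HH; lia).
 assert (HT : forall n, (T < n)%nat -> H n = 0) by (intros n Hn; apply HH; lia).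
 assert (Hb : forall m, rsum (S T) (fun n => bU U n * H (m * n)%nat) = rsum (S U) (fun d => mu d * rsum (S T) (fun j
  => H (m * d * j)%nat))). { intros m. unfold bU.
  rewrite (rsum_ext (S T) _ (fun n => rsum (S U) (fun d => mu d * (ind (Nat.divide d n) * H (m * n)%nat)))). 2:{
   intros n _. rewrite <- rsum_scalr. mono. }
  rewrite rsum_swap. ext d _. rewrite rsum_scal. f_equal. destruct (Nat.eq_dec m 0) as [->|Hm]. {
   rewrite !rsum_zero; [easy| |]; intros; simpl; rewrite HH by lia; ring. }
  destruct (Nat.eq_dec d 0) as [->|Hd]. { rewrite !rsum_zero; [easy| |].
   - intros j _. apply HH. lia.
   - intros n _. destruct (Nat.eq_dec n 0) as [->|Hn]; [rewrite H0; ring|]. rewrite ind_F; [ring|]. intros Hc.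
    apply Nat.divide_0_l in Hc. lia. }
  rewrite (rsum_ext (S T) _ (fun n => ind ((1 <= n)%nat /\ Nat.divide d n) * H (m * n)%nat)). 2:{ intros n _.
   destruct (Nat.eq_dec n 0) as [->|Hn]; [rewrite H0; ring|]. f_equal. apply ind_iff. intuition lia. }
  rewrite sum_multiples by lia. ext j _.
  destruct (Nat.eq_dec j 0) as [->|Hj]; [rewrite Nat.mul_0_r, H0, Nat.mul_0_r, HH by lia; ring|].
  rewrite Nat.mul_assoc. destruct (Nat.le_gt_cases (d * j) T).
  - rewrite ind_T by lia. ring.
  - rewrite HT by nia. ring. }
 assert (HW : rsum (S T) (fun m => lam m * rsum (S T) (fun n => bU U n * H (m * n)%nat)) = rsum (S U) (fun d => mu d *
  rsum (S T) (fun k => ln k * H (d * k)%nat))). {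
  rewrite (rsum_ext (S T) _ (fun m => rsum (S U) (fun d => mu d * (lam m * rsum (S T) (fun j => H (m * d *
   j)%nat))))). 2:{ intros m _. rewrite Hb, <- rsum_scal. mono. }
  rewrite rsum_swap. ext d _. rewrite rsum_scal. f_equal. destruct (Nat.eq_dec d 0) as [->|Hd]. {
   rewrite !rsum_zero; [easy| |].
   - intros k _. rewrite HH by lia. ring.
   - intros m _. rewrite rsum_zero; [ring|]. intros j _. apply HH. lia. }
  rewrite (rsum_ext (S T) (fun k => ln k * H (d * k)%nat) (fun k => ind (1 <= k)%nat * (H (d * k)%nat * rsum (S T)
   (fun m => ind (Nat.divide m k) * lam m)))). 2:{ intros k Hk.
   destruct (Nat.eq_dec k 0) as [->|Hk0]; [rewrite H0; ring|]. rewrite ind_T, <- lam_divisor_sum by lia.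
   rewrite (rsum_trunc (S k) (S T)); [ring|lia|]. intros i Hi. rewrite ind_F; [ring|]. intros Hc.
   apply dvd_pos in Hc; lia. }
  rewrite div_pairs. ext m _. rewrite <- rsum_scal. ext j _.
  destruct (Nat.eq_dec m 0) as [->|Hm]; [rewrite lam_0; ring|].
  destruct (Nat.eq_dec j 0) as [->|Hj]; [rewrite ind_F, H0 by lia; ring|].
  replace (d * (m * j))%nat with (m * d * j)%nat by ring. destruct (Nat.le_gt_cases (m * j) T).
  - rewrite ind_T by lia. ring.
  - rewrite HT by nia. ring. }
 assert (Hn : forall m, (m < S T)%nat -> rsum (S T) (fun n => bU U n * H (m * n)%nat) = H m + rsum (S T) (fun n => ind
  (U < n)%nat * bU U n * H (m * n)%nat)). { intros m Hm. destruct T as [|T']. { simpl.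
   rewrite Nat.mul_0_r, HH, HH by lia. ring. }
  rewrite rsum_first, rsum_first, rsum_first, rsum_first, H0, Nat.mul_1_r, bU_1, (ind_F (U < 1)%nat) by lia.
  rewrite (rsum_ext T' (fun i => bU U (S (S i)) * H (m * S (S i))%nat) (fun i => ind (U < S (S i))%nat * bU U (S (S
   i)) * H (m * S (S i))%nat)).
  - ring.
  - intros i _. destruct (Nat.lt_ge_cases U (S (S i))).
   + rewrite ind_T by easy. ring.
   + rewrite bU_small by lia. ring. }
 rewrite <- HW, (rsum_ext (S T) (fun m => lam m * rsum (S T) (fun n => bU U n * H (m * n)%nat)) (fun m => lam m * H m
  + (ind (V < m)%nat * lam m * rsum (S T) (fun n => ind (U < n)%nat * bU U n * H (m * n)%nat) + ind (m < S V)%nat *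
  (lam m * rsum (S T) (fun n => bU U n * H (m * n)%nat))))). 2:{ intros m Hm.
  destruct (Nat.lt_ge_cases V m) as [Hc|Hc].
  - rewrite Hn, ind_T, ind_F by lia. ring.
  - rewrite HH, ind_F, ind_T by lia. ring. }
 rewrite !rsum_plus.
 assert (E2 : rsum (S T) (fun m => ind (m < S V)%nat * (lam m * rsum (S T) (fun n => bU U n * H (m * n)%nat))) = rsum
  (S V) (fun m => lam m * rsum (S U) (fun d => mu d * rsum (S T) (fun j => H (m * d * j)%nat)))). {
  destruct (Nat.le_gt_cases V T) as [Hc|Hc].
  - rewrite (rsum_trunc (S V) (S T)) by (try lia; intros i Hi; rewrite ind_F by lia; ring). ext m Hm.
   rewrite ind_T, Hb by lia. ring.
  - rewrite (rsum_trunc (S T) (S V)); [|lia|].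
   + ext m Hm. rewrite ind_T, Hb by lia. ring.
   + intros m Hm. rewrite rsum_zero; [ring|]. intros d _. rewrite rsum_zero; [ring|]. intros j _. apply HH. lia. }
 rewrite E2, (rsum_ext (S T) (fun m => rsum (S T) (fun n => ind (V < m)%nat * lam m * (ind (U < n)%nat * bU U n) * H
  (m * n)%nat)) (fun m => ind (V < m)%nat * lam m * rsum (S T) (fun n => ind (U < n)%nat * bU U n * H (m * n)%nat))).
 2:{ intros m _. rewrite <- rsum_scal. mono. }
 ring.
Qed.

Lemma Rabs_sub_le a b : Rabs (a - b) <= Rabs a + Rabs b.
Proof. mono. Qed.

Lemma abel n (w g : nat -> R) B : (0 < n)%nat -> (forall k, (k < n)%nat -> 0 <= w k) -> (forall k, (S k < n)%nat -> w k <= w (S k)) ->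
  (forall k, (k <= n)%nat -> Rabs (rsum k g) <= B) -> Rabs (rsum n (fun k => w k * g k)) <= 2 * w (n - 1)%nat * B.
Proof.
 intros Hn0 H0 Hmon HB.
 assert (HB0 : 0 <= B) by (specialize (HB 0%nat ltac:(lia)); simpl in HB; rewrite Rabs_R0 in HB; lra).
 destruct n as [|n]; [lia|]. replace (S n - 1)%nat with n by lia.
 assert (E : rsum (S n) (fun k => w k * g k) = w n * rsum (S n) g - rsum n (fun k => (w (S k) - w k) * rsum (S k) g)).
 { clear. induction n as [|n IH]; [simpl; ring|].
  rewrite rsum_S, IH, (rsum_S (S n) g), (rsum_S n (fun k => (w (S k) - w k) * _)). ring. }
 rewrite E. from Rabs_sub_le. rewrite Rabs_mult, Rabs_right by pos.
 assert (Rabs (rsum n (fun k => (w (S k) - w k) * rsum (S k) g)) <= (w n - w 0%nat) * B). { from rsum_abs.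
  via (rsum n (fun k => (w (S k) - w k) * B)).
  - termwise k Hk. specialize (Hmon k ltac:(lia)). rewrite Rabs_mult, Rabs_right by lra. mono.
  - right. clear. induction n as [|n IH]; [simpl; ring|]. rewrite rsum_S, IH. ring. }
 specialize (HB (S n) ltac:(lia)). have (H0 n ltac:(lia)) as Hn. specialize (H0 0%nat ltac:(lia)). nra.
Qed.

Lemma log_power_small E : exists X0, 2 <= X0 /\ forall x, X0 <= x -> 2 <= ln (2 * x) /\ ln (2 * x) ^ E <= x.
Proof.
 set (e := INR (E + 2)). assert (He : 0 < e) by (apply lt_0_INR; lia).
 destruct (Rpower_large (/ e) (e ^ (E + 1))) as (X1 & HX1 & HX1'); [pos|]. exists (Rmax X1 (exp 2)).
 have (Rmax_l X1 (exp 2)). have (Rmax_r X1 (exp 2)). assert (He2 : 2 <= exp 2). { have (exp_ineq1_le 2). lra. }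
 split; [lra|]. intros x Hx. assert (Hl2 : 2 <= ln (2 * x)). { via (ln (exp 2)); [rewrite ln_exp; lra|]. mono. }
 set (z := 2 * x) in *. specialize (HX1' z ltac:(unfold z; lra)). set (y := Rpower z (/ e)) in *.
 assert (Hy : 0 < y) by apply Rpower_pos. assert (Hz : z = y ^ (E + 2)). { unfold y.
  rewrite <- Rpower_pow, Rpower_mult by apply Rpower_pos. fold e. rewrite Rinv_l, Rpower_1 by (unfold z; lra). easy. }
 assert (Hln : ln z <= e * y). { rewrite Hz at 1. rewrite ln_pow by easy. mul_l. have (ln_le_sub y Hy). lra. }
 assert (H1 : ln z ^ (E + 1) <= z). { via ((e * y) ^ (E + 1)); [mono|]. rewrite Rpow_mult_distr, Hz.
  replace (E + 2)%nat with (S (E + 1)) by lia. rewrite <- tech_pow_Rmult. mono. }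
 rewrite Nat.add_1_r, <- tech_pow_Rmult in H1. unfold z in *. nra.
Qed.

Lemma lam_square_sum (T n : nat) : (1 <= T)%nat -> rsum (S n) (fun m => (ind (m <= T)%nat * lam m) ^ 2) <= ln T * (4 * n).
Proof.
 intros HT. via (ln T * psi n).
 - unfold psi. rewrite <- rsum_scal. termwise m _. have (lam_nonneg m). have (ln_INR_nonneg T).
  destruct (Nat.le_gt_cases m T) as [Hc|Hc].
  + rewrite ind_T by easy. destruct m; [rewrite lam_0; simpl; nra|]. have (lam_le_ln (S m)).
   have (ln_INR_le (S m) T ltac:(lia) Hc). nra.
  + rewrite ind_F by lia. nra.
 - apply Rmult_le_compat_l; [pos|apply psi_upper].
Qed.

Lemma log2_bound (R X : nat) : (1 <= R)%nat -> (R <= 2 * X)%nat -> 2 <= ln (2 * X) -> INR (S (Nat.log2 R)) <= 3 * ln (2 * X).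
Proof.
 intros HR HX HL. have (Nat.log2_spec R ltac:(lia)) as [H _]. assert (H1 : INR (Nat.log2 R) * ln 2 <= ln (2 * X)). {
  rewrite <- ln_pow by lra. apply le_INR in H. rewrite pow_INR in H. change (INR 2) with 2 in H. apply le_INR in HX.
  rewrite mult_INR in HX. simpl (INR 2) in HX. mono. }
 rewrite S_INR. have ln2_bounds. nra.
Qed.

(** Both cut-offs in Vaughan's identity are a power U of L = ln (2 X): large enough for [type_two],
    small enough for all d <= U^2 to be admissible in [linear_sum]. *)
Lemma minor_arcs F : ppok F -> forall A : nat, exists (B : nat) (X0 : R), 1 <= X0 /\
  forall (X Y : nat) xi om, X0 <= X -> (Y <= 2 * X)%nat -> Rabs xi <= X ->
  ~ Maj F (INR X) (ln (2 * X) ^ B) xi ->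
  Rabs (dsum X (fun n => lam n * (inI X Y n * cs (xi * ppval F (INR n) + om)))) <= X / ln (2 * X) ^ A.
Proof.
 intros HF A. destruct (linear_sum F HF) as (C1 & X1 & HX1 & HC1). destruct (type_two F HF) as (C2 & X2 & HX2 & HC2).
 (* With D = L^e the square root in [type_two] is at most L^(-A-5): the constant 5 * 8 * 16 is below
    L^10, the square means bring L^4, and e = 10 + 4 + 2 (A + 5). The exponent e1 pays for two
    summations of length U <= L^u and leaves L^(A+2). *)
 set (e := (2 * A + 24)%nat). set (u := (e * C2 + 1)%nat). set (e1 := (2 * u + A + 6)%nat).
 set (B := (e1 * C1 + e * C2)%nat). destruct (log_power_small (e1 * C1 + u + 2)) as (X3 & HX3 & HX3').
 exists B, (X1 + X2 + X3). split; [lra|]. intros X Y xi om HX HY Hxi Hmaj.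
 destruct (HX3' (INR X) ltac:(lra)) as [HL HLX]. set (L := ln (2 * X)) in *.
 assert (HP0 : forall a, 0 < L ^ a) by (intros; pos). assert (HP1 : forall a, 1 <= L ^ a) by (intros; pos).
 assert (HX0' : (1 <= X)%nat) by inr. assert (HT1 : (1 <= 2 * X)%nat) by lia.
 assert (ELT : ln (INR (2 * X)) = L) by (unfold L; f_equal; rewrite mult_INR; simpl; ring).
 assert (Hmaj1 : ~ Maj F (INR X) ((L ^ e1) ^ C1) xi). { intros Hc. apply (Maj_mono _ _ _ (L ^ B)) in Hc; [easy|lra|].
  rewrite <- pow_mult. mono. }
 assert (Hmaj2 : ~ Maj F (INR X) ((L ^ e) ^ C2) xi). { intros Hc. apply (Maj_mono _ _ _ (L ^ B)) in Hc; [easy|lra|].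
  rewrite <- pow_mult. mono. }
 destruct (nfloor (L ^ (e * C2))) as (U0 & HU1 & HU2); [pos|]. set (U := S U0).
 assert (HUR : INR U = U0 + 1) by (unfold U; apply S_INR). assert (HUhi : U <= L ^ u). { unfold u.
  rewrite pow_add, pow_1. specialize (HP1 (e * C2)%nat). nra. }
 assert (HU0 : (1 <= U)%nat) by lia. assert (HUX : (U <= X)%nat). { apply INR_le. upto HLX. mono. }
 set (Hf := fun n => inI X Y n * cs (xi * ppval F (INR n) + om)).
 assert (HH : forall n, ~ (X < n <= Y)%nat -> Hf n = 0). { intros n Hn. unfold Hf, inI. rewrite ind_F by easy. ring. }
 set (D1 := L ^ e1). assert (HD1 : 2 <= D1). { unfold D1. via (L ^ 1); [lra|]. mono. }
 assert (HlinY : forall d Y', (1 <= d)%nat -> d <= D1 -> (Y' <= 2 * X)%nat -> Rabs (dsum X (fun j => inI X Y' (d * j)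
  * cs (xi * ppval F (INR (d * j)) + om))) <= X / D1). { intros d Y' Hd HdD HY'. apply HC1; auto; try lra. unfold D1.
  rewrite <- pow_mult. upto HLX. mono. }
 assert (HUD1 : U * U <= D1). { via (L ^ u * L ^ u).
  - mono.
  - rewrite <- pow_add. apply pow_mono; [lra|lia]. }
 assert (HUR1 : 1 <= U) by inr. assert (HXD : 0 <= X / D1) by pos.
 assert (HS1 : Rabs (rsum (S U) (fun d => mu d * dsum X (fun k => ln k * Hf (d * k)%nat))) <= X / L ^ (A + 2)). {
  from rsum_abs. via (rsum (S U) (fun _ => 2 * L * (X / D1))).
  - termwise d Hd. rewrite Rabs_mult, <- Rmult_1_l. apply Rmult_le_compat; auto using Rabs_pos, mu_abs.
   destruct (Nat.eq_dec d 0) as [->|Hd0]. { rewrite rsum_zero; [rewrite Rabs_R0; apply Rmult_le_pos; lra|].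
    intros k _. rewrite HH by lia. ring. }
   have (abel (S (2 * X)) (fun k => ln k) (fun k => Hf (d * k)%nat) (X / D1)) as Hab.
   replace (S (2 * X) - 1)%nat with (2 * X)%nat in Hab by lia. rewrite ELT in Hab. apply Hab; [lia| | |].
   + intros; apply ln_INR_nonneg.
   + intros k Hk. destruct k; [rewrite ln_INR_0; apply ln_INR_nonneg|mono].
   + intros k Hk. destruct k as [|k]. { simpl. rewrite Rabs_R0. easy. }
    assert (Ek : rsum (S k) (fun j => Hf (d * j)%nat) = dsum X (fun j => inI X (Nat.min Y (d * k)) (d * j) * cs (xi *
     ppval F (INR (d * j)) + om))). { rewrite (rsum_trunc (S k) (S (2 * X))); [|lia|].
     - ext j Hj. unfold Hf, inI. f_equal. apply ind_iff. nia.
     - intros j Hj. unfold inI. rewrite ind_F; [ring|]. assert (d * k < d * j)%nat by nia. lia. }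
    rewrite Ek. apply HlinY; [lia| |lia]. via (INR U); [mono|]. nra.
  - rewrite rsum_const. via (2 * L ^ u * (2 * L * (X / D1))).
   + mul_r. rewrite S_INR. lra.
   + unfold D1, e1. replace (2 * u + A + 6)%nat with (u + (A + 2) + 3 + (u + 1))%nat by lia. rewrite !pow_add.
    replace (2 * L ^ u * (2 * L * (X / (L ^ u * (L ^ A * L ^ 2) * L ^ 3 * (L ^ u * L ^ 1))))) with (X / (L ^ A * L ^
     2) * (4 / (L ^ 3 * L ^ u))). 2:{ have (HP0 A). field. lra. }
    rewrite <- (Rmult_1_r (X / (L ^ A * L ^ 2))) at 2. apply Rmult_le_compat_l.
    * pos.
    * apply div_le; [pos|]. assert (8 <= L ^ 3) by (replace 8 with (2 ^ 3) by ring; apply pow_incr; lra). nra. }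
 assert (HS2 : Rabs (rsum (S U) (fun m => lam m * rsum (S U) (fun d => mu d * dsum X (fun j => Hf (m * d * j)%nat))))
  <= X / L ^ (A + 2)). { from rsum_abs. via (rsum (S U) (fun _ => L * (INR (S U) * (X / D1)))).
  - termwise m Hm. rewrite Rabs_mult, Rabs_right by pos. apply Rmult_le_compat; [pos|pos| |].
   + destruct m; [rewrite lam_0; lra|]. from lam_le_ln. rewrite <- ELT. mono.
   + from rsum_abs. rewrite <- rsum_const. termwise d Hd. rewrite Rabs_mult, <- Rmult_1_l.
    apply Rmult_le_compat; auto using Rabs_pos, mu_abs. destruct (Nat.eq_dec (m * d) 0) as [E|Hmd]. {
     rewrite E, rsum_zero; [rewrite Rabs_R0; easy|]. intros j _. apply HH. lia. }
    apply HlinY; [lia| |easy]. upto HUD1. rewrite mult_INR. mono.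
  - rewrite rsum_const. via ((2 * L ^ u) * (L * ((2 * L ^ u) * (X / D1)))).
   + assert (HSU : INR (S U) <= 2 * L ^ u) by (rewrite S_INR; specialize (HP1 u); lra). mono.
   + unfold D1, e1. replace (2 * u + A + 6)%nat with (u + u + (A + 2) + 1 + 3)%nat by lia. rewrite !pow_add.
    replace (2 * L ^ u * (L * (2 * L ^ u * (X / (L ^ u * L ^ u * (L ^ A * L ^ 2) * L ^ 1 * L ^ 3))))) with (X / (L ^ A
     * L ^ 2) * (4 / L ^ 3)). 2:{ have (HP0 A). field. lra. }
    rewrite <- (Rmult_1_r (X / (L ^ A * L ^ 2))) at 2. apply Rmult_le_compat_l.
    * pos.
    * apply div_le; [pos|]. nra. }
 set (Rn := Nat.sqrt (2 * X)). have (Nat.sqrt_spec (2 * X) ltac:(lia)) as [HRn1 HRn2].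
 assert (HRn0 : (1 <= Rn)%nat) by lia. assert (HRnT : (Rn <= 2 * X)%nat) by nia. assert (HRnR : Rn ^ 2 <= 4 * X). {
  lhs (INR (Rn * Rn)) by inr. via (INR (2 * X)); [mono|]. inr. }
 set (I := S (Nat.log2 Rn)). assert (HI : I <= 3 * L) by (apply log2_bound; auto).
 assert (HI2 : (Rn < 2 ^ I * S U)%nat). { have (Nat.log2_spec Rn ltac:(lia)) as [_ Hl]. fold I in Hl. lia. }
 assert (HN0 : (L ^ e) ^ C2 <= INR (S U)) by (rewrite <- pow_mult, S_INR; lra).
 assert (HD2 : 2 <= L ^ e) by (via (L ^ 1); [lra|unfold e; mono]). assert (HlnU : 1 + ln U <= 2 * L). {
  assert (ln U <= L) by (rewrite <- ELT; apply ln_INR_le; lia). lra. }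
 assert (HbU : forall n, rsum (S n) (fun k => ind (1 <= k)%nat * bU U k ^ 2) <= n * (8 * L ^ 3)). { intros n.
  etrans; [apply bU_square; easy|]. mul_l. rhs ((2 * L) ^ 3). mono. }
 assert (HdivR : forall N, (S U <= N)%nat -> INR (2 * X / N) <= 2 * (X / N)). { intros N HN. assert (0 < N) by pos.
  rhs (2 * X / N). apply le_div; [easy|]. rhs (INR (2 * X)) by inr. rewrite <- mult_INR. apply le_INR.
  rewrite Nat.mul_comm. apply Nat.mul_div_le; lia. }
 assert (Hfin : I * (X * sqrt (5 * (8 * L * (16 * L ^ 3)) / L ^ e)) <= X / L ^ (A + 2)). {
  assert (Hs : sqrt (5 * (8 * L * (16 * L ^ 3)) / L ^ e) <= / L ^ (A + 5)). { rewrite <- sqrt_pow2 by pos.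
   apply sqrt_le_1_alt. rewrite pow_inv, <- pow_mult. apply div_le; [pos|]. rewrite (Rmult_comm (/ _)).
   apply le_div_inv_r; [pos|]. via (2 ^ 10 * L ^ 4 * L ^ ((A + 5) * 2)).
   - mul_r. specialize (HP0 4%nat). lra.
   - via (L ^ 10 * L ^ 4 * L ^ ((A + 5) * 2)).
    + mono.
    + rewrite <- !pow_add. mono. }
  via (3 * L * (X * / L ^ (A + 5))).
  - mono.
  - replace (A + 5)%nat with (A + 2 + 1 + 2)%nat by lia. rewrite pow_add, pow_add.
   lhs (X / L ^ (A + 2) * (3 / L ^ 2)) by (have (HP0 (A + 2)%nat); field; lra).
   rewrite <- (Rmult_1_r (X / L ^ (A + 2))) at 2. apply Rmult_le_compat_l.
   + pos.
   + apply div_le; [pos|]. nra. }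
 set (bl := fun n => ind (n <= 2 * X)%nat * lam n).
 assert (HA : Rabs (rsum (S Rn) (fun n => ind (S U <= n)%nat * bU U n * dsum X (fun m => (ind (U < m)%nat * bl m) *
  (inI X Y (m * n) * cs (xi * ppval F (m * n) + om))))) <= X / L ^ (A + 2)). { upto Hfin. apply HC2; auto; try lra.
  - pos.
  - intros N HN. via (ln (INR (2 * X)) * (4 * INR (2 * X / N))).
   + etrans; [|apply lam_square_sum; easy]. rewrite Nat.add_1_r. unfold bl. mono.
   + specialize (HdivR N HN). nra.
  - intros N HN. via (rsum (S (2 * N)) (fun k => ind (1 <= k)%nat * bU U k ^ 2)).
   + replace (S (2 * N)) with (N + N + 1)%nat by lia. rewrite !rsum_split.
    assert (0 <= rsum N (fun k => ind (1 <= k)%nat * bU U k ^ 2)) by pos.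
    assert (0 <= rsum 1 (fun i => ind (1 <= N + N + i)%nat * bU U (N + N + i) ^ 2)) by pos.
    assert (rsum N (fun u0 => bU U (N + u0) ^ 2) = rsum N (fun i => ind (1 <= N + i)%nat * bU U (N + i) ^ 2)) by (ext
     i _; rewrite ind_T by lia; ring). lra.
   + from HbU. inr. }
 assert (HB : Rabs (rsum (S Rn) (fun m => ind (S U <= m)%nat * bl m * dsum X (fun n => (ind (U < n)%nat * ind (Rn <
  n)%nat * bU U n) * (inI X Y (n * m) * cs (xi * ppval F (n * m) + om))))) <= X / L ^ (A + 2)). { upto Hfin.
  rewrite (Rmult_comm (8 * L) (16 * L ^ 3)). apply HC2; auto; try lra.
  - pos.
  - intros N HN. via (INR (2 * X / N) * (8 * L ^ 3)).
   + upto HbU. rewrite Nat.add_1_r. termwise n _. have (ind_01 (U < n)%nat). have (ind_01 (Rn < n)%nat).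
    destruct n as [|n].
    * rewrite ind_F, (ind_F (1 <= 0)%nat) by lia. lra.
    * rewrite (ind_T (1 <= S n)%nat) by lia. assert (ind (U < S n)%nat ^ 2 * ind (Rn < S n)%nat ^ 2 <= 1). {
      assert (0 <= ind (U < S n)%nat ^ 2 <= 1) by nra. nra. }
     nra.
   + specialize (HdivR N HN). specialize (HP0 3%nat). nra.
  - intros N HN. via (ln (INR (2 * X)) * (4 * INR (2 * N))).
   + etrans; [|apply lam_square_sum; easy]. unfold bl. replace (S (2 * N)) with (N + N + 1)%nat by lia.
    rewrite !rsum_split. assert (0 <= rsum N (fun k => (ind (k <= 2 * X)%nat * lam k) ^ 2)) by pos.
    assert (0 <= rsum 1 (fun i => (ind (N + N + i <= 2 * X)%nat * lam (N + N + i)) ^ 2)) by pos. lra.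
   + rewrite ELT, mult_INR. inr. }
 change (Rabs (dsum X (fun n => lam n * Hf n)) <= X / L ^ A). rewrite (vaughan X Y U U (2 * X) Hf HU0 HUX HY HH).
 (* If n exceeds sqrt (2 X), then m does not, so one of the two variables can always serve as the
    dyadic one. *)
 assert (E3 : dsum X (fun m => dsum X (fun n => ind (U < m)%nat * lam m * (ind (U < n)%nat * bU U n) * Hf (m *
  n)%nat)) = rsum (S Rn) (fun n => ind (S U <= n)%nat * bU U n * dsum X (fun m => (ind (U < m)%nat * bl m) * (inI X Y
  (m * n) * cs (xi * ppval F (m * n) + om)))) + rsum (S Rn) (fun m => ind (S U <= m)%nat * bl m * dsum X (fun n =>
  (ind (U < n)%nat * ind (Rn < n)%nat * bU U n) * (inI X Y (n * m) * cs (xi * ppval F (n * m) + om))))). {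
  set (t := fun m n => ind (U < m)%nat * lam m * (ind (U < n)%nat * bU U n) * Hf (m * n)%nat).
  rewrite (rsum_ext (S (2 * X)) _ (fun m => dsum X (fun n => ind (n <= Rn)%nat * t m n) + rsum (S (2 * X)) (fun n =>
   ind (Rn < n)%nat * t m n))). 2:{ intros m _. rewrite <- rsum_plus. ext n _. fold (t m n).
   destruct (Nat.le_gt_cases n Rn); [rewrite ind_T, ind_F by lia; ring|rewrite ind_F, ind_T by lia; ring]. }
  rewrite rsum_plus. f_equal.
  - rewrite rsum_swap. rewrite (rsum_trunc (S Rn) (S (2 * X))); [|lia|].
   + ext n Hn. rewrite <- rsum_scal. ext m Hm. rewrite ind_T by lia. unfold t, bl, Hf.
    rewrite (ind_T (m <= 2 * X)%nat), mult_INR by lia. change (U < n)%nat with (S U <= n)%nat. ring.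
   + intros n Hn. apply rsum_zero. intros m _. rewrite ind_F by lia. ring.
  - rewrite (rsum_trunc (S Rn) (S (2 * X))); [|lia|].
   + ext m Hm. rewrite <- rsum_scal. ext n Hn. unfold t, bl, Hf.
    rewrite (ind_T (m <= 2 * X)%nat), (Nat.mul_comm n m), (Rmult_comm (INR n)), mult_INR by lia.
    change (U < m)%nat with (S U <= m)%nat. ring.
   + intros m Hm. apply rsum_zero. intros n _.
    destruct (Nat.lt_ge_cases Rn n) as [Hc|Hc]; [|rewrite ind_F by lia; ring]. unfold t. rewrite HH; [ring|].
    assert (2 * X < m * n)%nat; [|lia]. apply Nat.lt_le_trans with (S Rn * S Rn)%nat; [easy|].
    apply Nat.mul_le_mono; lia. }
 rewrite E3. from Rabs_triang. rewrite Rabs_Ropp.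
 etrans; [apply Rplus_le_compat; [apply Rabs_sub_le|apply Rabs_triang]|].
 assert (E4 : X / L ^ A = 4 * (X / (4 * L ^ A))) by (field; specialize (HP0 A); lra).
 assert (E5 : X / L ^ (A + 2) <= X / (4 * L ^ A)). { mul_l. apply Rinv_le_contravar; [pos|]. rewrite pow_add.
  specialize (HP0 A). assert (4 <= L ^ 2) by nra. nra. }
 lra.
Qed.

(** * Selberg's weights *)

(** Dirichlet convolution, correct for 1 <= n <= N. Both variables run over a fixed range, so
    commutativity and associativity are interchanges of finite sums. *)
Definition conv (N : nat) (f g : nat -> R) (n : nat) : R :=
  rsum (S N) (fun d => rsum (S N) (fun e => ind ((d * e)%nat = n) * (f d * g e))).

Lemma conv_comm N f g n : conv N f g n = conv N g f n.
Proof. unfold conv. rewrite rsum_swap. ext e _. ext d _. rewrite Nat.mul_comm, (Rmult_comm (f d)). lra. Qed.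

Lemma conv_ext N f f' g g' n : (1 <= n)%nat -> (forall k, (1 <= k <= N)%nat -> f k = f' k) ->
  (forall k, (1 <= k <= N)%nat -> g k = g' k) -> conv N f g n = conv N f' g' n.
Proof.
 intros Hn Hf Hg. ext d Hd. ext e He. destruct (Nat.eq_dec (d * e) n) as [E|E]; [|rewrite !ind_F by exact E; ring].
 rewrite Hf, Hg by lia. lra.
Qed.

Lemma conv_plus N f g h n : conv N f (fun k => g k + h k) n = conv N f g n + conv N f h n.
Proof. unfold conv. rewrite <- rsum_plus. ext d _. rewrite <- rsum_plus. mono. Qed.

Lemma conv_scal N f g c n : conv N f (fun k => c * g k) n = c * conv N f g n.
Proof. unfold conv. rewrite <- rsum_scal. ext d _. rewrite <- rsum_scal. mono. Qed.

Lemma conv_assoc_aux N f g h n : (1 <= n <= N)%nat ->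
  conv N f (conv N g h) n
  = rsum (S N) (fun d => rsum (S N) (fun a => rsum (S N) (fun b => ind ((d * a * b)%nat = n) * (f d * g a * h b)))).
Proof.
 intros Hn. ext d Hd. unfold conv.
 rewrite (rsum_ext _ _ (fun e => rsum (S N) (fun a => rsum (S N) (fun b => ind (e = (a * b)%nat) * (ind ((d * e)%nat =
  n) * (f d * g a * h b)))))). 2:{ intros e _. rewrite <- !rsum_scal. ext a _. rewrite <- !rsum_scal. ext b _.
  rewrite (ind_iff ((a * b)%nat = e) (e = (a * b)%nat)) by lia. ring. }
 rewrite rsum_swap. ext a Ha. rewrite rsum_swap. ext b Hb. destruct (Nat.le_gt_cases (a * b) N) as [Hc|Hc].
 - rewrite rsum_pick by lia. now rewrite Nat.mul_assoc.
 - rewrite rsum_zero.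
  + rewrite ind_F; [ring|]. destruct d; [pos|]. nia.
  + intros e He. rewrite ind_F by lia. ring.
Qed.

Lemma conv_assoc N f g h n : (1 <= n <= N)%nat -> conv N f (conv N g h) n = conv N (conv N f g) h n.
Proof.
 intros Hn.
 rewrite (conv_comm N (conv N f g) h), !conv_assoc_aux, (rsum_swap (S N) (S N) (fun d a => rsum (S N) (fun b => ind
  ((d * a * b)%nat = n) * (h d * f a * g b)))) by easy. ext d _. rewrite rsum_swap. ext a _. ext b _.
 rewrite (ind_iff ((d * b * a)%nat = n) ((a * d * b)%nat = n)) by lia. ring.
Qed.

Lemma conv_one N f n : (1 <= n <= N)%nat ->
  conv N f (fun _ => 1) n = rsum (S n) (fun d => ind (Nat.divide d n) * f d).
Proof.
 intros Hn. rewrite <- (rsum_trunc (S n) (S N)); [|lia|].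
 - ext d Hd. rewrite (rsum_ext _ _ (fun e => f d * ind ((d * e)%nat = n))), rsum_scal, Rmult_comm by (intros; ring).
  f_equal. destruct (ind_cases (Nat.divide d n)) as [[[c Hc] ->]|[Hc ->]].
  + assert (1 <= d)%nat by lia. rewrite (rsum_ext _ _ (fun e => ind (e = c) * 1)).
   * apply rsum_pick. nia.
   * intros e _. rewrite Rmult_1_r. apply ind_iff. nia.
  + apply rsum_zero. intros e _. apply ind_F. intros E. apply Hc. exists e. lia.
 - intros d Hd. rewrite ind_F; [ring|]. intros Hc. apply Nat.divide_pos_le in Hc; lia.
Qed.

Lemma conv_unit N f n : (1 <= n <= N)%nat -> conv N (fun k => ind (k = 1%nat)) f n = f n.
Proof.
 intros Hn. unfold conv.
 rewrite (rsum_ext _ _ (fun d => ind (d = 1%nat) * rsum (S N) (fun e => ind ((d * e)%nat = n) * f e))).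
 - rewrite rsum_pick by lia. rewrite (rsum_ext _ _ (fun e => ind (e = n) * f e)).
  + apply rsum_pick. lia.
  + intros e _. f_equal. apply ind_iff. lia.
 - intros d _. rewrite <- rsum_scal. mono.
Qed.

Lemma mobius_inversion N f g n : (1 <= n <= N)%nat ->
  (forall k, (1 <= k <= N)%nat -> conv N (fun _ => 1) f k = g k) -> conv N mu g n = f n.
Proof.
 intros Hn H. rewrite (conv_ext N mu mu g (conv N (fun _ => 1) f)); [|lia|easy|intros; now rewrite H].
 rewrite conv_assoc by easy. rewrite (conv_ext N _ (fun k => ind (k = 1%nat)) f f); [now apply conv_unit|lia| |easy].
 intros k Hk. rewrite conv_one by easy. apply mu_divisor_sum. lia.
Qed.

Lemma conv_one_lam N n : (1 <= n <= N)%nat -> conv N (fun _ => 1) lam n = ln n.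
Proof. intros Hn. rewrite conv_comm, conv_one by easy. apply lam_divisor_sum. lia. Qed.

(** Selberg's identity 1 * (Lambda ln + Lambda * Lambda) = ln^2: after 1 * Lambda = ln is inserted,
    ln d + ln e = ln n comes out as a factor. *)
Lemma conv_one_lam2 N n : (1 <= n <= N)%nat ->
  conv N (fun _ => 1) (fun k => lam k * ln k + conv N lam lam k) n = ln n ^ 2.
Proof.
 intros Hn. rewrite conv_plus, conv_assoc by easy.
 rewrite (conv_ext N (conv N (fun _ => 1) lam) (fun k => ln k) lam lam n) by (auto using conv_one_lam; lia).
 transitivity (ln n * conv N (fun _ => 1) lam n); [|rewrite conv_one_lam by easy; ring]. unfold conv.
 rewrite <- rsum_plus, <- rsum_scal. ext d Hd. rewrite <- rsum_plus, <- rsum_scal. ext e He.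
 destruct (Nat.eq_dec (d * e) n) as [<-|E]; [|rewrite ind_F by easy; ring]. rewrite mult_INR, ln_mult by pos. ring.
Qed.

(** Selberg's weight, given by its divisor sum, because that form shows its distribution in
    progressions; its relation to the primes is [sel_identity]. *)
Definition sel (Z : R) (n : nat) : R := rsum (S n) (fun d => ind (Nat.divide d n) * (mu d * ln (Z / d) ^ 2)).

(** For n = d e one has ln (Z / d) = c + ln e with c = ln (Z / n). Moebius inversion sends the terms
    c^2, 2 c ln e, ln^2 e of the square to 0, 2 c lam, and lam ln + lam * lam; the first needs n >=
    2. *)
Lemma sel_identity Z N n : 0 < Z -> (2 <= n <= N)%nat ->
  sel Z n = lam n * (2 * ln Z - ln n) + conv N lam lam n.
Proof.
 intros HZ Hn. set (c := ln Z - ln n). transitivity (conv N mu (fun e => c ^ 2 * 1 + ((2 * c) * ln e + ln e ^ 2)) n).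
 - unfold sel. rewrite <- (conv_one N) by lia. ext d Hd. ext e He.
  destruct (Nat.eq_dec (d * e) n) as [E|E]; [|rewrite ind_F by easy; ring]. assert (0 < d) by pos.
  assert (0 < e) by pos. unfold c. rewrite <- E, mult_INR, ln_mult by easy. unfold Rdiv.
  rewrite ln_mult, ln_Rinv by pos. ring.
 -
  rewrite !conv_plus, !conv_scal, (mobius_inversion N lam (fun e => ln e)), (mobius_inversion N _ (fun e => ln e ^ 2)
   n ltac:(lia) (conv_one_lam2 N)) by (auto using conv_one_lam; lia). rewrite conv_one, mu_divisor_sum, ind_F by lia.
  unfold c. ring.
Qed.

Lemma conv_lam_nonneg N n : 0 <= conv N lam lam n.
Proof. apply rsum_nonneg. intros d _. pos. Qed.

(** Up to Z the weight is thus nonnegative and a majorant of lam, which is the source of all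
    Brun-Titchmarsh bounds below. *)
Lemma sel_lower Z n : 1 <= Z -> (1 <= n)%nat -> n <= Z -> lam n * ln Z <= sel Z n.
Proof.
 intros HZ Hn Hz. destruct (Nat.eq_dec n 1) as [->|].
 - replace (lam 1) with 0. 2:{ apply Rle_antisym; [pos|]. from lam_le_ln. simpl. rewrite ln_1. lra. }
  unfold sel. rewrite !rsum_S. change (rsum 0 _) with 0. rewrite (ind_T (Nat.divide 1 1)) by apply Nat.divide_refl.
  rewrite ind_F, mu_1 by (intros H; apply Nat.divide_0_l in H; lia). nra.
 - rewrite (sel_identity Z n n) by pos. have (conv_lam_nonneg n n). have (lam_nonneg n). assert (ln n <= ln Z). {
   mono. }
  nra.
Qed.

Lemma conv_sum T f g G : (forall n, (T < n)%nat -> G n = 0) ->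
  rsum (S T) (fun n => conv T f g n * G n) = rsum (S T) (fun d => rsum (S T) (fun e => f d * g e * G (d * e)%nat)).
Proof.
 intros H. unfold conv.
 rewrite (rsum_ext _ _ (fun n => rsum (S T) (fun d => rsum (S T) (fun e => ind (n = (d * e)%nat) * (f d * g e * G
  n))))). 2:{ intros n _. rewrite <- rsum_scalr. ext d _. rewrite <- rsum_scalr. ext e _.
  rewrite (ind_iff ((d * e)%nat = n) (n = (d * e)%nat)) by lia. ring. }
 rewrite rsum_swap. ext d _. rewrite rsum_swap. ext e _. destruct (Nat.le_gt_cases (d * e) T) as [Hc|Hc].
 - apply rsum_pick. lia.
 - rewrite H, Rmult_0_r by easy. apply rsum_zero. intros n Hn. rewrite ind_F by lia. ring.
Qed.

(** The summand [ln Z ^ 2] is the value at n = 1, where [sel_identity] does not apply. Chebyshev's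
    and Mertens' bounds give the rest. *)
Lemma sel_sum Z x : 1 <= Z -> (1 <= x)%nat -> x <= Z ->
  rsum (S x) (fun n => ind (1 <= n)%nat * sel Z n) <= ln Z ^ 2 + 16 * x * (ln Z + 1).
Proof.
 intros HZ Hx HxZ.
 via (rsum (S x) (fun n => ind (n = 1%nat) * ln Z ^ 2 + (lam n * (2 * ln Z) + conv x lam lam n * ind (n <= x)%nat))).
 - termwise n Hn. rewrite (ind_T (n <= x)%nat) by lia. destruct n as [|[|n]].
  + rewrite ind_F, ind_F, lam_0 by lia. have (conv_lam_nonneg x 0). lra.
  + rewrite ind_T, ind_T by lia. have (conv_lam_nonneg x 1). have (lam_nonneg 1). assert (0 <= ln Z) by pos.
   unfold sel. rewrite !rsum_S. change (rsum 0 _) with 0. rewrite (ind_T (Nat.divide 1 1)) by apply Nat.divide_refl.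
   rewrite ind_F, mu_1 by (intros H'; apply Nat.divide_0_l in H'; lia). replace (Z / INR 1) with Z by inr. nra.
  + rewrite ind_T, ind_F by lia. rewrite (sel_identity Z x) by pos. have (lam_nonneg (S (S n))).
   have (ln_INR_nonneg (S (S n))). nra.
 - rewrite !rsum_plus, rsum_pick, rsum_scalr by lia. fold (psi x). have (psi_upper x) as Hp.
  rewrite conv_sum by (intros n Hn; apply ind_F; lia). assert (HlZ : 0 <= ln Z) by pos. assert (Hlx : ln x <= ln Z).
  { mono. }
  assert (H2 : rsum (S x) (fun d => rsum (S x) (fun e => lam d * lam e * ind (d * e <= x)%nat)) <= 4 * x * (ln x +
   4)). { via (4 * x * rsum (S x) (fun d => lam d / d)). 2:{ mul_l. now apply mertens_upper. }
   rewrite <- rsum_scal. termwise d Hd. destruct d as [|d]; [rewrite rsum_zero; [|intros; rewrite lam_0; ring]|].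
   - rewrite lam_0. lra.
   - via (lam (S d) * psi (x / S d)).
    + unfold psi. rewrite <- rsum_scal. assert (x / S d <= x)%nat by (apply Nat.Div0.div_le_upper_bound; nia).
     rewrite (rsum_trunc (S (x / S d)) (S x)); [|lia|].
     * mono.
     * intros e He. rewrite ind_F; [ring|]. rewrite Nat.mul_comm, le_div_iff by lia. lia.
    + have (psi_upper (x / S d)) as Hq. have (lam_nonneg (S d)). assert (INR (x / S d) <= x / INR (S d)). {
      apply le_div; [pos|]. rewrite <- mult_INR. apply le_INR. rewrite Nat.mul_comm. apply Nat.Div0.mul_div_le. }
     nra. }
  have (pos_INR x). nra.
Qed.

(** * Residue classes *)

Lemma ap_solution m r d : (1 <= r)%nat -> (1 <= d)%nat -> coprime d r ->
  exists h, (h < d)%nat /\ Nat.divide d (m + r * h).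
Proof.
 intros Hr Hd Hg. destruct (Nat.gcd_bezout_pos r d ltac:(lia)) as (a & b & E). rewrite Nat.gcd_comm, Hg in E.
 set (h0 := (a * (m * (d - 1)))%nat). exists (h0 mod d)%nat. split; [apply Nat.mod_upper_bound; lia|].
 assert (H1 : Nat.divide d (m + r * h0)). { exists (m + b * (m * (d - 1)))%nat. nia. }
 have (Nat.div_mod_eq h0 d) as E2. rewrite E2 in H1.
 replace (m + r * (d * (h0 / d) + h0 mod d))%nat with (r * (h0 / d) * d + (m + r * (h0 mod d)))%nat in H1 by ring.
 apply Nat.divide_add_cancel_r in H1; [easy|]. apply Nat.divide_factor_r.
Qed.

Lemma ap_unique m r d i j : coprime d r -> (i <= j)%nat -> (j < i + d)%nat ->
  Nat.divide d (m + r * i) -> Nat.divide d (m + r * j) -> i = j.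
Proof.
 intros Hg Hij Hj Hi' Hj'. assert (H : Nat.divide d (r * (j - i))). {
  apply (Nat.divide_add_cancel_r _ (m + r * i)); [easy|].
  replace (m + r * i + r * (j - i))%nat with (m + r * j)%nat; [easy|]. nia. }
 apply Nat.gauss in H; [|easy]. destruct (Nat.eq_dec (j - i) 0) as [|Hn]; [lia|]. apply Nat.divide_pos_le in H; lia.
Qed.

Lemma ap_block m r d : (1 <= r)%nat -> (1 <= d)%nat -> coprime d r ->
  rsum d (fun h => ind (Nat.divide d (m + r * h))) = 1.
Proof.
 intros Hr Hd Hg. destruct (ap_solution m r d Hr Hd Hg) as (h1 & H1 & H2).
 rewrite (rsum_ext _ _ (fun h => ind (h = h1) * 1)).
 - now apply rsum_pick.
 - intros h Hh. rewrite Rmult_1_r. apply ind_iff. split; [|intros ->; easy]. intros H3.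
  destruct (Nat.le_gt_cases h h1) as [Hc|Hc].
  + apply (ap_unique m r d); auto; lia.
  + symmetry. apply (ap_unique m r d); auto; lia.
Qed.

Lemma ap_count m r d H : (1 <= r)%nat -> (1 <= d)%nat -> coprime d r ->
  Rabs (rsum H (fun h => ind (Nat.divide d (m + r * h))) - H / d) <= 1.
Proof.
 intros Hr Hd Hg. assert (Hd0 : 0 < d) by pos. euclid H d as E Hm. set (K := (H / d)%nat) in *.
 set (s := (H mod d)%nat) in *.
 assert (E1 : rsum H (fun h => ind (Nat.divide d (m + r * h))) = K + rsum s (fun h => ind (Nat.divide d (m + r * (K *
  d + h))))). { rewrite E, Nat.mul_comm, rsum_split, rsum_blocks.
  rewrite (rsum_ext _ _ (fun _ => 1)); [rewrite rsum_const; ring|]. intros b _.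
  rewrite <- (ap_block (m + r * (b * d)) r d Hr Hd Hg). ext j _. do 2 f_equal. ring. }
 assert (E2 : 0 <= rsum s (fun h => ind (Nat.divide d (m + r * (K * d + h)))) <= 1). { split; [pos|].
  rewrite <- (ap_block (m + r * (K * d)) r d Hr Hd Hg), (rsum_ext s _ (fun h => ind (Nat.divide d (m + r * (K * d) + r
   * h)))).
  - apply rsum_mono_n; [lia|intros; apply ind_01].
  - intros j _. do 2 f_equal. ring. }
 assert (E3 : H / d = K + s / d). { rewrite E, plus_INR, mult_INR. field. lra. }
 assert (E4 : 0 <= s / d <= 1). { split; [pos|]. apply div_le; [easy|]. rewrite Rmult_1_l. mono. }
 apply Rabs_le. lra.
Qed.

Lemma gcd_ne_1_prime a b : (1 <= b)%nat -> Nat.gcd a b <> 1%nat -> exists p, nprime p /\ Nat.divide p a /\ Nat.divide p b.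
Proof.
 intros Hb Hg. assert (Nat.gcd a b <> 0)%nat by (intros Hc; apply Nat.gcd_eq_0 in Hc; lia).
 destruct (exists_prime_divisor (Nat.gcd a b)) as (p & Hp & Hd); [lia|]. exists p. split; [easy|].
 split; (eapply Nat.divide_trans; [apply Hd|]); [apply Nat.gcd_divide_l|apply Nat.gcd_divide_r].
Qed.

Lemma ap_none m r d h : (1 <= r)%nat -> coprime m r -> Nat.gcd d r <> 1%nat -> ~ Nat.divide d (m + r * h).
Proof.
 intros Hr Hm Hd Hc. destruct (gcd_ne_1_prime d r Hr Hd) as (p & Hp & Hpd & Hpr). assert (Hpm : Nat.divide p m). {
  apply (Nat.divide_add_cancel_r _ (r * h)); [now apply Nat.divide_mul_l|]. rewrite Nat.add_comm.
  now apply (Nat.divide_trans _ d). }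
 have (Nat.gcd_greatest m r p Hpm Hpr) as Hg. rewrite Hm in Hg. apply Nat.divide_1_r in Hg. destruct Hp; lia.
Qed.

Definition sieved (z r n : nat) : Prop := forall p, nprime p -> (p <= z)%nat -> Nat.divide p r -> ~ Nat.divide p n.

(* The i-th prime divisor of r is at least i + 1, so that the product of the factors 1 - 1/p telescopes. *)
Lemma sieved_density r z : (1 <= r)%nat -> (1 <= z)%nat -> exists k P c : nat,
  (1 <= P)%nat /\ Nat.divide P r /\ (forall q, nprime q -> Nat.divide q P -> (q <= z)%nat) /\ (k < z)%nat /\ (2 ^ k <= P)%nat /\
  (forall a, rsum P (fun i => ind (sieved z r (a + i))) = INR c) /\ (P <= c * S k)%nat.
Proof.
 intros Hr Hz. induction z as [|z IH]; [lia|]. clear Hz. destruct (Nat.eq_dec z 0) as [->|Hz]. {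
  exists 0%nat, 1%nat, 1%nat. split; [lia|]. split; [apply Nat.divide_1_l|].
  split; [|split; [lia|split; [easy|split; [|lia]]]].
  - intros q [Hq _] Hd. apply Nat.divide_pos_le in Hd; lia.
  - intros a. rewrite rsum_S. rewrite ind_T; [simpl; ring|]. intros p [Hp _] Hp'. lia. }
 destruct IH as (k & P & c & HP & HPr & Hq & Hk & H2 & Hc & HPc); [lia|].
 destruct (classic (nprime (S z) /\ Nat.divide (S z) r)) as [[Hp Hpr]|Hn]. 2:{ exists k, P, c. do 2 (split; [easy|]).
  split; [pos|]. do 2 (split; [lia|]). split; [|easy]. intros a. rewrite <- (Hc a). ext i _. apply ind_iff.
  split; intros H p H3 H4 H5; [pos|]. destruct (Nat.eq_dec p (S z)) as [->|]; [pos|apply H; auto; lia]. }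
 set (p := S z) in *. assert (HpP : ~ Nat.divide p P) by (intros Hd; specialize (Hq p Hp Hd); lia).
 exists (S k), (P * p)%nat, ((p - 1) * c)%nat. split; [nia|].
 split; [|split; [|split; [lia|split; [|split; [|nia]]]]].
 - destruct HPr as [s Hs]. rewrite Hs in Hpr. apply nprime_dvd_mul in Hpr; [|easy].
  destruct Hpr as [[t Ht]|]; [|easy]. exists t. lia.
 - intros q H3 H4. apply nprime_dvd_mul in H4; [|easy]. destruct H4 as [H4|H4]; [specialize (Hq q H3 H4); lia|].
  destruct Hp as [_ Hp]. destruct (Hp q H4); lia.
 - rewrite Nat.pow_succ_r'. nia.
 - intros a. assert (E1 : rsum (P * p) (fun i => ind (sieved z r (a + i))) = p * c). {
   rewrite Nat.mul_comm, rsum_blocks. rewrite (rsum_ext _ _ (fun _ => INR c)); [apply rsum_const|]. intros b _.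
   rewrite <- (Hc (a + b * P)%nat). ext i _. do 2 f_equal. lia. }
  assert (Hpos : (p <> 0)%nat) by lia. set (a' := ((a + (p - 1)) / p)%nat). assert (Ha' : (a <= p * a' < a + p)%nat).
  { have (Nat.div_mod_eq (a + (p - 1)) p). have (Nat.mod_upper_bound (a + (p - 1)) p Hpos). lia. }
  assert (E2 : rsum (P * p) (fun i => ind (Nat.divide p (a + i)) * ind (sieved z r (a + i))) = INR c). {
   rewrite rsum_blocks, <- (Hc a'). ext b _.
   rewrite (rsum_ext _ _ (fun j => ind (j = p * a' - a)%nat * ind (sieved z r (p * (a' + b))))).
   - rewrite rsum_pick by lia. apply ind_iff. split; intros H q H3 H4 H5 H6; apply (H q); auto.
    + now apply Nat.divide_mul_r.
    + apply nprime_dvd_mul in H6; [|easy]. destruct H6 as [H6|]; [|easy]. destruct Hp as [_ Hp].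
     destruct (Hp q H6); [destruct H3; lia|lia].
   - intros j Hj. destruct (Nat.eq_dec j (p * a' - a)) as [->|Hne].
    + replace (a + (b * p + (p * a' - a)))%nat with (p * (a' + b))%nat by lia.
     rewrite ind_T by apply Nat.divide_factor_l. rewrite (ind_T (p * a' - a = p * a' - a)%nat) by easy. lra.
    + rewrite (ind_F (j = _)) by easy. rewrite ind_F; [ring|]. intros [t Ht]. assert (t = a' + b)%nat by nia. lia. }
  rewrite (rsum_ext _ _ (fun i => ind (sieved z r (a + i)) - ind (Nat.divide p (a + i)) * ind (sieved z r (a + i)))).
  + rewrite rsum_minus, E1, E2, mult_INR, minus_INR by lia. inr.
  + intros i _. ind_case (Nat.divide p (a + i)) as H.
   * rewrite ind_F; [ring|]. intros Hs. apply (Hs p); auto; lia.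
   * rewrite Rmult_0_l, Rminus_0_r. apply ind_iff. split; intros Hs q H3 H4 H5; [apply Hs; auto; lia|].
    destruct (Nat.eq_dec q p) as [->|]; [easy|apply Hs; auto; lia].
Qed.

(** An elementary lower bound for phi(r) / r: at most log2 r primes divide r, and the telescoping
    product of [sieved_density] over k primes is at least 1 / (k + 1). *)
Lemma coprime_density r a : (1 <= r)%nat ->
  r <= rsum r (fun i => ind (coprime (a + i) r)) * INR (S (Nat.log2 r)).
Proof.
 intros Hr. destruct (sieved_density r r Hr Hr) as (k & P & c & HP & [s Hs] & _ & _ & H2 & Hc & HPc).
 assert (Hk : (k <= Nat.log2 r)%nat). { rewrite <- (Nat.log2_pow2 k) by lia. apply Nat.log2_le_mono. destruct s; nia. }
 assert (E : rsum r (fun i => ind (coprime (a + i) r)) = s * c). { rewrite Hs at 1.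
  rewrite rsum_blocks, <- rsum_const. ext b _. rewrite <- (Hc (a + b * P)%nat). ext i _. rewrite Nat.add_assoc.
  apply ind_iff. split.
  - intros H p Hp _ Hpr Hpn. have (Nat.gcd_greatest _ _ p Hpn Hpr) as Hg. rewrite H in Hg. apply Nat.divide_1_r in Hg.
   destruct Hp; lia.
  - intros H. destruct (Nat.eq_dec (Nat.gcd (a + b * P + i) r) 1) as [|Hg]; [easy|].
   destruct (gcd_ne_1_prime _ _ Hr Hg) as (p & Hp & Hpn & Hpr). exfalso. apply (H p); auto.
   apply Nat.divide_pos_le; [lia|easy]. }
 rewrite E, <- !mult_INR. apply le_INR. nia.
Qed.

(** The mean value of [sel] in a reduced class modulo r, with divisors cut at D. It does not depend
    on the class, and it is never evaluated: [sel_windows] bounds it indirectly. *)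
Definition kap (Z : R) (r D : nat) : R :=
  rsum (S D) (fun d => ind ((1 <= d)%nat /\ coprime d r) * (mu d * ln (Z / d) ^ 2 / d)).

Lemma rsum_pad n T f : (n <= T)%nat -> rsum n f = rsum T (fun i => ind (i < n)%nat * f i).
Proof.
 intros H. rewrite (rsum_trunc n T); [|easy|intros i Hi; rewrite ind_F by lia; ring]. ext i Hi. rewrite ind_T by easy.
 ring.
Qed.

Lemma count_cofactors n D V : (1 <= n)%nat -> (n <= V * D)%nat ->
  rsum (S n) (fun d => ind ((D < d)%nat /\ Nat.divide d n)) <= rsum V (fun e => ind (Nat.divide (S e) n)).
Proof.
 intros Hn HV. via (rsum (S n) (fun d => rsum V (fun e => ind (Nat.divide (S e) n) * ind (d = n / S e)%nat))).
 - termwise d Hd. destruct (ind_cases ((D < d)%nat /\ Nat.divide d n)) as [[[H1 [c Hc]] ->]|[_ ->]]. 2:{ pos. }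
  assert (c - 1 < V)%nat by nia. via (ind (Nat.divide (S (c - 1)) n) * ind (d = n / S (c - 1))%nat).
  + replace (S (c - 1)) with c by lia. rewrite ind_T by (exists d; lia). rewrite ind_T; [lra|].
   rewrite Hc, Nat.mul_comm. symmetry. apply Nat.div_mul. lia.
  + apply (rsum_term_le V (c - 1) (fun e => ind (Nat.divide (S e) n) * ind (d = n / S e)%nat)); [easy|]. intros. pos.
 - rewrite rsum_swap. termwise e He. rewrite rsum_scal.
  have (rsum_pick_le (S n) (n / S e) (fun _ => 1) ltac:(intros; lra)) as Hp. cbv beta in Hp.
  rewrite rsum_scalr, Rmult_1_r in Hp. mono.
Qed.

Lemma sel_window Z m r H D V : (1 <= r)%nat -> (1 <= m)%nat -> coprime m r -> INR (m + r * H) <= Z ->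
  (1 <= D)%nat -> (1 <= V)%nat -> D <= Z -> Z <= V * D ->
  Rabs (rsum H (fun h => sel Z (m + r * h)) - kap Z r D * H)
  <= INR (S D) * ln Z ^ 2 + ln V ^ 2 * (H * (1 + ln V) + V).
Proof.
 intros Hr Hm Hg HZ HD HV HDZ HVD. set (T := (m + r * H + D)%nat).
 assert (EZ : forall h, (h < H)%nat -> (1 <= m + r * h)%nat /\ INR (m + r * h) <= Z /\ (m + r * h <= V * D)%nat /\ (m
  + r * h <= T)%nat). { intros h Hh. assert (r * h <= r * H)%nat by nia.
  assert (HhZ : INR (m + r * h) <= Z) by (upto HZ; apply le_INR; lia). split; [lia|]. split; [easy|]. split; [|pos].
  apply INR_le. rewrite mult_INR. lra. }
 assert (E : forall h, (h < H)%nat -> sel Z (m + r * h) = rsum (S D) (fun d => mu d * ln (Z / d) ^ 2 * ind (Nat.divide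
  d (m + r * h))) + rsum (S (m + r * h)) (fun d => ind ((D < d)%nat /\ Nat.divide d (m + r * h)) * (mu d * ln (Z / d)
  ^ 2))). { intros h Hh. destruct (EZ h Hh) as (H1 & _ & _ & H4). unfold sel.
  rewrite (rsum_pad (S (m + r * h)) (S T)), (rsum_pad (S D) (S T)), (rsum_pad (S (m + r * h)) (S T) (fun d => ind ((D
   < d)%nat /\ _) * _)), <- rsum_plus by lia. ext d _. rewrite ind_and.
  assert (Hi : ind (d < S (m + r * h))%nat * ind (Nat.divide d (m + r * h)) = ind (Nat.divide d (m + r * h))). {
   rewrite <- ind_and. apply ind_iff. split; [tauto|]. intros Hc. split; [|easy]. apply Nat.divide_pos_le in Hc; lia. }
  destruct (Nat.le_gt_cases d D); [rewrite (ind_T (d < S D)%nat), (ind_F (D < d)%nat) by lia|rewrite (ind_F (d < S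
   D)%nat), (ind_T (D < d)%nat) by lia]; rewrite <- Hi; ring_simplify; rewrite ?ind_sq; ring_simplify; replace (ind (d
   < S (m + r * h))%nat ^ 2) with (ind (d < S (m + r * h))%nat) by (simpl; rewrite Rmult_1_r; symmetry; apply ind_sq);
   ring. }
 rewrite (rsum_ext H _ _ E), rsum_plus, rsum_swap. set (S1 := rsum (S D) _). set (S2 := rsum H _).
 assert (B1 : Rabs (S1 - kap Z r D * H) <= INR (S D) * ln Z ^ 2). { unfold S1, kap.
  rewrite <- rsum_scalr, <- rsum_minus. from rsum_abs. rewrite <- rsum_const. termwise d Hd. rewrite rsum_scal.
  destruct d as [|d].
  - rewrite ind_F by lia. rewrite rsum_zero; [rewrite Rmult_0_r, !Rmult_0_l, Rminus_0_r, Rabs_R0; apply pow2_ge_0|].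
   intros h Hh. apply ind_F. intros Hc. apply Nat.divide_0_l in Hc. destruct (EZ h Hh); lia.
  - destruct (Nat.eq_dec (Nat.gcd (S d) r) 1) as [Hd1|Hd1].
   + rewrite ind_T by lia. have (ap_count m r (S d) H Hr ltac:(lia) Hd1) as Hc.
    set (c := rsum H (fun h => ind (Nat.divide (S d) (m + r * h)))) in *. set (l2 := ln (Z / INR (S d)) ^ 2).
    assert (0 < INR (S d)) by pos.
    assert (HSd : INR (S d) <= Z) by (etrans; [apply le_INR; instantiate (1 := D); lia|easy]).
    assert (Hl2 : 0 <= l2 <= ln Z ^ 2). { split; [apply pow2_ge_0|]. apply pow_incr.
     assert (1 <= Z / INR (S d)) by (apply le_div; lra). split; [pos|]. apply ln_le; [lra|]. apply div_le; [easy|].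
     mono. }
    arg (mu (S d) * (l2 * (c - H / INR (S d)))). rewrite !Rabs_mult, (Rabs_right l2) by lra. have (mu_abs (S d)).
    via (1 * (l2 * 1)); [|lra]. mono.
   + rewrite ind_F by tauto.
    rewrite rsum_zero; [rewrite Rmult_0_r, !Rmult_0_l, Rminus_0_r, Rabs_R0; apply pow2_ge_0|]. intros h Hh.
    apply ind_F. now apply ap_none. }
 assert (B2 : Rabs S2 <= ln V ^ 2 * (H * (1 + ln V) + V)). { from rsum_abs.
  via (rsum H (fun h => ln V ^ 2 * rsum V (fun e => ind (Nat.divide (S e) (m + r * h))))).
  - termwise h Hh. destruct (EZ h Hh) as (H1 & H2 & H3 & H4). from rsum_abs.
   via (rsum (S (m + r * h)) (fun d => ln V ^ 2 * ind ((D < d)%nat /\ Nat.divide d (m + r * h)))).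
   + termwise d Hd.
    destruct (ind_cases ((D < d)%nat /\ Nat.divide d (m + r * h))) as [[[H5 _] ->]|[_ ->]]; [|rewrite Rmult_0_l,
     Rabs_R0; lra]. rewrite Rmult_1_l, Rmult_1_r, Rabs_mult, (Rabs_right (_ ^ 2)), <- Rmult_1_l by nra.
    apply Rmult_le_compat; [pos|pos|apply mu_abs|]. apply pow_incr. assert (0 < d) by pos.
    assert (d <= Z) by (etrans; [apply le_INR; instantiate (1 := (m + r * h)%nat); lia|easy]).
    assert (D <= d) by mono. have (pos_INR V). assert (1 <= Z / d) by (apply le_div; lra). split; [pos|].
    apply ln_le; [lra|]. apply div_le; [easy|]. nra.
   + rewrite rsum_scal. mul_l. now apply count_cofactors.
  - rewrite rsum_scal. mul_l. rewrite rsum_swap. via (rsum V (fun e => H * / INR (S e) + 1)).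
   + termwise e He. destruct (Nat.eq_dec (Nat.gcd (S e) r) 1) as [Hd1|Hd1].
    * have (ap_count m r (S e) H Hr ltac:(lia) Hd1) as Hc. apply Rabs_le_between in Hc. lra.
    * rewrite rsum_zero; [|intros h Hh; apply ind_F; now apply ap_none]. pos.
   + rewrite rsum_plus, rsum_scal, rsum_const. have (harmonic_upper V HV). mono. }
 arg (S1 - kap Z r D * H + S2). mono.
Qed.

Lemma pow_lt_pow x y n : 0 < x < y -> x ^ S n < y ^ S n.
Proof.
 intros H. induction n as [|n IH]; [pos|]. rewrite <- !(tech_pow_Rmult _ (S n)). assert (0 < x ^ S n) by pos. nra.
Qed.

(** Compares the two scales used below: windows shorter by a power of L still fit when the range
    exceeds exp (sqrt L), and the errors left by the logarithms of such powers are below sqrt L. *)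
Lemma log_scale B : exists L0, 2 <= L0 /\ forall L, L0 <= L ->
  2 * L ^ B <= exp (sqrt L) /\ ln (2 * L ^ B) ^ 2 * (2 + ln (2 * L ^ B)) + 2 <= sqrt L.
Proof.
 destruct (log_power_small (2 * B)) as (X1 & H1 & H1'). destruct (log_power_small (8 * (B + 1))) as (X2 & H2 & H2').
 exists (4 * X1 ^ 2 + X2 + exp 3). assert (He : 0 < exp 3) by apply exp_pos. split; [nra|]. intros L HL.
 assert (HL2 : exp 3 <= L) by nra. set (s := sqrt L). assert (Hs : 2 * X1 <= s). {
  rewrite <- (sqrt_pow2 (2 * X1)) by lra. apply sqrt_le_1_alt. nra. }
 assert (Hss : s ^ 2 = L) by (apply pow2_sqrt; nra). split.
 - specialize (H1' (exp s / 2)). assert (Hes : X1 <= exp s / 2) by (have (exp_ineq1_le s); lra).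
  destruct (H1' Hes) as [_ H3]. replace (2 * (exp s / 2)) with (exp s) in H3 by field.
  rewrite ln_exp, pow_mult, Hss in H3. lra.
 - set (w := ln (2 * L ^ B)). set (v := ln (2 * L ^ (B + 1))). assert (HB : 1 <= L ^ B) by (apply pow_ge_1; nra).
  assert (HvL : v ^ 8 <= L). { apply Rnot_lt_le. intros Hc.
   assert (HX2 : X2 <= L ^ (B + 1)) by (rewrite pow_add, pow_1; nra). destruct (H2' _ HX2) as [_ H3]. fold v in H3.
   rewrite pow_mult in H3. assert (L ^ (B + 1) < (v ^ 8) ^ (B + 1)); [|lra]. rewrite Nat.add_1_r. apply pow_lt_pow.
   lra. }
  assert (Hwv : 0 <= w <= v). { split; [apply ln_ge_0; lra|]. apply ln_le; [lra|]. rewrite pow_add, pow_1. nra. }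
  assert (Hv3 : 3 <= v). { rewrite <- (ln_exp 3). apply ln_le; [easy|]. rewrite pow_add, pow_1. nra. }
  assert (Hv4 : v ^ 4 <= s). { nra. }
  assert (w ^ 2 * (2 + w) <= v ^ 2 * (2 + v)) by mono. assert (v ^ 2 * (2 + v) + 2 <= v ^ 4); [|lra]. nra.
Qed.

(** An upper bound for r / phi(r), by [coprime_density]. *)
Definition lg (r : nat) : R := INR (S (Nat.log2 r)).

Lemma lg_ge_1 r : 1 <= lg r.
Proof. unfold lg. inr. Qed.

Ltac pos_leaf ::= first [apply lam_nonneg | apply lg_ge_1 | apply Rle_trans with 1; [lra|apply lg_ge_1] | apply Rlt_le_trans with 1; [lra|apply lg_ge_1]].

Lemma residue_sum r H f : rsum r (fun i => rsum H (fun h => f (i + r * h)%nat)) = rsum (H * r) f.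
Proof. rewrite rsum_swap, rsum_blocks. mono. Qed.

(** The mean [kp] is bounded above by adding the windows of all reduced classes, at least r / lg r
    in number, and comparing with [sel_sum]; it is bounded below because [sel] is nonnegative up to
    Z = 8 M. The window error sqrt L, compared with the size ln Z of the weights, becomes the term 1
    / sqrt L of the later bounds. *)
Lemma sel_windows A : exists L0, 2 <= L0 /\ forall L M r, L0 <= L -> sqrt L <= ln (INR M) <= L -> (1 <= r)%nat -> INR r <= L ^ A ->
  exists kp, Rabs kp <= 140 * lg r * ln (8 * INR M) /\
  forall m H, (1 <= m)%nat -> coprime m r -> (m + r * H <= 8 * M)%nat -> INR M <= INR H * L ^ A ->
  Rabs (rsum H (fun h => sel (8 * INR M) (m + r * h)) - kp * INR H) <= INR H * sqrt L.
Proof.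
 (* Divisors are cut at about Z / L^B. The rounding errors, about Z L^(2-B), then stay below the
    window length, which is at least M / L^A. *)
 set (B := (A + 10)%nat). set (B2 := (B + A + 10)%nat). destruct (log_scale B2) as (L0 & HL0 & HL0'). exists (L0 + 8).
 split; [lra|]. intros L M r HL HM Hr HrL. destruct (HL0' L ltac:(lra)) as [HE1 HE2]. set (s := sqrt L) in *.
 set (w := ln (2 * L ^ B2)) in *. assert (HP1 : forall a, 1 <= L ^ a) by (intros; pos).
 assert (Hs1 : 1 <= s) by (rewrite <- sqrt_1; apply sqrt_le_1_alt; lra). assert (HM0 : 0 < M). { destruct M; [|pos].
  rewrite ln_INR_0 in HM. lra. }
 assert (HMe : 2 * L ^ B2 <= M). { from HE1. rewrite <- exp_ln by easy.
  destruct (Rle_lt_or_eq_dec s (ln M) ltac:(lra)) as [Hc|Hc].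
  - left. now apply exp_increasing.
  - rewrite Hc. lra. }
 set (Z := 8 * M). assert (HM2 : 2 <= M) by (specialize (HP1 B2); lra).
 assert (HlZ : ln Z <= 3 * L /\ 1 <= ln Z /\ s <= ln Z). { unfold Z. rewrite ln_mult by lra. have ln2_bounds.
  replace 8 with (2 ^ 3) by ring. rewrite ln_pow by lra. inr. }
 assert (HlZ2 : ln Z <= Z) by (have (ln_le_sub Z); unfold Z in *; lra).
 destruct (nfloor (L ^ B)) as (V0 & HV1 & HV2); [pos|]. set (V := S V0).
 assert (HVR : INR V = V0 + 1) by (unfold V; apply S_INR). have (HP1 B) as HB1. assert (HVlo : L ^ B <= V) by lra.
 assert (HVhi : V <= 2 * L ^ B) by lra. assert (HV2' : 2 <= V) by (upto HVlo; via (L ^ 1); [lra|unfold B; mono]).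
 destruct (nfloor (Z / V)) as (D0 & HD1 & HD2); [pos|]. set (D := S D0).
 assert (HDR : INR D = D0 + 1) by (unfold D; apply S_INR). assert (HZV : Z / V <= Z / L ^ B) by mono.
 assert (HDZ : D <= Z). { assert (Z / V <= Z / 2) by mono. unfold Z in *. lra. }
 assert (HVD : Z <= V * D). { rewrite Rmult_comm. apply div_le_inv; lra. }
 assert (Hmain : forall m H, (1 <= m)%nat -> coprime m r -> (m + r * H <= 8 * M)%nat -> M <= H * L ^ A -> Rabs (rsum H
  (fun h => sel Z (m + r * h)) - kap Z r D * H) <= H * s). { intros m H Hm Hg HmH HMH.
  assert (HZm : INR (m + r * H) <= Z). { apply le_INR in HmH. rewrite mult_INR in HmH.
   replace (INR 8) with 8 in HmH by inr. easy. }
  etrans; [apply (sel_window Z m r H D V); auto; unfold D, V; lia|]. assert (HH : 2 * L ^ (B + 10) <= H). {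
   apply (Rmult_le_reg_r (L ^ A)); [pos|]. lhs (2 * (L ^ (B + 10) * L ^ A)). rewrite <- pow_add.
   replace (B + 10 + A)%nat with B2 by lia. lra. }
  assert (HVH : V <= H) by (have (pow_mono L B (B + 10) ltac:(lra) ltac:(lia)); lra). assert (Hlv : 0 <= ln V <= w).
  { split; [pos|]. apply ln_le; [lra|]. from HVhi. mono. }
  assert (T2 : ln V ^ 2 * (H * (1 + ln V) + V) <= H * (w ^ 2 * (2 + w))). { rhs (w ^ 2 * (H * (1 + w) + H)). mono. }
  assert (T1 : INR (S D) * ln Z ^ 2 <= H * 2). { rewrite S_INR. via ((Z / L ^ B + 2) * (9 * L ^ 2)).
   - apply Rmult_le_compat; [pos|pos|lra|]. rhs ((3 * L) ^ 2). mono.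
   - assert (T3 : Z / L ^ B <= 8 * H / L ^ 10). { unfold B. rewrite pow_add. apply div_le; [pos|].
     rhs (8 * (H * L ^ A)). unfold Z. lra. }
    assert (T4 : 8 * H / L ^ 10 * (9 * L ^ 2) <= H). { lhs (H * (72 / L ^ 8)). rewrite <- (Rmult_1_r (INR H)) at 2.
     mul_l. apply div_le; [pos|]. assert (8 ^ 8 <= L ^ 8) by mono. lra. }
    assert (T5 : 18 * L ^ 2 <= H). { have (pow_mono L 4 (B + 10) ltac:(lra) ltac:(lia)).
     assert (64 <= L ^ 2) by (replace 64 with (8 ^ 2) by ring; apply pow_incr; lra).
     assert (64 * L ^ 2 <= L ^ 2 * L ^ 2) by mono. lra. }
    assert (Z / L ^ B * (9 * L ^ 2) <= H) by (etrans; [apply Rmult_le_compat_r; [have (pow2_ge_0 L); lra|apply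
     T3]|easy]). lra. }
  assert (H * (w ^ 2 * (2 + w) + 2) <= H * s) by mono. lra. }
 exists (kap Z r D). split; [|pos].
 (* total mass of the reduced classes in [M, 4 M) *)
 assert (HrM : r <= M). { have (pow_mono L A B2 ltac:(lra) ltac:(unfold B2, B; lia)). lra. }
 assert (HrM' : (r <= M)%nat) by inr. set (H0 := (M / r + 1)%nat). euclid M r as Hdm Hmm.
 assert (HrHR : M <= r * H0) by (rewrite <- mult_INR; apply le_INR; lia).
 assert (HMH : M <= H0 * L ^ A) by (have (pos_INR H0); nra). set (K := kap Z r D) in *.
 set (Nr := rsum r (fun i => ind (coprime (M + i) r))).
 assert (HNr : r <= Nr * lg r) by (apply coprime_density; easy). assert (HZ1 : 1 <= Z) by lra.
 assert (Hsum : Nr * (H0 * (K - s)) <= ln Z ^ 2 + 16 * (4 * M) * (ln Z + 1)). {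
  via (rsum (S (4 * M)) (fun n => ind (1 <= n)%nat * sel Z n)). 2:{
   etrans; [apply sel_sum; auto; [lia|]|]; rewrite mult_INR; replace (INR 4) with 4 by (simpl; lra); unfold Z; lra. }
  assert (Hpos : forall n, (n <= 8 * M)%nat -> 0 <= ind (1 <= n)%nat * sel Z n). { intros n Hn.
   destruct n; [rewrite ind_F by lia; lra|]. apply Rmult_le_pos; [pos|]. etrans; [|apply sel_lower; auto; [lia|]].
   - pos.
   - apply le_INR in Hn. rewrite mult_INR in Hn. replace (INR 8) with 8 in Hn by inr. exact Hn. }
  via (rsum (M + H0 * r) (fun n => ind (1 <= n)%nat * sel Z n)). 2:{ apply rsum_mono_n; [lia|].
   intros; apply Hpos; lia. }
  rewrite rsum_split.
  assert (0 <= rsum M (fun n => ind (1 <= n)%nat * sel Z n)) by (apply rsum_nonneg; intros; apply Hpos; lia).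
  rewrite <- residue_sum.
  assert (Nr * (H0 * (K - s)) <= rsum r (fun i => rsum H0 (fun h => ind (1 <= M + (i + r * h))%nat * sel Z (M + (i + r
   * h))))); [|lra]. unfold Nr. rewrite <- rsum_scalr. termwise i Hi. ind_case (coprime (M + i) r) as Hg.
  - rewrite (rsum_ext H0 _ (fun h => sel Z (M + i + r * h))).
   + assert (Hx : (M + i + r * H0 <= 8 * M)%nat) by lia. have (Hmain (M + i)%nat H0 ltac:(lia) Hg Hx HMH) as Hc.
    apply Rabs_le_between in Hc. lra.
   + intros h Hh. rewrite ind_T, Rmult_1_l by lia. f_equal. lia.
  - rewrite Rmult_0_l. apply rsum_nonneg. intros h Hh. apply Hpos. nia. }
 assert (Hlow : - (H0 * s) <= K * H0). { assert (Hg : coprime 1 r) by easy.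
  have (Hmain 1%nat H0 ltac:(lia) Hg ltac:(lia) HMH) as Hc. apply Rabs_le_between in Hc.
  assert (0 <= rsum H0 (fun h => sel Z (1 + r * h))); [|lra]. apply rsum_nonneg. intros h Hh.
  etrans; [|apply sel_lower; auto; [lia|]].
  - pos.
  - assert (Hx : (1 + r * h <= 8 * M)%nat) by nia. apply le_INR in Hx. rewrite mult_INR in Hx.
   replace (INR 8) with 8 in Hx by inr. exact Hx. }
 assert (HH0 : 1 <= H0) by inr. assert (HlgZ : ln Z <= lg r * ln Z) by mono.
 assert (HlgZ' : lg r <= lg r * ln Z) by mono. apply Rabs_le. split. {
  assert (- s <= K) by (apply (Rmult_le_reg_r (INR H0)); lra). lra. }
 destruct (Rle_lt_dec K s) as [Hc|Hc]; [lra|].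
 assert (T1 : M * (K - s) <= lg r * (ln Z ^ 2 + 16 * (4 * M) * (ln Z + 1))). { via (r * H0 * (K - s)); [mono|].
  via (Nr * lg r * H0 * (K - s)).
  - mono.
  - lhs (lg r * (Nr * (H0 * (K - s)))). mono. }
 assert (T2 : ln Z ^ 2 <= 8 * M * ln Z) by (simpl; rewrite Rmult_1_r; apply Rmult_le_compat_r; [lra|exact HlZ2]).
 assert (T3 : K - s <= lg r * (72 * ln Z + 64)). { apply (Rmult_le_reg_l (INR M)); [easy|]. from T1.
  rhs (lg r * (8 * M * ln Z + 16 * (4 * M) * (ln Z + 1))). mono. }
 lra.
Qed.

(** By [sel_lower], lam is at most sel / ln Z, and the mean of [sel] is at most a multiple of lg r
    ln Z. *)
Lemma brun_titchmarsh A : exists L0, 2 <= L0 /\ forall L M r, L0 <= L -> sqrt L <= ln (INR M) <= L -> (1 <= r)%nat -> INR r <= L ^ A ->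
  forall m H, (1 <= m)%nat -> coprime m r -> (m + r * H <= 8 * M)%nat -> INR M <= INR H * L ^ A ->
  rsum H (fun h => lam (m + r * h)) <= 141 * lg r * INR H.
Proof.
 destruct (sel_windows A) as (L0 & H0 & HS). exists L0. split; [easy|]. intros L M r HL HM Hr HrL m H Hm Hg HmH HMH.
 destruct (HS L M r HL HM Hr HrL) as (kp & Hk & Hw). specialize (Hw m H Hm Hg HmH HMH). apply Rabs_le_between in Hw.
 apply Rabs_le_between in Hk. set (Z := 8 * M) in *.
 assert (Hs1 : 1 <= sqrt L) by (rewrite <- sqrt_1; apply sqrt_le_1_alt; lra). assert (HM1 : 1 <= M) by inr.
 assert (HlZ : sqrt L <= ln Z). { from HM. apply ln_le; unfold Z; lra. }
 have (lg_ge_1 r). apply (Rmult_le_reg_r (ln Z)); [lra|]. via (rsum H (fun h => sel Z (m + r * h))).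
 - rewrite <- rsum_scalr. termwise h Hh. apply sel_lower; [unfold Z; lra|lia|].
  assert (Hx : (m + r * h <= 8 * M)%nat) by nia. apply le_INR in Hx. rewrite mult_INR in Hx.
  replace (INR 8) with 8 in Hx by inr. exact Hx.
 - via (kp * H + H * sqrt L); [lra|]. rhs (140 * lg r * ln Z * H + H * (lg r * ln Z)).
  apply Rplus_le_compat; [mono|mul_l]. nra.
Qed.

(** * Transference *)

Lemma power_shift (X k' r t i : nat) : (k' + r * t <= 2 * X)%nat ->
  exists T, ((k' + r * t) ^ i = k' ^ i + r * T)%nat /\ T * X <= i * (2 * X) ^ i * t.
Proof.
 intros H. set (k := (k' + r * t)%nat) in *. induction i as [|i (T & E & B)].
 - exists 0%nat. split; [simpl; lia|]. inr.
 - exists (k' * T + t * k ^ i)%nat. split.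
  + rewrite !Nat.pow_succ_r'. lia.
  + rewrite plus_INR, !mult_INR, pow_INR.
   assert (Hk : k <= 2 * X) by (apply le_INR in H; rewrite mult_INR in H; simpl (INR 2) in H; lra).
   assert (Hk' : k' <= 2 * X) by (upto Hk; apply le_INR; unfold k; lia).
   assert (A1 : k' * (T * X) <= 2 * X * (i * (2 * X) ^ i * t)). { mono. }
   assert (A2 : t * X * k ^ i <= t * X * (2 * X) ^ i). { mono. }
   assert (A3 : 0 <= t * X * (2 * X) ^ i) by pos. rewrite S_INR. simpl pow. lra.
Qed.

Definition osc_poly (F : ppdata) : R := rsum (S (deg F)) (fun i => i * 2 ^ i).
Definition osc_frac (F : ppdata) : R :=
  rsum (nfr F) (fun j => Rabs (fco F j) * (Rabs (fex F j) * Rpower 4 (Rabs (fex F j) + 1))).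
Definition oscc (F : ppdata) : R := 8 * (osc_poly F + osc_frac F).

Lemma oscc_nonneg F : 0 <= oscc F.
Proof.
 unfold oscc. assert (0 <= osc_poly F). { apply rsum_nonneg. intros. pos. }
 assert (0 <= osc_frac F); [|lra]. apply rsum_nonneg. intros. pos.
Qed.

(** A shift by r t changes the i-th power by a multiple r T, and r xi c_i is within Q0 / X^i of an
    integer; the fractional powers are handled by their Lipschitz bound. Both effects are of order
    Q0 / Q as long as the shift is at most X / Q. *)
Lemma oscillation F : ppok F -> forall (X r : nat) Q0 Q xi om, (1 <= X)%nat -> 0 <= Q0 -> 0 < Q -> (1 <= r)%nat ->
  ((0 < nfr F)%nat -> Rabs xi * Rpower X (fex F 0%nat) <= Q0) ->
  (forall i, (1 <= i <= deg F)%nat -> near (Q0 / X ^ i) (r * (xi * co F i))) ->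
  forall k' t : nat, (X <= k')%nat -> (k' + r * t <= 2 * X)%nat -> INR (r * t) * Q <= X ->
  Rabs (cs (xi * ppval F (INR (k' + r * t)) + om) - cs (xi * ppval F (INR k') + om)) <= oscc F * (Q0 / Q).
Proof.
 intros (_ & HF2 & HF3) X r Q0 Q xi om HX HQ0 HQ Hr Hfr Hpo k' t Hk Hk2 Hq. set (k := (k' + r * t)%nat) in *.
 assert (HX0 : 1 <= X) by inr. assert (Hr1 : 1 <= r) by inr.
 assert (HkR : INR k = k' + INR (r * t)) by (unfold k; apply plus_INR). assert (HtX : t / X <= / Q). {
  apply div_le; [lra|]. rewrite Rmult_comm. apply le_div_inv_r; [easy|]. rewrite mult_INR in Hq. nra. }
 assert (HrtX : INR (r * t) / X <= / Q). { apply div_le; [lra|]. rewrite Rmult_comm. apply le_div_inv_r; easy. }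
 assert (Hk2R : k <= 2 * X) by (apply le_INR in Hk2; rewrite mult_INR in Hk2; simpl (INR 2) in Hk2; lra).
 assert (HkX : X <= k') by mono. have (pos_INR (r * t)) as Hrt.
 set (P := rsum (S (deg F)) (fun i => xi * co F i * (k ^ i - k' ^ i))).
 set (S := rsum (nfr F) (fun j => xi * fco F j * (Rpower k (fex F j) - Rpower k' (fex F j)))).
 assert (EP : xi * ppval F (INR k) + om = P + (S + (xi * ppval F (INR k') + om))). { unfold ppval, gph, P, S.
  rewrite (rsum_ext (Datatypes.S (deg F)) (fun i => xi * co F i * _) (fun i => xi * (co F i * k ^ i - co F i * k' ^
   i))), (rsum_ext (nfr F) (fun i => xi * fco F i * _) (fun i => xi * (fco F i * Rpower k (fex F i) - fco F i * Rpower
   k' (fex F i)))), !rsum_scal, !rsum_minus by (intros; ring). ring. }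
 assert (BP : near (osc_poly F * (Q0 / Q)) P). { unfold osc_poly, P. rewrite <- rsum_scalr. apply near_rsum.
  intros i Hi. destruct (Nat.eq_dec i 0) as [->|Hi0]. { exists 0%Z. simpl.
   rewrite !Rminus_diag, Rmult_0_r, Rminus_0_r, Rabs_R0. lra. }
  destruct (power_shift X k' r t i Hk2) as (T & E & B). fold k in E. assert (E' : k ^ i - k' ^ i = T * r). {
   rewrite <- !pow_INR, E, plus_INR, mult_INR. ring. }
  rewrite E'. rhs (T * (r * (xi * co F i))). eapply near_le; [|apply near_mul, Hpo; lia].
  assert (HXi : 0 < X ^ i) by pos. lhs (Q0 * (T * X / (X ^ i * X))). rhs (Q0 * (i * 2 ^ i * / Q)). mul_l.
  via (i * (2 * X) ^ i * t / (X ^ i * X)).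
  - mono.
  - rewrite Rpow_mult_distr. lhs (i * 2 ^ i * (t / X)). mono. }
 assert (BS : Rabs S <= osc_frac F * (Q0 / Q)). { unfold S, osc_frac. from rsum_abs. rewrite <- rsum_scalr.
  termwise j Hj. rewrite !Rabs_mult, HkR.
  have (lipschitz_Rpower (fex F j) (INR X) (INR k') (INR (r * t)) ltac:(lra) HkX Hrt ltac:(lra)) as Hl.
  assert (Hx : Rabs xi * Rpower X (fex F j) <= Q0). { etrans; [|apply Hfr; lia]. mul_l. apply Rle_Rpower; [easy|].
   destruct j; [lra|]. left. apply HF3. lia. }
  set (c := Rabs (fex F j) * Rpower 4 (Rabs (fex F j) + 1)) in *.
  assert (Hc : 0 <= c) by (apply Rmult_le_pos; [apply Rabs_pos|left; apply Rpower_pos]).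
  via (Rabs xi * Rabs (fco F j) * (c * Rpower X (fex F j) * (INR (r * t) / X))). { mono. }
  lhs (Rabs (fco F j) * c * (Rabs xi * Rpower X (fex F j) * (INR (r * t) / X))). unfold Rdiv at 2. mono. }
 rewrite EP. destruct BP as [z Hz].
 replace (P + (S + (xi * ppval F (INR k') + om))) with ((P - IZR z) + (S + (xi * ppval F (INR k') + om)) + IZR z) by
  ring. rewrite cs_period. from cs_lip. unfold oscc. arg ((P - IZR z) + S). have (Rabs_triang (P - IZR z) S). lra.
Qed.

(* Shifting the argument of u by r h is the same as shifting that of g by - r h. *)
Lemma smoothing (T r H : nat) (u g E : nat -> R) : (0 < H)%nat -> (forall m, 0 <= u m) ->
  (forall m, (T <= m)%nat -> u m = 0) -> (forall m, (m < r * H)%nat -> u m = 0) ->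
  (forall m h, (m < T)%nat -> (h < H)%nat -> (r * h <= m)%nat -> u m <> 0 -> Rabs (g m - g (m - r * h)%nat) <= E m) ->
  Rabs (rsum T (fun m => u m * g m) - rsum T (fun m => / H * rsum H (fun h => u (m + r * h)%nat) * g m))
  <= rsum T (fun m => u m * E m).
Proof.
 intros HH Hu HT Hlow HE. assert (HHR : 0 < H) by pos.
 assert (Esh : forall h, (h < H)%nat -> rsum T (fun m => u (m + r * h)%nat * g m) = rsum T (fun m => u m * g (m - r *
  h)%nat)). { intros h Hh. assert (Hrh : (r * h <= r * H)%nat) by nia.
  destruct (Nat.le_gt_cases (r * h) T) as [Hc|Hc].
  - replace T with (r * h + (T - r * h))%nat at 2 by lia. rewrite rsum_split, (rsum_zero (r * h)). 2:{ intros i Hi.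
    rewrite Hlow by lia. ring. }
   rewrite (rsum_trunc (T - r * h) T); [|lia|intros i Hi; rewrite HT by lia; ring]. rewrite Rplus_0_l. ext i Hi.
   rewrite Nat.add_comm. f_equal. f_equal. lia.
  - rewrite !rsum_zero; [easy| |]; intros i Hi; [rewrite Hlow by lia|rewrite HT by lia]; ring. }
 assert (E2 : rsum T (fun m => / H * rsum H (fun h => u (m + r * h)%nat) * g m) = rsum T (fun m => u m * (/ H * rsum H
  (fun h => g (m - r * h)%nat)))). {
  rewrite (rsum_ext T _ (fun m => rsum H (fun h => / H * (u (m + r * h)%nat * g m)))). 2:{ intros m _.
   rewrite rsum_scal, rsum_scalr. ring. }
  rewrite rsum_swap, (rsum_ext H _ (fun h => rsum T (fun m => / H * (u m * g (m - r * h)%nat)))). 2:{ intros h Hh.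
   rewrite !rsum_scal, Esh by easy. lra. }
  rewrite rsum_swap. ext m _. rewrite !rsum_scal. ring. }
 rewrite E2, <- rsum_minus. from rsum_abs. termwise m Hm.
 destruct (Req_dec (u m) 0) as [E0|E0]; [rewrite E0, !Rmult_0_l, Rminus_diag, Rabs_R0; lra|].
 rewrite <- Rmult_minus_distr_l, Rabs_mult, Rabs_right by pos. mul_l.
 replace (g m - / H * rsum H (fun h => g (m - r * h)%nat)) with (/ H * rsum H (fun h => g m - g (m - r * h)%nat)).
 2:{ rewrite rsum_minus, rsum_const. field. lra. }
 rewrite Rabs_mult, Rabs_right by pos. apply (Rmult_le_reg_l (INR H)); [easy|].
 rewrite <- Rmult_assoc, Rinv_r, Rmult_1_l, <- rsum_const by lra. from rsum_abs. termwise h Hh. apply HE; auto.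
 destruct (Nat.le_gt_cases (r * h) m) as [|Hc]; [easy|]. exfalso. apply E0, Hlow. nia.
Qed.

(** Counts the end points of (X, Y] that are crossed when k is lowered by W. *)
Definition jump (X Y W k : nat) : R := ind (X < k <= X + W)%nat + ind (Y < k <= Y + W)%nat.

(* G is supported on (X, Y] and, away from the end points of that interval, changes by at most de
   under the shifts by a multiple of r that do not exceed W. *)
Definition slow (G : nat -> R) (X Y r W : nat) (de : R) : Prop :=
  (forall k, Rabs (G k) <= inI X Y k) /\
  forall k' t, (r * t <= W)%nat -> Rabs (G (k' + r * t)%nat - G k') <= de * ind (k' + r * t <= 2 * X)%nat + jump X Y W (k' + r * t).

Lemma jump_nonneg X Y W k : 0 <= jump X Y W k.
Proof. unfold jump. pos. Qed.

Lemma interval_multiples T n E W f : (1 <= n)%nat -> (forall m, 0 <= f m) ->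
  rsum T (fun m => f m * ind (E < m * n <= E + W)%nat) <= rsum (W / n + 1) (fun h => f (E / n + 1 + h)%nat).
Proof.
 intros Hn Hf. assert (Hi : forall m, ind (E < m * n <= E + W)%nat <= ind (E / n < m <= E / n + (W / n + 1))%nat). {
  intros m. apply ind_imp. rewrite (div_lt_iff E m n Hn), (le_div_iff (E + W) m n Hn). intros [H1 H2]. split; [easy|].
  euclid E n. euclid W n. assert ((E + W) / n < E / n + W / n + 2)%nat; [|lia]. apply Nat.Div0.div_lt_upper_bound.
  nia. }
 set (T' := (T + S (E / n + (W / n + 1)))%nat).
 via (rsum T' (fun m => ind (E / n < m <= E / n + (W / n + 1))%nat * f m)).
 - via (rsum T (fun m => ind (E / n < m <= E / n + (W / n + 1))%nat * f m)).
  + termwise m _. rewrite Rmult_comm. mono.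
  + apply rsum_mono_n; [pos|]. intros m _. pos.
 - rewrite interval_sum by lia. replace (E / n + (W / n + 1) - E / n)%nat with (W / n + 1)%nat by lia. lra.
Qed.

Lemma lam_psi T f : (forall m, 0 <= f m <= lam m) -> rsum T f <= 4 * T.
Proof.
 intros H. destruct T as [|T]; [simpl; lra|]. via (psi T).
 - apply rsum_le. intros; apply H.
 - from psi_upper. mono.
Qed.

Lemma gcd_shift m r h : Nat.gcd (m + r * h) r = Nat.gcd m r.
Proof. rewrite !(Nat.gcd_comm _ r), Nat.mul_comm. apply Nat.gcd_add_mult_diag_r. Qed.

(** Since G is slow along shifts of r times the other variable, each prime weight in turn may be
    replaced by its mean over a progression modulo r. The hypotheses of Brun-Titchmarsh type bound
    these means by [ka], because u1 and u2 live on residues coprime to r and shifts by r preserve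
    these. With both weights bounded, the bilinear estimate loses no logarithm. The price is the
    variation [de] and the terms near the ends of (X, Y]. *)
Lemma block (G : nat -> R) (X Y N r W H1 H2 : nat) de D ka (u1 u2 : nat -> R) :
  (1 <= N <= X)%nat -> 0 < D -> 1 <= ka -> 0 <= de -> slow G X Y r W de -> (W <= X)%nat -> (1 <= H1)%nat -> (1 <= H2)%nat ->
  (r * H1 * (2 * N) <= W)%nat -> (r * H2 * (2 * X / N) <= W)%nat -> (r * H2 < N)%nat ->
  (forall m, (1 <= m <= 2 * X / N + 1)%nat -> rsum (W / N + 1) (fun h => lam (m + h)) <= ka * INR (W / N + 1)) ->
  (forall m, (1 <= m <= 2 * X / N)%nat -> coprime m r -> rsum H1 (fun h => lam (m + r * h)) <= ka * H1) ->
  (forall m, (1 <= m < 2 * N)%nat -> coprime m r -> rsum H2 (fun h => lam (m + r * h)) <= ka * H2) ->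
  (forall a b : nat -> R, rsum (2 * X / N + 1) (fun m => a m * rsum N (fun v => b (N + v)%nat * G (m * (N + v))%nat)) ^ 2
  <= rsum (2 * X / N + 1) (fun m => a m ^ 2) * (rsum N (fun v => b (N + v)%nat ^ 2) * (5 * X / D))) ->
  (Y <= 2 * X)%nat ->
  (forall m, 0 <= u1 m <= lam m * ind (coprime m r)) -> (forall m, 0 <= u2 m <= lam m * ind (coprime m r)) ->
  Rabs (rsum (2 * X / N + 1) (fun m => u1 m * rsum N (fun v => u2 (N + v)%nat * G (m * (N + v))%nat)))
  <= ka ^ 2 * (120 * de * X + 33 * (W + N) + 4 * X / sqrt D).
Proof.
 intros HN HD Hka Hde [HG1 HG2] HWX HH1 HH2 HW1 HW2 HrN BT1 BT2 BT3 Hbil HY2 Hu1 Hu2. set (T := (2 * X / N + 1)%nat).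
 assert (Hu1' : forall m, 0 <= u1 m <= lam m). { intros m. specialize (Hu1 m). have (ind_01 (coprime m r)).
  have (lam_nonneg m). nra. }
 assert (Hu2' : forall m, 0 <= u2 m <= lam m). { intros m. specialize (Hu2 m). have (ind_01 (coprime m r)).
  have (lam_nonneg m). nra. }
 assert (HG0 : forall k, ~ (X < k <= Y)%nat -> G k = 0). { intros k Hk. specialize (HG1 k). unfold inI in HG1.
  rewrite ind_F in HG1 by easy. apply Rabs_le_between in HG1. lra. }
 assert (HN1 : 1 <= N) by inr. assert (HX1 : N <= X) by mono. assert (HT : T * N <= 3 * X). { rewrite <- mult_INR.
  rhs (INR (3 * X)) by inr. apply le_INR. have (Nat.mul_div_le (2 * X) N ltac:(lia)). nia. }
 assert (HWN : INR (W / N + 1) * N <= W + N). { rewrite <- mult_INR, <- plus_INR. apply le_INR.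
  have (Nat.mul_div_le W N ltac:(lia)). nia. }
 (* Removing m < r H1 costs nothing: then m n < 2 N r H1 <= W <= X, outside the support of G. *)
 have (pos_INR W) as HW0. set (v1 := fun m => ind (r * H1 <= m < T)%nat * u1 m).
 set (v2 := fun n => ind (N <= n < 2 * N)%nat * u2 n). assert (Hv1 : forall m, 0 <= v1 m <= lam m). { intros m.
  unfold v1. have (ind_01 (r * H1 <= m < T)%nat). specialize (Hu1' m). nra. }
 assert (Hv2 : forall m, 0 <= v2 m <= lam m). { intros m. unfold v2. have (ind_01 (N <= m < 2 * N)%nat).
  specialize (Hu2' m). nra. }
 assert (Hv1g : forall m, Nat.gcd m r <> 1%nat -> v1 m = 0). { intros m Hm. unfold v1. specialize (Hu1 m).
  rewrite ind_F in Hu1 by easy. replace (u1 m) with 0 by lra. ring. }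
 assert (Hv2g : forall m, Nat.gcd m r <> 1%nat -> v2 m = 0). { intros m Hm. unfold v2. specialize (Hu2 m).
  rewrite ind_F in Hu2 by easy. replace (u2 m) with 0 by lra. ring. }
 assert (HS2 : rsum (2 * N) v2 <= 8 * N). { from (lam_psi (2 * N) v2 Hv2). inr. }
 set (g1 := fun m => rsum (2 * N) (fun n => v2 n * G (m * n)%nat)).
 assert (E0 : rsum T (fun m => u1 m * rsum N (fun v => u2 (N + v)%nat * G (m * (N + v))%nat)) = rsum T (fun m => v1 m
  * g1 m)). { ext m Hm. assert (Eg : rsum N (fun v => u2 (N + v)%nat * G (m * (N + v))%nat) = g1 m). { unfold g1.
   replace (2 * N)%nat with (N + N)%nat by lia. rewrite rsum_split, (rsum_zero N (fun n => v2 n * G (m * n)%nat)).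
   - rewrite Rplus_0_l. ext v Hv. unfold v2. rewrite ind_T by lia. ring.
   - intros n Hn. unfold v2. rewrite ind_F by lia. ring. }
  rewrite Eg. unfold v1. destruct (Nat.le_gt_cases (r * H1) m) as [Hc|Hc]; [rewrite ind_T by lia; ring|].
  rewrite <- Eg, rsum_zero; [ring|]. intros v Hv. rewrite HG0; [ring|]. nia. }
 rewrite E0.
 (* smoothing of the first variable *)
 set (err := fun k => de * ind (k <= 2 * X)%nat + jump X Y W k).
 assert (S1 : Rabs (rsum T (fun m => v1 m * g1 m) - rsum T (fun m => / H1 * rsum H1 (fun h => v1 (m + r * h)%nat) * g1
  m)) <= 96 * de * X + 16 * ka * (W + N)). {
  etrans; [apply (smoothing T r H1 v1 g1 (fun m => rsum (2 * N) (fun n => v2 n * err (m * n)%nat)))|].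
  - lia.
  - intros; apply Hv1.
  - intros m Hm. unfold v1. rewrite ind_F by lia. ring.
  - intros m Hm. unfold v1. rewrite ind_F by lia. ring.
  - intros m h Hm Hh Hrh _. unfold g1. rewrite <- rsum_minus. from rsum_abs. termwise n Hn.
   rewrite <- Rmult_minus_distr_l, Rabs_mult, Rabs_right by (apply Rle_ge, Hv2).
   apply Rmult_le_compat_l; [apply Hv2|]. replace (m * n)%nat with ((m - r * h) * n + r * (h * n))%nat by nia.
   apply HG2. apply Nat.le_trans with (r * H1 * (2 * N))%nat; [|easy]. rewrite Nat.mul_assoc.
   apply Nat.mul_le_mono; [apply Nat.mul_le_mono_l; lia|lia].
  - rewrite (rsum_ext T _ (fun m => rsum (2 * N) (fun n => v2 n * (v1 m * err (m * n)%nat)))). 2:{ intros m _.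
    rewrite <- rsum_scal. mono. }
   rewrite rsum_swap. via (rsum (2 * N) (fun n => v2 n * (de * (4 * T) + 2 * (ka * INR (W / N + 1))))).
   + termwise n Hn. rewrite rsum_scal. destruct (Nat.lt_ge_cases n N) as [Hc|Hc]. { unfold v2. rewrite ind_F by lia.
     lra. }
    apply Rmult_le_compat_l; [apply Hv2|].
    rewrite (rsum_ext T _ (fun m => de * (v1 m * ind (m * n <= 2 * X)%nat) + (v1 m * ind (X < m * n <= X + W)%nat + v1
     m * ind (Y < m * n <= Y + W)%nat))), !rsum_plus, rsum_scal by (intros; unfold err, jump; ring).
    assert (A1 : rsum T (fun m => v1 m * ind (m * n <= 2 * X)%nat) <= 4 * T). { apply lam_psi. intros m.
     have (ind_01 (m * n <= 2 * X)%nat). specialize (Hv1 m). nra. }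
    assert (A2 : forall E, (E <= 2 * X)%nat -> rsum T (fun m => v1 m * ind (E < m * n <= E + W)%nat) <= ka * INR (W /
     N + 1)). { intros E HE. etrans; [apply interval_multiples; [lia|apply Hv1]|].
     assert (HWn : (W / n <= W / N)%nat) by (apply Nat.div_le_compat_l; lia).
     via (rsum (W / N + 1) (fun h => lam (E / n + 1 + h))).
     - via (rsum (W / n + 1) (fun h => lam (E / n + 1 + h))); [apply rsum_le; intros; apply Hv1|].
      apply rsum_mono_n; [lia|intros; apply lam_nonneg].
     - apply BT1. assert (E / n <= 2 * X / N)%nat; [|lia].
      eapply Nat.le_trans; [apply Nat.div_le_compat_l; split; [|apply Hc]; lia|]. apply Nat.Div0.div_le_mono. lia. }
    have (A2 X ltac:(lia)). have (A2 Y HY2). mono.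
   + rewrite rsum_scalr. via (8 * N * (de * (4 * T) + 2 * (ka * INR (W / N + 1)))).
    * mono.
    * nra. }
 (* smoothing of the second variable *)
 set (w1 := fun m => ind (1 <= m < T)%nat * (/ H1 * rsum H1 (fun h => v1 (m + r * h)%nat))).
 assert (HH1R : 0 < H1) by pos. assert (HH2R : 0 < H2) by pos. assert (Hw1 : forall m, 0 <= w1 m <= ka). { intros m.
  unfold w1. destruct (ind_cases (1 <= m < T)%nat) as [[Hm ->]|[_ ->]]; [|lra]. rewrite Rmult_1_l. split.
  - apply Rmult_le_pos; [pos|]. apply rsum_nonneg. intros; apply Hv1.
  - rewrite Rmult_comm. apply div_le; [easy|]. destruct (Nat.eq_dec (Nat.gcd m r) 1) as [Hg|Hg].
   + etrans; [|apply (BT2 m); [unfold T in Hm; lia|easy]]. apply rsum_le. intros; apply Hv1.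
   + rewrite rsum_zero; [pos|]. intros h _. apply Hv1g. now rewrite gcd_shift. }
 set (g2 := fun n => rsum T (fun m => w1 m * G (m * n)%nat)).
 assert (E1 : rsum T (fun m => / H1 * rsum H1 (fun h => v1 (m + r * h)%nat) * g1 m) = rsum (2 * N) (fun n => v2 n * g2
  n)). { unfold g1, g2. rewrite (rsum_ext T _ (fun m => rsum (2 * N) (fun n => v2 n * (w1 m * G (m * n)%nat)))).
  - rewrite rsum_swap. ext n _. now rewrite rsum_scal.
  - intros m Hm. rewrite <- rsum_scal. ext n _. unfold w1. destruct m.
   + rewrite HG0 by lia. ring.
   + rewrite ind_T by lia. ring. }
 rewrite E1 in S1.
 assert (Hcnt : forall E n, (N <= n)%nat -> rsum T (fun m => ind (E < m * n <= E + W)%nat) <= INR (W / N + 1)). {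
  intros E n Hn. rewrite (rsum_ext T _ (fun m => 1 * ind (E < m * n <= E + W)%nat)) by (intros; ring).
  etrans; [apply (interval_multiples T n E W (fun _ => 1)); [lia|intros; lra]|]. rewrite rsum_const, Rmult_1_r.
  apply le_INR. assert (W / n <= W / N)%nat by (apply Nat.div_le_compat_l; lia). lia. }
 assert (S2 : Rabs (rsum (2 * N) (fun n => v2 n * g2 n) - rsum (2 * N) (fun n => / H2 * rsum H2 (fun h => v2 (n + r *
  h)%nat) * g2 n)) <= ka * (24 * de * X + 16 * (W + N))). {
  etrans; [apply (smoothing (2 * N) r H2 v2 g2 (fun _ => ka * (de * T + 2 * INR (W / N + 1))))|].
  - lia.
  - intros; apply Hv2.
  - intros n Hn. unfold v2. rewrite ind_F by lia. ring.
  - intros n Hn. unfold v2. rewrite ind_F by lia. ring.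
  - intros n h Hn Hh Hrh Hnz. assert (HNn : (N <= n)%nat). { destruct (Nat.le_gt_cases N n) as [|Hc]; [easy|].
    exfalso. apply Hnz. unfold v2. rewrite ind_F by lia. ring. }
   unfold g2. rewrite <- rsum_minus. from rsum_abs.
   via (rsum T (fun m => ka * (de * 1 + (ind (X < m * n <= X + W)%nat + ind (Y < m * n <= Y + W)%nat)))).
   + termwise m Hm. rewrite <- Rmult_minus_distr_l, Rabs_mult, Rabs_right by (apply Rle_ge, Hw1).
    apply Rmult_le_compat; [apply Hw1|pos|apply Hw1|].
    replace (m * n)%nat with (m * (n - r * h) + r * (h * m))%nat by nia. from HG2.
    * apply Nat.le_trans with (r * H2 * (2 * X / N))%nat; [|easy]. rewrite Nat.mul_assoc.
     apply Nat.mul_le_mono; [apply Nat.mul_le_mono_l; lia|pos].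
    * mono.
   + rewrite rsum_scal. mul_l. rewrite !rsum_plus, rsum_const. have (Hcnt X n HNn). have (Hcnt Y n HNn). lra.
  - rewrite rsum_scalr. via (8 * N * (ka * (de * T + 2 * INR (W / N + 1)))).
   + mono.
   + lhs (ka * (8 * (de * (T * N)) + 16 * (INR (W / N + 1) * N))). mul_l. nra. }
 set (w2 := fun n => / H2 * rsum H2 (fun h => v2 (n + r * h)%nat)).
 assert (Hw2 : forall n, (n < 2 * N)%nat -> 0 <= w2 n <= ka * ind (N <= n + r * H2)%nat). { intros n Hn. unfold w2.
  split.
  - apply Rmult_le_pos; [pos|]. apply rsum_nonneg. intros; apply Hv2.
  - destruct (ind_cases (N <= n + r * H2)%nat) as [[Hc ->]|[Hc ->]].
   + rewrite Rmult_1_r, Rmult_comm. apply div_le; [easy|]. destruct (Nat.eq_dec (Nat.gcd n r) 1) as [Hg|Hg].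
    * etrans; [|apply (BT3 n); [lia|easy]]. apply rsum_le. intros; apply Hv2.
    * rewrite rsum_zero; [pos|]. intros h _. apply Hv2g. now rewrite gcd_shift.
   + rewrite rsum_zero; [lra|]. intros h Hh. unfold v2. rewrite ind_F; [ring|]. nia. }
 (* Averaging carries the second weight into [N - r H2, N). These n are bounded trivially, by r H2 T
    <= W + N; the bilinear hypothesis covers [N, 2 N). *)
 assert (S3 : Rabs (rsum (2 * N) (fun n => w2 n * g2 n)) <= ka ^ 2 * (W + N) + ka ^ 2 * (4 * X / sqrt D)). {
  replace (2 * N)%nat with (N + N)%nat by lia. rewrite rsum_split. from Rabs_triang. apply Rplus_le_compat.
  - from rsum_abs. via (rsum N (fun n => ind (N - r * H2 - 1 < n <= N - 1)%nat * (ka * (ka * T)))).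
   + termwise n Hn. rewrite Rabs_mult. destruct (Hw2 n ltac:(lia)) as [A1 A2]. rewrite Rabs_right by lra.
    rewrite (ind_iff (N - r * H2 - 1 < n <= N - 1)%nat (N <= n + r * H2)%nat) by lia.
    assert (Hg2 : Rabs (g2 n) <= ka * T). { from rsum_abs. rewrite Rmult_comm, <- rsum_const. termwise m _.
     rewrite Rabs_mult, Rabs_right, <- Rmult_1_r by (apply Rle_ge, Hw1).
     apply Rmult_le_compat; [apply Hw1|pos|apply Hw1|]. from HG1. apply ind_01. }
    have (Rabs_pos (g2 n)). nra.
   + rewrite interval_sum, rsum_const by lia. replace (N - 1 - (N - r * H2 - 1))%nat with (r * H2)%nat by lia.
    lhs (ka ^ 2 * (INR (r * H2) * T)). rewrite <- mult_INR, <- plus_INR. mono.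
  - set (z := rsum N _).
   assert (Ez : z = rsum T (fun m => w1 m * rsum N (fun v => w2 (N + v)%nat * G (m * (N + v))%nat))). { unfold z, g2.
    rewrite (rsum_ext N _ (fun v => rsum T (fun m => w1 m * (w2 (N + v)%nat * G (m * (N + v))%nat)))).
    - rewrite rsum_swap. ext m _. now rewrite rsum_scal.
    - intros v _. rewrite <- rsum_scal. mono. }
   assert (Hz : z ^ 2 <= (ka ^ 2 * (4 * X / sqrt D)) ^ 2). { rewrite Ez. from Hbil.
    via ((T * ka ^ 2) * ((N * ka ^ 2) * (5 * X / D))).
    - apply Rmult_le_compat.
     + pos.
     + pos.
     + rewrite <- rsum_const. termwise m _. apply pow_incr, Hw1.
     + mul_r. rewrite <- rsum_const. termwise v Hv. apply pow_incr. destruct (Hw2 (N + v)%nat ltac:(lia)) as [A1 A2].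
      have (ind_01 (N <= N + v + r * H2)%nat). nra.
    - assert (HsD : sqrt D ^ 2 = D) by (apply pow2_sqrt; lra). assert (0 < sqrt D) by pos.
     rhs (ka ^ 4 * (16 * X ^ 2 / sqrt D ^ 2)). rewrite HsD. lhs (ka ^ 4 * ((T * N) * (5 * X) / D)). mul_l. mul_r. nra. }
   assert (0 <= ka ^ 2 * (4 * X / sqrt D)). { pos. }
   rewrite <- Rabs_right by lra. apply Rsqr_le_abs_0. unfold Rsqr. lra. }
 change (fun n => / H2 * rsum H2 (fun h => v2 (n + r * h)%nat) * g2 n) with (fun n => w2 n * g2 n) in S2.
 set (q1 := rsum T (fun m => v1 m * g1 m)) in *. set (q2 := rsum (2 * N) (fun n => v2 n * g2 n)) in *.
 set (q3 := rsum (2 * N) (fun n => w2 n * g2 n)) in *.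
 assert (Hq : Rabs q1 <= Rabs (q1 - q2) + (Rabs (q2 - q3) + Rabs q3)). {
  replace q1 with ((q1 - q2) + ((q2 - q3) + q3)) at 1 by ring. mono. }
 assert (Hk1 : ka <= ka ^ 2) by nra. assert (P1 : 0 <= de * X) by pos. nra.
Qed.

Definition phase (F : ppdata) (X Y : nat) (xi om : R) (k : nat) : R := inI X Y k * cs (xi * ppval F (INR k) + om).

(* The denominator r witnesses that xi F is major at level Q0 on the scale X. *)
Definition majwit (F : ppdata) (X : nat) (Q0 xi : R) (r : nat) : Prop :=
  (1 <= r)%nat /\ r <= Q0 /\
  ((0 < nfr F)%nat -> Rabs xi * Rpower X (fex F 0%nat) <= Q0) /\
  (forall i, (1 <= i <= deg F)%nat -> near (Q0 / X ^ i) (r * (xi * co F i))).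

Lemma phase_abs F X Y xi om k : Rabs (phase F X Y xi om k) <= inI X Y k.
Proof.
 unfold phase, inI. have (ind_01 (X < k <= Y)%nat). rewrite Rabs_mult, Rabs_right by lra.
 have (cs_abs (xi * ppval F (INR k) + om)). nra.
Qed.

Lemma phase_slow F X Y xi om r W Q0 Q : ppok F -> (1 <= X)%nat -> (Y <= 2 * X)%nat -> 0 < Q ->
  majwit F X Q0 xi r -> INR W * Q <= INR X -> slow (phase F X Y xi om) X Y r W (oscc F * (Q0 / Q)).
Proof.
 intros HF HX HY HQ (Hr & HrQ & Hfr & Hpo) HW. split; [apply phase_abs|].
 assert (HQ0 : 0 <= Q0) by (have (pos_INR r); lra).
 assert (Hde : 0 <= oscc F * (Q0 / Q)) by (apply Rmult_le_pos; [apply oscc_nonneg|now apply Rdiv_le_0_compat]).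
 intros k' t Ht. set (k := (k' + r * t)%nat). have (jump_nonneg X Y W k) as Hj.
 assert (Hp : 0 <= oscc F * (Q0 / Q) * ind (k <= 2 * X)%nat) by pos.
 assert (HJ : (X < k <= X + W \/ Y < k <= Y + W)%nat -> 1 <= jump X Y W k). { unfold jump.
  have (ind_01 (X < k <= X + W)%nat). have (ind_01 (Y < k <= Y + W)%nat).
  intros [Hc|Hc]; [rewrite (ind_T _ Hc)|rewrite (ind_T (Y < k <= Y + W)%nat Hc)]; lra. }
 unfold phase, inI. have (cs_abs (xi * ppval F (INR k) + om)). have (cs_abs (xi * ppval F (INR k') + om)).
 destruct (ind_cases (X < k <= Y)%nat) as [[Hk ->]|[Hk ->]]; destruct (ind_cases (X < k' <= Y)%nat) as [[Hk' ->]|[Hk'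
  ->]].
 - rewrite !Rmult_1_l, ind_T, Rmult_1_r by lia. assert (Hq : INR (r * t) * Q <= X). { upto HW. mono. }
  have (oscillation F HF X r Q0 Q xi om HX HQ0 HQ Hr Hfr Hpo k' t ltac:(lia) ltac:(fold k; lia) Hq). fold k in H1.
  lra.
 - rewrite Rmult_0_l, Rminus_0_r, Rmult_1_l. assert (1 <= jump X Y W k) by (apply HJ; left; unfold k in *; lia). lra.
 - rewrite Rmult_0_l, Rminus_0_l, Rmult_1_l, Rabs_Ropp.
  assert (1 <= jump X Y W k) by (apply HJ; right; unfold k in *; lia). lra.
 - rewrite !Rmult_0_l, Rminus_0_r, Rabs_R0. lra.
Qed.

Lemma small_variable N0 T (G u1 u2 : nat -> R) : (1 <= N0)%nat -> (forall k, (T < k)%nat -> G k = 0) -> (forall k, Rabs (G k) <= 1) ->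
  (forall m, 0 <= u1 m <= lam m) -> (forall m, 0 <= u2 m <= lam m) ->
  Rabs (rsum N0 (fun n => u2 n * rsum (S T) (fun m => u1 m * G (m * n)%nat))) <= 4 * T * (ln N0 + 4).
Proof.
 intros HN0 HG0 HG1 Hu1 Hu2. from rsum_abs. via (4 * T * rsum (S N0) (fun d => lam d / d)). 2:{ mul_l.
  now apply mertens_upper. }
 via (4 * T * rsum N0 (fun d => lam d / d)). 2:{ mul_l. rewrite rsum_S. assert (0 <= lam N0 / N0); [|lra]. pos. }
 rewrite <- rsum_scal. termwise n Hn. rewrite Rabs_mult, Rabs_right by (apply Rle_ge, Hu2). destruct n as [|n]. {
  replace (u2 0%nat) with 0; [|specialize (Hu2 0%nat); rewrite lam_0 in Hu2; lra]. rewrite lam_0. lra. }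
 assert (Hs : Rabs (rsum (S T) (fun m => u1 m * G (m * S n)%nat)) <= 4 * (T / INR (S n))). { from rsum_abs.
  assert (T / S n <= T)%nat by (apply Nat.Div0.div_le_upper_bound; nia).
  rewrite (rsum_trunc (S (T / S n)) (S T)); [|lia|].
  - via (psi (T / S n)).
   + termwise m _. rewrite Rabs_mult, Rabs_right by (apply Rle_ge, Hu1). specialize (HG1 (m * S n)%nat).
    specialize (Hu1 m). nra.
   + from psi_upper. mul_l. apply le_div; [pos|]. rewrite <- mult_INR. apply le_INR. rewrite Nat.mul_comm.
    apply Nat.Div0.mul_div_le.
  - intros m Hm. rewrite HG0; [rewrite Rmult_0_r, Rabs_R0; easy|]. have (le_div_iff T m (S n) ltac:(lia)). lia. }
 rhs (lam (S n) * (4 * (T / INR (S n)))). apply Rmult_le_compat; auto; [apply Hu2|pos|apply Hu2].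
Qed.

Lemma mul_ge_1 a b : (1 <= a)%nat -> (1 <= b)%nat -> (1 <= a * b)%nat.
Proof. nia. Qed.

(** W is about X / q, M N about X, and H steps of length 2 r N fill W, so H is at least M / (10 q
    r). [brun_titchmarsh] needs such a lower bound for the length of the progression; the next lemma
    is its analogue for the second variable. *)
Lemma window_first X M N q r W H : (1 <= N)%nat -> (M * N <= X)%nat -> (X < q * (W + 1))%nat -> (W < 2 * r * N * H + 2 * r * N)%nat ->
  (10 * (q * r) <= M)%nat -> (M <= 10 * (q * r) * H)%nat /\ (1 <= H)%nat.
Proof. intros HN HM HX HW HB. nia. Qed.

Lemma window_second X M N V q r W H : (1 <= M)%nat -> (M * N <= X)%nat -> (X < q * (W + 1))%nat -> (W < r * V * H + r * V)%nat -> (V <= 3 * M)%nat ->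
  (10 * (q * r) <= N)%nat -> (N <= 10 * (q * r) * H)%nat /\ (1 <= H)%nat.
Proof. intros HM HN HX HW HV HB. nia. Qed.

Lemma window_short X M N V q r W H : (1 <= M)%nat -> (X < M * N + N)%nat -> (r * V * H <= W)%nat -> (q * W <= X)%nat -> (2 <= q)%nat ->
  (2 * M <= V)%nat -> (r * H < N)%nat.
Proof. intros HM HX HW Hq Hq2 HV. nia. Qed.

Lemma window_unit X M N q W : (1 <= N)%nat -> (M * N <= X)%nat -> (X < q * (W + 1))%nat -> (M <= q * (W / N + 1))%nat.
Proof. intros HN HM HX. euclid W N as E Hm. nia. Qed.

Lemma square_scale X N : (64 <= N)%nat -> (N * N <= 2 * X)%nat ->
  (N <= X)%nat /\ (N <= 4 * (X / N))%nat /\ (X / N <= X)%nat /\ (X / N * N <= X < X / N * N + N)%nat /\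
  (2 * (X / N) <= 2 * X / N <= 2 * (X / N) + 1)%nat.
Proof.
 intros HN HX. euclid X N as E Hm.
 assert (Hd : (2 * (X / N) <= 2 * X / N <= 2 * (X / N) + 1)%nat) by (apply floor_double; lia). nia.
Qed.

(** Shifts up to X / D^(2C+1), with oscillation level D^(2C), make the variation of the phase 1 / D.
    The assumption on D^(4C+1) keeps r and the shortening of the progressions below L^A, and N >= 4
    exp (sqrt L) puts both N and X / N into the range of [brun_titchmarsh]. *)
Lemma block_major F : ppok F -> exists C0 : nat, forall C, (C0 <= C)%nat -> forall A, exists K X0, 1 <= X0 /\ 0 <= K /\
  forall D (X Y N r : nat) xi om (u1 u2 : nat -> R),
  2 <= D -> X0 <= X -> (Y <= 2 * X)%nat -> Rabs xi <= X ->
  let L := ln (2 * X) in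
  40 * D ^ (4 * C + 1) <= L ^ A ->
  ~ Maj F (INR X) (D ^ C) xi -> majwit F X (D ^ (2 * C)) xi r ->
  4 * exp (sqrt L) <= N -> (N * N <= 2 * X)%nat ->
  (forall m, 0 <= u1 m <= lam m * ind (coprime m r)) -> (forall m, 0 <= u2 m <= lam m * ind (coprime m r)) ->
  Rabs (rsum (2 * X / N + 1) (fun m => u1 m * rsum N (fun v => u2 (N + v)%nat * phase F X Y xi om (m * (N + v)))))
  <= K * lg r ^ 2 * X / sqrt D.
Proof.
 intros HF. destruct (bilinear F HF) as (C0 & X1 & HX1 & HB). exists (S C0). intros C HC A.
 destruct (brun_titchmarsh A) as (L0 & HL0 & HBT). destruct (log_scale (A + 3)) as (L1 & HL1 & HLs).
 exists (141 ^ 2 * (120 * oscc F + 70)), (X1 + exp L0 + exp L1 + 8). have (exp_pos L0). have (exp_pos L1).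
 have (oscc_nonneg F) as Hosc. split; [lra|]. split; [lra|].
 intros D X Y N r xi om u1 u2 HD HX HY Hxi L HDL Hmaj Hwit HN HN2 Hu1 Hu2.
 assert (HL : L0 + L1 <= 2 * L /\ L0 <= L /\ L1 <= L). { assert (L0 <= L) by (apply le_ln; lra).
  assert (L1 <= L) by (apply le_ln; lra). lra. }
 destruct (HLs L ltac:(lra)) as [HE _]. set (s := sqrt L) in *.
 assert (HD0 : forall a, 0 < D ^ a) by (intros; apply pow_pos_2; lra). assert (HLA : 1 <= L ^ A) by pos.
 destruct Hwit as (Hr & HrQ & Hw). have (conj Hr (conj HrQ Hw) : majwit F X (D ^ (2 * C)) xi r) as Hwit.
 assert (Hr1 : 1 <= r) by inr.
 (* W = X / q with q close to D ^ (2 C + 1) *)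
 destruct (nfloor (D ^ (2 * C + 1))) as (q0 & Hq1 & Hq2); [pos|]. set (q := S q0).
 assert (HqR : INR q = q0 + 1) by (unfold q; apply S_INR). assert (HD1 : 1 <= D ^ (2 * C + 1)) by pos.
 assert (Hqlo : D ^ (2 * C + 1) <= q) by lra. set (W := (X / q)%nat). assert (HWq : W * q <= X). {
  rewrite <- mult_INR. apply le_INR. rewrite Nat.mul_comm. apply Nat.mul_div_le. lia. }
 assert (HWQ : W * D ^ (2 * C + 1) <= X). { upto HWq. mono. }
 assert (HqrL : 10 * (q * r) <= L ^ A / 2). { via (20 * D ^ (4 * C + 1)); [|lra].
  rhs (10 * (2 * D ^ (2 * C + 1) * D ^ (2 * C))) by (rewrite <- Rmult_1_l; replace (4 * C + 1)%nat with ((2 * C + 1) +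
   2 * C)%nat by lia; rewrite !pow_add; ring). mono. }
 assert (Hq2' : (2 <= q)%nat). { apply INR_le. simpl (INR 2). upto Hqlo. via (D ^ 1); [lra|]. mono. }
 assert (HNL : 8 * L ^ (A + 3) <= N) by lra. assert (HNLA : 8 * (L ^ A * 8) <= N). { upto HNL. rewrite pow_add.
  assert (8 <= L ^ 3) by (replace 8 with (2 ^ 3) by ring; apply pow_incr; lra). nra. }
 assert (HN1 : (64 <= N)%nat) by inr. assert (HqrN : (40 * (q * r) <= N)%nat). { apply INR_le. rewrite !mult_INR.
  replace (INR 40) with 40 by inr. lra. }
 set (M := (X / N)%nat). destruct (square_scale X N HN1 HN2) as (HNX & HMN & HMX & HMNX & Hdiv2).
 fold M in HMN, HMX, HMNX, Hdiv2. assert (HrL : r <= L ^ A). { assert (r * 1 <= r * q) by mono. lra. }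
 assert (HlnX : forall k, (1 <= k <= 2 * X)%nat -> ln k <= L). { intros k Hk. unfold L.
  replace (2 * X) with (INR (2 * X)) by inr. mono. }
 assert (HsN : s <= ln N <= L). { split; [|apply HlnX; lia]. rewrite <- (ln_exp s). mono. }
 assert (HsM : s <= ln M <= L). { split; [|apply HlnX; lia]. rewrite <- (ln_exp s). apply ln_le; [pos|].
  apply le_INR in HMN. rewrite mult_INR in HMN. replace (INR 4) with 4 in HMN by inr. lra. }
 set (H1 := (W / (2 * r * N))%nat). set (H2 := (W / (r * (2 * X / N)))%nat). euclid X q as Edq Emq.
 assert (HWlo : (X < q * (W + 1))%nat) by lia.
 assert (HWX' : (W <= X)%nat) by (assert (1 * W <= q * W)%nat by (apply Nat.mul_le_mono_r; lia); lia).
 assert (HrV1 : (1 <= r * (2 * X / N))%nat) by (apply mul_ge_1; lia).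
 assert (HH1a : (2 * r * N * H1 <= W)%nat) by (apply Nat.mul_div_le; lia).
 assert (HH1b : (W < 2 * r * N * H1 + 2 * r * N)%nat). { have (Nat.div_mod_eq W (2 * r * N)) as E1.
  have (Nat.mod_upper_bound W (2 * r * N) ltac:(lia)). lia. }
 assert (HH2a : (r * (2 * X / N) * H2 <= W)%nat) by (apply Nat.mul_div_le; lia).
 assert (HH2b : (W < r * (2 * X / N) * H2 + r * (2 * X / N))%nat). { have (Nat.div_mod_eq W (r * (2 * X / N))) as E1.
  have (Nat.mod_upper_bound W (r * (2 * X / N)) ltac:(lia)). lia. }
 destruct (window_first X M N q r W H1) as [HH1c HH1d]; try easy; try lia.
 destruct (window_second X M N (2 * X / N) q r W H2) as [HH2c HH2d]; try easy; try lia.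
 assert (HLA1 : forall a H, (a <= 10 * (q * r) * H)%nat -> a <= H * L ^ A). { intros a H' Ha. apply le_INR in Ha.
  rewrite !mult_INR in Ha. replace (INR 10) with 10 in Ha by inr. assert (H' * (10 * (q * r)) <= H' * L ^ A) by mono.
  lra. }
 assert (HrH2 : (r * H2 < N)%nat) by (apply (window_short X M N (2 * X / N) q r W H2); lia). have (lg_ge_1 r) as Hlg.
 set (de := oscc F * (D ^ (2 * C) / D ^ (2 * C + 1))). assert (Ede : de = oscc F / D). { unfold de.
  rewrite pow_add, pow_1. field; lra. }
 assert (Hblock : Rabs (rsum (2 * X / N + 1) (fun m => u1 m * rsum N (fun v => u2 (N + v)%nat * phase F X Y xi om (m *
  (N + v))))) <= (141 * lg r) ^ 2 * (120 * de * X + 33 * (W + N) + 4 * X / sqrt D)). {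
  apply (block (phase F X Y xi om) X Y N r W H1 H2); auto; try lra; try lia.
  - rewrite Ede. pos.
  - apply phase_slow; auto; lia.
  - intros m Hm. rewrite (rsum_ext _ _ (fun h => lam (m + 1 * h))) by (intros; do 2 f_equal; lia).
   assert (HWN : (M <= 10 * (q * r) * (W / N + 1))%nat). { have (window_unit X M N q W ltac:(lia) ltac:(lia) HWlo).
    assert (q * (W / N + 1) <= q * r * (W / N + 1))%nat; [|lia]. apply Nat.mul_le_mono_r. rewrite <- Nat.mul_1_r at 1.
    now apply Nat.mul_le_mono_l. }
   etrans; [apply (HBT L M 1%nat); auto; try lra|].
   + lia.
   + apply Nat.divide_1_r, Nat.gcd_divide_r.
   + assert (W / N <= M)%nat by (now apply Nat.Div0.div_le_mono). lia.
   + mono.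
  - intros m Hm Hg. apply (HBT L M r); auto; try lra; [lia|]. assert (r * H1 <= M)%nat; [|lia].
   apply Nat.div_le_lower_bound; lia.
  - intros m Hm Hg. apply (HBT L N r); auto; try lra; [lia|]. lia.
  - intros a b. have (HB D X Y N xi om a b HD ltac:(lra)) as Hb. upto Hb; auto.
   + right. f_equal. ext m _. f_equal. ext v _. unfold phase, inI. rewrite mult_INR. ring.
   + via (1 * D ^ (4 * C + 1)); [rewrite Rmult_1_l; mono|]. lra.
   + apply le_INR in HN2. rewrite !mult_INR in HN2. simpl (INR 2) in HN2. lra.
   + intros Hc. apply (Maj_mono _ _ _ (D ^ C)) in Hc; [easy|lra|]. mono. }
 from Hblock. assert (HsD : 0 < sqrt D) by pos. assert (HsD2 : sqrt D * sqrt D = D) by (apply sqrt_sqrt; lra).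
 assert (HiD : / D <= / sqrt D) by (apply Rinv_le_contravar; nra). set (y := X / sqrt D).
 assert (Hy : X * / D <= y) by (apply Rmult_le_compat_l; lra). assert (B1 : de * X <= oscc F * y). { rewrite Ede.
  lhs (oscc F * (X * / D)). mono. }
 assert (B2 : W <= y). { upto Hy. apply le_div_inv_r; [lra|]. upto HWQ. mul_l. rewrite <- pow_1 at 1. mono. }
 assert (B3 : N <= y). { upto Hy. apply le_div_inv_r; [lra|]. via (N * (N / 2)); [mul_l|].
  - via (1 * D ^ (4 * C + 1)).
   + rewrite Rmult_1_l. rewrite <- pow_1 at 1. mono.
   + lra.
  - apply le_INR in HN2. rewrite !mult_INR in HN2. simpl (INR 2) in HN2. lra. }
 rhs ((141 * lg r) ^ 2 * ((120 * oscc F + 70) * y)) by (unfold y; field; lra). mul_l.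
 replace (4 * X / sqrt D) with (4 * y) by (unfold y; field; lra). lra.
Qed.

Lemma phase_0 F X Y xi om k : ~ (X < k <= Y)%nat -> phase F X Y xi om k = 0.
Proof. intros H. unfold phase, inI. rewrite ind_F by easy. ring. Qed.

(** About L dyadic ranges of n, each with the bound of [block_major]. The trivial size of the sum is
    X L, so the number of ranges is not a loss. Values of n below about 4 exp (sqrt L) are left to
    [small_variable]. *)
Lemma half_major F : ppok F -> exists C0 : nat, forall C, (C0 <= C)%nat -> forall A, exists K X0, 1 <= X0 /\ 0 <= K /\
  forall D (X Y r : nat) xi om (u1 u2 : nat -> R),
  2 <= D -> X0 <= X -> (Y <= 2 * X)%nat -> Rabs xi <= X ->
  let L := ln (2 * X) in
  40 * D ^ (4 * C + 1) <= L ^ A ->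
  ~ Maj F (INR X) (D ^ C) xi -> majwit F X (D ^ (2 * C)) xi r ->
  (forall m, 0 <= u1 m <= lam m * ind (coprime m r)) -> (forall m, 0 <= u2 m <= lam m * ind (coprime m r)) ->
  Rabs (rsum (S (Nat.sqrt (2 * X))) (fun n => u2 n * dsum X (fun m => u1 m * phase F X Y xi om (m * n))))
  <= X * (K * L * lg r ^ 2 / sqrt D + 72 * sqrt L).
Proof.
 intros HF. destruct (block_major F HF) as (C0 & HB). exists C0. intros C HC A.
 destruct (HB C HC A) as (K & X0 & HX0 & HK & HBl). exists (3 * K), (X0 + exp 2). have (exp_pos 2). split; [lra|].
 split; [lra|]. intros D X Y r xi om u1 u2 HD HX HY Hxi L HDL Hmaj Hwit Hu1 Hu2. assert (HX1 : (1 <= X)%nat) by inr.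
 assert (HL2 : 2 <= L) by (apply le_ln; lra). set (s := sqrt L).
 assert (Hs : 1 <= s) by (rewrite <- sqrt_1; apply sqrt_le_1_alt; lra). set (Rn := Nat.sqrt (2 * X)).
 have (Nat.sqrt_spec (2 * X) ltac:(lia)) as [HR1 HR2]. assert (HRn1 : (1 <= Rn)%nat) by lia.
 assert (HRn2 : (Rn <= 2 * X)%nat) by (assert (Rn * 1 <= Rn * Rn)%nat by (now apply Nat.mul_le_mono_l); lia).
 have (exp_pos s) as Hes. destruct (nfloor (4 * exp s)) as (n0 & Hn1 & Hn2); [lra|]. set (N0 := S n0).
 assert (HN0R : INR N0 = n0 + 1) by (unfold N0; apply S_INR).
 assert (Hes1 : 1 <= exp s) by (have (exp_ineq1_le s); lra). assert (HlN0 : ln N0 <= s + 4). {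
  via (ln (exp s * 5)); [mono|]. rewrite ln_mult, ln_exp by lra. have (ln_le_sub 5). lra. }
 set (G := phase F X Y xi om) in *.
 assert (HG0 : forall k, (2 * X < k)%nat -> G k = 0) by (intros; apply phase_0; lia).
 assert (HG1 : forall k, Rabs (G k) <= 1) by (intros; upto ind_01; apply phase_abs).
 set (v2 := fun n => ind (n <= Rn)%nat * u2 n). assert (Hv2 : forall m, 0 <= v2 m <= lam m * ind (coprime m r)). {
  intros m. unfold v2. have (ind_01 (m <= Rn)%nat). specialize (Hu2 m). nra. }
 assert (Hlam : forall u : nat -> R, (forall m, 0 <= u m <= lam m * ind (coprime m r)) -> forall m, 0 <= u m <= lam
  m). { intros u Hu m. specialize (Hu m). have (ind_01 (coprime m r)). have (lam_nonneg m). nra. }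
 set (g := fun n => dsum X (fun m => u1 m * G (m * n)%nat)). set (I := S (Nat.log2 Rn)).
 assert (HI : I <= 3 * L) by (apply log2_bound; auto). have (Nat.log2_spec Rn ltac:(lia)) as [_ Hl2]. fold I in Hl2.
 assert (HIN : (S Rn <= 2 ^ I * N0)%nat). { lia. }
 assert (E : rsum (S Rn) (fun n => u2 n * g n) = rsum (2 ^ I * N0) (fun n => v2 n * g n)). {
  rewrite (rsum_trunc (S Rn) (2 ^ I * N0)) by (auto; intros n Hn; unfold v2; rewrite ind_F by lia; ring). ext n Hn.
  unfold v2. rewrite ind_T by lia. ring. }
 change (Rabs (rsum (S Rn) (fun n => u2 n * g n)) <= X * (3 * K * L * lg r ^ 2 / sqrt D + 72 * s)).
 rewrite E, dyadic_sum. from Rabs_triang. assert (B1 : Rabs (rsum N0 (fun n => v2 n * g n)) <= X * (72 * s)). {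
  etrans; [apply small_variable; auto; unfold N0; lia|]. rewrite mult_INR. simpl (INR 2). nra. }
 assert (Hbp : 0 <= K * lg r ^ 2 * X / sqrt D). { pos. }
 assert (B2 : Rabs (rsum I (fun i => rsum (2 ^ i * N0) (fun u => v2 (2 ^ i * N0 + u)%nat * g (2 ^ i * N0 + u)%nat)))
  <= I * (K * lg r ^ 2 * X / sqrt D)). { from rsum_abs. rewrite <- rsum_const. termwise i Hi.
  set (N := (2 ^ i * N0)%nat). assert (HNN : (N0 <= N)%nat). { rewrite <- Nat.mul_1_l at 1. apply Nat.mul_le_mono_r.
   have (Nat.pow_nonzero 2 i). lia. }
  destruct (Nat.le_gt_cases N Rn) as [Hc|Hc]. 2:{ rewrite rsum_zero; [rewrite Rabs_R0; easy|]. intros u Hu. unfold v2.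
   rewrite ind_F by lia. ring. }
  assert (HT : (2 * X / N <= 2 * X)%nat). { apply Nat.Div0.div_le_upper_bound. nia. }
  assert (Es : rsum N (fun u => v2 (N + u)%nat * g (N + u)%nat) = rsum (2 * X / N + 1) (fun m => u1 m * rsum N (fun v
   => v2 (N + v)%nat * G (m * (N + v))%nat))). {
   rewrite (rsum_ext N _ (fun v => rsum (2 * X / N + 1) (fun m => u1 m * (v2 (N + v)%nat * G (m * (N + v))%nat)))).
   - rewrite rsum_swap. ext m _. now rewrite rsum_scal.
   - intros v Hv. unfold g. rewrite (rsum_trunc (2 * X / N + 1) (S (2 * X))); [|lia|].
    + rewrite <- rsum_scal. mono.
    + intros m Hm. rewrite HG0; [ring|]. assert (2 * X < m * N)%nat by (apply div_lt_iff; lia). lia. }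
  rewrite Es. apply HBl; auto; try lra.
  - fold L s. apply le_INR in HNN. lra.
  - nia. }
 nra.
Qed.

Definition lamr (r m : nat) : R := lam m * ind (coprime m r).

Lemma lamr_bounds r m : 0 <= lamr r m <= lam m * ind (coprime m r).
Proof. unfold lamr. have (lam_nonneg m). have (ind_01 (coprime m r)). nra. Qed.

Lemma hyperbola (X : nat) (u G : nat -> R) : (forall k, (2 * X < k)%nat -> G k = 0) -> (1 <= X)%nat ->
  let Rn := Nat.sqrt (2 * X) in
  dsum X (fun m => dsum X (fun n => u m * u n * G (m * n)%nat))
  = rsum (S Rn) (fun n => u n * dsum X (fun m => u m * G (m * n)%nat))
  + rsum (S Rn) (fun m => u m * dsum X (fun n => (ind (Rn < n)%nat * u n) * G (n * m)%nat)).
Proof.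
 intros HG HX Rn. have (Nat.sqrt_spec (2 * X) ltac:(lia)) as [HR1 HR2]. fold Rn in HR1, HR2.
 assert (HRn2 : (Rn <= 2 * X)%nat) by (destruct Rn; [lia|]; assert (S Rn * 1 <= S Rn * S Rn)%nat by (apply
  Nat.mul_le_mono_l; lia); lia). set (t := fun m n => u m * u n * G (m * n)%nat).
 rewrite (rsum_ext (S (2 * X)) _ (fun m => dsum X (fun n => ind (n <= Rn)%nat * t m n) + rsum (S (2 * X)) (fun n =>
  ind (Rn < n)%nat * t m n))). 2:{ intros m _. rewrite <- rsum_plus. ext n _. fold (t m n).
  destruct (Nat.le_gt_cases n Rn); [rewrite ind_T, ind_F by lia; ring|rewrite ind_F, ind_T by lia; ring]. }
 rewrite rsum_plus. f_equal.
 - rewrite rsum_swap. rewrite (rsum_trunc (S Rn) (S (2 * X))); [|lia|].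
  + ext n Hn. rewrite <- rsum_scal. ext m Hm. rewrite ind_T by lia. unfold t. ring.
  + intros n Hn. apply rsum_zero. intros m _. rewrite ind_F by lia. ring.
 - rewrite (rsum_trunc (S Rn) (S (2 * X))); [|lia|].
  + ext m Hm. rewrite <- rsum_scal. ext n Hn. unfold t. rewrite (Nat.mul_comm n m). ring.
  + intros m Hm. apply rsum_zero. intros n _.
   destruct (Nat.lt_ge_cases Rn n) as [Hc|Hc]; [|rewrite ind_F by lia; ring]. unfold t. rewrite HG; [ring|]. nia.
Qed.

Lemma lam_lam_major F : ppok F -> exists C0 : nat, forall C, (C0 <= C)%nat -> forall A, exists K X0, 1 <= X0 /\ 0 <= K /\
  forall D (X Y r : nat) xi om,
  2 <= D -> X0 <= X -> (Y <= 2 * X)%nat -> Rabs xi <= X ->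
  let L := ln (2 * X) in
  40 * D ^ (4 * C + 1) <= L ^ A ->
  ~ Maj F (INR X) (D ^ C) xi -> majwit F X (D ^ (2 * C)) xi r ->
  Rabs (dsum X (fun m => dsum X (fun n => lamr r m * lamr r n * phase F X Y xi om (m * n))))
  <= X * (K * L * lg r ^ 2 / sqrt D + 144 * sqrt L).
Proof.
 intros HF. destruct (half_major F HF) as (C0 & HB). exists C0. intros C HC A.
 destruct (HB C HC A) as (K & X0 & HX0 & HK & HBl). exists (2 * K), X0. split; [lra|]. split; [lra|].
 intros D X Y r xi om HD HX HY Hxi L HDL Hmaj Hwit. assert (HX1 : (1 <= X)%nat) by inr.
 rewrite hyperbola by (auto; intros; apply phase_0; lia). from Rabs_triang.
 have (HBl D X Y r xi om (lamr r) (lamr r) HD HX HY Hxi HDL Hmaj Hwit (lamr_bounds r) (lamr_bounds r)) as H1.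
 have (HBl D X Y r xi om (fun n => ind (Nat.sqrt (2 * X) < n)%nat * lamr r n) (lamr r) HD HX HY Hxi HDL Hmaj Hwit) as
  H2. assert (H3 : forall m, 0 <= ind (Nat.sqrt (2 * X) < m)%nat * lamr r m <= lam m * ind (coprime m r)). { intros m.
  have (ind_01 (Nat.sqrt (2 * X) < m)%nat). have (lamr_bounds r m). nra. }
 specialize (H2 H3 (lamr_bounds r)). fold L in H1, H2. lra.
Qed.

(** * Single sums over reduced residues and Selberg's weights *)

Lemma scale_window (X r : nat) Q : 1 <= Q -> (1 <= r)%nat -> 8 * Q * r <= X ->
  exists W H : nat, (1 <= H)%nat /\ (r * H <= W)%nat /\ (W <= X)%nat /\ W * Q <= X /\ X <= 4 * Q * r * H.
Proof.
 intros HQ Hr HX. destruct (nfloor Q) as (q0 & Hq1 & Hq2); [lra|]. set (q := S q0).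
 assert (HqR : INR q = q0 + 1) by (unfold q; apply S_INR). set (W := (X / q)%nat). set (H := (W / r)%nat).
 exists W, H. have (Nat.div_mod_eq X q) as E1. have (Nat.mod_upper_bound X q ltac:(unfold q; lia)) as M1.
 euclid W r as E2 M2. assert (HW : W * q <= X) by (rewrite <- mult_INR; apply le_INR; lia).
 assert (H1 : X <= q * (W + 1)). { rewrite <- S_INR, <- mult_INR. mono. }
 assert (H2 : W + 1 <= r * (H + 1)). { rewrite <- !S_INR, <- mult_INR. mono. }
 have (pos_INR W) as HW0. have (pos_INR H) as HH0. assert (H3 : X <= 2 * Q * (r * (H + 1))). { nra. }
 assert (HH : (1 <= H)%nat). { destruct (Nat.eq_dec H 0) as [E0|]; [|lia]. rewrite E0 in H3. simpl (INR 0) in H3. nra. }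
 split; [easy|]. split; [pos|]. split. { lia. }
 nra.
Qed.

(** [smoothing] for a single variable; the weight is first cut to (X, 3 X], which contains every
    shift of the support of G. *)
Lemma smooth_scale (G u : nat -> R) X Y r W H de : slow G X Y r W de -> (Y <= 2 * X)%nat -> (W <= X)%nat -> (1 <= H)%nat -> (r * H <= W)%nat ->
  (forall k, (X < k)%nat -> 0 <= u k) ->
  Rabs (dsum X (fun k => u k * G k) - dsum X (fun k => / H * rsum H (fun h => u (k + r * h)%nat) * G k))
  <= de * dsum X (fun k => ind (X < k)%nat * u k) + rsum (S (3 * X)) (fun k => ind (X < k)%nat * u k * jump X Y W k).
Proof.
 intros [HG1 HG2] HY HW HH HrH Hu. assert (HG0 : forall k, ~ (X < k <= Y)%nat -> G k = 0). { intros k Hk.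
  specialize (HG1 k). unfold inI in HG1. rewrite ind_F in HG1 by easy. apply Rabs_le_between in HG1. lra. }
 set (v := fun k => ind (X < k <= 3 * X)%nat * u k). assert (Hv : forall k, 0 <= v k). { intros k. unfold v.
  destruct (ind_cases (X < k <= 3 * X)%nat) as [[Hk ->]|[_ ->]]; [|lra]. specialize (Hu k ltac:(lia)). lra. }
 have (smoothing (S (3 * X)) r H v G (fun k => de * ind (k <= 2 * X)%nat + jump X Y W k)) as Hs.
 assert (E1 : rsum (S (3 * X)) (fun m => v m * G m) = dsum X (fun k => u k * G k)). {
  rewrite (rsum_trunc (S (2 * X)) (S (3 * X))); [|lia|intros i Hi; rewrite HG0 by lia; ring]. ext k Hk. unfold v.
  destruct (Nat.lt_ge_cases X k); [rewrite ind_T by lia; ring|rewrite HG0 by lia; ring]. }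
 assert (E2 : rsum (S (3 * X)) (fun m => / H * rsum H (fun h => v (m + r * h)%nat) * G m) = dsum X (fun k => / H *
  rsum H (fun h => u (k + r * h)%nat) * G k)). {
  rewrite (rsum_trunc (S (2 * X)) (S (3 * X))); [|lia|intros i Hi; rewrite HG0 by lia; ring]. ext k Hk.
  destruct (Nat.lt_ge_cases X k) as [Hc|Hc]; [|rewrite HG0 by lia; ring]. do 2 f_equal. ext h Hh. unfold v.
  rewrite ind_T; [ring|]. nia. }
 rewrite E1, E2 in Hs. from Hs.
 - lia.
 - easy.
 - intros m Hm. unfold v. rewrite ind_F by lia. ring.
 - intros m Hm. unfold v. rewrite ind_F by lia. ring.
 - intros m h Hm Hh Hrh _. replace m with ((m - r * h) + r * h)%nat at 1 3 4 by lia. apply HG2. nia.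
 -
  rewrite (rsum_ext _ _ (fun k => de * (ind (k <= 2 * X)%nat * v k) + v k * jump X Y W k)), rsum_plus, rsum_scal by
   (intros; ring). right. f_equal; [f_equal|].
  + rewrite (rsum_trunc (S (2 * X)) (S (3 * X))); [|lia|intros i Hi; rewrite ind_F by lia; ring]. ext k Hk.
   rewrite ind_T by lia. unfold v. rewrite (ind_iff (X < k <= 3 * X)%nat (X < k)%nat) by lia. ring.
  + ext k Hk. unfold v. rewrite (ind_iff (X < k <= 3 * X)%nat (X < k)%nat) by lia. ring.
Qed.

Lemma jump_sum (T X Y W : nat) (u : nat -> R) B : (forall k, (X < k)%nat -> 0 <= u k) -> (X <= Y)%nat -> (X < T)%nat ->
  (forall E, (E = X \/ E = Y) -> rsum W (fun h => u (E + 1 + h)%nat) <= B) ->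
  rsum T (fun k => ind (X < k)%nat * u k * jump X Y W k) <= 2 * B.
Proof.
 intros Hu HXY HT HB.
 assert (HE : forall E, (X <= E)%nat -> rsum T (fun k => ind (X < k)%nat * u k * ind (E < k <= E + W)%nat) <= rsum W
  (fun h => u (E + 1 + h)%nat)). { intros E HE. via (rsum (T + S (E + W)) (fun k => ind (E < k <= E + W)%nat * u k)).
  - via (rsum T (fun k => ind (E < k <= E + W)%nat * u k)).
   + termwise k _. destruct (ind_cases (E < k <= E + W)%nat) as [[Hk ->]|[_ ->]]; [rewrite ind_T by lia; lra|lra].
   + apply rsum_mono_n; [lia|]. intros k _. destruct (ind_cases (E < k <= E + W)%nat) as [[Hk ->]|[_ ->]]; [|lra].
    specialize (Hu k ltac:(lia)). lra.
  - rewrite interval_sum by lia. replace (E + W - E)%nat with W by lia. lra. }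
 unfold jump.
 rewrite (rsum_ext _ _ (fun k => ind (X < k)%nat * u k * ind (X < k <= X + W)%nat + ind (X < k)%nat * u k * ind (Y < k
  <= Y + W)%nat)), rsum_plus by (intros; ring). have (HE X ltac:(lia)). have (HE Y HXY). have (HB X ltac:(auto)).
 have (HB Y ltac:(auto)). lra.
Qed.

Lemma gcd_mul_1 m n r : coprime (m * n) r <-> coprime m r /\ coprime n r.
Proof.
 split.
 - intros H. split; apply Nat.divide_1_r; rewrite <- H; apply Nat.gcd_greatest; try apply Nat.gcd_divide_r.
  + apply Nat.divide_mul_l, Nat.gcd_divide_l.
  + apply Nat.divide_mul_r, Nat.gcd_divide_l.
 - intros [H1 H2]. set (g := Nat.gcd (m * n) r). assert (Hg1 : Nat.divide g (m * n)) by apply Nat.gcd_divide_l.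
  assert (Hg2 : Nat.divide g r) by apply Nat.gcd_divide_r. assert (Hgm : coprime g m). { apply Nat.divide_1_r.
   rewrite <- H1. apply Nat.gcd_greatest; [apply Nat.gcd_divide_r|].
   eapply Nat.divide_trans; [apply Nat.gcd_divide_l|easy]. }
  apply Nat.gauss in Hg1; [|easy]. apply Nat.divide_1_r. rewrite <- H2. now apply Nat.gcd_greatest.
Qed.

Lemma count_multiples_interval n E W : (1 <= n)%nat -> rsum W (fun h => ind (Nat.divide n (E + 1 + h))) <= W / n + 1.
Proof.
 intros Hn. have (ap_count (E + 1) 1 n W ltac:(lia) Hn (Nat.divide_1_r _ (Nat.gcd_divide_r n 1))) as H.
 rewrite (rsum_ext W _ (fun h => ind (Nat.divide n (E + 1 + 1 * h)))) by (intros; do 2 f_equal; lia).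
 apply Rabs_le_between in H. lra.
Qed.

(** A bilinear substitute for the indicator of the integers coprime to r: on such k it counts the
    divisors in [N, 2N). Its mean along progressions modulo r is constant on the reduced residues,
    while its sum against a phase is a double sum with bounded coefficients. *)
Definition rho (N r k : nat) : R :=
  ind (coprime k r) * rsum N (fun v => ind (coprime (N + v) r) * ind (Nat.divide (N + v) k)).

Lemma rho_nonneg N r k : 0 <= rho N r k.
Proof. apply Rmult_le_pos; [pos|]. pos. Qed.

Lemma rho_interval N r E W : (1 <= N)%nat -> rsum W (fun h => rho N r (E + 1 + h)) <= W + N.
Proof.
 intros HN. assert (HN0 : 0 < N) by pos.
 via (rsum W (fun h => rsum N (fun v => ind (Nat.divide (N + v) (E + 1 + h))))).
 - termwise h _. unfold rho. set (z := rsum N (fun v => ind (Nat.divide (N + v) (E + 1 + h)))).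
  assert (Hz : 0 <= rsum N (fun v => ind (coprime (N + v) r) * ind (Nat.divide (N + v) (E + 1 + h))) <= z). {
   split; [pos|]. termwise v _. mono. }
  have (ind_01 (coprime (E + 1 + h) r)). nra.
 - rewrite rsum_swap. via (rsum N (fun _ => W / N + 1)).
  + termwise v _. etrans; [apply count_multiples_interval; lia|]. mono.
  + rewrite rsum_const. right. field. lra.
Qed.

Lemma rho_window N r k H : (1 <= N)%nat -> (1 <= r)%nat -> (1 <= H)%nat ->
  Rabs (/ H * rsum H (fun h => rho N r (k + r * h))
  - ind (coprime k r) * rsum N (fun v => ind (coprime (N + v) r) * / INR (N + v))) <= N / H.
Proof.
 intros HN Hr HH. assert (HHR : 0 < H) by pos. unfold rho.
 rewrite (rsum_ext H _ (fun h => ind (coprime k r) * rsum N (fun v => ind (coprime (N + v) r) * ind (Nat.divide (N +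
  v) (k + r * h))))). 2:{ intros h _. now rewrite gcd_shift. }
 rewrite rsum_scal, rsum_swap.
 replace (/ H * (ind (coprime k r) * rsum N (fun j => rsum H (fun i => ind (coprime (N + j) r) * ind (Nat.divide (N +
  j) (k + r * i))))) - ind (coprime k r) * rsum N (fun v => ind (coprime (N + v) r) * / INR (N + v))) with (ind
  (coprime k r) * rsum N (fun v => / H * (rsum H (fun i => ind (Nat.gcd (N + v) r = 1%nat) * ind (Nat.divide (N + v)
  (k + r * i))) - ind (coprime (N + v) r) * (H / INR (N + v))))). 2:{
  rewrite rsum_scal, rsum_minus, (rsum_ext N (fun i => ind _ * (H / INR (N + i))) (fun v => H * (ind (Nat.gcd (N + v)
   r = 1%nat) * / INR (N + v)))), rsum_scal by (intros; unfold Rdiv; ring). field. lra. }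
 rewrite Rabs_mult, Rabs_right by pos. via (1 * (N / H)); [|lra]. apply Rmult_le_compat; [pos|pos|pos|].
 from rsum_abs. unfold Rdiv. rewrite <- rsum_const. termwise v Hv. rewrite Rabs_mult, Rabs_right by pos.
 rewrite <- (Rmult_1_r (/ INR H)) at 2. mul_l. rewrite rsum_scal, <- Rmult_minus_distr_l, Rabs_mult.
 ind_case (coprime (N + v) r) as Hg; [|rewrite Rabs_R0; lra]. rewrite Rabs_R1, Rmult_1_l. apply ap_count; auto; lia.
Qed.

Lemma reduced_harmonic N r : (1 <= r <= N)%nat ->
  1 <= 4 * lg r * rsum N (fun v => ind (coprime (N + v) r) * / INR (N + v)).
Proof.
 intros HN. assert (HN0 : 0 < N) by pos. set (c := rsum N (fun v => ind (coprime (N + v) r))).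
 assert (H1 : / (2 * N) * c <= rsum N (fun v => ind (coprime (N + v) r) * / INR (N + v))). { unfold c.
  rewrite <- rsum_scal. termwise v Hv. rewrite Rmult_comm. mul_l. apply Rinv_le_contravar; [pos|].
  rhs (INR (2 * N)) by inr. mono. }
 euclid N r as E Hm. set (t := (N / r)%nat) in *. assert (Ht : (1 <= t)%nat) by lia.
 assert (HtN : (N <= 2 * (t * r))%nat) by nia. assert (H2 : t * r <= c * lg r). {
  via (rsum (t * r) (fun v => ind (coprime (N + v) r)) * lg r).
  - rewrite rsum_blocks, <- rsum_scalr, <- rsum_const. termwise b _.
   etrans; [apply (coprime_density r (N + b * r)); lia|]. mul_r. termwise i _. rewrite Nat.add_assoc. lra.
  - mul_r. apply rsum_mono_n; [lia|intros; apply ind_01]. }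
 apply le_INR in HtN. rewrite !mult_INR in HtN. simpl (INR 2) in HtN. via (4 * lg r * (/ (2 * N) * c)); [|mono].
 apply (Rmult_le_reg_r (INR N)); [easy|]. rhs (2 * (c * lg r)). lra.
Qed.

Lemma rho_bilinear F (X Y N r : nat) xi om : (1 <= N)%nat -> (Y <= 2 * X)%nat ->
  dsum X (fun k => rho N r k * phase F X Y xi om k)
  = rsum (2 * X / N + 1) (fun m => ind (coprime m r) *
  rsum N (fun v => ind (coprime (N + v) r) * phase F X Y xi om (m * (N + v)))).
Proof.
 intros HN HY. set (G := phase F X Y xi om). assert (HT : (2 * X / N <= 2 * X)%nat). {
  apply Nat.Div0.div_le_upper_bound. nia. }
 assert (HG0 : forall k, ~ (X < k <= Y)%nat -> G k = 0) by (intros; now apply phase_0).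
 rewrite (rsum_ext (S (2 * X)) _ (fun k => rsum N (fun v => ind (coprime (N + v) r) * (ind ((1 <= k)%nat /\ Nat.divide
  (N + v) k) * (ind (coprime k r) * G k))))). 2:{ intros k _. unfold rho. destruct k as [|k].
  - rewrite HG0, Rmult_0_r by lia. symmetry. apply rsum_zero. intros; ring.
  - rewrite <- ?rsum_scal, <- ?rsum_scalr. ext v _. rewrite ind_and, (ind_T (1 <= S k)%nat) by lia. ring. }
 rewrite rsum_swap, (rsum_ext (2 * X / N + 1) _ (fun m => rsum N (fun v => ind (coprime m r) * (ind (Nat.gcd (N + v) r
  = 1%nat) * G (m * (N + v))%nat)))), (rsum_swap (2 * X / N + 1) N) by (intros; now rewrite rsum_scal). ext v Hv.
 rewrite rsum_scal, sum_multiples by lia. rewrite (rsum_trunc (2 * X / N + 1) (S (2 * X))); [|lia|].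
 - rewrite <- rsum_scal. ext m _. rewrite Nat.mul_comm.
  destruct (Nat.eq_dec m 0) as [->|Hm0]; [rewrite HG0 by lia; ring|].
  destruct (Nat.le_gt_cases (m * (N + v)) (2 * X)) as [Hc|Hc]; [|rewrite HG0 by lia; ring].
  rewrite (ind_T ((1 <= m)%nat /\ _)), (ind_iff _ _ (gcd_mul_1 m (N + v) r)), ind_and by lia.
  destruct (ind_cases (coprime (N + v) r)) as [[_ ->]|[_ ->]]; ring.
 - intros m Hm. rewrite ind_F; [ring|]. intros [_ Hc]. assert (2 * X < m * N)%nat by (apply div_lt_iff; lia). lia.
Qed.

Lemma phase_total F X Y xi om : (Y <= 2 * X)%nat -> dsum X (fun k => Rabs (phase F X Y xi om k)) <= X.
Proof.
 intros HY. via (dsum X (fun k => ind (X < k <= Y)%nat * 1)).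
 - termwise k _. rewrite Rmult_1_r. apply phase_abs.
 - rewrite interval_sum, rsum_const, Rmult_1_r by lia. mono.
Qed.

(** The sum with weights [rho] is small by [bilinear]. Smoothing turns these weights into a multiple
    of the indicator of coprimality, and this multiple is at least 1 / (4 lg r) by
    [reduced_harmonic], whence the factor lg r. *)
Lemma red_major F : ppok F -> exists C0 : nat, forall C, (C0 <= C)%nat -> exists K X0, 1 <= X0 /\ 0 <= K /\
  forall D (X Y r : nat) xi om,
  2 <= D -> X0 <= X -> (X <= Y <= 2 * X)%nat -> Rabs xi <= X -> D ^ (6 * C + 8) <= X ->
  ~ Maj F (INR X) (D ^ C) xi -> majwit F X (D ^ (2 * C)) xi r ->
  Rabs (dsum X (fun k => ind (coprime k r) * phase F X Y xi om k)) <= K * lg r * (X / sqrt D).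
Proof.
 intros HF. destruct (bilinear F HF) as (C0 & X1 & HX1 & HB). exists C0. intros C HC. have (oscc_nonneg F) as Hosc.
 exists (4 * (9 + 2 * oscc F)), X1. split; [lra|]. split; [lra|]. intros D X Y r xi om HD HX HY Hxi HDX Hmaj Hwit.
 assert (PD : forall a b, (a <= b)%nat -> D ^ a <= D ^ b) by (intros; mono).
 assert (HD0 : forall a, 0 < D ^ a) by (intros; apply pow_pos_2; lra).
 assert (HD1 : forall a, 1 <= D ^ a) by (intros; pos). have Hwit as (Hr & HrQ & _). assert (Hr1 : 1 <= r) by inr.
 assert (E8 : 8 * D ^ (6 * C + 2) <= X). { upto HDX. replace (6 * C + 8)%nat with ((6 * C + 2) + 6)%nat by lia.
  rewrite (pow_add D (6 * C + 2)), Rmult_comm. mul_l. via (2 ^ 6); [pos|mono]. }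
 (* N must be at least r for [reduced_harmonic], and at most H / D, so that counting multiples in
    windows of H terms is accurate to 1 / D. *)
 destruct (nfloor (D ^ (2 * C))) as (n0 & Hn1 & Hn2); [pos|]. set (N := S n0).
 assert (HNR : INR N = n0 + 1) by (unfold N; apply S_INR). specialize (HD1 (2 * C)%nat).
 assert (HNlo : D ^ (2 * C) <= N) by lra. assert (HN1 : (1 <= N)%nat) by lia.
 destruct (scale_window X r (D ^ (2 * C + 1))) as (W & H & HH & HrH & HWX & HWQ & HXH); auto. { pos. }
 { upto E8. rewrite Rmult_assoc. mul_l. via (D ^ (2 * C + 1) * D ^ (2 * C)); [mono|]. rewrite <- pow_add. mono. }
 assert (HHR : 1 <= H) by inr. assert (HND : N * D <= H). {
  assert (T1 : 8 * D ^ (6 * C + 2) <= 4 * D ^ (2 * C + 1) * D ^ (2 * C) * H). { nra. }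
  assert (T2 : 2 * D ^ (2 * C + 1) <= H). { apply (Rmult_le_reg_l (4 * D ^ (4 * C + 1))); [pos|].
   lhs (8 * (D ^ (4 * C + 1) * D ^ (2 * C + 1))).
   replace (4 * D ^ (4 * C + 1) * H) with (4 * D ^ (2 * C + 1) * D ^ (2 * C) * H).
   - rewrite <- pow_add. replace (4 * C + 1 + (2 * C + 1))%nat with (6 * C + 2)%nat by lia. easy.
   - replace (4 * C + 1)%nat with ((2 * C + 1) + 2 * C)%nat by lia. rewrite (pow_add D (2 * C + 1)). ring. }
  rewrite pow_add, pow_1 in T2. nra. }
 assert (HHX : H <= X). { apply le_INR. nia. }
 set (y := X / sqrt D). assert (HsD : 0 < sqrt D) by pos.
 assert (HsD2 : sqrt D * sqrt D = D) by (apply sqrt_sqrt; lra). assert (Hy : X / D <= y). { mul_l.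
  apply Rinv_le_contravar; [easy|]. nra. }
 assert (B2 : W <= y). { upto Hy. apply le_div; [lra|]. upto HWQ. mul_l. rewrite <- pow_1 at 1. mono. }
 assert (B3 : N <= y). { upto Hy. apply le_div; lra. }
 set (G := phase F X Y xi om). set (de := oscc F * (D ^ (2 * C) / D ^ (2 * C + 1))). assert (Ede : de = oscc F / D).
 { unfold de. rewrite pow_add, pow_1. field; lra. }
 assert (B1 : de * X <= oscc F * y). { nra. }
 assert (Hde0 : 0 <= de) by (rewrite Ede; apply Rdiv_le_0_compat; lra).
 assert (Hslow : slow G X Y r W de) by (apply phase_slow; auto; lia).
 have (smooth_scale G (rho N r) X Y r W H de Hslow ltac:(lia) HWX HH HrH ltac:(intros; apply rho_nonneg)) as Hsm.
 assert (Hj : rsum (S (3 * X)) (fun k => ind (X < k)%nat * rho N r k * jump X Y W k) <= 2 * (W + N)). {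
  apply jump_sum; [intros; apply rho_nonneg|lia|lia|]. intros E _. now apply rho_interval. }
 assert (Ht : dsum X (fun k => ind (X < k)%nat * rho N r k) <= X + N). {
  rewrite (rsum_ext _ _ (fun k => ind (X < k <= 2 * X)%nat * rho N r k)) by (intros k Hk; f_equal; apply ind_iff;
   lia). rewrite interval_sum by lia. replace (2 * X - X)%nat with X by lia. now apply rho_interval. }
 assert (Hbil : Rabs (dsum X (fun k => rho N r k * G k)) <= 4 * y). { unfold G. rewrite rho_bilinear by lia.
  set (z := rsum _ _). assert (Hz : z ^ 2 <= (4 * y) ^ 2). {
   have (HB D X Y N xi om (fun m => ind (coprime m r)) (fun n => ind (coprime n r)) HD HX) as Hb.
   via ((INR (2 * X / N + 1) * 1) * ((N * 1) * (5 * X / D))).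
   - etrans; [|from Hb]; auto; try lia.
    + right. f_equal. ext m _. f_equal. ext v _. unfold phase, inI. rewrite mult_INR. ring.
    + via (D ^ (2 * C)); [mono|easy].
    + via ((2 * D ^ (2 * C)) ^ 2); [mono|]. rewrite Rpow_mult_distr, <- pow_mult.
     have (PD (2 * C * 2)%nat (6 * C + 2)%nat ltac:(lia)). lra.
    + intros Hc. apply (Maj_mono _ _ _ (D ^ C)) in Hc; [easy|lra|]. mono.
    + assert (Hi : forall P, ind P ^ 2 <= 1) by (intros P; have (ind_01 P); nra). apply Rmult_le_compat.
     * pos.
     * pos.
     * rewrite <- rsum_const. mono.
     * rewrite <- rsum_const. mono.
   - assert (HT : INR (2 * X / N + 1) * N <= 3 * X). { rewrite plus_INR. simpl (INR 1).
     assert (INR (2 * X / N) * N <= 2 * X). { rewrite <- mult_INR. rhs (INR (2 * X)) by inr. apply le_INR.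
      rewrite Nat.mul_comm. apply Nat.mul_div_le. lia. }
     assert (N <= X) by (assert (N * 1 <= N * D) by (mono); lra). lra. }
    unfold y. rhs (16 * X ^ 2 / (sqrt D * sqrt D)). rewrite HsD2. lhs ((INR (2 * X / N + 1) * N) * (5 * X) / D).
    mul_r. via (3 * X * (5 * X)); [mono|]. nra. }
  rewrite <- Rabs_right by lra. apply Rsqr_le_abs_0. unfold Rsqr. lra. }
 set (vb := rsum N (fun v => ind (coprime (N + v) r) * / INR (N + v))).
 assert (Hvb : 1 <= 4 * lg r * vb) by (apply reduced_harmonic; split; [easy|apply INR_le; lra]).
 set (S0 := dsum X (fun k => ind (coprime k r) * G k)).
 assert (Hw : Rabs (dsum X (fun k => / H * rsum H (fun h => rho N r (k + r * h)) * G k) - vb * S0) <= y). { unfold S0.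
  rewrite <- rsum_scal, <- rsum_minus. from rsum_abs. via (dsum X (fun k => N / H * Rabs (G k))).
  - termwise k _. arg ((/ H * rsum H (fun h => rho N r (k + r * h)) - ind (coprime k r) * vb) * G k).
   rewrite Rabs_mult. mul_r. now apply rho_window.
  - rewrite rsum_scal. via (N / H * X).
   + mul_l. apply phase_total. lia.
   + upto Hy. unfold Rdiv at 2. rewrite (Rmult_comm (INR X)). mul_r. apply div_le; [lra|]. rewrite Rmult_comm.
    apply le_div_inv_r; lra. }
 set (SR := dsum X (fun k => rho N r k * G k)) in *.
 set (SW := dsum X (fun k => / H * rsum H (fun h => rho N r (k + r * h)) * G k)) in *.
 assert (Hd1 : de * dsum X (fun k => ind (X < k)%nat * rho N r k) <= 2 * (oscc F * y)). { via (de * (2 * X)); [|lra].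
  mul_l. assert (N <= X) by (assert (N * 1 <= N * D) by (mono); lra). lra. }
 assert (Hfin : Rabs (vb * S0) <= (9 + 2 * oscc F) * y). { arg (- (SW - vb * S0) + (- (SR - SW) + SR)).
  from Rabs_triang. rewrite Rabs_Ropp. etrans; [apply Rplus_le_compat_l, Rabs_triang|]. rewrite Rabs_Ropp. lra. }
 assert (Hvb0 : 0 <= vb). { apply rsum_nonneg. intros v _. pos. }
 rewrite Rabs_mult, Rabs_right in Hfin by lra. via (4 * lg r * vb * Rabs S0).
 - mono.
 - rhs (4 * lg r * ((9 + 2 * oscc F) * y)). rewrite Rmult_assoc. mono.
Qed.

Lemma conv_lamr N r k : (1 <= k)%nat -> ind (coprime k r) * conv N lam lam k = conv N (lamr r) (lamr r) k.
Proof.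
 intros Hk. unfold conv, lamr. rewrite <- rsum_scal. ext d _. rewrite <- rsum_scal. ext e _.
 destruct (ind_cases ((d * e)%nat = k)) as [[<- ->]|[_ ->]]; [|ring].
 rewrite (ind_iff _ _ (gcd_mul_1 d e r)), ind_and. ring.
Qed.

(** Selberg's weights on the reduced classes are smoothed to the constant [kp], and [red_major]
    bounds what remains. Subtracting the part lam * lam by [lam_lam_major] leaves lam with the
    factor 2 ln Z - ln k, Z = 8 X. The weights have size L, so the bound is a relative saving of lg
    r ^ 2 / sqrt D + 1 / sqrt L. *)
Lemma lam_major F : ppok F -> exists C0 : nat, forall C, (C0 <= C)%nat -> forall A, exists K X0, 1 <= X0 /\ 0 <= K /\
  forall D (X Y r : nat) xi om,
  2 <= D -> X0 <= X -> (X <= Y <= 2 * X)%nat -> Rabs xi <= X ->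
  let L := ln (2 * X) in
  40 * D ^ (4 * C + 1) <= L ^ A ->
  ~ Maj F (INR X) (D ^ C) xi -> majwit F X (D ^ (2 * C)) xi r ->
  Rabs (dsum X (fun k => lamr r k * ((2 * ln (8 * X) - ln k) * phase F X Y xi om k)))
  <= K * X * (L * lg r ^ 2 / sqrt D + sqrt L).
Proof.
 intros HF. destruct (lam_lam_major F HF) as (C1 & HC1). destruct (red_major F HF) as (C2 & HC2).
 exists (C1 + C2)%nat. intros C HC A. destruct (HC1 C ltac:(lia) A) as (K1 & X1 & HX1 & HK1 & HLL).
 destruct (HC2 C ltac:(lia)) as (K2 & X2 & HX2 & HK2 & HRed). destruct (sel_windows A) as (L0 & HL0 & HSW).
 destruct (log_power_small (A * (6 * C + 8))) as (X3 & HX3 & HX3'). have (oscc_nonneg F) as Hosc.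
 exists (K1 + 420 * K2 + 216 * oscc F + 846 + 145), (X1 + X2 + X3 + exp L0 + exp 4 + 2). have (exp_pos L0) as He1.
 have (exp_pos 4) as He2. split; [lra|]. split; [lra|]. intros D X Y r xi om HD HX HY Hxi L HDL Hmaj Hwit.
 destruct (HX3' (INR X) ltac:(lra)) as [_ HLX]. assert (HL4 : 4 <= L) by (apply le_ln; lra).
 assert (HLL0 : L0 <= L) by (apply le_ln; lra). assert (HD0 : forall a, 0 < D ^ a) by (intros; apply pow_pos_2; lra).
 have Hwit as (Hr & HrQ & _). assert (Hr1 : 1 <= r) by inr. have (HD0 (4 * C + 1)%nat) as HDp.
 assert (HDLA : D ^ (4 * C + 1) <= L ^ A) by lra. assert (HDX : D ^ (6 * C + 8) <= X). { upto HLX. rewrite pow_mult.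
  apply pow_incr. split; [lra|]. via (D ^ (4 * C + 1)); [rewrite <- pow_1 at 1; mono|easy]. }
 assert (HrL : r <= L ^ A). { via (D ^ (4 * C + 1)); [mono|easy]. }
 set (s := sqrt L). assert (Hss : s * s = L) by (apply sqrt_sqrt; lra).
 assert (Hs2 : 2 <= s) by (rewrite <- (sqrt_pow2 2) by lra; apply sqrt_le_1_alt; lra). assert (HlX : s <= ln X <= L).
 { split; [|apply ln_le; lra]. unfold L in Hss. rewrite ln_mult in Hss by lra. have ln2_bounds.
  assert (2 * s <= s * s) by mono. lra. }
 set (Z := 8 * X). assert (HlZ : ln Z <= 3 * L /\ s <= ln Z). { unfold Z. rewrite ln_mult by lra.
  replace 8 with (2 ^ 3) by ring. rewrite ln_pow by lra. simpl (INR 3). have ln2_bounds. lra. }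
 assert (HlZZ : ln Z <= Z) by (have (ln_le_sub Z); unfold Z in *; lra).
 destruct (HSW L X r HLL0 HlX Hr HrL) as (kp & Hkp & Hwin).
 destruct (HSW L X 1%nat HLL0 HlX ltac:(lia)) as (kp1 & Hkp1 & Hwin1). { inr. }
 fold s Z in Hwin, Hwin1. fold Z in Hkp, Hkp1. unfold lg in Hkp1. change (INR (S (Nat.log2 1))) with 1 in Hkp1.
 destruct (scale_window X r (D ^ (2 * C + 1))) as (W & H & HH & HrH & HWX & HWQ & HXH); auto. { pos. }
 { upto HDX. rewrite Rmult_assoc. via (2 ^ 3 * (D ^ (2 * C + 1) * D ^ (2 * C))).
  - mono.
  - rewrite <- pow_add. via (D ^ 3 * D ^ (2 * C + 1 + 2 * C)).
   + mono.
   + rewrite <- pow_add. mono. }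
 assert (HHR : 1 <= H) by inr. assert (HXHL : X <= H * L ^ A). { from HXH. rewrite Rmult_comm. mul_l.
  via (4 * D ^ (2 * C + 1) * D ^ (2 * C)).
  - mono.
  - rewrite Rmult_assoc, <- pow_add. replace (2 * C + 1 + 2 * C)%nat with (4 * C + 1)%nat by lia. lra. }
 assert (HHW : (H <= W)%nat) by (assert (1 * H <= r * H)%nat by (now apply Nat.mul_le_mono_r); lia).
 assert (HXWL : X <= W * L ^ A). { from HXHL. mono. }
 set (y := X / sqrt D). assert (HsD : 0 < sqrt D) by pos.
 assert (HsD2 : sqrt D * sqrt D = D) by (apply sqrt_sqrt; lra).
 assert (HsD1 : 1 <= sqrt D) by (rewrite <- sqrt_1; apply sqrt_le_1_alt; lra). assert (Hy : X / D <= y). { mul_l.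
  apply Rinv_le_contravar; [easy|]. rewrite <- HsD2 at 2. mono. }
 assert (Hy0 : 0 <= y) by (apply Rdiv_le_0_compat; lra). assert (B2 : W <= y). { upto Hy. apply le_div; [lra|].
  upto HWQ. mul_l. rewrite <- pow_1 at 1. mono. }
 set (G := phase F X Y xi om). set (de := oscc F * (D ^ (2 * C) / D ^ (2 * C + 1))). assert (Ede : de = oscc F / D).
 { unfold de. rewrite pow_add, pow_1. field; lra. }
 assert (B1 : de * X <= oscc F * y). { rewrite Ede. lhs (oscc F * (X / D)). mono. }
 assert (Hde0 : 0 <= de) by (rewrite Ede; apply Rdiv_le_0_compat; lra).
 assert (Hslow : slow G X Y r W de) by (apply phase_slow; auto; lia).
 assert (HG0 : forall k, ~ (X < k <= Y)%nat -> G k = 0) by (intros; now apply phase_0).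
 assert (HINR8 : forall n, (n <= 8 * X)%nat -> n <= Z). { intros n Hn. apply le_INR in Hn. rewrite mult_INR in Hn.
  replace (INR 8) with 8 in Hn by inr. exact Hn. }
 assert (Hselpos : forall k, (1 <= k <= 8 * X)%nat -> 0 <= sel Z k). { intros k Hk.
  etrans; [|apply sel_lower; [unfold Z; lra|lia|apply HINR8; lia]]. pos. }
 (* The cut at 8 X = Z keeps the weight nonnegative; all arguments that occur lie below it. *)
 set (u := fun k => ind (coprime k r) * (ind (k <= 8 * X)%nat * sel Z k)).
 assert (Hsel8 : forall k, (1 <= k)%nat -> 0 <= ind (k <= 8 * X)%nat * sel Z k). { intros k Hk.
  destruct (ind_cases (k <= 8 * X)%nat) as [[Hc ->]|[_ ->]]; [|lra]. pos. }
 assert (Hu : forall k, (1 <= k)%nat -> 0 <= u k <= ind (k <= 8 * X)%nat * sel Z k). { intros k Hk. unfold u.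
  split; [pos|]. mono. }
 have (smooth_scale G u X Y r W H de Hslow ltac:(lia) HWX HH HrH ltac:(intros; apply Hu; lia)) as Hsm.
 assert (Hj : rsum (S (3 * X)) (fun k => ind (X < k)%nat * u k * jump X Y W k) <= 2 * (141 * y * ln Z)). {
  apply jump_sum; [intros; apply Hu; lia|lia|lia|]. intros E HE. assert (HE8 : (E + 1 + 1 * W <= 8 * X)%nat) by lia.
  assert (Hg1 : coprime (E + 1) 1) by (apply Nat.divide_1_r, Nat.gcd_divide_r).
  have (Hwin1 (E + 1)%nat W ltac:(lia) Hg1 HE8 HXWL) as Hc. apply Rabs_le_between in Hc.
  apply Rabs_le_between in Hkp1. via (rsum W (fun h => sel Z (E + 1 + 1 * h))).
  - termwise h Hh. replace (E + 1 + 1 * h)%nat with (E + 1 + h)%nat by lia. etrans; [apply Hu; lia|].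
   rewrite ind_T by lia. lra.
  - assert (kp1 * W <= 140 * 1 * ln Z * W) by mono. assert (W * s <= W * ln Z) by mono.
   via (141 * (W * ln Z)); [lra|]. rewrite Rmult_assoc. mono. }
 assert (Ht : dsum X (fun k => ind (X < k)%nat * u k) <= 72 * X * ln Z). {
  via (dsum X (fun n => ind (1 <= n)%nat * sel Z n)).
  - termwise k Hk. destruct (ind_cases (X < k)%nat) as [[Hc ->]|[_ ->]].
   + rewrite ind_T, !Rmult_1_l by lia. etrans; [apply Hu; lia|]. rewrite ind_T by lia. lra.
   + destruct k; [rewrite ind_F by lia; lra|]. rewrite ind_T, Rmult_0_l, Rmult_1_l by lia. apply Hselpos. lia.
  - etrans; [apply sel_sum; [unfold Z; lra|lia|apply HINR8; lia]|]. rewrite mult_INR. simpl (INR 2).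
   assert (HZZ : ln Z * ln Z <= 8 * X * ln Z) by mono. assert (X * 1 <= X * ln Z) by mono. lra. }
 set (S0 := dsum X (fun k => ind (coprime k r) * G k)).
 assert (HS0 : Rabs S0 <= K2 * lg r * y) by (apply HRed; auto; lra).
 assert (Hw : Rabs (dsum X (fun k => / H * rsum H (fun h => u (k + r * h)%nat) * G k) - kp * S0) <= X * s). {
  unfold S0. rewrite <- rsum_scal, <- rsum_minus. from rsum_abs. via (dsum X (fun k => s * Rabs (G k))).
  - termwise k Hk. destruct (Nat.le_gt_cases k X) as [Hc|Hc]. { rewrite HG0, !Rmult_0_r, Rminus_0_r, Rabs_R0 by lia.
    lra. }
   arg ((/ H * rsum H (fun h => u (k + r * h)%nat) - ind (coprime k r) * kp) * G k). rewrite Rabs_mult. mul_r.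
   assert (Eu : rsum H (fun h => u (k + r * h)%nat) = ind (coprime k r) * rsum H (fun h => sel Z (k + r * h))). {
    rewrite <- rsum_scal. ext h Hh. unfold u. rewrite gcd_shift, (ind_T (k + r * h <= 8 * X)%nat); [ring|]. nia. }
   rewrite Eu. ind_case (coprime k r) as Hg.
   + have (Hwin k H ltac:(lia) Hg ltac:(lia) HXHL) as Hc2. arg (/ H * (rsum H (fun h => sel Z (k + r * h)) - kp * H)).
    rewrite Rabs_mult, Rabs_right, Rmult_comm by pos. apply div_le; [lra|]. lra.
   + rewrite !Rmult_0_l, Rmult_0_r, Rminus_0_r, Rabs_R0. lra.
  - rewrite rsum_scal, Rmult_comm. mul_r. apply phase_total. lia. }
 set (SU := dsum X (fun k => u k * G k)) in *.
 set (SW := dsum X (fun k => / H * rsum H (fun h => u (k + r * h)%nat) * G k)) in *.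
 assert (HSU : Rabs SU <= 420 * K2 * (L * (lg r ^ 2 * y)) + X * s + (216 * oscc F + 846) * (L * (lg r ^ 2 * y))). {
  replace SU with (kp * S0 + (SW - kp * S0) + (SU - SW)) by ring. from Rabs_triang.
  apply Rplus_le_compat; [from Rabs_triang; apply Rplus_le_compat; [|easy]|].
  - rewrite Rabs_mult. via (140 * lg r * ln Z * (K2 * lg r * y)).
   + mono.
   + lhs (140 * K2 * (ln Z * (lg r ^ 2 * y))). rhs (140 * K2 * (3 * L * (lg r ^ 2 * y))). mono.
  - assert (Hyl : y * ln Z <= 3 * (L * (lg r ^ 2 * y))). { rhs ((lg r ^ 2 * y) * (3 * L)). mono. }
   assert (T1 : de * dsum X (fun k => ind (X < k)%nat * u k) <= 72 * oscc F * (y * ln Z)). {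
    via (de * (72 * X * ln Z)); [mono|]. lhs (72 * ((de * X) * ln Z)). rhs (72 * (oscc F * y * ln Z)). mono. }
   assert (T2 : 72 * oscc F * (y * ln Z) <= 72 * oscc F * (3 * (L * (lg r ^ 2 * y)))) by mono. lra. }
 assert (Esplit : SU = dsum X (fun k => lamr r k * ((2 * ln Z - ln k) * G k)) + dsum X (fun m => dsum X (fun n => lamr
  r m * lamr r n * G (m * n)%nat))). { rewrite <- conv_sum by (intros; apply HG0; lia). rewrite <- rsum_plus.
  ext k Hk. destruct (Nat.le_gt_cases k X) as [Hc|Hc]; [rewrite HG0 by lia; ring|]. rewrite <- conv_lamr by lia.
  unfold u, lamr. rewrite (ind_T (k <= 8 * X)%nat) by lia. rewrite (sel_identity Z (2 * X)) by pos. ring. }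
 have (HLL D X Y r xi om HD ltac:(lra) ltac:(lia) Hxi HDL Hmaj Hwit) as Hll. fold L s G in Hll.
 set (SL := dsum X (fun m => dsum X (fun n => lamr r m * lamr r n * G (m * n)%nat))) in *.
 set (ST := dsum X (fun k => lamr r k * ((2 * ln Z - ln k) * G k))) in *. assert (Rabs ST <= Rabs SU + Rabs SL). {
  replace ST with (SU - SL) by lra. mono. }
 set (q := L * (lg r ^ 2 * y)) in *.
 assert (Hq0 : 0 <= q) by (apply Rmult_le_pos; [lra|apply Rmult_le_pos; [apply pow2_ge_0|easy]]).
 assert (Hll' : Rabs SL <= K1 * q + X * (144 * s)). { unfold q, y. lra. }
 rhs ((K1 + 420 * K2 + 216 * oscc F + 846 + 145) * (q + X * s)) by (unfold q, y; field; lra).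
 assert (0 <= (K1 + 420 * K2 + 216 * oscc F + 846) * (X * s)) by pos. lra.
Qed.

(** * From von Mangoldt weights to primes *)

Lemma phase_trunc F X Y xi om (c : nat -> R) k : (k <= S (2 * X))%nat -> (Y <= 2 * X)%nat ->
  rsum k (fun i => c i * phase F X Y xi om i) = dsum X (fun i => c i * phase F X (Nat.min Y (k - 1)) xi om i).
Proof.
 intros Hk HY. destruct k as [|k].
 - symmetry. apply rsum_zero. intros i _. rewrite phase_0; [ring|]. lia.
 - rewrite (rsum_trunc (S k) (S (2 * X))); [|lia|].
  + ext i Hi. f_equal. unfold phase, inI. f_equal. apply ind_iff. lia.
  + intros i Hi. rewrite phase_0; [ring|]. lia.
Qed.

Lemma abel_phase F X Y xi om (c w : nat -> R) B : (Y <= 2 * X)%nat ->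
  (forall Y', (Y' <= 2 * X)%nat -> Rabs (dsum X (fun k => c k * phase F X Y' xi om k)) <= B) ->
  (forall k, (k <= 2 * X)%nat -> 0 <= w k) -> (forall k, (k < 2 * X)%nat -> w k <= w (S k)) ->
  Rabs (dsum X (fun k => w k * (c k * phase F X Y xi om k))) <= 2 * w (2 * X)%nat * B.
Proof.
 intros HY HB Hw0 Hw. have (abel (S (2 * X)) w (fun k => c k * phase F X Y xi om k) B) as H.
 replace (S (2 * X) - 1)%nat with (2 * X)%nat in H by lia. apply H.
 - lia.
 - intros; apply Hw0; lia.
 - intros; apply Hw; lia.
 - intros k Hk. rewrite phase_trunc by lia. apply HB. lia.
Qed.

(** Primes above X >= r are coprime to r, so the restriction to reduced residues loses only proper
    prime powers. The weight 1 / ln k decreases, whereas [abel] asks for nondecreasing weights; it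
    is written as 1 / ln X minus a nondecreasing one, which gives the constant 1 + 2. *)
Lemma primes_of_lam F X Y xi om r B : (2 <= X)%nat -> (Y <= 2 * X)%nat -> (1 <= r <= X)%nat ->
  (forall Y', (Y' <= 2 * X)%nat -> Rabs (dsum X (fun k => lamr r k * phase F X Y' xi om k)) <= B) ->
  Rabs (dsum X (fun k => ind (nprime k) * phase F X Y xi om k))
  <= 3 / ln X * (B + (INR (Nat.sqrt (2 * X)) + 1) * ln (INR (2 * X))).
Proof.
 intros HX HY Hr HB. set (B' := B + (INR (Nat.sqrt (2 * X)) + 1) * ln (INR (2 * X))). assert (HlX : 0 < ln X). {
  rewrite <- ln_1. apply ln_increasing; [lra|]. change 1 with (INR 1). mono. }
 assert (HB' : forall Y', (Y' <= 2 * X)%nat -> Rabs (dsum X (fun k => (ind (nprime k) * ln k) * phase F X Y' xi om k))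
  <= B'). { intros Y' HY'.
  rewrite (rsum_ext _ _ (fun k => lamr r k * phase F X Y' xi om k - (1 - ind (nprime k)) * lamr r k * phase F X Y' xi
   om k)).
  - rewrite rsum_minus. from Rabs_sub_le. apply Rplus_le_compat; [pos|]. etrans; [|apply lam_proper_powers; lia].
   from rsum_abs. termwise k _. rewrite Rabs_mult. have (phase_abs F X Y' xi om k) as Hp. unfold inI in Hp.
   have (ind_01 (X < k <= Y')%nat). have (ind_01 (nprime k)). have (lamr_bounds r k).
   assert (Hl : lamr r k <= lam k) by (assert (lam k * ind (coprime k r) <= lam k * 1) by (mono); lra).
   assert (H6 : 0 <= (1 - ind (nprime k)) * lamr r k) by pos. rewrite Rabs_right by lra. nra.
  - intros k _. destruct (Nat.le_gt_cases k X) as [Hc|Hc]; [rewrite phase_0 by lia; ring|].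
   ind_case (nprime k) as Hp; [|ring]. unfold lamr. rewrite (lam_prime k Hp), ind_T; [ring|].
   destruct (Nat.eq_dec (Nat.gcd k r) 1) as [|Hg]; [easy|].
   assert (Hd1 : Nat.divide (Nat.gcd k r) k) by apply Nat.gcd_divide_l.
   assert (Hd2 : Nat.divide (Nat.gcd k r) r) by apply Nat.gcd_divide_r. destruct Hp as [_ Hp].
   destruct (Hp _ Hd1) as [|E]; [easy|]. apply Nat.divide_pos_le in Hd2; lia. }
 set (c := fun k => ind (nprime k) * ln k). set (w := fun k => ind (X <= k)%nat * (/ ln X - / ln k)).
 assert (Hlk : forall k, (X <= k)%nat -> ln X <= ln k) by (intros; apply ln_INR_le; lia).
 assert (Hw0 : forall k, 0 <= w k <= / ln X). { intros k. unfold w.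
  destruct (ind_cases (X <= k)%nat) as [[Hc ->]|[_ ->]].
  - specialize (Hlk k Hc). assert (/ ln k <= / ln X) by mono. assert (0 < / ln k) by pos. lra.
  - assert (0 < / ln X) by pos. lra. }
 assert (Hwm : forall k, w k <= w (S k)). { intros k. destruct (Nat.le_gt_cases X k) as [Hc|Hc].
  - unfold w. rewrite !ind_T by lia. have (Hlk k Hc). assert (/ ln (INR (S k)) <= / ln k) by mono. lra.
  - unfold w at 1. rewrite ind_F, Rmult_0_l by lia. apply Hw0. }
 rewrite (rsum_ext _ _ (fun k => / ln X * (c k * phase F X Y xi om k) - w k * (c k * phase F X Y xi om k))).
 - rewrite rsum_minus, rsum_scal. from Rabs_sub_le.
  have (abel_phase F X Y xi om c w B' HY HB' (fun k _ => proj1 (Hw0 k)) (fun k _ => Hwm k)) as HA.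
  assert (Hi : 0 < / ln X) by pos. assert (HB0 : 0 <= B') by (upto (HB' Y HY); apply Rabs_pos).
  rewrite Rabs_mult, Rabs_right by lra.
  assert (H2 : / ln X * Rabs (dsum X (fun k => c k * phase F X Y xi om k)) <= / ln X * B'). { mono. }
  assert (2 * w (2 * X)%nat * B' <= 2 * / ln X * B'). { mul_r. have (Hw0 (2 * X)%nat). lra. }
  lra.
 - intros k _. destruct (Nat.le_gt_cases k X) as [Hc|Hc]; [rewrite phase_0 by lia; ring|]. unfold c, w.
  rewrite (ind_T (X <= k)%nat) by lia. specialize (Hlk k ltac:(lia)). field; lra.
Qed.

Definition qroot (D : R) : R := sqrt (sqrt D).

(** Half of the saving sqrt D pays for the density losses lg r ^ 2: log2 r is at most a multiple of
    ln D, and ln D <= 8 D^(1/8). *)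
Lemma lg_bound C r D : (1 <= r)%nat -> 2 <= D -> r <= D ^ (2 * C) -> lg r ^ 2 / sqrt D <= (1 + 32 * C) ^ 2 / qroot D.
Proof.
 intros Hr HD HrD. unfold qroot. set (e := sqrt (sqrt (sqrt D))). assert (H2 : 0 <= sqrt D) by apply sqrt_pos.
 assert (H4 : 0 <= sqrt (sqrt D)) by apply sqrt_pos. assert (E2 : sqrt D ^ 2 = D) by (apply pow2_sqrt; lra).
 assert (E4 : sqrt (sqrt D) ^ 2 = sqrt D) by (now apply pow2_sqrt).
 assert (E8 : e ^ 2 = sqrt (sqrt D)) by (now apply pow2_sqrt). assert (He1 : 1 <= e). { rewrite <- sqrt_1.
  apply sqrt_le_1_alt. rewrite <- sqrt_1. apply sqrt_le_1_alt. nra. }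
 assert (Hl : lg r <= (1 + 32 * C) * e). { unfold lg. rewrite S_INR. have (Nat.log2_spec r ltac:(lia)) as [Hs _].
  apply le_INR in Hs. rewrite pow_INR in Hs. simpl (INR 2) in Hs.
  assert (H5 : INR (Nat.log2 r) * ln 2 <= INR (2 * C) * ln D). { rewrite <- !ln_pow by lra. apply ln_le; [pos|].
   replace (1 + 1) with 2 in Hs by ring. lra. }
  assert (H6 : ln D <= 8 * e). { assert (ED : D = e ^ 8) by nra.
   assert (El : ln D = INR 8 * ln e) by (rewrite ED at 1; apply ln_pow; lra). assert (E8' : INR 8 = 8) by inr.
   rewrite El, E8'. have (ln_le_sub e ltac:(lra)). lra. }
  rewrite mult_INR in H5. simpl (INR 2) in H5. have ln2_bounds. have (pos_INR C). have (pos_INR (Nat.log2 r)). nra. }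
 have (lg_ge_1 r). assert (Hl2 : lg r ^ 2 <= (1 + 32 * C) ^ 2 * e ^ 2) by nra. rewrite <- E8, <- E4, <- E8.
 apply div_le; [pos|]. rhs ((1 + 32 * C) ^ 2 * e ^ 2). easy.
Qed.

Lemma sqrt_small A : exists X0, 2 <= X0 /\ forall X : nat, X0 <= X ->
  2 <= ln (2 * X) /\ (INR (Nat.sqrt (2 * X)) + 1) * ln (INR (2 * X)) <= X / ln (2 * X) ^ A.
Proof.
 destruct (log_power_small (2 * A + 6)) as (X0 & H0 & H). exists X0. split; [easy|]. intros X HX.
 destruct (H (INR X) HX) as [HL HLX]. split; [easy|]. replace (INR (2 * X)) with (2 * X) by inr.
 set (L := ln (2 * X)) in *. set (z := INR (Nat.sqrt (2 * X)) + 1). assert (Hz : z ^ 2 <= 8 * X). {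
  have (Nat.sqrt_spec (2 * X) ltac:(lia)) as [Hs _]. apply le_INR in Hs. rewrite !mult_INR in Hs. simpl (INR 2) in Hs.
  unfold z. nra. }
 apply le_div; [pos|]. assert (Hsq : (z * L * L ^ A) ^ 2 <= X ^ 2). { lhs (z ^ 2 * (L ^ A * L ^ A * L ^ 2)).
  rhs (8 * X * (X / 8)). apply Rmult_le_compat; [pos| |easy|].
  - pos.
  - apply le_div; [lra|]. upto HLX. rewrite <- !pow_add. replace (2 * A + 6)%nat with (A + A + 2 + 4)%nat by lia.
   rewrite (pow_add L (A + A + 2) 4). mul_l. via (2 ^ 4); [lra|mono]. }
 nra.
Qed.

Lemma lamr_1 k : lamr 1 k = lam k.
Proof. unfold lamr. rewrite ind_T; [ring|]. apply Nat.divide_1_r, Nat.gcd_divide_r. Qed.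

Lemma minor_primes F : ppok F -> forall A : nat, exists (B : nat) (X0 : R), 1 <= X0 /\
  forall (X Y : nat) xi om, X0 <= X -> (Y <= 2 * X)%nat -> Rabs xi <= X ->
  ~ Maj F (INR X) (ln (2 * X) ^ B) xi ->
  Rabs (dsum X (fun k => ind (nprime k) * phase F X Y xi om k)) <= X / ln (2 * X) ^ A.
Proof.
 intros HF A. destruct (minor_arcs F HF (A + 3)) as (B & X1 & HX1 & HM).
 destruct (sqrt_small (A + 3)) as (X2 & HX2 & HS). exists B, (X1 + X2 + exp 1 + 2). have (exp_pos 1). split; [lra|].
 intros X Y xi om HX HY Hxi Hmaj. destruct (HS X ltac:(lra)) as [HL2 HS']. set (L := ln (2 * X)) in *.
 assert (HX2' : (2 <= X)%nat) by inr. assert (HlX : 1 <= ln X) by (apply le_ln; lra).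
 assert (HP : 0 < L ^ (A + 3)) by pos.
 etrans; [apply (primes_of_lam F X Y xi om 1 (X / L ^ (A + 3))); auto; try lia|].
 - intros Y' HY'.
  rewrite (rsum_ext _ _ (fun n => lam n * (inI X Y' n * cs (xi * ppval F (INR n) + om)))) by (intros; now rewrite
   lamr_1). apply HM; auto; lra.
 - set (x := X / L ^ (A + 3)) in *. assert (Hx : 0 <= x) by (apply Rdiv_le_0_compat; lra).
  assert (H3 : 3 / ln X <= 3) by (apply div_le; lra). assert (0 < 3 / ln X) by pos. via (3 * (x + x)).
  + nra.
  + unfold x. rewrite pow_add. assert (0 < L ^ A) by pos.
   assert (8 <= L ^ 3) by (replace 8 with (2 ^ 3) by ring; apply pow_incr; lra). lhs (X / L ^ A * (6 / L ^ 3)).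
   rewrite <- (Rmult_1_r (X / L ^ A)) at 2. mul_l. apply div_le; lra.
Qed.

(** The factor 2 ln Z - ln k is at least L, and its inverse is nondecreasing in k, so partial
    summation removes it from [lam_major] and gains 1 / L. *)
Lemma major_primes F : ppok F -> exists C0 : nat, forall C, (C0 <= C)%nat -> forall A, exists K X0, 1 <= X0 /\ 0 <= K /\
  forall D (X Y : nat) xi om,
  2 <= D -> X0 <= X -> (Y <= 2 * X)%nat -> Rabs xi <= X ->
  let L := ln (2 * X) in
  40 * D ^ (4 * C + 1) <= L ^ A ->
  ~ Maj F (INR X) (D ^ C) xi -> Maj F (INR X) (D ^ (2 * C)) xi ->
  Rabs (dsum X (fun k => ind (nprime k) * phase F X Y xi om k))
  <= K * (X / L) * (/ qroot D + / sqrt L).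
Proof.
 intros HF. destruct (lam_major F HF) as (C0 & HC0). exists C0. intros C HC A.
 destruct (HC0 C HC A) as (K & X1 & HX1 & HK & HM). destruct (sqrt_small 2) as (X2 & HX2 & HS).
 destruct (log_power_small (A + 1)) as (X3 & HX3 & HX3'). set (K' := (1 + 32 * C) ^ 2).
 assert (HK' : 1 <= K') by (apply pow_R1_Rle; have (pos_INR C); lra).
 exists (12 * K * K' + 6), (X1 + X2 + X3 + exp 4 + 2). have (exp_pos 4). split; [lra|]. split. { pos. }
 intros D X Y xi om HD HX HY Hxi L HDL Hmaj (Hfr & r & Hr & HrQ & Hpo).
 assert (Hwit : majwit F X (D ^ (2 * C)) xi r) by easy. destruct (HS X ltac:(lra)) as [_ HS']. fold L in HS'.
 assert (HL4 : 4 <= L) by (apply le_ln; lra). destruct (HX3' (INR X) ltac:(lra)) as [_ HLX]. fold L in HLX.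
 assert (HX2' : (2 <= X)%nat) by inr. assert (HrX : (r <= X)%nat). { apply INR_le. upto HLX. via (L ^ A); [|mono].
  assert (D ^ (2 * C) <= D ^ (4 * C + 1)) by mono. assert (0 < D ^ (4 * C + 1)) by pos. lra. }
 assert (HlX : L / 2 <= ln X). { unfold L in *. rewrite ln_mult in * by lra. have ln2_bounds. lra. }
 set (Z := 8 * X). assert (HlZ : L <= ln Z) by (apply ln_le; unfold Z; lra). set (s := sqrt L).
 assert (Hss : s * s = L) by (apply sqrt_sqrt; lra). assert (Hs2 : 0 < s) by (apply sqrt_lt_R0; lra).
 assert (HqD : 0 < qroot D) by (apply sqrt_lt_R0, sqrt_lt_R0; lra). set (sv := / qroot D + / s).
 set (Bm := K * X * (L * lg r ^ 2 / sqrt D + s)). assert (HBm : Bm <= K * K' * X * (L * sv)). {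
  rhs (K * X * (L * (K' * sv))). mul_l. replace (L * lg r ^ 2 / sqrt D + s) with (L * (lg r ^ 2 / sqrt D + / s)).
  - mul_l. unfold sv. rewrite Rmult_plus_distr_l. apply Rplus_le_compat.
   + apply lg_bound; auto.
   + mono.
  - assert (HLs : L * / s = s) by (rewrite <- Hss at 1; field; lra). lra. }
 assert (HBm0 : 0 <= Bm). { unfold Bm. pos. }
 set (c := fun k => lamr r k * (2 * ln Z - ln k)).
 assert (Hc : forall Y', (Y' <= 2 * X)%nat -> Rabs (dsum X (fun k => c k * phase F X Y' xi om k)) <= Bm). {
  intros Y' HY'. destruct (Nat.le_gt_cases X Y') as [Hxy|Hxy].
  -
   rewrite (rsum_ext _ _ (fun k => lamr r k * ((2 * ln Z - ln k) * phase F X Y' xi om k))) by (intros; unfold c;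
    ring). apply HM; auto; lra.
  - rewrite rsum_zero; [rewrite Rabs_R0; easy|]. intros k _. rewrite phase_0 by lia. ring. }
 assert (Hlk : forall k, (k <= 2 * X)%nat -> 0 <= ln k <= L). { intros k Hk. split; [apply ln_INR_nonneg|].
  destruct k; [rewrite ln_INR_0; lra|]. unfold L. replace (2 * X) with (INR (2 * X)) by inr. mono. }
 set (w := fun k : nat => / (2 * ln Z - ln k)).
 assert (Hlam : forall Y', (Y' <= 2 * X)%nat -> Rabs (dsum X (fun k => lamr r k * phase F X Y' xi om k)) <= 2 * / L *
  Bm). { intros Y' HY'. rewrite (rsum_ext _ _ (fun k => w k * (c k * phase F X Y' xi om k))).
  - etrans; [apply abel_phase; auto|].
   + intros k Hk. left. apply Rinv_0_lt_compat. specialize (Hlk k Hk). lra.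
   + intros k Hk. have (Hlk (S k) ltac:(lia)). apply Rinv_le_contravar; [lra|]. destruct k; [rewrite ln_INR_0; lra|].
    have (ln_INR_le (S k) (S (S k)) ltac:(lia) ltac:(lia)). lra.
   + mul_r. mul_l. apply Rinv_le_contravar; [lra|]. specialize (Hlk (2 * X)%nat ltac:(lia)). lra.
  - intros k Hk. unfold w, c. specialize (Hlk k ltac:(lia)). field. lra. }
 from (primes_of_lam F X Y xi om r _ HX2' HY ltac:(lia) Hlam). assert (T1 : 2 * / L * Bm <= 2 * (K * K') * (X * sv)).
 { rhs (2 * / L * (K * K' * X * (L * sv))). mono. }
 assert (T2 : X / L ^ 2 <= X * sv). { mul_l. via (/ s).
  - apply Rinv_le_contravar; [easy|]. assert (1 <= s) by nra. nra.
  - unfold sv. have (Rinv_0_lt_compat _ HqD). lra. }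
 assert (T3 : 3 / ln X <= 6 / L). { apply div_le; [lra|]. rhs (6 * ln X / L). apply le_div; lra. }
 via (6 / L * (2 * (K * K') * (X * sv) + X * sv)).
 - mono.
 - lra.
Qed.

(** D is squared until xi F is major at level D^(2C), where [major_primes] applies, or until D^C
    reaches the power L^B of the logarithm required by [minor_primes]. Squaring only improves the
    bound. The induction variable n counts the squarings still possible. *)
Lemma prime_sum F : ppok F -> exists (C : nat) K X0, (1 <= C)%nat /\ 1 <= X0 /\ 0 <= K /\
  forall D (X Y : nat) xi om, 2 <= D -> X0 <= X -> (Y <= 2 * X)%nat -> Rabs xi <= X ->
  ~ Maj F (INR X) (D ^ C) xi ->
  Rabs (dsum X (fun k => ind (nprime k) * phase F X Y xi om k))
  <= K * (X / ln (2 * X)) * (/ qroot D + / sqrt (ln (2 * X))).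
Proof.
 intros HF. destruct (major_primes F HF) as (C0 & HC0). set (C := S C0).
 destruct (minor_primes F HF 2) as (B & X1 & HX1 & HMin).
 (* The exponent 11: since 40 <= D^6 and C >= 1, the quantity 40 D^(4C+1) is at most D^(11C). Once
    it exceeds L^(11B), therefore D^C >= L^B. *)
 destruct (HC0 C ltac:(unfold C; lia) (11 * B)%nat) as (K & X2 & HX2 & HK & HMaj).
 exists C, (K + 1), (X1 + X2 + exp 2 + 1). have (exp_pos 2). split; [pos|]. split; [lra|]. split; [lra|].
 intros D X Y xi om HD HX HY Hxi. set (L := ln (2 * X)). assert (HL2 : 2 <= L) by (apply le_ln; lra).
 assert (Hs : 0 < sqrt L) by pos. assert (Hq0 : forall D, 2 <= D -> 0 < / qroot D). { intros D' HD'. unfold qroot.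
  pos. }
 destruct (pow2_exceeds (L ^ (11 * B))) as [n Hn].
 assert (HminD : forall D, 2 <= D -> L ^ B <= D ^ C -> ~ Maj F (INR X) (D ^ C) xi -> Rabs (dsum X (fun k => ind
  (nprime k) * phase F X Y xi om k)) <= (K + 1) * (X / L) * (/ qroot D + / sqrt L)). { clear D HD.
  intros D HD HDB Hmaj. assert (Hm2 : ~ Maj F (INR X) (L ^ B) xi). { intros Hc.
   apply (Maj_mono _ _ _ (D ^ C)) in Hc; [easy|lra|easy]. }
  etrans; [apply HMin; auto; lra|]. fold L. lhs (1 * (X / L) * (/ L)). specialize (Hq0 D HD).
  assert (/ L <= / sqrt L). { apply Rinv_le_contravar; [easy|]. rewrite <- (sqrt_sqrt L) at 2 by lra.
   assert (1 <= sqrt L) by (rewrite <- sqrt_1; apply sqrt_le_1_alt; lra). nra. }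
  mono. }
 assert (Hmain : forall n D, 2 <= D -> L ^ (11 * B) <= D ^ (2 ^ n) -> ~ Maj F (INR X) (D ^ C) xi -> Rabs (rsum (S (2 *
  X)) (fun k => ind (nprime k) * phase F X Y xi om k)) <= (K + 1) * (X / L) * (/ qroot D + / sqrt L)). {
  clear n Hn D HD. induction n as [|n IH]; intros D HD Hn Hmaj.
  - simpl in Hn. rewrite Rmult_1_r in Hn. apply HminD; auto.
   via D; [|rewrite <- pow_1 at 1; apply pow_mono; [lra|pos]]. upto Hn. mono.
  - destruct (Rle_lt_dec (40 * D ^ (4 * C + 1)) (L ^ (11 * B))) as [Hc|Hc].
   + destruct (classic (Maj F (INR X) (D ^ (2 * C)) xi)) as [Hm|Hm].
    * etrans; [apply (HMaj D X Y xi om); auto; lra|]. fold L. specialize (Hq0 D HD). mono.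
    * from (IH (D ^ 2)).
     -- nra.
     -- rewrite <- pow_mult. exact Hn.
     -- now rewrite <- pow_mult.
     -- assert (/ qroot (D ^ 2) <= / qroot D); [|mono].
      apply Rinv_le_contravar; [unfold qroot; apply sqrt_lt_R0, sqrt_lt_R0; lra|]. apply sqrt_le_1_alt, sqrt_le_1_alt.
      nra.
   + assert (HDB : L ^ B <= D ^ C). { apply Rnot_lt_le. intros Hlt.
     assert (D ^ (11 * C) < 40 * D ^ (4 * C + 1) \/ 40 * D ^ (4 * C + 1) <= D ^ (11 * C)) as [H1|H1] by lra.
     - assert (40 * D ^ (4 * C + 1) <= D ^ (11 * C)); [|lra]. via (D ^ 6 * D ^ (4 * C + 1)).
      + mul_r. via (2 ^ 6); [lra|mono].
      + rewrite <- pow_add. mono.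
     - assert (D ^ (11 * C) <= L ^ (11 * B)); [|lra]. rewrite Nat.mul_comm, (Nat.mul_comm 11 B), !pow_mult. mono. }
    pos. }
 intros Hmaj. apply (Hmain n D HD); auto. from Hn. via (D ^ n); [mono|]. apply pow_mono; [lra|].
 have (Nat.pow_gt_lin_r 2 n). lia.
Qed.

(** * Pseudo-polynomials *)

Lemma nonint_INR b : 0 < b -> ~ nonint b -> exists k : nat, b = INR k.
Proof.
 intros Hb Hn. apply not_all_ex_not in Hn. destruct Hn as [z Hz]. apply NNPP in Hz. exists (Z.to_nat z).
 rewrite INR_IZR_INZ, Z2Nat.id; [easy|]. apply le_IZR. lra.
Qed.

Lemma least_index (P : nat -> Prop) n : (exists i, (i <= n)%nat /\ P i) -> exists i, (i <= n)%nat /\ P i /\ forall j, (j < i)%nat -> ~ P j.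
Proof.
 intros (i & Hi & HP). revert Hi HP. induction i as [i IH] using lt_wf_ind. intros Hi HP.
 destruct (classic (exists j, (j < i)%nat /\ P j)) as [(j & Hj & HPj)|Hn].
 - apply (IH j); auto; lia.
 - exists i. repeat split; auto. intros j Hj HPj. apply Hn. now exists j.
Qed.

Definition ppint (d : nat) (alpha beta : nat -> R) (k : nat) : R := rsum (S d) (fun i => ind (beta i = INR k) * alpha i).

Lemma decreasing_beta (beta : nat -> R) d : (forall i, (i < d)%nat -> beta (S i) < beta i) ->
  forall i j, (i < j <= d)%nat -> beta j < beta i.
Proof.
 intros H i j Hij. induction j as [|j IH]; [lia|]. destruct (Nat.eq_dec i j) as [->|]; [apply H; lia|].
 specialize (H j ltac:(lia)). specialize (IH ltac:(lia)). lra.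
Qed.

Lemma integral_part_sum d alpha beta K x : 0 < x -> (forall i, (i <= d)%nat -> 0 < beta i <= INR K) ->
  rsum (S K) (fun k => ppint d alpha beta k * x ^ k)
  = rsum (S d) (fun i => (1 - ind (nonint (beta i))) * (alpha i * Rpower x (beta i))).
Proof.
 intros Hx Hb. unfold ppint.
 rewrite (rsum_ext (S K) _ (fun k => rsum (S d) (fun i => ind (beta i = INR k) * (alpha i * x ^ k)))). 2:{ intros k _.
  rewrite <- rsum_scalr. mono. }
 rewrite rsum_swap. ext i Hi. destruct (Hb i ltac:(lia)) as [B1 B2]. ind_case (nonint (beta i)) as Hn.
 - rewrite rsum_zero; [ring|]. intros k _. rewrite ind_F; [ring|]. intros E. apply (Hn (Z.of_nat k)).
  now rewrite E, INR_IZR_INZ.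
 - destruct (nonint_INR _ B1 Hn) as [k0 Hk0]. rewrite (rsum_ext _ _ (fun k => ind (k = k0) * (alpha i * x ^ k))).
  + rewrite rsum_pick; [rewrite Hk0, INR_Rpower_pow by easy; ring|]. inr.
  + intros k _. f_equal. apply ind_iff. rewrite Hk0. split; [intros E; now apply INR_eq in E|pos].
Qed.

(** The fractional list begins at the first term with nonintegral exponent and nonzero coefficient.
    Integral exponents met after it are kept there with coefficient 0, which preserves the
    decreasing order; their true coefficients are in the polynomial part. *)
Lemma ppdata_of d alpha beta :
  alpha 0%nat <> 0 -> (forall i : nat, (i < d)%nat -> beta (S i) < beta i) -> 0 < beta d ->
  exists F, ppok F /\ (forall x, 0 < x -> ppval F x = pseudo_poly d alpha beta x) /\
  ((nonint (beta 0%nat) /\ (0 < nfr F)%nat /\ fex F 0%nat = beta 0%nat) \/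
  (exists k, (1 <= k <= deg F)%nat /\ beta 0%nat = INR k /\ co F k = alpha 0%nat)).
Proof.
 intros Ha Hdec Hpos. have (decreasing_beta beta d Hdec) as Hlt.
 assert (Hb : forall i, (i <= d)%nat -> 0 < beta i <= beta 0%nat). { intros i Hi. split.
  - destruct (Nat.eq_dec i d) as [->|]; [easy|]. specialize (Hlt i d ltac:(lia)). lra.
  - destruct (Nat.eq_dec i 0) as [->|]; [lra|]. specialize (Hlt 0%nat i ltac:(lia)). lra. }
 destruct (nfloor (beta 0%nat)) as (K0 & HK1 & HK2); [destruct (Hb 0%nat ltac:(lia)); lra|]. set (K := S K0).
 assert (HbK : forall i, (i <= d)%nat -> 0 < beta i <= K). { intros i Hi. specialize (Hb i Hi). unfold K. inr. }
 assert (Hint : forall k, beta 0%nat = INR k -> (1 <= k <= K)%nat /\ ppint d alpha beta k = alpha 0%nat). {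
  intros k Hk. destruct (HbK 0%nat ltac:(lia)) as [B1 B2]. rewrite Hk in B1, B2. apply INR_le in B2. split.
  - destruct k; [simpl in B1; lra|lia].
  - unfold ppint. rewrite (rsum_ext _ _ (fun i => ind (i = 0%nat) * alpha i)).
   + apply rsum_pick. lia.
   + intros i Hi. f_equal. apply ind_iff. split; [|intros ->; easy]. intros E.
    destruct (Nat.eq_dec i 0) as [|Hi0]; [easy|]. specialize (Hlt 0%nat i ltac:(lia)). lra. }
 assert (Elead : forall F, deg F = K -> co F = ppint d alpha beta -> ~ nonint (beta 0%nat) -> exists k, (1 <= k <= deg
  F)%nat /\ beta 0%nat = INR k /\ co F k = alpha 0%nat). { intros F E1 E2 Hn.
  destruct (nonint_INR (beta 0%nat)) as [k Hk]; auto; [apply HbK; lia|]. exists k. rewrite E1, E2.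
  destruct (Hint k Hk). auto. }
 destruct (classic (exists i, (i <= d)%nat /\ (nonint (beta i) /\ alpha i <> 0))) as [Hex|Hex].
 - destruct (least_index _ d Hex) as (i0 & Hi0 & [Hn0 Ha0] & Hleast).
  set (F := {| deg := K; co := ppint d alpha beta; nfr := (S d - i0)%nat; fco := fun j => ind (nonint (beta (i0 +
   j)%nat)) * alpha (i0 + j)%nat; fex := fun j => beta (i0 + j)%nat |}). exists F. split; [|split].
  + unfold F. repeat split; cbn [nfr fco fex].
   * rewrite Nat.add_0_r, ind_T by easy. lra.
   * now rewrite Nat.add_0_r.
   * intros j Hj. apply Hb. lia.
   * intros j Hj. apply Hlt. lia.
  + intros x Hx. unfold ppval, gph, pseudo_poly, F. cbn [deg co nfr fco fex].
   rewrite sum_f_R0_rsum, integral_part_sum by auto.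
   rewrite (rsum_ext (S d) (fun i => alpha i * Rpower x (beta i)) (fun i => (1 - ind (nonint (beta i))) * (alpha i *
    Rpower x (beta i)) + ind (nonint (beta i)) * alpha i * Rpower x (beta i))), rsum_plus by (intros; ring). f_equal.
   replace (S d) with (i0 + (S d - i0))%nat at 2 by lia. rewrite rsum_split. rewrite (rsum_zero i0); [pos|].
   intros i Hi. ind_case (nonint (beta i)) as Hn; [|ring]. replace (alpha i) with 0; [ring|]. apply NNPP. intros Hc.
   now apply (Hleast i Hi).
  + destruct (classic (nonint (beta 0%nat))) as [Hn|Hn]; [|pos]. left. split; [easy|]. simpl.
   assert (i0 = 0%nat) as ->; [|split; [lia|easy]]. destruct i0; [easy|]. exfalso. apply (Hleast 0%nat); [lia|auto].
 - set (F := {| deg := K; co := ppint d alpha beta; nfr := 0%nat; fco := fun _ => 0; fex := fun _ => 0 |}). exists F.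
  split; [|split].
  + easy.
  + intros x Hx. unfold ppval, gph, pseudo_poly, F. cbn [deg co nfr fco fex].
   rewrite sum_f_R0_rsum, integral_part_sum by auto. rewrite Rplus_0_r. ext i Hi.
   ind_case (nonint (beta i)) as Hn; [|ring]. replace (alpha i) with 0; [ring|]. apply NNPP. intros Hc. apply Hex.
   exists i. split; [lia|auto].
  + right. apply Elead; auto. intros Hn. apply Hex. exists 0%nat. split; [lia|auto].
Qed.

(* A phase with leading term xi x^b0 is major on the scale X only at levels exceeding the number of its
   oscillations, and the period of its integral part. *)
Lemma Maj_lower F b0 a0 : 0 < b0 -> a0 <> 0 ->
  ((nonint b0 /\ (0 < nfr F)%nat /\ fex F 0%nat = b0) \/ (exists k, (1 <= k <= deg F)%nat /\ b0 = INR k /\ co F k = a0)) ->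
  exists c, 0 < c <= 1 /\ forall X Q xi, 1 <= X -> 0 < xi -> Maj F X Q xi -> c * Rmin (xi * Rpower X b0) (/ xi) <= Q.
Proof.
 intros Hb Ha [(Hn & Hf & He)|(k & Hk & Ek & Ec)].
 - exists 1. split; [lra|]. intros X Q xi HX Hxi [H _]. specialize (H Hf). rewrite He, Rabs_right in H by lra.
  have (Rmin_l (xi * Rpower X b0) (/ xi)). lra.
 - set (A := Rabs a0). assert (HA : 0 < A) by now apply Rabs_pos_lt. exists (Rmin (/ 2) (Rmin A (/ (2 * A)))).
  have (Rmin_l (/ 2) (Rmin A (/ (2 * A)))) as M1. have (Rmin_r (/ 2) (Rmin A (/ (2 * A)))) as M2.
  have (Rmin_l A (/ (2 * A))) as M3. have (Rmin_r A (/ (2 * A))) as M4.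
  set (c := Rmin (/ 2) (Rmin A (/ (2 * A)))) in *. assert (HiA : 0 < / (2 * A)) by pos.
  assert (Hc0 : 0 < c) by (unfold c; repeat apply Rmin_glb_lt; lra). split; [lra|].
  intros X Q xi HX Hxi [_ (r & Hr & HrQ & Hpo)]. destruct (Hpo k Hk) as [z Hz]. rewrite Ec in Hz.
  assert (HXk : Rpower X b0 = X ^ k) by (rewrite Ek; apply INR_Rpower_pow; lra). rewrite HXk. set (Y := X ^ k) in *.
  assert (HY : 1 <= Y) by (apply pow_R1_Rle; lra). have (Rmin_l (xi * Y) (/ xi)) as R1.
  have (Rmin_r (xi * Y) (/ xi)) as R2. set (T := Rmin (xi * Y) (/ xi)) in *.
  assert (Hxi' : 0 < / xi) by now apply Rinv_0_lt_compat. assert (HxY : 0 < xi * Y) by pos.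
  assert (HT : 0 < T) by (apply Rmin_glb_lt; easy). assert (Hr1 : 1 <= r) by inr. assert (HTY : T <= Y). {
   destruct (Rle_lt_dec 1 xi); [|via (xi * Y); [easy|]; rewrite <- (Rmult_1_l Y) at 2; mono]. via 1; [|easy].
   via (/ xi); [easy|]. rewrite <- Rinv_1. mono. }
  assert (Habs : Rabs (r * (xi * a0)) = r * (xi * A)). { rewrite !Rabs_mult, Rabs_right, Rabs_right by lra. easy. }
  (* If r xi a0 is near 0, this bounds xi X^k by Q. If it is near another integer, then r, hence Q,
     is at least of order 1 / xi, unless Q exceeds X^k / 2, which is enough as well. *)
  destruct (Z.eq_dec z 0) as [->|Hz0].
  + rewrite Rminus_0_r, Habs in Hz. apply le_div_inv in Hz; [|lra]. via (A * (xi * Y)).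
   * mono.
   * nra.
  + destruct (Rle_lt_dec (/ 2) (Q / Y)) as [Hq|Hq].
   * apply le_div_inv in Hq; [|lra]. via (/ 2 * Y); [mono|easy].
   * assert (Hz1 : 1 <= Rabs (IZR z)). { rewrite <- abs_IZR. apply IZR_le. lia. }
    assert (/ 2 <= r * (xi * A)). { have (Rabs_triang_inv (IZR z) (r * (xi * a0))) as Ht.
     rewrite Rabs_minus_sym in Ht. lra. }
    via (/ (2 * A) * / xi); [mono|]. rewrite <- Rinv_mult, <- (Rmult_1_l (/ _)). apply div_le; [pos|].
    via (r * (2 * A * xi)); [lra|]. mono.
Qed.

(** * Discrepancy *)

(* H times the Fejer kernel of order H. *)
Definition fej (H : nat) (t : R) : R := rsum H (fun n => cs (n * t)) ^ 2 + rsum H (fun n => sn (n * t)) ^ 2.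

Lemma fej_nonneg H t : 0 <= fej H t.
Proof. unfold fej. pos. Qed.

Lemma fej_expand H t : fej H t = rsum H (fun n => rsum H (fun m => cs (n * t - m * t))).
Proof.
 unfold fej.
 replace (rsum H (fun n => cs (n * t)) ^ 2) with (rsum H (fun n => cs (n * t)) * rsum H (fun n => cs (n * t))) by
  ring.
 replace (rsum H (fun n => sn (n * t)) ^ 2) with (rsum H (fun n => sn (n * t)) * rsum H (fun n => sn (n * t))) by
  ring. rewrite !rsum_mul, <- rsum_plus. ext n _. rewrite <- rsum_plus. ext m _. now rewrite cs_sub.
Qed.

Lemma character_sum H d c : (1 <= d < H)%nat -> rsum H (fun i => cs (c - d * (i / H))) = 0.
Proof.
 intros Hd. assert (HH : 0 < H) by pos. set (t := - (d / H)).
 rewrite (rsum_ext H _ (fun i => cs (c + t * i))) by (intros; unfold t; f_equal; field; lra).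
 have (geometric_cs H c t) as G. replace (c + t * H) with (c - d) in G by (unfold t; field; lra).
 assert (Hs : sin (2 * PI * (c - d) - PI * t) = sin (2 * PI * c - PI * t)). {
  replace (2 * PI * c - PI * t) with (2 * PI * (c - d) - PI * t + 2 * d * PI) by ring. now rewrite sin_period. }
 assert (Hdn : 0 < d / H < 1). { split; [pos|]. apply Rlt_div_l; [easy|]. rewrite Rmult_1_l. mono. }
 assert (Hsin : 0 < sin (PI * (d / H))). { have PI_RGT_0. apply sin_gt_0; nra. }
 assert (Hsin2 : sin (PI * t) <> 0). { unfold t. replace (PI * - (d / H)) with (- (PI * (d / H))) by ring.
  rewrite sin_neg. lra. }
 nra.
Qed.

Lemma cs_0 : cs 0 = 1.
Proof. unfold cs. rewrite Rmult_0_r. apply cos_0. Qed.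

(** Frequencies between 1 and H - 1 in absolute value sum to zero over the H equidistant shifts, so
    only the diagonal remains. *)
Lemma fej_grid H u : (1 <= H)%nat -> rsum H (fun i => fej H (u - i / H)) = H ^ 2.
Proof.
 intros HH.
 rewrite (rsum_ext H _ (fun i => rsum H (fun n => rsum H (fun m => cs (n * (u - i / H) - m * (u - i / H)))))),
  rsum_swap by (intros; apply fej_expand). rewrite (rsum_ext H _ (fun n => INR H)); [rewrite rsum_const; ring|].
 intros n Hn. rewrite rsum_swap, (rsum_ext H _ (fun m => ind (m = n) * H)).
 - apply (rsum_pick H n (fun _ => INR H)). easy.
 - intros m Hm. destruct (Nat.lt_trichotomy m n) as [Hc|[Hc|Hc]].
  + rewrite ind_F, Rmult_0_l, <- (character_sum H (n - m) (INR (n - m) * u)) by lia. ext i _. f_equal.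
   rewrite minus_INR by lia. ring.
  + subst m. rewrite ind_T by easy. rewrite (rsum_ext H _ (fun _ => 1)); [rewrite rsum_const; ring|]. intros i _.
   rewrite Rminus_diag. apply cs_0.
  + rewrite ind_F, Rmult_0_l, <- (character_sum H (m - n) (INR (m - n) * u)) by lia. ext i _. rewrite <- cs_opp.
   f_equal. rewrite minus_INR by lia. ring.
Qed.

Lemma fej_far H t de : 0 < de -> - 1 + de <= t <= - de -> fej H t <= 2 / de ^ 2.
Proof.
 intros Hd Ht. assert (Hs : de <= Rabs (sin (PI * t))). { destruct (Rle_lt_dec (- / 2) t) as [Hc|Hc].
  - via (Rabs t); [rewrite Rabs_left1; lra|]. apply sin_lower. rewrite Rabs_left1; lra.
  - rewrite <- (sin_sq_period t 1). via (Rabs (IZR 1 + t)); [rewrite Rabs_right; simpl; lra|]. apply sin_lower.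
   rewrite Rabs_right; simpl; lra. }
 assert (Hb : forall c, rsum H (fun i => cs (c + t * i)) ^ 2 <= / de ^ 2). { intros c.
  have (geometric_bound H c t) as G. set (z := rsum H (fun i => cs (c + t * i))) in *.
  assert (Hz : de * Rabs z <= 1) by nra. rewrite <- Rmult_1_l. apply le_div; [pos|]. rewrite <- pow2_abs.
  lhs ((de * Rabs z) ^ 2). replace 1 with (1 ^ 2) by ring. mono. }
 unfold fej. have (Hb 0) as H1. have (Hb (- / 4)) as H2.
 rewrite (rsum_ext H _ (fun n => cs (n * t))) in H1 by (intros; f_equal; ring).
 rewrite (rsum_ext H _ (fun n => sn (n * t))) in H2 by (intros; rewrite sn_as_cs; f_equal; ring). lra.
Qed.

(** For a < Q the integer z is forced to be the integer part of y, and the fractional part lies in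
    [a/Q, (a+1)/Q). *)
Definition frcell (Q a : nat) (y : R) : Prop := exists z : Z, a <= Q * (y - IZR z) < a + 1.

Lemma cs_shift_period H t z : fej H (t + IZR z) = fej H t.
Proof.
 rewrite !fej_expand. ext n _. ext m _.
 replace (n * (t + IZR z) - m * (t + IZR z)) with (n * t - m * t + IZR (Z.of_nat n * z - Z.of_nat m * z)).
 - apply cs_period.
 - rewrite minus_IZR, !mult_IZR, <- !INR_IZR_INZ. ring.
Qed.

(** A cell is M steps of a grid of H = Q M points. The kernels centred in the cell, widened by about
    R steps on both sides, carry the full mass H^2 up to a share 2 H / R^2 at every point of the
    cell, and the assumed bounds evaluate each kernel on average. *)
Lemma fejer_upper (T : nat) (wt y : nat -> R) E (Q a M R : nat) : (1 <= Q)%nat -> (1 <= M)%nat -> (1 <= R)%nat ->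
  (forall k, 0 <= wt k) -> 0 <= E ->
  (forall h om, (1 <= h < Q * M)%nat -> Rabs (rsum T (fun k => wt k * cs (h * y k + om))) <= E) ->
  rsum T (fun k => wt k * ind (frcell Q a (y k)))
  <= rsum T wt * (/ Q + (2 * R + 1) / INR (Q * M) + 2 * INR (Q * M) / R ^ 2) + INR (Q * M) * E.
Proof.
 intros HQ HM HR Hwt HE0 HE. set (H := (Q * M)%nat). set (P := rsum T wt). assert (HH1 : (1 <= H)%nat) by lia.
 assert (HH : 1 <= H) by inr. assert (HQR : 1 <= Q) by inr. assert (HMR : 1 <= M) by inr.
 assert (HRR : 1 <= R) by inr. assert (HHQ : INR H = Q * M) by (unfold H; apply mult_INR).
 assert (HP : 0 <= P) by (apply rsum_nonneg; intros; apply Hwt).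
 set (N := rsum T (fun k => wt k * ind (frcell Q a (y k)))). assert (HNP : N <= P). { termwise k _. mono. }
 assert (Hpos1 : 0 <= 2 * H / R ^ 2) by pos. assert (EM : / Q = M / H) by (rewrite HHQ; field; lra).
 set (J := (M + 2 * R + 1)%nat). assert (HJ : J / H = / Q + (2 * R + 1) / H). { unfold J. inr. }
 destruct (Nat.le_gt_cases H J) as [Hc|Hc]. {
  assert (1 <= J / H) by (apply le_div; [lra|]; rewrite Rmult_1_l; now apply le_INR). nra. }
 set (c := (a * M - R) / H). set (K := fun k i => fej H (y k - c - i / H)).
 (* the kernels centred away from the cell contribute little *)
 assert (Hcell : forall k, frcell Q a (y k) -> H ^ 2 - H * (2 * H ^ 2 / R ^ 2) <= rsum J (K k)). { intros k [z Hz].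
  assert (HU : H ^ 2 = rsum J (K k) + rsum (H - J) (fun i => K k (J + i)%nat)). {
   rewrite <- (fej_grid H (y k - c) HH1). replace H with (J + (H - J))%nat at 1 by lia. apply rsum_split. }
  assert (Hfar : rsum (H - J) (fun i => K k (J + i)%nat) <= H * (2 * H ^ 2 / R ^ 2)). {
   via (rsum (H - J) (fun _ => 2 * H ^ 2 / R ^ 2)).
   - termwise i Hi. unfold K.
    replace (y k - c - INR (J + i) / H) with ((y k - IZR z) - c - INR (J + i) / H + IZR z) by ring.
    rewrite cs_shift_period. rhs (2 / (R / H) ^ 2). apply fej_far; [pos|].
    assert (HJi : M + 2 * R + 1 <= INR (J + i)). { replace (M + 2 * R + 1) with (INR J); [mono|]. unfold J. inr. }
    assert (HJi2 : INR (J + i) <= H - 1). { rhs (INR (H - 1)) by (rewrite minus_INR by easy; simpl; ring). mono. }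
    set (v := y k - IZR z) in *. assert (Hv : a * M <= H * v < (a + 1) * M). { nra. }
    assert (Ev : v - c - INR (J + i) / H = (H * v - a * M + R - INR (J + i)) / H) by (unfold c; field; lra).
    rewrite Ev. split.
    + apply le_div; [lra|]. lhs (R - H). lra.
    + apply div_le; [lra|]. rhs (- INR R). lra.
   - rewrite rsum_const. mono. }
  lra. }
 assert (Hup : rsum J (fun i => rsum T (fun k => wt k * K k i)) <= J * (H * P + H ^ 2 * E)). { rewrite <- rsum_const.
  termwise i _. unfold K. set (s := c + i / H).
  rewrite (rsum_ext T _ (fun k => rsum H (fun n => rsum H (fun m => wt k * cs (n * (y k - s) - m * (y k - s)))))).
  2:{ intros k _. replace (y k - c - i / H) with (y k - s) by (unfold s; ring). rewrite fej_expand, <- rsum_scal.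
   ext n _. now rewrite <- rsum_scal. }
  rewrite rsum_swap. rhs (H * (P + H * E)). rewrite <- rsum_const. termwise n Hn. rewrite rsum_swap.
  via (rsum H (fun m => ind (m = n) * P + E)).
  - termwise m Hm. destruct (Nat.lt_trichotomy m n) as [Hc1|[Hc1|Hc1]].
   + rewrite ind_F, Rmult_0_l, Rplus_0_l by lia.
    etrans; [|apply (HE (n - m)%nat (- INR (n - m) * s)); unfold H in *; lia]. upto Rle_abs. right. ext k _.
    do 2 f_equal. rewrite minus_INR by lia. ring.
   + subst m. rewrite ind_T by easy. rewrite (rsum_ext T _ wt); [fold P; lra|]. intros k _. rewrite Rminus_diag, cs_0.
    ring.
   + rewrite ind_F, Rmult_0_l, Rplus_0_l by lia.
    etrans; [|apply (HE (m - n)%nat (- INR (m - n) * s)); unfold H in *; lia]. upto Rle_abs. right. ext k _.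
    rewrite <- cs_opp. do 2 f_equal. rewrite minus_INR by lia. ring.
  - rewrite rsum_plus, rsum_const, rsum_pick by easy. lra. }
 assert (Hlow : N * (H ^ 2 - H * (2 * H ^ 2 / R ^ 2)) <= rsum J (fun i => rsum T (fun k => wt k * K k i))). {
  rewrite rsum_swap. unfold N. rewrite <- rsum_scalr. termwise k _. rewrite rsum_scal, Rmult_assoc. mul_l.
  ind_case (frcell Q a (y k)) as Hk.
  - rewrite Rmult_1_l. pos.
  - rewrite Rmult_0_l. apply rsum_nonneg. intros; apply fej_nonneg. }
 assert (Hdiv : N * (1 - 2 * H / R ^ 2) <= J / H * P + J * E). { apply (Rmult_le_reg_r (H ^ 2)); [pos|].
  rhs (J * (H * P + H ^ 2 * E)). lra. }
 assert (J * E <= H * E) by mono. nra.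
Qed.

Lemma frcell_partition Q y : (1 <= Q)%nat -> rsum Q (fun a => ind (frcell Q a y)) = 1.
Proof.
 intros HQ. assert (HQR : 1 <= Q) by inr. destruct (archimed y) as [A1 A2]. set (z := (up y - 1)%Z).
 assert (Hz : 0 <= y - IZR z < 1) by (unfold z; rewrite minus_IZR; lra).
 destruct (nfloor (Q * (y - IZR z))) as (a & Ha1 & Ha2); [pos|]. assert (HaQ : (a < Q)%nat) by (apply INR_lt; nra).
 rewrite (rsum_ext Q _ (fun b => ind (b = a) * 1)); [now apply rsum_pick|]. intros b Hb. rewrite Rmult_1_r.
 apply ind_iff. split; [|intros ->; now exists z]. intros [z' Hz'].
 assert (Hb' : b + 1 <= Q) by (rewrite <- S_INR; apply le_INR; lia). have (pos_INR b). assert (z' = z). {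
  assert (0 <= y - IZR z' < 1) by nra.
  apply Z.le_antisymm; apply Zlt_succ_le; apply lt_IZR; unfold Z.succ; rewrite plus_IZR; lra. }
 subst z'. apply Nat.le_antisymm; apply Nat.lt_succ_r; apply INR_lt; rewrite S_INR; lra.
Qed.

(** M = m^4 and R = Q m^3 make both error terms of [fejer_upper] of order 1 / m. The lower bound
    follows from the upper bounds for the other cells, as the Q cells share the whole mass; this
    costs the factor Q. *)
Lemma fejer_discrepancy (T : nat) (wt y : nat -> R) E (Q m a : nat) : (1 <= Q)%nat -> (1 <= m)%nat -> (a < Q)%nat ->
  (forall k, 0 <= wt k) -> 0 <= E ->
  (forall h om, (1 <= h < Q * m ^ 4)%nat -> Rabs (rsum T (fun k => wt k * cs (h * y k + om))) <= E) ->
  Rabs (rsum T (fun k => wt k * ind (frcell Q a (y k))) - rsum T wt / Q)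
  <= Q * (5 * rsum T wt / m + Q * m ^ 4 * E).
Proof.
 intros HQ Hm Ha Hwt HE0 HE. set (P := rsum T wt).
 set (N := fun b => rsum T (fun k => wt k * ind (frcell Q b (y k)))). assert (HQR : 1 <= Q) by inr.
 assert (HmR : 1 <= m) by inr. assert (HP : 0 <= P) by (apply rsum_nonneg; intros; apply Hwt).
 set (B := 5 * P / m + Q * m ^ 4 * E). assert (HB : 0 <= B). { assert (0 <= 5 * P / m) by pos.
  assert (0 <= Q * m ^ 4 * E); [|unfold B; lra]. pos. }
 assert (Hup : forall b, N b <= P / Q + B). { intros b.
  etrans; [apply (fejer_upper T wt y E Q b (m ^ 4) (Q * m ^ 3)); auto|].
  - have (Nat.pow_nonzero m 4). lia.
  - have (Nat.pow_nonzero m 3). lia.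
  - fold P. rewrite !mult_INR, !pow_INR. unfold B. assert (T1 : (2 * (Q * m ^ 3) + 1) / (Q * m ^ 4) <= 3 / m). {
    apply div_le; [pos|]. rhs (3 * (Q * m ^ 3)). assert (1 <= m ^ 3) by pos. nra. }
   assert (T2 : 2 * (Q * m ^ 4) / (Q * m ^ 3) ^ 2 <= 2 / m). { lhs (2 / m * / (Q * m)).
    rewrite <- (Rmult_1_r (2 / m)) at 2. mul_l. rewrite <- Rinv_1. apply Rinv_le_contravar; nra. }
   nra. }
 assert (Hsum : rsum Q N = P). { unfold N, P. rewrite rsum_swap. ext k _. rewrite rsum_scal, frcell_partition by easy.
  ring. }
 change (Rabs (N a - P / Q) <= Q * B). apply Rabs_le. split.
 - assert (Hs : P <= rsum Q (fun b => P / Q + B + ind (b = a) * (N b - P / Q - B))). { rewrite <- Hsum at 1.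
   termwise b _. destruct (ind_cases (b = a)) as [[-> ->]|[_ ->]]; [lra|]. specialize (Hup b). lra. }
  rewrite rsum_plus, rsum_const, rsum_pick in Hs by easy.
  replace (Q * (P / Q + B)) with (P + Q * B) in Hs by (field; lra). lra.
 - specialize (Hup a). nra.
Qed.

(** * Cells along the primes of a dyadic range *)

Definition prime_wt (X Y k : nat) : R := ind (nprime k) * inI X Y k.

Lemma prime_wt_01 X Y k : 0 <= prime_wt X Y k <= 1.
Proof. unfold prime_wt, inI. have (ind_01 (nprime k)). have (ind_01 (X < k <= Y)%nat). nra. Qed.

Lemma prime_count_upper (X Y : nat) : (2 <= X)%nat -> (Y <= 2 * X)%nat -> dsum X (prime_wt X Y) <= 8 * X / ln X.
Proof.
 intros HX HY.
 assert (HlX : 0 < ln X) by (rewrite <- ln_1; apply ln_increasing; [lra|]; change 1 with (INR 1); apply lt_INR; lia).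
 apply le_div; [easy|]. rewrite <- rsum_scalr. via (psi (2 * X)).
 - termwise k Hk. unfold prime_wt, inI. ind_case (nprime k) as Hp; [|have (lam_nonneg k); lra].
  destruct (ind_cases (X < k <= Y)%nat) as [[Hc ->]|[_ ->]]; [|have (lam_nonneg k); lra]. rewrite (lam_prime k Hp).
  have (ln_INR_le X k ltac:(lia) ltac:(lia)). lra.
 - from psi_upper. inr.
Qed.

Lemma qroot_pow g n : 0 <= g -> qroot (g ^ (4 * n)) = g ^ n.
Proof.
 intros Hg. assert (H : 0 <= g ^ n) by now apply pow_le. unfold qroot.
 replace (g ^ (4 * n)) with (((g ^ n) ^ 2) ^ 2) by (rewrite <- !pow_mult; f_equal; lia).
 rewrite sqrt_pow2 by apply pow2_ge_0. now apply sqrt_pow2.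
Qed.

(** The order of the Fejer kernel follows T: m is a small power of T, capped by a power of L. Three
    ranges occur: bounded T, where the trivial bound suffices; T below a power of L, with
    [prime_sum]; and larger T, with [minor_primes]. *)
Lemma cell_error F b0 a0 (Q : nat) : ppok F -> 0 < b0 -> a0 <> 0 ->
  ((nonint b0 /\ (0 < nfr F)%nat /\ fex F 0%nat = b0) \/ (exists k, (1 <= k <= deg F)%nat /\ b0 = INR k /\ co F k = a0)) ->
  (1 <= Q)%nat ->
  exists g K X0, 0 < g <= 1 /\ 0 <= K /\ 2 <= X0 /\ forall (X Y a : nat) x, X0 <= X -> (Y <= 2 * X)%nat -> (a < Q)%nat -> 0 < x <= 1 ->
  Rabs (dsum X (fun k => prime_wt X Y k * ind (frcell Q a (x * ppval F (INR k)))) - dsum X (prime_wt X Y) / Q)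
  <= K * (X / ln (2 * X)) * (Rpower (Rmin (x * Rpower X b0) (/ x)) (- g) + / ln (2 * X)).
Proof.
 intros HF Hb Ha Hlead HQ. destruct (Maj_lower F b0 a0 Hb Ha Hlead) as (c0 & Hc0 & HMl).
 destruct (prime_sum F HF) as (C & K1 & X1 & HC & HX1 & HK1 & HPS).
 destruct (minor_primes F HF 7) as (B & X2 & HX2 & HMP). destruct (log_power_small 5) as (X3 & HX3 & HX3').
 (* In the middle range D = w^32, whose fourth root w^8 beats the factor w^4 from the number of
    frequencies. By [Maj_lower] the frequencies h <= Q w^4 are not major at level D^C = w^(32C) once
    w^(32C+5) is below a multiple of T; the extra factor w gives strictness. *)
 assert (HQR : 1 <= Q) by inr. set (E0 := (32 * C + 5)%nat). set (B2 := (B + 5)%nat). set (c2 := c0 / Q).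
 assert (Hc2 : 0 < c2 <= 1) by (unfold c2; split; [apply Rdiv_lt_0_compat; lra|apply div_le; lra]).
 assert (HE0 : 0 < E0) by pos. assert (HB2 : 0 < B2) by pos. set (g := Rmin (/ INR E0) (/ (16 * B2))).
 assert (Hg0 : 0 < g) by (apply Rmin_glb_lt; apply Rinv_0_lt_compat; lra). assert (HgE : g <= / E0) by apply Rmin_l.
 assert (HgB : g <= / (16 * B2)) by apply Rmin_r.
 assert (HE01 : / E0 <= 1) by (rewrite <- Rinv_1; apply Rinv_le_contravar; [lra|]; apply (le_INR 1); unfold E0; lia).
 set (T1 := 2 ^ E0 / c2). assert (H2E : 1 <= 2 ^ E0) by pos. set (M1 := Rpower T1 g).
 assert (HM1 : 0 < M1) by apply Rpower_pos. set (M2 := Rpower c2 (- / E0)). assert (HM2 : 0 < M2) by apply Rpower_pos.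
 set (KA := Q * (160 + Q * (2 * K1))).
 assert (HKA : 0 <= KA) by (apply Rmult_le_pos; [lra|]; assert (0 <= Q * (2 * K1)) by (apply Rmult_le_pos; lra); lra).
 set (KB := Q * (160 + Q)). assert (HKB : 0 <= KB) by (apply Rmult_le_pos; lra).
 exists g, (KA * (M2 + 1) + KB + 32 * M1), (X1 + X2 + X3 + exp (2 ^ 16) + exp (Q / c0) + exp Q + 2).
 have (exp_pos (2 ^ 16)). have (exp_pos (Q / c0)). have (exp_pos (INR Q)). split; [lra|]. split. { pos. }
 split; [lra|]. intros X Y a x HX HY HaQ Hx. set (L := ln (2 * X)). destruct (HX3' (INR X) ltac:(lra)) as [_ HLX].
 fold L in HLX. assert (HL16 : 2 ^ 16 <= L) by (apply le_ln; lra).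
 assert (HLQ : Q / c0 < L) by (rewrite <- (ln_exp (Q / c0)); apply ln_increasing; lra).
 assert (HLQ2 : Q <= L) by (apply le_ln; lra). assert (HX2' : (2 <= X)%nat) by inr.
 set (T := Rmin (x * Rpower X b0) (/ x)). assert (Hix : 0 < / x) by pos. assert (HxX : 0 < x * Rpower X b0) by pos.
 assert (HT0 : 0 < T) by (apply Rmin_glb_lt; easy). assert (HT1a : T <= x * Rpower X b0) by apply Rmin_l.
 assert (HT1b : T <= / x) by apply Rmin_r. set (P := dsum X (prime_wt X Y)). assert (HP : P <= 16 * (X / L)). {
  etrans; [apply prime_count_upper; auto|]. assert (HlX : L / 2 <= ln X). { unfold L in *.
   rewrite ln_mult in * by lra. have ln2_bounds. lra. }
  apply div_le; [lra|]. via (16 * X / L * (L / 2)); [right; field; lra|]. mono. }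
 set (err := Rabs (dsum X (fun k => prime_wt X Y k * ind (frcell Q a (x * ppval F (INR k)))) - P / Q)).
 (* Passing from x to h x divides T by at most h. *)
 assert (HnoMaj : forall (h m : nat) V w, (1 <= h < Q * m ^ 4)%nat -> m <= w -> 0 < V -> Q * w ^ 4 * V < c0 * T -> ~
  Maj F (INR X) V (h * x)). { intros h m V w Hh Hmw HV Hlt Hm. assert (Hh1 : 1 <= h) by inr.
  assert (HhQ : h <= Q * w ^ 4). { via (INR (Q * m ^ 4)); [mono|]. rewrite mult_INR, pow_INR. mono. }
  apply HMl in Hm; [|lra|pos]. assert (HTh : T <= h * Rmin (h * x * Rpower X b0) (/ (h * x))). {
   pattern (Rmin (h * x * Rpower X b0) (/ (h * x))). apply Rmin_case.
   - via (1 * (1 * T)); [lra|]. rewrite Rmult_assoc. mono.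
   - rewrite Rinv_mult, <- Rmult_assoc, Rinv_r, Rmult_1_l by lra. easy. }
  set (z := Rmin (h * x * Rpower X b0) (/ (h * x))) in *. assert (c0 * T <= h * V). { via (c0 * (h * z)); [mono|].
   lhs (h * (c0 * z)). mono. }
  assert (h * V <= Q * w ^ 4 * V) by mono. lra. }
 assert (Herr : forall (m : nat) w E, (1 <= m)%nat -> w / 2 <= m -> m <= w -> w <= L -> 0 <= E -> (forall h om, (1 <=
  h < Q * m ^ 4)%nat -> Rabs (h * x) <= X -> Rabs (dsum X (fun k => ind (nprime k) * phase F X Y (h * x) om k)) <= E)
  -> err <= Q * (160 * (X / L) / w + Q * w ^ 4 * E)). { intros m w E Hm Hmw1 Hmw2 HwL HE0' HE.
  assert (Hm1 : 1 <= m) by inr.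
  have (fejer_discrepancy (S (2 * X)) (prime_wt X Y) (fun k => x * ppval F (INR k)) E Q m a HQ Hm HaQ (fun k => proj1
   (prime_wt_01 X Y k)) HE0') as Hf. from Hf.
  - intros h om Hh. rewrite (rsum_ext _ _ (fun k => ind (nprime k) * phase F X Y (h * x) om k)).
   + apply HE; [easy|]. rewrite Rabs_right by pos. via (INR (Q * m ^ 4) * 1).
    * mono.
    * rewrite Rmult_1_r, mult_INR, pow_INR. upto HLX. rhs (L * L ^ 4). mono.
   + intros k _. unfold prime_wt, phase. rewrite (Rmult_assoc (INR h)). ring.
  - mul_l. apply Rplus_le_compat.
   + fold P. apply div_le; [lra|]. via (80 * (X / L)); [lra|]. rhs (80 * (X / L) * (2 * m / w)).
    rewrite <- Rmult_1_r at 1. mul_l. apply le_div; lra.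
   + mono. }
 set (TG := Rpower T (- g)). assert (HTG : 0 < TG) by apply Rpower_pos. assert (HiL : 0 < / L) by pos.
 assert (Hgoal : err <= KA * (M2 + 1) * (X / L) * TG \/ err <= KB * (X / L) * / L \/ err <= 32 * M1 * (X / L) * TG).
 { destruct (Rlt_le_dec (c2 * T) (2 ^ E0)) as [Hs|Hs]. { right. right.
   assert (HTT : T <= T1) by (unfold T1; apply le_div; lra). assert (HM : 1 <= M1 * TG). { unfold M1, TG.
    rewrite Rpower_Ropp. apply le_div_inv_r; [pos|]. rewrite Rmult_1_l. apply Rpower_incr; lra. }
   via (2 * P).
   - from Rabs_sub_le.
    assert (Hn : 0 <= dsum X (fun k => prime_wt X Y k * ind (frcell Q a (x * ppval F (INR k)))) <= P). {
     split; [apply rsum_nonneg; intros; apply Rmult_le_pos; [apply prime_wt_01|pos]|]. termwise k _.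
     rewrite <- (Rmult_1_r (prime_wt X Y k)) at 2. apply Rmult_le_compat_l; [apply prime_wt_01|pos]. }
    assert (HPQ : 0 <= P / Q <= P) by (split; [pos|apply div_le; [lra|]; assert (P * 1 <= P * Q) by (mono); lra]).
    rewrite !Rabs_right by lra. lra.
   - via (32 * (X / L) * 1); [lra|]. rhs (32 * (X / L) * (M1 * TG)). mono. }
  (* Above L^(B+5) no frequency is major at level L^B, and the order of the kernel can be as large
     as L itself, which yields the term 1 / L. *)
  assert (HT1' : 1 <= T) by (assert (c2 * T <= 1 * T) by mono; lra). destruct (Rle_lt_dec (L ^ B2) T) as [Hb2|Hb2].
  - right. left. destruct (nfloor L) as (m & Hm1 & Hm2); [lra|]. assert (Hm : (1 <= m)%nat) by inr.
   etrans; [apply (Herr m L (X / L ^ 7)); auto; try lra|].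
   + pos.
   + intros h om Hh Hhx. apply HMP; auto; [lra|]. apply (HnoMaj h m (L ^ B) L); auto; [pos|].
    apply Rlt_le_trans with (c0 * L ^ B2); [|mono]. unfold B2. rewrite pow_add. lhs (L ^ B * L ^ 4 * Q).
    rhs (L ^ B * L ^ 4 * (c0 * L)). apply Rmult_lt_compat_l; [pos|]. rewrite Rmult_comm. apply Rlt_div_l; [lra|easy].
   + unfold KB. rhs (Q * (160 * (X / L) / L + Q * (X / L * / L))). mul_l. apply Rplus_le_compat_l.
    rewrite Rmult_assoc. mul_l. lhs (X / L * (/ L * / L)). rewrite <- (Rmult_1_r (/ L)) at 3. rewrite <- Rinv_1. mono.
  (* The cap w <= L^(1/16) makes 1 / sqrt L at most w^(-8). Because T < L^B2 here, the cap still
     leaves a saving T^(-1/(16 B2)), which is why g is chosen that small. *)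
  - left. set (g1 := Rpower (c2 * T) (/ INR E0)). set (g2 := Rpower L (/ 16)). set (w := Rmin g1 g2).
   assert (Hg1p : g1 ^ E0 = c2 * T). { unfold g1. rewrite <- Rpower_pow by apply Rpower_pos.
    rewrite Rpower_mult, Rinv_l, Rpower_1; lra. }
   assert (Hg2p : g2 ^ 16 = L). { unfold g2. rewrite <- Rpower_pow, Rpower_mult by apply Rpower_pos.
    replace (/ 16 * INR 16) with 1 by inr. rewrite Rpower_1; lra. }
   assert (Hg1 : 2 <= g1). { apply Rnot_lt_le. intros Hc. assert (g1 ^ E0 < 2 ^ E0); [|lra].
    replace E0 with (S (32 * C + 4)) by lia. apply pow_lt_pow. split; [apply Rpower_pos|easy]. }
   assert (Hg2 : 2 <= g2). { apply Rnot_lt_le. intros Hc.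
    assert (g2 ^ 16 < 2 ^ 16) by (apply pow_lt_pow; split; [apply Rpower_pos|easy]). lra. }
   assert (Hw : 2 <= w) by (apply Rmin_glb; easy). assert (Hw1 : w <= g1) by apply Rmin_l.
   assert (Hw2 : w <= g2) by apply Rmin_r. assert (Hw16 : w ^ 16 <= L) by (rewrite <- Hg2p; apply pow_incr; lra).
   assert (HwE : w ^ E0 <= c2 * T) by (rewrite <- Hg1p; apply pow_incr; lra).
   assert (HwL : w <= L) by (upto Hw16; rewrite <- pow_1 at 1; apply pow_mono; [lra|lia]).
   destruct (nfloor w) as (m & Hm1 & Hm2); [lra|]. assert (Hm : (1 <= m)%nat) by inr.
   set (E := K1 * (X / L) * (/ w ^ 8 + / sqrt L)). assert (Hw8 : w ^ 8 <= sqrt L). {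
    rewrite <- (sqrt_pow2 (w ^ 8)) by pos. mono. }
   assert (HsL : / sqrt L <= / w ^ 8) by mono. assert (HE1 : E <= K1 * (X / L) * (2 * / w ^ 8)). { unfold E. mono. }
   assert (Herrw : err <= KA * (X / L) * / w). { etrans; [apply (Herr m w E); auto; try lra|].
    - unfold E. pos.
    - intros h om Hh Hhx. have (HPS (w ^ (4 * 8)) X Y (h * x) om) as Hps. rewrite qroot_pow in Hps by lra.
     apply Hps; auto; [|lra|].
     + via (w ^ 1); [lra|]. mono.
     + rewrite <- pow_mult. apply (HnoMaj h m (w ^ (4 * 8 * C)) w); auto; [pos|]. assert (Hz : Q * w ^ E0 <= c0 * T).
      { via (Q * (c2 * T)); [mono|]. unfold c2. right. field. lra. }
      unfold E0 in Hz. replace (32 * C + 5)%nat with (4 * 8 * C + 4 + 1)%nat in Hz by lia.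
      rewrite !pow_add, pow_1 in Hz. assert (0 < Q * w ^ 4 * w ^ (4 * 8 * C)) by pos.
      assert (Q * w ^ 4 * w ^ (4 * 8 * C) * 2 <= Q * w ^ 4 * w ^ (4 * 8 * C) * w) by mono. lra.
    - unfold KA. rhs (Q * (160 * (X / L) / w + Q * (K1 * (X / L) * (2 * / w)))). mul_l. apply Rplus_le_compat_l.
     rewrite Rmult_assoc. mul_l. via (w ^ 4 * (K1 * (X / L) * (2 * / w ^ 8))); [mono|].
     lhs (K1 * (X / L) * (2 * / w ^ 4)). mul_l. mul_l. apply Rinv_le_contravar; [lra|]. rewrite <- pow_1 at 1. mono. }
   assert (Hiw : / w <= (M2 + 1) * TG). { assert (I1 : / g1 <= M2 * TG). { unfold g1, M2, TG.
     rewrite <- Rpower_Ropp, <- Rpower_mult_distr by lra. mono. }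
    assert (I2 : / g2 <= TG). { unfold g2, TG. rewrite <- Rpower_Ropp. via (Rpower (Rpower T (/ INR B2)) (- / 16)).
     - apply Rpower_decr; [|lra]. split; [pos|]. via (Rpower (Rpower L (INR B2)) (/ INR B2)).
      + apply Rpower_incr; [|pos]. rewrite Rpower_pow by lra. lra.
      + rewrite Rpower_mult, Rinv_r, Rpower_1; lra.
     - rewrite Rpower_mult. apply Rle_Rpower; [easy|]. lhs (- / (16 * B2)). lra. }
    unfold w. apply Rmin_case; [pos|]. assert (0 < M2 * TG) by pos. lra. }
   from Herrw. rhs (KA * (X / L) * ((M2 + 1) * TG)). mono. }
 set (KK := KA * (M2 + 1) + KB + 32 * M1). assert (HA0 : 0 <= KA * (M2 + 1)) by pos.
 assert (Hmono : forall k z, 0 <= k <= KK -> 0 <= z <= TG + / L -> k * (X / L) * z <= KK * (X / L) * (TG + / L)). {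
  intros k z Hk Hz. mono. }
 destruct Hgoal as [Hg|[Hg|Hg]]; (from Hg); apply Hmono; unfold KK; lra.
Qed.

(** * Digits *)

Lemma pseudo_poly_growth d alpha beta : 0 < alpha 0%nat -> (forall i : nat, (i < d)%nat -> beta (S i) < beta i) ->
  exists c1 c2 x0, 0 < c1 <= 1 /\ 0 < c2 /\ 1 <= x0 /\ forall x, x0 <= x ->
  c1 * Rpower x (beta 0%nat) <= pseudo_poly d alpha beta x <= c2 * Rpower x (beta 0%nat).
Proof.
 intros Ha Hdec. have (decreasing_beta beta d Hdec) as Hlt. set (b0 := beta 0%nat).
 destruct (Rpower_large_all d (fun i => b0 - beta (S i)) (fun i => 2 * d * Rabs (alpha (S i)) / alpha 0%nat)) as (x0 &
  Hx0 & HL). { intros i Hi. specialize (Hlt 0%nat (S i) ltac:(lia)). unfold b0. lra. }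
 exists (Rmin 1 (alpha 0%nat / 2)), (3 * alpha 0%nat / 2), x0. have (Rmin_l 1 (alpha 0%nat / 2)).
 have (Rmin_r 1 (alpha 0%nat / 2)). split; [split; [apply Rmin_glb_lt; lra|easy]|]. split; [lra|]. split; [easy|].
 intros x Hx. unfold pseudo_poly. rewrite sum_f_R0_rsum, rsum_first. fold b0.
 assert (Hrest : Rabs (rsum d (fun i => alpha (S i) * Rpower x (beta (S i)))) <= alpha 0%nat / 2 * Rpower x b0). {
  from rsum_abs. destruct (Nat.eq_dec d 0) as [->|Hd].
  - simpl. pos.
  - assert (HdR : 0 < d) by pos. via (rsum d (fun _ => alpha 0%nat / 2 * Rpower x b0 / d)).
   + termwise i Hi. specialize (HL x i Hi Hx). rewrite Rabs_mult, (Rabs_right (Rpower _ _)) by pos.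
    apply div_le_inv in HL; [|easy]. apply le_div; [easy|].
    replace (Rpower x b0) with (Rpower x (b0 - beta (S i)) * Rpower x (beta (S i))) by (rewrite <- Rpower_plus;
     f_equal; ring). have (Rpower_pos x (beta (S i))). nra.
   + rewrite rsum_const. right. field. lra. }
 apply Rabs_le_between in Hrest. nra.
Qed.

Lemma ndigits_aux_spec q : (2 <= q)%nat -> forall fuel m, (m <= fuel)%nat ->
  (m < q ^ ndigits_aux fuel q m)%nat /\ ((1 <= m)%nat -> (1 <= ndigits_aux fuel q m)%nat /\ (q ^ (ndigits_aux fuel q m - 1) <= m)%nat).
Proof.
 intros Hq. induction fuel as [|fuel IH]; intros m Hm.
 - assert (m = 0)%nat as -> by lia. pos.
 - simpl ndigits_aux. destruct (Nat.eqb_spec m 0) as [->|Hm0]; [pos|]. euclid m q as E Hu.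
  set (t := (m / q)%nat) in *. assert (Ht : (t <= fuel)%nat) by nia. destruct (IH t Ht) as [H1 H2].
  set (k := ndigits_aux fuel q t) in *. split.
  + rewrite Nat.pow_succ_r'. nia.
  + intros _. replace (S k - 1)%nat with k by lia. destruct (Nat.eq_dec t 0) as [Ht0|Ht0].
   * assert (k = 0)%nat as ->; [|simpl; lia]. unfold k. rewrite Ht0. now destruct fuel.
   * replace k with (S (k - 1)) by lia. rewrite Nat.pow_succ_r'. nia.
Qed.

Lemma ndigits_upper q m : (2 <= q)%nat -> (m < q ^ ndigits q m)%nat.
Proof. intros Hq. now apply ndigits_aux_spec. Qed.

Lemma ndigits_lower q m : (2 <= q)%nat -> (1 <= m)%nat -> (1 <= ndigits q m)%nat /\ (q ^ (ndigits q m - 1) <= m)%nat.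
Proof. intros Hq Hm. now apply ndigits_aux_spec. Qed.

Lemma block_val_floor f p : 0 <= f (INR p) -> INR (block_val f p) <= f (INR p) < INR (block_val f p) + 1.
Proof.
 intros H. unfold block_val. destruct (base_Int_part (f (INR p))) as [H1 H2].
 assert (H0 : (0 <= Int_part (f (INR p)))%Z). { apply Z.lt_succ_r. apply lt_IZR. unfold Z.succ. rewrite plus_IZR. lra. }
 rewrite INR_IZR_INZ, Z2Nat.id by easy. lra.
Qed.

Lemma nat_div_real v e y : (1 <= e)%nat -> INR v <= y < INR v + 1 -> INR (v / e) <= y / INR e < INR (v / e) + 1.
Proof.
 intros He Hy. euclid v e as E Hm. set (t := (v / e)%nat) in *.
 assert (H1 : t * e <= v) by (rewrite <- mult_INR; apply le_INR; lia).
 assert (H2 : v + 1 <= (t + 1) * e) by (rewrite <- !S_INR, <- mult_INR; apply le_INR; lia).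
 split; [apply le_div; lra|]. apply Rlt_div_l; lra.
Qed.

(** The end points of the cells correspond to integral values of y, so a real number and its integer
    part fall into the same cell. Digits of floor(f(p)) can thus be read from f(p). *)
Lemma frcell_iff (Q a v e : nat) y : (1 <= Q)%nat -> (1 <= e)%nat -> (a < Q)%nat -> v <= y < v + 1 ->
  ((v / e) mod Q = a)%nat <-> frcell Q a (y / INR (e * Q)).
Proof.
 intros HQ He Ha Hy. have (nat_div_real v e y He Hy) as Hu. set (u := (v / e)%nat) in *. assert (HQ0 : 0 < Q) by pos.
 assert (He0 : 0 < e) by pos. euclid u Q as E Hm.
 assert (Ey : forall z, Q * (y / INR (e * Q) - IZR z) = y / e - Q * IZR z) by (intros; rewrite mult_INR; field; lra).
 assert (Hcell : frcell Q (u mod Q) (y / INR (e * Q))). { exists (Z.of_nat (u / Q)).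
  rewrite Ey, <- INR_IZR_INZ, <- mult_INR.
  assert (Eu : INR u = INR (Q * (u / Q)) + INR (u mod Q)) by (rewrite <- plus_INR; f_equal; exact E). lra. }
 split; [intros <-; easy|]. intros Hf. have (frcell_partition Q (y / INR (e * Q)) HQ) as Hp.
 destruct (Nat.eq_dec (u mod Q) a) as [|Hne]; [easy|].
 assert (H2 : 2 <= rsum Q (fun b => ind (frcell Q b (y / INR (e * Q))))); [|lra].
 via (rsum Q (fun b => ind (b = a) * 1 + ind (b = (u mod Q)%nat) * 1)).
 - rewrite rsum_plus, rsum_pick, rsum_pick by easy. lra.
 - termwise b Hb. destruct (ind_cases (b = a)) as [[-> ->]|[_ ->]].
  + rewrite ind_F by lia. rewrite ind_T by easy. lra.
  + destruct (ind_cases (b = (u mod Q)%nat)) as [[-> ->]|[_ ->]]; [rewrite ind_T by easy; lra|].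
   have (ind_01 (frcell Q b (y / INR (e * Q)))). lra.
Qed.

(** Induction from X = ceil(n / 2) to n. Beyond 4096 the bound X / ln X is at most 3/4 of n / ln n,
    and (M + 3 K) 3/4 + K 3/4 <= M + 3 K, so no logarithm accumulates over the dyadic steps. *)
Lemma dyadic_total (D : nat -> R) K X0 : 0 <= K -> 1 <= X0 ->
  (forall X Y : nat, X0 <= X -> (X <= Y <= 2 * X)%nat -> Rabs (D Y - D X) <= K * (X / ln (2 * X))) ->
  exists A, 0 <= A /\ forall n, (2 <= n)%nat -> Rabs (D n) <= A * (n / ln n).
Proof.
 intros HK HX0 HD. destruct (nfloor (2 * X0 + 4096)) as (n1 & Hn1 & Hn1'); [lra|].
 set (M := rsum (S n1) (fun n => Rabs (D n))). assert (HM : 0 <= M) by (apply rsum_nonneg; intros; apply Rabs_pos).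
 exists (M + 3 * K). split; [lra|]. intros n. induction n as [n IH] using lt_wf_ind. intros Hn.
 assert (HnR : 2 <= n) by inr. assert (Hln : 0 < ln n) by pos. destruct (Nat.le_gt_cases n n1) as [Hc|Hc].
 - via (M * 1).
  + rewrite Rmult_1_r. apply (rsum_term_le (S n1) n (fun n => Rabs (D n))); [lia|intros; apply Rabs_pos].
  + apply Rmult_le_compat; [easy|lra|lra|]. apply le_div; [easy|]. have (ln_le_sub (INR n) ltac:(lra)). lra.
 - assert (Hbig : 2 * X0 + 4096 < n) by (apply le_INR in Hc; rewrite S_INR in Hc; lra).
  assert (Hn10 : (10 < n)%nat) by inr. set (X := ((n + 1) / 2)%nat). euclid (n + 1)%nat 2%nat as E Hm.
  assert (HX : (X <= n <= 2 * X)%nat) by lia. assert (HXR : 2 * X <= n + 1). { change 2 with (INR 2).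
   rewrite <- mult_INR, <- S_INR. mono. }
  assert (HXR2 : n <= 2 * X). { change 2 with (INR 2). rewrite <- mult_INR. mono. }
  have (HD X n ltac:(lra) HX) as H1. have (IH X ltac:(lia) ltac:(lia)) as H2. set (l := ln n) in *.
  assert (Hl6 : 6 <= l). { unfold l. via (ln (2 ^ 12)).
   - rewrite ln_pow by lra. have ln2_bounds. inr.
   - mono. }
  assert (HlX : l - 1 <= ln X). { unfold l.
   via (ln (2 * X) - 1); [assert (ln n <= ln (2 * X)) by (apply ln_le; lra); lra|]. rewrite ln_mult by lra.
   have ln2_bounds. lra. }
  assert (Hfr : X / ln X <= 3 / 4 * (n / l)). { apply div_le; [lra|]. via (3 / 4 * (n / l) * (l - 1)).
   - assert (Hll : 5 / 6 <= (l - 1) / l) by (apply le_div; lra). nra.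
   - mono. }
  assert (Hfr2 : X / ln (2 * X) <= 3 / 4 * (n / l)). { upto Hfr. mono. }
  assert (H3 : (M + 3 * K) * (X / ln X) <= (M + 3 * K) * (3 / 4 * (n / l))) by mono.
  assert (H4 : K * (X / ln (2 * X)) <= K * (3 / 4 * (n / l))) by mono. assert (H6 : 0 <= M * (n / l)) by pos.
  arg (D X + (D n - D X)). from Rabs_triang. lra.
Qed.

Lemma geometric_upper rho n : 0 < rho < 1 -> rsum n (fun e => rho ^ e) <= / (1 - rho).
Proof.
 intros Hr. via ((1 - rho ^ n) / (1 - rho)).
 - right. induction n as [|n IH]; [simpl; field; lra|]. rewrite rsum_S, IH. simpl. field. lra.
 - unfold Rdiv. rewrite <- (Rmult_1_l (/ (1 - rho))) at 2. mul_r. assert (0 < rho ^ n) by pos. lra.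
Qed.

Lemma geometric_rev_upper rho n : 0 < rho < 1 -> rsum n (fun e => rho ^ (n - 1 - e)) <= / (1 - rho).
Proof.
 intros Hr. induction n as [|n IH]; [simpl; left; apply Rinv_0_lt_compat; lra|]. rewrite rsum_S.
 replace (S n - 1 - n)%nat with 0%nat by lia. rewrite (rsum_ext n _ (fun e => rho * rho ^ (n - 1 - e))).
 - rewrite rsum_scal. assert (rho * rsum n (fun e => rho ^ (n - 1 - e)) <= rho * / (1 - rho)) by mono.
  rhs (rho * / (1 - rho) + 1). lra.
 - intros e He. replace (S n - 1 - e)%nat with (S (n - 1 - e)) by lia. easy.
Qed.

(* The number of occurrences, among the q-ary digits of v, of the length l block with value a. *)
Definition blk (q l a v : nat) : R :=
  rsum (ndigits q v) (fun e => ind ((e + l <= ndigits q v)%nat /\ ((v / q ^ e) mod q ^ l = a)%nat)).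

Lemma pow_lt_inv q a b : (2 <= q)%nat -> (q ^ a < q ^ b)%nat -> (a < b)%nat.
Proof. intros Hq H. apply (Nat.pow_lt_mono_r_iff q); lia. Qed.

Lemma blk_split q l a v E : (2 <= q)%nat -> (E + l <= ndigits q v)%nat ->
  0 <= blk q l a v - rsum E (fun e => ind ((v / q ^ e) mod q ^ l = a)%nat) <= INR (ndigits q v) - E.
Proof.
 intros Hq HE. unfold blk. set (nd := ndigits q v) in *.
 set (ph := fun e => ind ((e + l <= nd)%nat /\ ((v / q ^ e) mod q ^ l = a)%nat)).
 assert (Es : rsum nd ph = rsum E ph + rsum (nd - E) (fun i => ph (E + i)%nat)) by (rewrite <- rsum_split; f_equal;
  lia). rewrite Es, (rsum_ext E _ (fun e => ind ((v / q ^ e) mod q ^ l = a)%nat)). 2:{ intros e He. apply ind_iff.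
  lia. }
 set (z := rsum (nd - E) (fun i => ph (E + i)%nat)). assert (Hz : 0 <= z <= INR (nd - E)). {
  split; [apply rsum_nonneg; intros; apply ind_01|apply rsum_eq_count]. }
 rewrite minus_INR in Hz by lia. lra.
Qed.

(** All blocks of the range have between nN and nN + K0 digits, nN being the length of the lower
    bound c1 X^b0. Only the E = nN - l positions common to all are treated by [cell_error], with x =
    1 / q^(e + l); the others, at most K0 + l per block, cost O(1) for each prime. *)
Lemma block_dyadic q d alpha beta l a : (2 <= q)%nat -> 0 < alpha 0%nat -> (forall i : nat, (i < d)%nat -> beta (S i) < beta i) ->
  0 < beta d -> (1 <= l)%nat -> (a < q ^ l)%nat ->
  let bv := block_val (pseudo_poly d alpha beta) in
  exists K X0, 0 <= K /\ 2 <= X0 /\ forall X Y : nat, X0 <= X -> (Y <= 2 * X)%nat ->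
  Rabs (dsum X (fun k => prime_wt X Y k * (blk q l a (bv k) - INR (ndigits q (bv k)) / INR (q ^ l)))) <= K * (X / ln (2 * X)).
Proof.
 intros Hq Ha Hdec Hpos Hl Haq bv. set (f := pseudo_poly d alpha beta) in *.
 have (decreasing_beta beta d Hdec) as Hlt. assert (Hb0 : 0 < beta 0%nat). {
  destruct (Nat.eq_dec d 0) as [->|]; [easy|]. specialize (Hlt 0%nat d ltac:(lia)). lra. }
 destruct (ppdata_of d alpha beta) as (F & HF & HFv & Hlead); auto; [lra|]. fold f in HFv.
 destruct (pseudo_poly_growth d alpha beta Ha Hdec) as (c1 & c2 & x0 & Hc1 & Hc2 & Hx0 & Hgr).
 set (b0 := beta 0%nat) in *. set (Q := (q ^ l)%nat). assert (HQ : (1 <= Q)%nat) by lia.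
 destruct (cell_error F b0 (alpha 0%nat) Q HF Hb0 ltac:(lra) Hlead HQ) as (g & K & X1 & Hg & HK & HX1 & HCE).
 destruct (Rpower_large b0 (INR (q ^ l) / c1)) as (X2 & HX2 & HX2'); [easy|].
 destruct (pow2_exceeds (c2 * Rpower 2 b0 / c1)) as [K0 HK0]. assert (HqR : 2 <= q) by inr.
 set (rho := Rpower q (- g)). assert (Hrho : 0 < rho < 1). { split; [apply Rpower_pos|].
  rewrite <- (Rpower_O (INR q)) by lra. apply Rpower_lt; lra. }
 set (G := / (1 - rho)). assert (HG : 0 < G) by (apply Rinv_0_lt_compat; lra).
 exists (K * (2 * G + 2 * b0) + INR (K0 + l) * 16), (X1 + X2 + x0 + exp 1). have (exp_pos 1). split. { pos. }
 split; [lra|]. intros X Y HX HY. set (L := ln (2 * X)). assert (HX2n : (2 <= X)%nat) by inr.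
 assert (HL1 : 1 <= L) by (apply le_ln; lra). set (XB := Rpower X b0). assert (HXB : 0 < XB) by apply Rpower_pos.
 set (Z := c1 * XB). assert (HZq : INR (q ^ l) <= Z). { specialize (HX2' (INR X) ltac:(lra)).
  apply div_le_inv in HX2'; [|lra]. unfold Z, XB. lra. }
 assert (HZ1 : 1 <= Z) by (upto HZq; apply (le_INR 1); exact HQ). destruct (nfloor Z) as (N & HN1 & HN2); [lra|].
 assert (HNq : (q ^ l <= N)%nat). { apply Nat.lt_succ_r. apply INR_lt. rewrite S_INR. lra. }
 set (nN := ndigits q N). assert (HN1' : (1 <= N)%nat) by lia. destruct (ndigits_lower q N Hq HN1') as [HnN1 HnN2].
 have (ndigits_upper q N Hq) as HnN3. fold nN in HnN1, HnN2, HnN3.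
 assert (HlN : (l < nN)%nat) by (apply (pow_lt_inv q); lia). set (E := (nN - l)%nat).
 set (P := dsum X (prime_wt X Y)). assert (HP : P <= 16 * (X / L)). { etrans; [apply prime_count_upper; auto|].
  assert (HlX : L / 2 <= ln X). { unfold L in *. rewrite ln_mult in * by lra. assert (ln 2 <= ln X); [|lra]. mono. }
  apply div_le; [lra|]. via (16 * X / L * (L / 2)); [right; field; lra|]. mono. }
 (* the length of a block differs from E by a bounded amount *)
 assert (Hk : forall k, (X < k <= 2 * X)%nat -> INR (bv k) <= f (INR k) < INR (bv k) + 1 /\ (nN <= ndigits q (bv
  k))%nat /\ (ndigits q (bv k) <= nN + K0)%nat). { intros k Hk. assert (HkX : X <= k) by mono.
  assert (HkX2 : k <= 2 * X) by (change 2 with (INR 2); rewrite <- mult_INR; apply le_INR; lia).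
  destruct (Hgr (INR k) ltac:(lra)) as [G1 G2]. assert (HfZ : Z <= f (INR k)). { upto G1. mul_l.
   apply Rpower_incr; lra. }
  assert (HfZ2 : f (INR k) <= 2 ^ K0 * Z). { from G2. via (c2 * (Rpower 2 b0 * XB)).
   - mul_l. unfold XB. rewrite Rpower_mult_distr by lra. apply Rpower_incr; lra.
   - via (c2 * Rpower 2 b0 / c1 * Z); [unfold Z; right; field; lra|]. mono. }
  have (block_val_floor f k ltac:(lra)) as Hv. fold bv in Hv. set (v := bv k) in *. split; [easy|].
  assert (HNv : (N <= v)%nat). { apply Nat.lt_succ_r. inr. }
  destruct (ndigits_lower q v Hq ltac:(lia)) as [V1 V2]. have (ndigits_upper q v Hq) as V3.
  set (nv := ndigits q v) in *. split.
  - assert (nN - 1 < nv)%nat; [|lia]. apply (pow_lt_inv q); [easy|lia].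
  - assert (nv - 1 < nN + K0)%nat; [|lia]. apply (pow_lt_inv q); [easy|]. apply INR_lt.
   rewrite Nat.pow_add_r, mult_INR. apply le_INR in V2. apply lt_INR in HnN3.
   apply Rle_lt_trans with (2 ^ K0 * Z); [lra|]. assert (HZn : Z < INR (q ^ nN)). {
    apply Rlt_le_trans with (N + 1); [easy|]. rewrite <- S_INR. apply le_INR. apply INR_lt in HnN3. lia. }
   assert (H2q : 2 ^ K0 <= INR (q ^ K0)) by (rewrite pow_INR; apply pow_incr; lra). assert (0 < 2 ^ K0) by pos.
   apply Rlt_le_trans with (2 ^ K0 * INR (q ^ nN)).
   + apply Rmult_lt_compat_l; lra.
   + rewrite Rmult_comm. mono. }
 set (cell := fun k e => ind (frcell Q a (f (INR k) / INR (q ^ e * Q)))).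
 assert (Hk2 : forall k, (X < k <= 2 * X)%nat -> Rabs (blk q l a (bv k) - INR (ndigits q (bv k)) / Q - (rsum E (cell
  k) - E / Q)) <= INR (K0 + l)). { intros k Hk'. destruct (Hk k Hk') as (Hv & Hn1 & Hn2). set (v := bv k) in *.
  set (nv := ndigits q v) in *. have (blk_split q l a v E Hq) as Hs. fold nv in Hs.
  specialize (Hs ltac:(unfold E; lia)). rewrite (rsum_ext E _ (cell k)) in Hs. 2:{ intros e He. apply ind_iff.
   apply frcell_iff; auto. have (Nat.pow_nonzero q e). lia. }
  assert (HnE : E <= nv <= E + INR (K0 + l)) by (rewrite <- plus_INR; split; apply le_INR; unfold E; lia).
  assert (HQ1 : 1 <= Q) by inr. set (s := nv - E) in *. assert (0 <= s / Q <= s). { split; [pos|apply div_le; [lra|]].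
   mono. }
  apply Rabs_le. unfold s in *. lra. }
 (* T^(-g) is at most the larger of its values at the two arguments of the minimum, here bounded by
    the sum of rho^(E-1-e) and rho^e, with rho = q^(-g): the two geometric series, one from each end
    of the block. *)
 assert (Herr : forall e, (e < E)%nat -> Rabs (dsum X (fun k => prime_wt X Y k * cell k e) - P / Q) <= K * (X / L) *
  (rho ^ (E - 1 - e) + rho ^ e + / L)). { intros e He. set (x := / INR (q ^ e * Q)).
  assert (HqQ : 1 <= INR (q ^ e * Q)). { apply (le_INR 1). have (Nat.pow_nonzero q e). lia. }
  assert (Hx : 0 < x <= 1) by (unfold x; split; [apply Rinv_0_lt_compat; lra|rewrite <- Rinv_1; apply
   Rinv_le_contravar; lra]). have (HCE X Y a x ltac:(lra) HY Haq Hx) as Hc. fold L XB P in Hc.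
  rewrite (rsum_ext _ _ (fun k => prime_wt X Y k * cell k e)) in Hc. 2:{ intros k _. unfold cell.
   destruct (Nat.eq_dec k 0) as [->|Hk0].
   - unfold prime_wt. rewrite ind_F; [ring|]. intros [Hp _]. lia.
   - do 3 f_equal. rewrite HFv by pos. unfold x. lra. }
  from Hc. mul_l. assert (R1 : Rpower (x * XB) (- g) <= rho ^ (E - 1 - e)). { unfold rho.
   rewrite <- Rpower_pow, Rpower_mult, (Rmult_comm (- g)), <- Rpower_mult by apply Rpower_pos.
   apply Rpower_decr; [|lra]. split; [pos|]. rewrite Rpower_pow by lra. rewrite Rmult_comm.
   apply le_div_inv_r; [lra|]. rewrite <- pow_INR, <- mult_INR.
   replace (q ^ (E - 1 - e) * (q ^ e * Q))%nat with (q ^ (nN - 1))%nat.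
   - via (INR N); [mono|]. via Z; [lra|]. unfold Z. mono.
   - unfold Q. rewrite <- !Nat.pow_add_r. f_equal. lia. }
  assert (R2 : Rpower (/ x) (- g) <= rho ^ e). { unfold rho.
   rewrite <- Rpower_pow, Rpower_mult, Rmult_comm, <- Rpower_mult by apply Rpower_pos. apply Rpower_decr; [|lra].
   split; [pos|]. rewrite Rpower_pow by lra. unfold x. rewrite Rinv_inv, <- pow_INR. apply le_INR. nia. }
  assert (0 < rho ^ (E - 1 - e)) by pos. assert (0 < rho ^ e) by pos. apply Rmin_case; lra. }
 assert (HEL : E <= 2 * b0 * L). { assert (HqE : q ^ (nN - 1) <= XB). { rewrite <- pow_INR. via (INR N); [mono|].
   via Z; [lra|]. unfold Z. mono. }
  assert (H1 : INR (nN - 1) * ln q <= b0 * L). { rewrite <- ln_pow by lra. via (ln XB); [mono|]. unfold XB.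
   rewrite ln_Rpower by lra. mul_l. apply ln_le; lra. }
  assert (H2 : / 2 <= ln q) by (have ln2_bounds; assert (ln 2 <= ln q) by (apply ln_le; lra); lra).
  assert (H3 : E <= INR (nN - 1)) by mono. assert (INR (nN - 1) * / 2 <= INR (nN - 1) * ln q) by mono. lra. }
 rewrite (rsum_ext _ _ (fun k => prime_wt X Y k * (rsum E (cell k) - E / Q) + prime_wt X Y k * (blk q l a (bv k) - INR
  (ndigits q (bv k)) / Q - (rsum E (cell k) - E / Q)))), rsum_plus by (intros; fold Q; ring). from Rabs_triang.
 rewrite Rmult_plus_distr_r. apply Rplus_le_compat.
 -
  assert (E1 : dsum X (fun k => prime_wt X Y k * (rsum E (cell k) - E / Q)) = rsum E (fun e => rsum (S (2 * X)) (fun k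
   => prime_wt X Y k * cell k e) - P / Q)). { rewrite rsum_minus, rsum_const, rsum_swap. unfold P.
   rewrite (rsum_ext (S (2 * X)) _ (fun k => rsum E (fun e => prime_wt X Y k * cell k e) - prime_wt X Y k * (E / Q))).
   - rewrite rsum_minus, rsum_scalr. lra.
   - intros k _. rewrite rsum_scal. ring. }
  rewrite E1. from rsum_abs. via (rsum E (fun e => K * (X / L) * (rho ^ (E - 1 - e) + rho ^ e + / L))); [mono|].
  rewrite rsum_scal, !rsum_plus, rsum_const. have (geometric_upper rho E Hrho) as G1.
  have (geometric_rev_upper rho E Hrho) as G2. fold G in G1, G2. change (fun e => rho ^ e) with (pow rho) in G1.
  rhs (K * (X / L) * (G + G + 2 * b0)). mul_l. assert (E * / L <= 2 * b0); [|lra]. apply div_le; lra.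
 - from rsum_abs. via (dsum X (fun k => prime_wt X Y k * INR (K0 + l))).
  + termwise k Hk'. rewrite Rabs_mult, Rabs_right by (apply Rle_ge, prime_wt_01).
   destruct (Nat.le_gt_cases k X) as [Hc|Hc].
   * unfold prime_wt, inI. rewrite (ind_F (X < k <= Y)%nat) by lia. lra.
   * apply Rmult_le_compat_l; [apply prime_wt_01|]. apply Hk2. lia.
  + rewrite rsum_scalr. rewrite Rmult_comm, Rmult_assoc. mono.
Qed.

(** * Counting primes and the lengths of their blocks *)

Lemma is_primeb_nprime n : is_primeb n = true <-> nprime n.
Proof.
 unfold is_primeb. destruct (prime_dec (Z.of_nat n)) as [Hp|Hp]; split; intros H; try easy.
 - destruct Hp as [H1 H2]. split; [lia|]. intros d [c Hc]. destruct (Nat.eq_dec d n) as [|Hdn]; [pos|left].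
  assert (Hd : (1 <= d < n)%nat) by (destruct c; [lia|]; destruct c; [lia|]; destruct d; [lia|]; nia).
  specialize (H2 (Z.of_nat d) ltac:(lia)). destruct H2 as [_ _ H2]. assert (Hz : (Z.of_nat d | 1)%Z). {
   apply H2; [easy|]. exists (Z.of_nat c). lia. }
  apply Z.divide_1_r_nonneg in Hz; lia.
 - exfalso. apply Hp. destruct H as [H1 H2]. apply prime_alt. split; [lia|]. intros m Hm [c Hc].
  assert (Hd : Nat.divide (Z.to_nat m) n). { exists (Z.to_nat c). lia. }
  destruct (H2 _ Hd); lia.
Qed.

Lemma endpos_sum f q n : INR (endpos f q n) = rsum (S n) (fun k => ind (nprime k) * INR (ndigits q (block_val f k))).
Proof.
 induction n as [|n IH].
 - simpl. rewrite ind_F; [ring|]. intros [H _]. lia.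
 - rewrite rsum_S, <- IH.
  change (endpos f q (S n)) with (endpos f q n + (if is_primeb (S n) then ndigits q (block_val f (S n)) else 0))%nat.
  rewrite plus_INR. destruct (is_primeb (S n)) eqn:Ep.
  + rewrite ind_T by (now apply is_primeb_nprime). ring.
  + rewrite ind_F; [simpl; ring|]. intros H. apply is_primeb_nprime in H. congruence.
Qed.

Lemma theta_lower : exists n0, (2 <= n0)%nat /\ forall n, (n0 <= n)%nat -> n / 16 <= rsum (S n) (fun k => ind (nprime k) * ln k).
Proof.
 destruct (sqrt_small 5) as (X0 & HX0 & HS). destruct (nfloor X0) as (n0 & Hn1 & Hn2); [lra|]. exists (n0 + 2)%nat.
 split; [lia|]. intros n Hn.
 assert (HnR : n0 + 2 <= n) by (apply le_INR in Hn; rewrite plus_INR in Hn; simpl in Hn; lra).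
 destruct (HS n ltac:(lra)) as [HL HS']. have (lam_proper_powers n ltac:(lia)) as H1.
 have (psi_lower n ltac:(lia)) as H2. assert (H3 : (INR (Nat.sqrt n) + 1) * ln n <= n / 16). {
  via ((INR (Nat.sqrt (2 * n)) + 1) * ln (INR (2 * n))).
  - apply Rmult_le_compat; [pos|pos| |mono]. apply Rplus_le_compat_r, le_INR, Nat.sqrt_le_mono. lia.
  - from HS'. mul_l. apply Rinv_le_contravar; [lra|]. via (2 ^ 5); [lra|mono]. }
 assert (E : rsum (S n) (fun k => ind (nprime k) * ln k) = psi n - rsum (S n) (fun k => (1 - ind (nprime k)) * lam
  k)). { unfold psi. rewrite <- rsum_minus. ext k _. ind_case (nprime k) as Hp; [rewrite (lam_prime k Hp)|]; ring. }
 lra.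
Qed.

Lemma theta_upper n : rsum (S n) (fun k => ind (nprime k) * ln k) <= 4 * n.
Proof.
 upto psi_upper. termwise k _. ind_case (nprime k) as Hp; [rewrite (lam_prime k Hp); lra|have (lam_nonneg k); lra].
Qed.

Lemma ndigits_log q d alpha beta : (2 <= q)%nat -> 0 < alpha 0%nat -> (forall i : nat, (i < d)%nat -> beta (S i) < beta i) -> 0 < beta d ->
  let bv := block_val (pseudo_poly d alpha beta) in
  exists c C k1, 0 < c /\ 0 < C /\ (3 <= k1)%nat /\ forall k, (k1 <= k)%nat -> c * ln k <= INR (ndigits q (bv k)) <= C * ln k.
Proof.
 intros Hq Ha Hdec Hpos bv. set (f := pseudo_poly d alpha beta) in *. have (decreasing_beta beta d Hdec) as Hlt.
 assert (Hb0 : 0 < beta 0%nat). { destruct (Nat.eq_dec d 0) as [->|]; [easy|]. specialize (Hlt 0%nat d ltac:(lia)).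
  lra. }
 destruct (pseudo_poly_growth d alpha beta Ha Hdec) as (c1 & c2 & x0 & Hc1 & Hc2 & Hx0 & Hgr). fold f in Hgr.
 set (b0 := beta 0%nat) in *. destruct (Rpower_large (b0 / 2) (/ c1)) as (X1 & HX1 & HX1'); [lra|].
 destruct (Rpower_large b0 c2) as (X2 & HX2 & HX2'); [lra|]. assert (HqR : 2 <= q) by inr.
 assert (Hlq : / 2 <= ln q) by (have ln2_bounds; assert (ln 2 <= ln q) by (apply ln_le; lra); lra).
 have (exp_pos 1) as He. destruct (nfloor (X1 + X2 + x0 + exp 1)) as (k0 & Hk1 & Hk2); [lra|].
 assert (Hlq0 : 0 < b0 / (2 * ln q)) by pos. exists (b0 / (2 * ln q)), (1 + 4 * b0), (k0 + 3)%nat. split; [easy|].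
 split; [lra|]. split; [lia|]. intros k Hk.
 assert (HkR : X1 + X2 + x0 + exp 1 <= k) by (apply le_INR in Hk; rewrite plus_INR in Hk; simpl in Hk; lra).
 assert (Hlk : 1 <= ln k) by (apply le_ln; lra). destruct (Hgr (INR k) ltac:(lra)) as [G1 G2].
 set (kb := Rpower k b0) in *. assert (Hkb : 0 < kb) by apply Rpower_pos.
 assert (Hlkb : ln kb = b0 * ln k) by (unfold kb; apply ln_Rpower; lra).
 assert (Hf0 : 0 < f (INR k)) by (assert (0 < c1 * kb) by (apply Rmult_lt_0_compat; lra); lra).
 have (block_val_floor f k ltac:(lra)) as Hv. fold bv in Hv. set (v := bv k) in *. have (ndigits_upper q v Hq) as V3.
 set (nd := ndigits q v) in *. split.
 - assert (Hfn : f (INR k) <= q ^ nd). { rewrite <- pow_INR. via (v + 1); [lra|]. rewrite <- S_INR. mono. }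
  assert (H1 : b0 / 2 * ln k <= nd * ln q). { rewrite <- ln_pow by lra. via (ln (f (INR k))); [|mono].
   rewrite <- ln_Rpower by lra. apply ln_le; [pos|]. upto G1.
   assert (Ekb : kb = Rpower k (b0 / 2) * Rpower k (b0 / 2)) by (unfold kb; rewrite <- Rpower_plus; f_equal; field).
   specialize (HX1' (INR k) ltac:(lra)). have (Rpower_pos (INR k) (b0 / 2)). rewrite Ekb.
   set (z := Rpower k (b0 / 2)) in *. assert (1 <= c1 * z). { apply (Rmult_le_reg_l (/ c1)); [pos|].
    rewrite <- Rmult_assoc, Rinv_l; lra. }
   assert (1 * z <= c1 * z * z) by mono. lra. }
  lhs (b0 / 2 * ln k / ln q). apply div_le; lra.
 - destruct (Nat.eq_dec v 0) as [E0|Hv0].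
  + unfold nd. rewrite E0. simpl. pos.
  + destruct (ndigits_lower q v Hq ltac:(lia)) as [V1 V2]. fold nd in V1, V2.
   assert (H1 : INR (nd - 1) * ln q <= 2 * b0 * ln k). { rewrite <- ln_pow by lra. via (ln (kb * kb)).
    - apply ln_le; [pos|]. apply le_INR in V2. rewrite pow_INR in V2. via (f (INR k)); [lra|]. from G2. mul_r.
     apply HX2'. lra.
    - rewrite ln_mult by easy. lra. }
   rewrite minus_INR in H1 by easy. simpl (INR 1) in H1. assert (H2 : (nd - 1) * / 2 <= (nd - 1) * ln q). {
    apply Rmult_le_compat_l; [|easy]. apply le_INR in V1. simpl in V1. lra. }
   lra.
Qed.

Lemma prime_wt_diff (X Y : nat) (h : nat -> R) : (X <= Y <= 2 * X)%nat ->
  rsum (S Y) (fun k => ind (nprime k) * h k) - rsum (S X) (fun k => ind (nprime k) * h k) = dsum X (fun k => prime_wt X Y k * h k).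
Proof.
 intros H. replace (S Y) with (S X + (Y - X))%nat by lia.
 rewrite rsum_split, (rsum_ext (S (2 * X)) _ (fun k => ind (X < k <= Y)%nat * (ind (nprime k) * h k))) by (intros;
  unfold prime_wt, inI; ring). rewrite interval_sum by lia.
 rewrite (rsum_ext (Y - X) (fun t => ind (nprime (X + 1 + t)) * h (X + 1 + t)%nat) (fun t => ind (nprime (S X + t)) *
  h (S X + t)%nat)).
 - ring.
 - intros i _. replace (X + 1 + i)%nat with (S X + i)%nat by lia. lra.
Qed.

Lemma prime_count_total : exists A, 0 <= A /\ forall n, (2 <= n)%nat -> rsum (S n) (fun k => ind (nprime k)) <= A * (n / ln n).
Proof.
 destruct (dyadic_total (fun n => rsum (S n) (fun k => ind (nprime k) * 1)) 16 2) as (A & HA & H); [lra|lra| |].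
 - intros X Y HX HY. rewrite prime_wt_diff by easy. assert (HX2 : (2 <= X)%nat) by inr.
  rewrite (rsum_ext _ _ (prime_wt X Y)) by (intros; ring).
  rewrite Rabs_right by (apply Rle_ge, rsum_nonneg; intros; apply prime_wt_01).
  etrans; [apply prime_count_upper; lia|]. assert (H1 : 0 < ln X) by pos. assert (H2 : ln (2 * X) <= 2 * ln X). {
   rewrite ln_mult by lra. assert (ln 2 <= ln X) by mono. lra. }
  assert (H3 : 0 < ln (2 * X)) by pos. apply div_le; [easy|]. rhs (8 * X * (2 * ln X / ln (2 * X))).
  rewrite <- Rmult_1_r at 1. mul_l. apply le_div; lra.
 - exists A. split; [easy|]. intros n Hn. specialize (H n Hn).
  rewrite (rsum_ext _ _ (fun k => ind (nprime k) * 1)) by (intros; ring). apply Rabs_le_between in H. lra.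
Qed.

(** A block has about ln k digits, so the end position is comparable with Chebyshev's theta
    function, which is of order n. The terms below the threshold of [ndigits_log] are absorbed in M1
    and M2. *)
Lemma endpos_linear q d alpha beta : (2 <= q)%nat -> 0 < alpha 0%nat -> (forall i : nat, (i < d)%nat -> beta (S i) < beta i) -> 0 < beta d ->
  exists c C n0, 0 < c /\ 0 < C /\ (2 <= n0)%nat /\ forall n, (n0 <= n)%nat ->
  c * n <= INR (endpos (pseudo_poly d alpha beta) q n) <= C * n.
Proof.
 intros Hq Ha Hdec Hpos. set (f := pseudo_poly d alpha beta).
 destruct (ndigits_log q d alpha beta Hq Ha Hdec Hpos) as (c & C & k1 & Hc & HC & Hk1 & Hnd). fold f in Hnd.
 destruct theta_lower as (n0 & Hn0 & Hth). set (M1 := rsum k1 (fun k => ln k)).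
 set (M2 := rsum k1 (fun k => INR (ndigits q (block_val f k)))).
 assert (HM1 : 0 <= M1) by (apply rsum_nonneg; intros; apply ln_INR_nonneg).
 assert (HM2 : 0 <= M2) by (apply rsum_nonneg; intros; apply pos_INR).
 destruct (nfloor (32 * M1)) as (n1 & Hn1 & Hn1'); [lra|]. exists (c / 32), (4 * C + M2), (n0 + n1 + k1 + 2)%nat.
 split; [lra|]. split; [lra|]. split; [lia|]. intros n Hn. rewrite endpos_sum. assert (HnR : 32 * M1 <= n). {
  apply le_INR in Hn. rewrite !plus_INR in Hn. have (pos_INR n0). have (pos_INR k1). simpl (INR 2) in Hn. lra. }
 assert (Hn1R : 1 <= n) by inr. split.
 - via (c * (rsum (S n) (fun k => ind (nprime k) * ln k) - M1)).
  + specialize (Hth n ltac:(lia)). nra.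
  + unfold M1. rewrite (rsum_pad k1 (S n)), <- rsum_minus, <- rsum_scal by lia. termwise k _. have (ln_INR_nonneg k).
   have (ind_01 (nprime k)). have (pos_INR (ndigits q (block_val f k))). destruct (Nat.lt_ge_cases k k1) as [Hc1|Hc1].
   * rewrite (ind_T (k < k1)%nat) by easy. assert (ind (nprime k) * ln k <= 1 * ln k) by mono. nra.
   * rewrite (ind_F (k < k1)%nat) by lia. destruct (Hnd k Hc1) as [N1 _]. nra.
 - via (C * rsum (S n) (fun k => ind (nprime k) * ln k) + M2).
  + unfold M2. rewrite (rsum_pad k1 (S n)), <- rsum_scal, <- rsum_plus by lia. termwise k _. have (ln_INR_nonneg k).
   have (ind_01 (nprime k)). have (pos_INR (ndigits q (block_val f k))) as Hp.
   assert (Hz : 0 <= C * (ind (nprime k) * ln k)) by pos. destruct (Nat.lt_ge_cases k k1) as [Hc1|Hc1].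
   * rewrite (ind_T (k < k1)%nat) by easy. nra.
   * rewrite (ind_F (k < k1)%nat) by lia. destruct (Hnd k Hc1) as [_ N2]. nra.
  + have (theta_upper n) as Hu. nra.
Qed.

Lemma block_total q d alpha beta l a : (2 <= q)%nat -> 0 < alpha 0%nat -> (forall i : nat, (i < d)%nat -> beta (S i) < beta i) ->
  0 < beta d -> (1 <= l)%nat -> (a < q ^ l)%nat ->
  let f := pseudo_poly d alpha beta in
  exists A, 0 <= A /\ forall n, (2 <= n)%nat ->
  Rabs (rsum (S n) (fun k => ind (nprime k) * blk q l a (block_val f k)) - INR (endpos f q n) / INR (q ^ l)) <= A * (n / ln n).
Proof.
 intros Hq Ha Hdec Hpos Hl Haq f.
 destruct (block_dyadic q d alpha beta l a Hq Ha Hdec Hpos Hl Haq) as (K & X0 & HK & HX0 & HB).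
 set (h := fun k => blk q l a (block_val f k) - INR (ndigits q (block_val f k)) / INR (q ^ l)).
 destruct (dyadic_total (fun n => rsum (S n) (fun k => ind (nprime k) * h k)) K X0) as (A & HA & H); [lra|lra| |].
 - intros X Y HX HY. rewrite prime_wt_diff by easy. apply HB; [easy|lia].
 - exists A. split; [easy|]. intros n Hn. specialize (H n Hn). rewrite endpos_sum. unfold Rdiv at 1.
  rewrite <- rsum_scalr, <- rsum_minus. rewrite (rsum_ext _ _ (fun k => ind (nprime k) * h k)); [easy|].
  intros; unfold h, Rdiv; ring.
Qed.

(** * The blocks as digits of tau *)

Lemma Int_part_nat x m : INR m <= x < INR m + 1 -> Int_part x = Z.of_nat m.
Proof.
 intros H. destruct (base_Int_part x) as [H1 H2]. rewrite INR_IZR_INZ in H.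
 apply Z.le_antisymm; apply Z.lt_succ_r; apply lt_IZR; unfold Z.succ; rewrite plus_IZR; lra.
Qed.

Lemma nat_floor_unique m m' x : INR m <= x < INR m + 1 -> INR m' <= x < INR m' + 1 -> m = m'.
Proof. intros H H'. apply Nat.le_antisymm; apply Nat.lt_succ_r; apply INR_lt; rewrite S_INR; lra. Qed.

Definition tau_term (f : R -> R) (q n : nat) : R :=
  if is_primeb n then INR (block_val f n) / (INR q) ^ (endpos f q n) else 0.

(* The integer whose digits are the blocks of the primes up to n. *)
Fixpoint head_val (f : R -> R) (q n : nat) : nat :=
  match n with
  | O => O
  | S n' => if is_primeb n then (head_val f q n' * q ^ ndigits q (block_val f n) + block_val f n)%nat else head_val f q n'
  end.

Lemma is_primeb_0 : is_primeb 0 = false.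
Proof. easy. Qed.

Lemma endpos_S f q n : endpos f q (S n) = (endpos f q n + (if is_primeb (S n) then ndigits q (block_val f (S n)) else 0))%nat.
Proof. easy. Qed.

Lemma head_val_sum f q n : (2 <= q)%nat -> rsum (S n) (tau_term f q) = INR (head_val f q n) / q ^ endpos f q n.
Proof.
 intros Hq. assert (HqR : 0 < q) by pos. assert (Hp : forall a, 0 < q ^ a) by (intros; now apply pow_lt).
 induction n as [|n IH].
 - simpl. unfold tau_term. rewrite is_primeb_0. field.
 - rewrite rsum_S, IH. unfold tau_term. rewrite endpos_S. cbn [head_val]. have (Hp (endpos f q n)).
  destruct (is_primeb (S n)); [|rewrite Nat.add_0_r; ring]. rewrite plus_INR, mult_INR, pow_INR, pow_add.
  have (Hp (ndigits q (block_val f (S n)))). field. lra.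
Qed.

Lemma tau_term_nonneg f q n : (2 <= q)%nat -> 0 <= tau_term f q n.
Proof. intros Hq. unfold tau_term. destruct (is_primeb n); [|lra]. pos. Qed.

(** A block of k digits is at most q^k - 1, with equality when all digits are q - 1; the terms then
    telescope to one unit in the last place. *)
Lemma tau_term_upper f q n : (2 <= q)%nat -> tau_term f q (S n) <= / q ^ endpos f q n - / q ^ endpos f q (S n).
Proof.
 intros Hq. assert (HqR : 0 < q) by pos. assert (Hp : forall a, 0 < q ^ a) by (intros; now apply pow_lt).
 unfold tau_term. rewrite endpos_S. destruct (is_primeb (S n)); [|rewrite Nat.add_0_r; lra].
 set (v := block_val f (S n)). set (e := endpos f q n). have (ndigits_upper q v Hq) as Hv.
 set (k := ndigits q v) in *. apply le_INR in Hv. rewrite S_INR, pow_INR in Hv. have (Hp e). have (Hp k).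
 rewrite pow_add. rhs ((q ^ k - 1) / (q ^ e * q ^ k)). mono.
Qed.

Lemma partial_tail f q n j : (2 <= q)%nat ->
  rsum (S (n + j)) (tau_term f q) <= rsum (S n) (tau_term f q) + / q ^ endpos f q n - / q ^ endpos f q (n + j).
Proof.
 intros Hq. induction j as [|j IH]; [rewrite Nat.add_0_r; lra|]. rewrite Nat.add_succ_r, rsum_S.
 have (tau_term_upper f q (n + j) Hq). lra.
Qed.

(* A block all of whose digits are q - 1 leaves no room in the telescoping bound of the tail;
   any other block beyond n makes the tail strictly smaller than one unit in the last place. *)
Lemma tau_floor f q n : (2 <= q)%nat ->
  (exists p, (n < p)%nat /\ nprime p /\ (S (block_val f p) < q ^ ndigits q (block_val f p))%nat) ->
  INR (head_val f q n) <= q ^ endpos f q n * tau q f < INR (head_val f q n) + 1.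
Proof.
 intros Hq (p & Hnp & Hp & Hslack). assert (HqR : 0 < q) by pos.
 assert (Hpw : forall a, 0 < q ^ a) by (intros; now apply pow_lt). set (a := tau_term f q).
 set (s := fun m => rsum (S m) a).
 assert (Ea : forall m, sum_n a m = s m) by (intros; rewrite sum_n_Reals; apply sum_f_R0_rsum).
 assert (Hinc : forall m, s m <= s (S m)). { intros m. unfold s. rewrite (rsum_S (S m)).
  have (tau_term_nonneg f q (S m) Hq). fold a in H. lra. }
 assert (Hmono : forall m j, s m <= s (m + j)%nat). { intros m j. induction j as [|j IH]; [rewrite Nat.add_0_r; lra|].
  rewrite Nat.add_succ_r. specialize (Hinc (m + j)%nat). lra. }
 assert (Hb : forall m j, s (m + j)%nat <= s m + / q ^ endpos f q m - / q ^ endpos f q (m + j)). { intros m j.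
  apply partial_tail. easy. }
 assert (Hex : ex_finite_lim_seq (sum_n a)). { apply (ex_finite_lim_seq_incr _ (s 0%nat + / q ^ endpos f q 0)).
  - intros m. rewrite !Ea. easy.
  - intros m. rewrite Ea. specialize (Hb 0%nat m). simpl (0 + m)%nat in Hb.
   have (Rinv_0_lt_compat _ (Hpw (endpos f q m))). lra. }
 destruct Hex as [t Ht]. assert (Htau : tau q f = t) by (apply is_series_unique; exact Ht).
 (* the strict bound for the tail *)
 destruct p as [|p]; [lia|]. set (v := block_val f (S p)) in *. set (k := ndigits q v) in *.
 assert (Hpb : is_primeb (S p) = true) by (now apply is_primeb_nprime). set (de := / q ^ endpos f q (S p)).
 assert (Hde : 0 < de) by (apply Rinv_0_lt_compat, Hpw). assert (Hterm : a (S p) <= / q ^ endpos f q p - 2 * de). {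
  unfold a, tau_term. unfold de. rewrite endpos_S, Hpb. fold v k. rewrite pow_add. set (e := endpos f q p).
  have (Hpw e). have (Hpw k). assert (Hv : v + 2 <= q ^ k). { rewrite <- pow_INR. lhs (INR (S (S v))) by inr. mono. }
  rhs ((q ^ k - 2) / (q ^ e * q ^ k)). mono. }
 assert (Hup : forall j, s (S p + j)%nat <= s n + / q ^ endpos f q n - de). { intros j. specialize (Hb (S p) j).
  fold de in Hb. have (Rinv_0_lt_compat _ (Hpw (endpos f q (S p + j)))). have (partial_tail f q n (p - n) Hq) as H2.
  replace (n + (p - n))%nat with p in H2 by lia. fold a in H2. fold (s p) (s n) in H2.
  assert (E : s (S p) = s p + a (S p)) by easy. lra. }
 assert (Hlo : s n <= t). { apply (is_lim_seq_le_loc (fun _ => s n) (sum_n a) (s n) t); [|apply is_lim_seq_const|pos].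
  exists n. intros m Hm. rewrite Ea. replace m with (n + (m - n))%nat by lia. easy. }
 assert (Hhi : t <= s n + / q ^ endpos f q n - de). {
  apply (is_lim_seq_le_loc (sum_n a) (fun _ => s n + / q ^ endpos f q n - de) t (s n + / q ^ endpos f q n - de));
   [|pos|apply is_lim_seq_const]. exists (S p). intros m Hm. rewrite Ea. replace m with (S p + (m - S p))%nat by lia.
  easy. }
 rewrite Htau. unfold s, a in Hlo, Hhi. rewrite head_val_sum in Hlo, Hhi by easy. set (W := q ^ endpos f q n) in *.
 assert (HW : 0 < W) by apply Hpw. split.
 - apply (Rmult_le_reg_r (/ W)); [pos|]. replace (W * t * / W) with t by (field; lra). lra.
 - apply (Rmult_lt_reg_r (/ W)); [pos|]. replace (W * t * / W) with t by (field; lra). lra.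
Qed.

(** Arbitrarily late blocks differ from q^k - 1, that is, have a digit other than q - 1. Then the
    concatenated string is the expansion read off by floors, by [tau_floor]. *)
Definition slack (f : R -> R) (q : nat) : Prop :=
  forall n, exists p, (n < p)%nat /\ nprime p /\ (S (block_val f p) < q ^ ndigits q (block_val f p))%nat.

Definition flr (q : nat) (t : R) (k : nat) : nat := Z.to_nat (Int_part (q ^ k * t)).

Lemma flr_spec q t k : (2 <= q)%nat -> 0 <= t -> INR (flr q t k) <= q ^ k * t < INR (flr q t k) + 1.
Proof.
 intros Hq Ht. destruct (nfloor (q ^ k * t)) as (m & Hm).
 - pos.
 - unfold flr. rewrite (Int_part_nat _ m Hm), Nat2Z.id. easy.
Qed.

Lemma flr_div q t k j : (2 <= q)%nat -> 0 <= t -> flr q t k = (flr q t (k + j) / q ^ j)%nat.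
Proof.
 intros Hq Ht. apply (nat_floor_unique _ _ (q ^ k * t)); [now apply flr_spec|].
 assert (Hqj : (1 <= q ^ j)%nat) by (have (Nat.pow_nonzero q j); lia).
 have (nat_div_real _ (q ^ j) _ Hqj (flr_spec q t (k + j) Hq Ht)) as H.
 replace (q ^ (k + j) * t / INR (q ^ j)) with (q ^ k * t) in H; [easy|]. rewrite pow_add, pow_INR. field. pos.
Qed.

Lemma digit_flr q t k : (2 <= q)%nat -> 0 <= t -> digit q t k = (flr q t k mod q)%nat.
Proof.
 intros Hq Ht. unfold digit. rewrite (Int_part_nat _ _ (flr_spec q t k Hq Ht)), <- Nat2Z.inj_mod, Nat2Z.id. lia.
Qed.

(** The head of the list is the most significant digit, as words are read from left to right. *)
Fixpoint wval (q : nat) (w : list nat) : nat :=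
  match w with nil => O | cons a w' => (a * q ^ length w' + wval q w')%nat end.

Lemma wval_lt q w : (2 <= q)%nat -> (forall a, In a w -> (a < q)%nat) -> (wval q w < q ^ length w)%nat.
Proof.
 intros Hq. induction w as [|a w IH]; intros H; [pos|]. specialize (IH (fun b Hb => H b (or_intror Hb))).
 specialize (H a (or_introl eq_refl)). cbn [wval length]. rewrite Nat.pow_succ_r'. nia.
Qed.

Lemma digits_wval q w A : (2 <= q)%nat -> (forall a, In a w -> (a < q)%nat) ->
  (forall j, (j < length w)%nat -> ((A / q ^ (length w - 1 - j)) mod q)%nat = nth j w 0%nat) <-> (A mod q ^ length w)%nat = wval q w.
Proof.
 intros Hq. induction w as [|a w IH]; intros H.
 - easy.
 - specialize (IH (fun b Hb => H b (or_intror Hb))). have (wval_lt q w Hq (fun b Hb => H b (or_intror Hb))) as Hw.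
  assert (Hl : (q ^ length w <> 0)%nat) by lia.
  assert (E : (A mod q ^ length (a :: w))%nat = (A mod q ^ length w + q ^ length w * ((A / q ^ length w) mod q))%nat).
  { cbn [length]. rewrite Nat.pow_succ_r', Nat.mul_comm. apply Nat.Div0.mod_mul_r. }
  cbn [wval]. split.
  + intros Hd. assert (H0 := Hd 0%nat ltac:(simpl; lia)). cbn [length nth] in H0.
   replace (S (length w) - 1 - 0)%nat with (length w) in H0 by lia. assert (Hr : (A mod q ^ length w)%nat = wval q w).
   { apply IH. intros j Hj. specialize (Hd (S j) ltac:(simpl; lia)). cbn [length nth] in Hd. rewrite <- Hd.
    do 3 f_equal. lia. }
   lia.
  + intros Heq. have (Nat.mod_upper_bound A (q ^ length w) Hl) as Hm. set (r := (A mod q ^ length w)%nat) in *.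
   set (t := ((A / q ^ length w) mod q)%nat) in *. assert (t = a /\ r = wval q w) as [Ht Hr]. {
    destruct (Nat.lt_trichotomy t a) as [Hc|[Hc|Hc]]; [exfalso; nia|pos|exfalso; nia]. }
   intros j Hj. destruct j as [|j].
   * cbn [length nth]. replace (S (length w) - 1 - 0)%nat with (length w) by lia. exact Ht.
   * cbn [length nth]. cbn [length] in Hj. rewrite <- (proj2 IH Hr j) by lia. do 3 f_equal. lia.
Qed.

Lemma occurs_at_flr q t w i : (2 <= q)%nat -> 0 <= t -> (forall a, In a w -> (a < q)%nat) ->
  occurs_at q t w i = true <-> (flr q t (i + length w) mod q ^ length w)%nat = wval q w.
Proof.
 intros Hq Ht Hw. rewrite <- digits_wval by easy. unfold occurs_at. rewrite forallb_forall. split.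
 - intros H j Hj. specialize (H j). rewrite in_seq in H. specialize (H ltac:(lia)). apply Nat.eqb_eq in H.
  rewrite <- H, digit_flr, (flr_div q t (i + 1 + j) (length w - 1 - j)) by easy. do 3 f_equal. lia.
 - intros H j Hj. rewrite in_seq in Hj. apply Nat.eqb_eq. rewrite <- H by lia.
  rewrite digit_flr, (flr_div q t (i + 1 + j) (length w - 1 - j)) by easy. do 3 f_equal. lia.
Qed.

Lemma Nocc_sum q t w N : INR (Nocc q t w N) = rsum N (fun i => ind (occurs_at q t w i = true)).
Proof.
 unfold Nocc. induction N as [|N IH]; [easy|]. rewrite seq_S, filter_app, length_app, plus_INR, IH, rsum_S. simpl.
 destruct (occurs_at q t w N) eqn:E.
 - rewrite ind_T by easy. easy.
 - rewrite ind_F by easy. easy.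
Qed.

Lemma rsum_rev n f : rsum n f = rsum n (fun i => f (n - 1 - i)%nat).
Proof.
 induction n as [|n IH]; [easy|]. rewrite (rsum_first n (fun i => f (S n - 1 - i)%nat)), rsum_S, IH.
 replace (S n - 1 - 0)%nat with n by lia. rewrite Rplus_comm. f_equal. ext i Hi. f_equal. lia.
Qed.

(** Positions count from the left in tau and from the right in [blk]: an occurrence starting t
    digits into a block of nd digits is the exponent nd - l - t. Fewer than l starting positions let
    the word run over the end of the block. *)
Lemma block_occurrences f q w p : (2 <= q)%nat -> (1 <= length w)%nat -> (forall a, In a w -> (a < q)%nat) -> slack f q -> 0 <= tau q f ->
  nprime (S p) ->
  let l := length w in let v := block_val f (S p) in
  Rabs (rsum (ndigits q v) (fun t => ind (occurs_at q (tau q f) w (endpos f q p + t) = true)) - blk q l (wval q w) v) <= l.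
Proof.
 intros Hq Hl Hw Hsl Htau Hp l v. set (nd := ndigits q v). set (e := endpos f q p).
 assert (Hpb : is_primeb (S p) = true) by (now apply is_primeb_nprime).
 assert (He : endpos f q (S p) = (e + nd)%nat) by (rewrite endpos_S, Hpb; reflexivity).
 have (tau_floor f q (S p) Hq (Hsl (S p))) as Hfl. rewrite He in Hfl.
 assert (Hhead : head_val f q (S p) = (head_val f q p * q ^ nd + v)%nat) by (cbn [head_val]; rewrite Hpb;
  reflexivity). assert (Hflr : flr q (tau q f) (e + nd) = head_val f q (S p)). {
  apply (nat_floor_unique _ _ (q ^ (e + nd) * tau q f)); [now apply flr_spec|easy]. }
 assert (Hocc : forall t, (t + l <= nd)%nat -> ind (occurs_at q (tau q f) w (e + t) = true) = ind (((v / q ^ (nd - l -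
  t)) mod q ^ l)%nat = wval q w)). { intros t Ht. apply ind_iff. rewrite occurs_at_flr by easy. fold l.
  rewrite (flr_div q (tau q f) (e + t + l) (nd - l - t)) by easy.
  replace (e + t + l + (nd - l - t))%nat with (e + nd)%nat by lia. rewrite Hflr, Hhead. set (r := (nd - l - t)%nat).
  assert (Hpr : (q ^ nd = q ^ t * q ^ l * q ^ r)%nat) by (rewrite <- !Nat.pow_add_r; f_equal; unfold r; lia).
  assert (Hr0 : (q ^ r <> 0)%nat) by (apply Nat.pow_nonzero; lia). rewrite Hpr.
  replace (head_val f q p * (q ^ t * q ^ l * q ^ r) + v)%nat with (v + head_val f q p * q ^ t * q ^ l * q ^ r)%nat by
   ring. rewrite Nat.div_add, Nat.Div0.mod_add by easy. lia. }
 unfold blk. fold nd. destruct (Nat.le_gt_cases l nd) as [Hc|Hc].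
 -
  assert (E1 : rsum nd (fun e0 => ind ((e0 + l <= nd)%nat /\ ((v / q ^ e0) mod q ^ l)%nat = wval q w)) = rsum (nd - l
   + 1) (fun e0 => ind (((v / q ^ e0) mod q ^ l)%nat = wval q w))). {
   rewrite (rsum_trunc (nd - l + 1) nd); [|lia|intros i Hi; apply ind_F; lia]. ext i Hi. apply ind_iff. lia. }
  assert (E2 : rsum nd (fun t => ind (occurs_at q (tau q f) w (e + t) = true)) = rsum (nd - l + 1) (fun e0 => ind (((v
   / q ^ e0) mod q ^ l)%nat = wval q w)) + rsum (l - 1) (fun i => ind (occurs_at q (tau q f) w (e + ((nd - l + 1) +
   i)) = true))). { replace nd with ((nd - l + 1) + (l - 1))%nat at 1 by lia. rewrite rsum_split. f_equal.
   rewrite (rsum_rev (nd - l + 1) (fun e0 => ind (((v / q ^ e0) mod q ^ l)%nat = wval q w))). ext t Ht.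
   rewrite Hocc by lia. do 5 f_equal. lia. }
  rewrite E1, E2. set (z := rsum (l - 1) _).
  assert (Hz : 0 <= z <= INR (l - 1)) by (split; [apply rsum_nonneg; intros; apply ind_01|apply rsum_eq_count]).
  assert (INR (l - 1) <= l) by mono. rewrite Rabs_right; lra.
 -
  rewrite (rsum_zero nd (fun e0 => ind ((e0 + l <= nd)%nat /\ ((v / q ^ e0) mod q ^ l)%nat = wval q w))), Rminus_0_r
   by (intros i Hi; apply ind_F; intros [H _]; lia). set (z := rsum nd _).
  assert (Hz : 0 <= z <= nd) by (split; [apply rsum_nonneg; intros; apply ind_01|apply rsum_eq_count]).
  assert (nd <= l) by mono. rewrite Rabs_right; lra.
Qed.

Lemma occurrences_total f q w n : (2 <= q)%nat -> (1 <= length w)%nat -> (forall a, In a w -> (a < q)%nat) -> slack f q -> 0 <= tau q f ->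
  let l := length w in
  Rabs (rsum (endpos f q n) (fun i => ind (occurs_at q (tau q f) w i = true)) - rsum (S n) (fun k => ind (nprime k) * blk q l (wval q w) (block_val f k)))
  <= l * rsum (S n) (fun k => ind (nprime k)).
Proof.
 intros Hq Hl Hw Hsl Htau l. induction n as [|n IH].
 - simpl. rewrite ind_F, !Rmult_0_l, Rplus_0_l, Rminus_0_r, Rabs_R0 by (intros [H _]; lia). lra.
 - rewrite rsum_S, (rsum_S (S n)), endpos_S. destruct (is_primeb (S n)) eqn:E.
  + assert (Hp : nprime (S n)) by (now apply is_primeb_nprime). rewrite ind_T, rsum_split by easy.
   have (block_occurrences f q w n Hq Hl Hw Hsl Htau Hp) as Hb. cbv zeta in Hb. fold l in Hb.
   set (x1 := rsum (endpos f q n) _) in *. set (x2 := rsum (ndigits q (block_val f (S n))) _) in *.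
   set (y1 := rsum (S n) (fun k => ind (nprime k) * _)) in *. set (y2 := blk q l (wval q w) (block_val f (S n))) in *.
   arg ((x1 - y1) + (x2 - y2)). from Rabs_triang. lra.
  + rewrite ind_F, Nat.add_0_r, Rmult_0_l, !Rplus_0_r by (intros H; apply is_primeb_nprime in H; congruence).
   exact IH.
Qed.

(** The hypothesis forces v = q^k - 1, all of whose digits are q - 1 > 0. *)
Lemma blk_full_zero q v : (2 <= q)%nat -> (q ^ ndigits q v <= S v)%nat -> blk q 1 0 v = 0.
Proof.
 intros Hq Hv. have (ndigits_upper q v Hq) as Hu. apply rsum_zero. intros e He. apply ind_F. intros [H1 H2].
 rewrite Nat.pow_1_r in H2. apply Nat.Div0.mod_divides in H2. destruct H2 as [c Hc].
 have (Nat.pow_nonzero q e ltac:(lia)) as H0. have (Nat.div_mod v (q ^ e) H0) as Hd.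
 have (Nat.mod_upper_bound v (q ^ e) H0) as Hm.
 assert (E : (q ^ ndigits q v = q ^ e * q * q ^ (ndigits q v - e - 1))%nat). {
  replace (ndigits q v) with (e + 1 + (ndigits q v - e - 1))%nat at 1 by lia. now rewrite !Nat.pow_add_r, Nat.pow_1_r. }
 set (b := (q ^ (ndigits q v - e - 1))%nat) in *. set (W := (q ^ e)%nat) in *.
 destruct (Nat.le_gt_cases b c) as [Hb|Hb].
 - assert (W * q * b <= W * q * c)%nat by (apply Nat.mul_le_mono_l; lia). lia.
 - assert (W * q * (c + 1) <= W * q * b)%nat by nia. nia.
Qed.

Lemma ln_large M : exists n0 : nat, (2 <= n0)%nat /\ forall n, (n0 <= n)%nat -> M <= ln n.
Proof.
 destruct (INR_unbounded (exp M)) as [m Hm]. exists (m + 2)%nat. split; [lia|]. intros n Hn. assert (m <= n) by mono.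
 rewrite <- (ln_exp M). mono.
Qed.

(* If only finitely many blocks had a digit other than q - 1, the digit 0 would not have its expected frequency. *)
Lemma pseudo_poly_slack q d alpha beta : (2 <= q)%nat -> 0 < alpha 0%nat -> (forall i : nat, (i < d)%nat -> beta (S i) < beta i) -> 0 < beta d ->
  slack (pseudo_poly d alpha beta) q.
Proof.
 intros Hq Ha Hb Hd n0. set (f := pseudo_poly d alpha beta). apply NNPP. intros Hno.
 assert (Hz : forall p, (n0 < p)%nat -> nprime p -> blk q 1 0 (block_val f p) = 0). { intros p H1 H2.
  apply blk_full_zero; [easy|].
  destruct (Nat.le_gt_cases (q ^ ndigits q (block_val f p)) (S (block_val f p))) as [H|H]; [easy|]. exfalso.
  apply Hno. exists p. easy. }
 destruct (block_total q d alpha beta 1 0 Hq Ha Hb Hd (le_n 1)) as (A & HA & HA'); [rewrite Nat.pow_1_r; lia|].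
 fold f in HA'. destruct (endpos_linear q d alpha beta Hq Ha Hb Hd) as (c & C & n1 & Hc & HC & Hn1 & Hend).
 fold f in Hend. set (g := fun k => ind (nprime k) * blk q 1 0 (block_val f k)) in *.
 assert (Hg : forall k, (n0 < k)%nat -> g k = 0). { intros k Hk. unfold g.
  ind_case (nprime k) as H; [rewrite Hz by easy|]; ring. }
 set (K0 := rsum (S n0) g). assert (HqR : 0 < q) by pos. destruct (ln_large (2 * A * q / c + 1)) as (n2 & Hn2 & Hln).
 destruct (INR_unbounded (2 * Rabs K0 * q / c)) as [n3 Hn3]. set (n := (n0 + n1 + n2 + n3)%nat).
 assert (Hs : rsum (S n) g = K0) by (apply rsum_trunc; [lia|intros i Hi; apply Hg; lia]).
 specialize (HA' n ltac:(lia)). rewrite Hs, Nat.pow_1_r in HA'. specialize (Hend n ltac:(lia)).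
 specialize (Hln n ltac:(lia)). assert (Hn3' : n3 <= n) by mono. assert (Hn : 0 < n) by pos. set (L := ln n) in *.
 set (x := INR n) in *. set (e := INR (endpos f q n)) in *. set (Q := INR q) in *.
 assert (HL : 0 < L) by (assert (0 <= 2 * A * Q / c) by (apply Rdiv_le_0_compat; [pos|lra]); lra).
 assert (H1 : e / Q <= Rabs K0 + A * (x / L)) by (apply Rabs_le_between in HA'; have (Rle_abs K0); lra).
 assert (H2 : c * x / Q <= e / Q) by mono. assert (H3 : A * (x / L) < c * x / (2 * Q)). {
  apply (Rmult_lt_reg_r (2 * Q * L / (c * x))); [pos|]. lhs (2 * A * Q / c).
  replace (c * x / (2 * Q) * (2 * Q * L / (c * x))) with L by (field; lra). lra. }
 assert (H4 : Rabs K0 < c * x / (2 * Q)). { apply (Rmult_lt_reg_r (2 * Q / c)); [pos|].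
  replace (c * x / (2 * Q) * (2 * Q / c)) with x by (field; lra). lra. }
 replace (c * x / Q) with (c * x / (2 * Q) + c * x / (2 * Q)) in H2 by (field; lra). lra.
Qed.

(** * From end positions to all N, and from words to the supremum *)

Lemma words_spec q l w : In w (words q l) -> length w = l /\ forall a, In a w -> (a < q)%nat.
Proof.
 revert w. induction l as [|l IH]; intros w Hw.
 - destruct Hw as [<-|[]]. easy.
 - apply in_flat_map in Hw. destruct Hw as (w' & Hw' & Hw). apply in_map_iff in Hw. destruct Hw as (a & <- & Ha).
  apply in_seq in Ha. destruct (IH w' Hw') as [H1 H2]. split; [simpl; lia|]. intros b [<-|Hb]; [lia|auto].
Qed.

Lemma discrepancy_upper q N l theta B : 0 <= B ->
  (forall w, In w (words q l) -> Rabs (INR (Nocc q theta w N) / N - / q ^ l) <= B) -> discrepancy q N l theta <= B.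
Proof.
 intros HB H. unfold discrepancy. induction (words q l) as [|w ws IH]; [easy|]. apply Rmax_lub.
 - apply H. now left.
 - apply IH. intros w' Hw'. apply H. now right.
Qed.

Lemma endpos_mono f q m n : (m <= n)%nat -> (endpos f q m <= endpos f q n)%nat.
Proof. intros H. induction H; [lia|]. rewrite endpos_S. lia. Qed.

Lemma endpos_window f q N : (exists m, (N < endpos f q m)%nat) -> exists n, (endpos f q n <= N < endpos f q (S n))%nat.
Proof.
 intros [m Hm]. induction m as [|m IH]; [easy|].
 destruct (Nat.le_gt_cases (endpos f q m) N) as [H|H]; [exists m; lia|auto].
Qed.

(** Provides one constant for all q^l values of a word of length l. *)
Lemma finite_sup (m : nat) (P : nat -> R -> Prop) : (forall a A A', P a A -> A <= A' -> P a A') ->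
  (forall a, (a < m)%nat -> exists A, 0 <= A /\ P a A) -> exists A, 0 <= A /\ forall a, (a < m)%nat -> P a A.
Proof.
 intros Hmon. induction m as [|m IH]; intros H; [exists 0; split; [lra|lia]|]. destruct IH as (A & HA & HA'); [pos|].
 destruct (H m ltac:(lia)) as (A1 & HA1 & HA1'). exists (A + A1). split; [lra|]. intros a Ha.
 destruct (Nat.eq_dec a m) as [->|Hne].
 - apply (Hmon _ A1); [easy|lra].
 - apply (Hmon _ A); [apply HA'; lia|lra].
Qed.

(** Three errors: words across the boundaries of blocks, at most l for each prime; the counts inside
    complete blocks; and the incomplete last stretch from endpos n to N. *)
Lemma occurrences_window f q w n N : (2 <= q)%nat -> (1 <= length w)%nat -> (forall a, In a w -> (a < q)%nat) -> slack f q ->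
  (endpos f q n <= N)%nat -> let l := length w in
  Rabs (INR (Nocc q (tau q f) w N) - N / INR (q ^ l))
  <= l * rsum (S n) (fun k => ind (nprime k))
  + Rabs (rsum (S n) (fun k => ind (nprime k) * blk q l (wval q w) (block_val f k)) - INR (endpos f q n) / INR (q ^ l))
  + (N - INR (endpos f q n)).
Proof.
 intros Hq Hl Hw Hsl HN l.
 assert (Htau : 0 <= tau q f) by (have (tau_floor f q 0 Hq (Hsl 0%nat)) as H; simpl in H; lra).
 have (occurrences_total f q w n Hq Hl Hw Hsl Htau) as Ho. rewrite Nocc_sum. set (m := (N - endpos f q n)%nat).
 replace N with (endpos f q n + m)%nat by lia. rewrite rsum_split, plus_INR. set (e := INR (endpos f q n)) in *.
 set (x1 := rsum (endpos f q n) _) in *. set (x2 := rsum m _).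
 assert (Hx2 : 0 <= x2 <= m) by (split; [apply rsum_nonneg; intros; apply ind_01|apply rsum_eq_count]).
 set (y := rsum (S n) (fun k => ind (nprime k) * _)) in *.
 assert (HQ : 1 <= INR (q ^ l)) by (change 1 with (INR 1); apply le_INR; have (Nat.pow_nonzero q l); lia).
 assert (Hm : 0 <= m / INR (q ^ l) <= m). { split; [pos|]. apply Rle_div_l; [lra|]. nra. }
 arg ((x1 - y) + (y - e / INR (q ^ l)) + (x2 - m / INR (q ^ l))). from Rabs_triang. apply Rplus_le_compat.
 - mono.
 - apply Rabs_le. lra.
Qed.

Theorem theorem1p2 :
  forall (q : nat) (d : nat) (alpha beta : nat -> R),
    (2 <= q)%nat ->
    0 < alpha 0%nat ->
    (forall i : nat, (i < d)%nat -> beta (S i) < beta i) ->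
    0 < beta d ->
    (exists i : nat, (i <= d)%nat /\ forall z : Z, beta i <> IZR z) ->
    forall l : nat, (1 <= l)%nat ->
      exists C : R, exists N0 : nat,
        forall N : nat, (N0 <= N)%nat ->
          discrepancy q N l (tau q (pseudo_poly d alpha beta)) <= C / ln (INR N).
Proof.
 intros q d alpha beta Hq Ha Hb Hd _ l Hl. set (f := pseudo_poly d alpha beta).
 have (pseudo_poly_slack q d alpha beta Hq Ha Hb Hd) as Hsl.
 destruct (finite_sup (q ^ l) (fun a A => forall n, (2 <= n)%nat -> Rabs (rsum (S n) (fun k => ind (nprime k) * blk q
  l a (block_val f k)) - INR (endpos f q n) / INR (q ^ l)) <= A * (n / ln n))) as (A & HA & HA'). {
  intros a A A' H HAA n Hn. etrans; [pos|]. apply Rmult_le_compat_r; [|easy]. assert (2 <= n) by inr. pos. }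
 { intros a Hla. exact (block_total q d alpha beta l a Hq Ha Hb Hd Hl Hla). }
 destruct prime_count_total as (P & HP & HP').
 destruct (endpos_linear q d alpha beta Hq Ha Hb Hd) as (c & C & n1 & Hc & HC & Hn1 & Hend). fold f in Hend.
 destruct (ndigits_log q d alpha beta Hq Ha Hb Hd) as (c' & C' & n2 & Hc' & HC' & Hn2 & Hnd). fold f in Hnd.
 destruct (log_power_small 2) as (X0 & HX0 & HX0'). destruct (INR_unbounded (X0 + 2 * C)) as [n3 Hn3].
 set (B := l * P + A + 2 * C'). assert (HB : 0 <= B) by (unfold B; have (Rmult_le_pos _ _ (pos_INR l) HP); lra).
 (* B collects the three errors, in units of n / ln n. The division by c comes from N >= c n and the
    factor 2 from ln N <= 2 ln n. The threshold makes the index n of the last complete block exceed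
    n1, n2 and n3. *)
 exists (2 * B / c), (S (endpos f q (n1 + n2 + n3))). intros N HN. destruct (endpos_window f q N) as (n & Hn & HnS).
 { destruct (INR_unbounded (N / c)) as [m Hm]. exists (m + n1)%nat. apply INR_lt. assert (N < c * INR (m + n1)). {
   rewrite plus_INR. have (pos_INR n1). apply Rlt_div_l in Hm; [|easy]. nra. }
  specialize (Hend (m + n1)%nat ltac:(lia)). lra. }
 assert (Hlarge : (n1 + n2 + n3 <= n)%nat). { apply Nat.nlt_ge. intros H.
  have (endpos_mono f q (S n) (n1 + n2 + n3) ltac:(lia)). lia. }
 have (Hend n ltac:(lia)) as Hen. have (Hend (S n) ltac:(lia)) as HeS.
 assert (Hxn : X0 + 2 * C <= n) by (assert (n3 <= n) by (apply le_INR; lia); lra).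
 destruct (HX0' (INR n) ltac:(lra)) as [_ HLsq]. assert (HnN : INR (endpos f q n) <= N) by mono.
 (* The interval from endpos n to endpos (n + 1) contains N, so n + 1 is prime and the incomplete
    block has O(ln n) digits, which is below a multiple of n / ln n. *)
 assert (HNS : N < INR (endpos f q (S n))) by mono. assert (Htail : N - INR (endpos f q n) <= C' * ln (INR (S n))). {
  rewrite endpos_S in HNS, HnS. destruct (is_primeb (S n)); [|lia]. rewrite plus_INR in HNS.
  specialize (Hnd (S n) ltac:(lia)). lra. }
 rewrite S_INR in *. set (x := INR n) in *. assert (HL : 0 < ln x) by pos.
 assert (HL2 : ln (2 * x) <= 2 * ln x) by (rewrite ln_mult by lra; assert (ln 2 <= ln x) by (apply ln_le; lra); lra).
 assert (HLn : ln x <= x / ln x). { apply (Rmult_le_reg_r (ln x)); [easy|].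
  replace (x / ln x * ln x) with x by (field; lra). assert (ln x <= ln (2 * x)) by mono. nra. }
 assert (Htail2 : C' * ln (x + 1) <= 2 * C' * (x / ln x)). { assert (ln (x + 1) <= ln (2 * x)) by mono. nra. }
 (* N is at most C (n + 1), and n >= 2 C makes this at most n^2. *)
 assert (Hcx : 0 < c * x) by pos. assert (HlnN : 0 < ln N <= 2 * ln x). {
  assert (1 < N) by (change 1 with (INR 1); apply lt_INR; have (endpos_mono f q n1 (n1 + n2 + n3) ltac:(lia));
   specialize (Hend n1 (le_n _)); assert (0 < INR (endpos f q n1)) by (assert (0 < c * n1) by (apply
   Rmult_lt_0_compat; [easy|pos]); lra); assert (0 < endpos f q n1)%nat by (apply INR_lt; simpl; lra); lia).
  split; [pos|]. rhs (ln (x * x)) by (rewrite ln_mult by lra; ring). apply ln_le; nra. }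
 apply discrepancy_upper. { pos. }
 intros w Hwin. destruct (words_spec q l w Hwin) as [Hlen Hdig].
 have (occurrences_window f q w n N Hq ltac:(lia) Hdig Hsl Hn) as Ho. rewrite Hlen in Ho.
 have (HA' (wval q w)) as HAw. specialize (HAw ltac:(rewrite <- Hlen; now apply wval_lt) n ltac:(lia)).
 specialize (HP' n ltac:(lia)). fold x in HAw, HP'.
 assert (Hmain : Rabs (INR (Nocc q (tau q f) w N) - N / INR (q ^ l)) <= B * (x / ln x)). {
  assert (l * rsum (S n) (fun k => ind (nprime k)) <= l * (P * (x / ln x))) by mono. unfold B. lra. }
 rewrite pow_INR in Hmain. assert (HQ : 0 < q ^ l) by pos. arg ((INR (Nocc q (tau q f) w N) - N / q ^ l) / N).
 rewrite Rabs_div, (Rabs_right (INR N)) by lra. via (B * (x / ln x) / (c * x)). { mono. }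
 lhs (2 * B / c * / (2 * ln x)). mul_l. mono.
Qed.
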